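(* Let $T>0$. In the case of no external force ($\boldsymbol g=\boldsymbol 0$), the solution to the initial boundary value problem $$\begin{cases}\ddot{\boldsymbol x}-(\tau\boldsymbol x')'=\boldsymbol 0,\quad |\boldsymbol x'|=1 & \text{in }(0,1)\times(0,T),\\ \boldsymbol x=\boldsymbol 0 \text{ on }\{s=1\}\times(0,T),\quad \tau=0\text{ on }\{s=0\}\times(0,T),\\ (\boldsymbol x,\dot{\boldsymbol x})|_{t=0}=(\boldsymbol x_0^{\rm in},\boldsymbol x_1^{\rm in})&\text{in }(0,1)\end{cases}$$ is unique in the class $\boldsymbol x'\in L^\infty(0,T;X^2)\cap W^{1,\infty}(0,T;X^1)$. That is, if $(\boldsymbol x_1,\tau_1)$ and $(\boldsymbol x_2,\tau_2)$ are two solutions in this class with the same initial data, then $\boldsymbol x_1=\boldsymbol x_2$ and $\tau_1=\tau_2$.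
   Context: Unknowns: $\boldsymbol x=\boldsymbol x(s,t)\in\mathbb R^3$ and $\tau=\tau(s,t)\in\mathbb R$. A dot denotes the $t$-derivative, a prime the $s$-derivative. $L^p$, $H^k$ are spaces on $(0,1)$. The norms are $\|u\|_{X^1}^2=\|u\|_{L^2}^2+\|s^{1/2}u'\|_{L^2}^2$ and $\|u\|_{X^2}^2=\|u\|_{H^1}^2+\|su''\|_{L^2}^2$, and $X^k$ is the set of $u\in L^2$ with $\|u\|_{X^k}<\infty$. The tension of a solution is, for each time $t$, the solution of the two-point boundary value problem $-\tau''+|\boldsymbol x''|^2\tau=|\dot{\boldsymbol x}'|^2$ in $(0,1)$, $\tau(0,t)=0$, $\tau'(1,t)=0$, which follows from the equations of motion and the constraint $|\boldsymbol x'|=1$. The equations are understood to hold almost everywhere. Solutions in the class also satisfy $\boldsymbol x'\in W^{2,\infty}(0,T;L^2)$, so one may assume $\boldsymbol x,\boldsymbol x'\in C^0([0,T];X^1)\cap C^1([0,T];L^2)$ and the initial conditions are understood in the classical sense. *)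

(* Defs.v *)
From HB Require Import structures.
From mathcomp Require Import all_boot all_order all_algebra.
From mathcomp Require Import all_classical all_reals all_analysis.

Set Implicit Arguments.
Unset Strict Implicit.
Unset Printing Implicit Defensive.

Import Order.TTheory GRing.Theory Num.Theory.
Import numFieldNormedType.Exports.

Local Open Scope classical_set_scope.
Local Open Scope ring_scope.

(* Conventions.  A function of (s, t) is curried with the time first:
   x t s stands for x(s, t), so that x t : R -> 'rV_3 is the curve at time t.
   Elements of L^2, X^1, X^2, ... are represented by functions R -> 'rV_n of
   which only the values on (0, 1) matter, up to null sets. *)

Section Euclidean.
Context {R : realType} {n : nat}.

(* The norm `|v| of 'rV_n in the library is the sup norm. *)
Definition dotv (v w : 'rV[R]_n) : R := \sum_(i < n) v 0 i * w 0 i.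
Definition enorm (v : 'rV[R]_n) : R := Num.sqrt (dotv v v).

End Euclidean.

Section WeakDerivative.
Context {R : realType}.
Local Notation mu := (@lebesgue_measure R).

(* phi belongs to C_c^\infty(a, b) *)
Definition test_function (a b : R) (phi : R -> R) : Prop :=
  (forall k x, derivable ((phi^`(k))%classic) x 1) /\
  exists c d, [/\ a < c, d < b & forall x, ~ `[c, d]%classic x -> phi x = 0].

Definition is_wderiv (u v : R -> R) : Prop :=
  [/\ locally_integrable `]0, 1[%classic u,
      locally_integrable `]0, 1[%classic v &
      forall phi, test_function 0 1 phi ->
        \int[mu]_(s in `]0, 1[) (u s * (phi^`())%classic s) =
        - \int[mu]_(s in `]0, 1[) (v s * phi s)].

Definition has_wderiv (u : R -> R) : Prop := exists v, is_wderiv u v.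

(* A representative of the weak derivative on (0, 1); 0 if there is none. *)
Definition wderiv (u : R -> R) : R -> R := xget (fun=> 0) (is_wderiv u).

Context {n : nat}.

Definition has_wderivv (u : R -> 'rV[R]_n) : Prop :=
  forall i, has_wderiv (fun s => u s 0 i).

Definition wderivv (u : R -> 'rV[R]_n) : R -> 'rV[R]_n :=
  fun s => \row_i wderiv (fun r => u r 0 i) s.

End WeakDerivative.

(* The boundary value of u at s0 (an end point of (0, 1)) is v.  As u is only
   given up to null sets, this is the limit of a representative. *)
Definition boundary_value {R : realType} {V : topologicalType}
    (u : R -> V) (s0 : R) (v : V) : Prop :=
  exists w : R -> V,
    {ae lebesgue_measure, forall s, `]0, 1[%classic s -> u s = w s} /\
    w s @[s --> within `]0, 1[%classic (nbhs s0)] --> v.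

Section Spaces.
Context {R : realType} {n : nat}.
Local Notation mu := (@lebesgue_measure R).
Local Notation vfun := (R -> 'rV[R]_n).

(* The weighted integral int_0^1 s^k |u(s)|^2 ds *)
Definition wsq (k : nat) (u : vfun) : \bar R :=
  (\int[mu]_(s in `]0%R, 1%R[) (s ^+ k * enorm (u s) ^+ 2)%:E)%E.

Definition L2norm (u : vfun) : \bar R := sqrte (wsq 0 u).

Definition X1norm (u : vfun) : \bar R :=
  if `[< has_wderivv u >] then sqrte (wsq 0 u + wsq 1 (wderivv u))%E
  else +oo%E.

Definition X2norm (u : vfun) : \bar R :=
  if `[< has_wderivv u /\ has_wderivv (wderivv u) >] then
    sqrte (wsq 0 u + wsq 0 (wderivv u) + wsq 2 (wderivv (wderivv u)))%E
  else +oo%E.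

(* The functions of L^2(0, 1) with finite norm N; in particular L^2(0, 1)
   itself for N = L2norm, and X^k for N = Xknorm *)
Definition nspace (N : vfun -> \bar R) : set vfun :=
  [set u : vfun |
    [/\ forall i, measurable_fun (`]0, 1[%classic : set R) (fun s => u s 0 i),
        (L2norm u < +oo)%E & (N u < +oo)%E]].

Definition L2dot (u v : vfun) : R := \int[mu]_(s in `]0, 1[) dotv (u s) (v s).

End Spaces.

Section TimeDependent.
Context {R : realType} {n : nat}.
Local Notation mu := (@lebesgue_measure R).
Local Notation vfun := (R -> 'rV[R]_n).
Implicit Types (N : vfun -> \bar R) (T : R) (U : R -> vfun).

Definition simple_vfun N U : Prop :=
  exists (m : nat) (A : 'I_m -> set R) (w : 'I_m -> vfun),
    [/\ forall i, measurable (A i), forall i, nspace N (w i) &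
        U = fun t s => \sum_(i < m) \1_(A i) t *: w i s].

(* Bochner measurability on (0, T) with values in nspace N *)
Definition strongly_measurable N T U : Prop :=
  exists F : nat -> R -> vfun,
    (forall k, simple_vfun N (F k)) /\
    {ae mu, forall t : R, `]0, T[%classic t ->
       N (F k t \- U t) @[k --> \oo] --> 0%E}.

(* L^\infty(0, T; nspace N) *)
Definition Linfty N T U : Prop :=
  strongly_measurable N T U /\
  exists M : R, {ae mu, forall t : R, `]0, T[%classic t ->
    nspace N (U t) /\ (N (U t) <= M%:E)%E}.

(* V is the weak derivative of U on (0, T): the Bochner integrals of phi' U and
   of - phi V agree, which is tested against the elements of L^2(0, 1). *)
Definition is_weak_dt T (U V : R -> vfun) : Prop :=
  forall phi psi, test_function 0 T phi -> nspace L2norm psi ->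
    \int[mu]_(t in `]0, T[) ((phi^`())%classic t * L2dot (U t) psi) =
    - \int[mu]_(t in `]0, T[) (phi t * L2dot (V t) psi).

(* W^{1,\infty}(0, T; nspace N) *)
Definition W1infty N T U : Prop :=
  Linfty N T U /\ exists V, Linfty N T V /\ is_weak_dt T U V.

(* C^0([0, T]; nspace N) *)
Definition C0time N T U : Prop :=
  (forall t : R, `[0, T]%classic t -> nspace N (U t)) /\
  (forall t : R, `[0, T]%classic t ->
     N (U r \- U t) @[r --> within `[0, T]%classic (nbhs t)] --> 0%E).

(* v is the derivative in L^2(0, 1) of U : [0, T] -> L^2(0, 1) at t *)
Definition is_dt T U (t : R) (v : vfun) : Prop :=
  nspace L2norm v /\
  L2norm (fun s => (r - t)^-1 *: (U r s - U t s) - v s)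
    @[r --> within `[0, T]%classic t^'] --> 0%E.

Definition dt T U (t : R) : vfun := xget (fun=> 0) (is_dt T U t).

(* C^1([0, T]; L^2(0, 1)) *)
Definition C1time T U : Prop :=
  [/\ C0time L2norm T U,
      forall t : R, `[0, T]%classic t -> exists v, is_dt T U t v &
      C0time L2norm T (dt T U)].

Definition ds U : R -> vfun := fun t => wderivv (U t).

End TimeDependent.

Section String.
Context {R : realType}.
Local Notation mu := (@lebesgue_measure R).
Local Notation V := 'rV[R]_3.

(* For each t, tau is the solution of - tau'' + |x''|^2 tau = |\dot x'|^2 in
   (0, 1), with tau = 0 at s = 0 and tau' = 0 at s = 1.  This is what fixes tau:
   no other regularity is imposed on it. *)
Definition is_tension (T : R) (x : R -> R -> V) (tau : R -> R -> R) : Prop :=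
  forall t : R, `]0, T[%classic t ->
    [/\ has_wderiv (tau t), has_wderiv (wderiv (tau t)),
        {ae mu, forall s, `]0, 1[%classic s ->
           - wderiv (wderiv (tau t)) s + enorm (ds (ds x) t s) ^+ 2 * tau t s
           = enorm (dt T (ds x) t s) ^+ 2},
        boundary_value (tau t) 0 0 &
        boundary_value (wderiv (tau t)) 1 0].

(* \ddot x - (tau x')' = 0 almost everywhere, where xtt is \ddot x.  "Almost
   everywhere" is for a.e. t and then a.e. s: this does not depend on the
   representatives in s chosen at each t, unlike a condition on the product. *)
Definition motion_equation (T : R) (x : R -> R -> V) (tau : R -> R -> R) :
    Prop :=
  exists xtt : R -> R -> V,
    [/\ Linfty L2norm T xtt, is_weak_dt T (dt T x) xtt &
        {ae mu, forall t : R, `]0, T[%classic t ->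
           has_wderivv (fun s => tau t s *: ds x t s) /\
           {ae mu, forall s, `]0, 1[%classic s ->
              xtt t s - wderivv (fun r => tau t r *: ds x t r) s = 0}}].

Definition inextensible (T : R) (x : R -> R -> V) : Prop :=
  {ae mu, forall t : R, `]0, T[%classic t ->
     {ae mu, forall s, `]0, 1[%classic s -> enorm (ds x t s) = 1}}.

(* x, x' \in C^0([0, T]; X^1) \cap C^1([0, T]; L^2).  This selects the
   representative continuous in time, for which x and \dot x have values at
   t = 0. *)
Definition time_regular (T : R) (x : R -> R -> V) : Prop :=
  [/\ C0time X1norm T x, C1time T x, C0time X1norm T (ds x) &
      C1time T (ds x)].

Definition is_solution (T : R) (x0 x1 : R -> V) (x : R -> R -> V)
    (tau : R -> R -> R) : Prop :=
  [/\ time_regular T x, motion_equation T x tau /\ inextensible T x,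
      (forall t : R, `]0, T[%classic t -> boundary_value (x t) 1 0),
      is_tension T x tau &
      {ae mu, forall s, `]0, 1[%classic s -> x 0 s = x0 s /\ dt T x 0 s = x1 s}].

(* x' \in L^\infty(0, T; X^2) \cap W^{1,\infty}(0, T; X^1) *)
Definition in_class (T : R) (x : R -> R -> V) : Prop :=
  Linfty X2norm T (ds x) /\ W1infty X1norm T (ds x).

End String.

(* Main.v *)
(* Write v = x', w = x_t, a = v_t, p = x'', and for two solutions let z, e and nu be the
   differences of v, w and tau, and taubar = (tau1 + tau2) / 2.

   The kinetic energy |w|^2 is conserved, since a.v = 0.  If it vanishes, nothing moves.
   Otherwise Hardy's inequality bounds int s |a|^2 from below and the two-point problem
   for the tension gives tau >= c s.

   Let E = |e|^2 + int taubar |z|^2.  The equations give E' <= C E + J with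
   J = int nu (a1 + a2).z, because (v1 + v2).(a1 - a2) = - (a1 + a2).z.  Here nu solves
   nu'' = qbar nu - (B' - g), where B and g are linear in (e, z) and q = |p|^2; testing this
   equation with the weight s^(1/2) nu yields nu^2 <= C E s^(1/2), while the class of the
   solutions gives int s^(-1/2) |a|^2 < oo, so that |J| <= K E.  Gronwall's lemma then
   gives E = 0.

   The quantitative bounds come from the class, at almost every time; they reach every
   time by continuity in L^2.  No second time derivative is used: E is differentiated
   through one-sided increments, and the Lipschitz dependence of tau on time follows from
   that of a and of s^(1/2) p, which is obtained by duality. *)
Require Import Defs.
From HB Require Import structures.
From mathcomp Require Import all_boot all_order all_algebra.
From mathcomp Require Import all_classical all_reals all_analysis.
From mathcomp Require Import measurable_realfun ring lra.

Set Implicit Arguments.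
Unset Strict Implicit.
Unset Printing Implicit Defensive.

Import Order.TTheory GRing.Theory Num.Theory.
Import numFieldNormedType.Exports.

Local Open Scope classical_set_scope.
Local Open Scope ring_scope.

(* The cost of [lra] grows with the context, so bounds that are literally at hand are
   looked up first, and [lra] is first tried with the comparisons that look useful only. *)
Ltac order_fact := solve [
  repeat match goal with |- is_true (_ && _) => apply/andP; split end;
  match goal with
  | H : is_true ?P |- is_true ?P => exact: H
  | H : is_true (?P && _) |- is_true ?P => exact: (proj1 (andP H))
  | H : is_true (_ && ?P) |- is_true ?P => exact: (proj2 (andP H))
  | H : is_true (Order.lt ?x ?y) |- is_true (Order.le ?x ?y) => exact: (ltW H)
  | H : is_true (Order.lt ?x ?y && _) |- is_true (Order.le ?x ?y) => exact: (ltW (proj1 (andP H)))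
  | H : is_true (_ && Order.lt ?x ?y) |- is_true (Order.le ?x ?y) => exact: (ltW (proj2 (andP H)))
  end].
Ltac comparison P :=
  lazymatch P with
  | is_true (Order.le _ _) => idtac | is_true (Order.lt _ _) => idtac | is_true (_ && _) => idtac
  end;
  lazymatch P with
  | context [Rintegral _ _ _] => lazymatch goal with |- context [Rintegral _ _ _] => idtac end
  | _ => idtac
  end.
Ltac slim := repeat match goal with H : ?P |- _ =>
  lazymatch P with measurable _ => fail | _ => tryif comparison P then fail else clear H end end.
Ltac slra := first [order_fact | by slim; lra | lra].
Ltac snra := first [by slim; nra | nra].

(** The string loses its stiffness at the free end, where tau is comparable to s: E controls z only
    through s^(1/2) z, and a, which lies in X^1, may be unbounded there. The integrand of J is
    therefore split as (s^(-1/2) nu a)(s^(1/2) z), and nu has to vanish at 0 at a rate paid by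
    E^(1/2). The exponent of the weight is a compromise: the term a'.e of g is controlled with
    weight s^alpha if alpha >= 1/2, because s^(1/2) a' is what belongs to L^2, while the last step
    needs int s^(-alpha) |a|^2 < oo, that is alpha < 1.

    Writing the difference of the quadratic sources as B' - g removes e' and z', which E does not
    control.

    At the fixed end, the weighted identity produces a boundary term with B, in which e vanishes but
    z need not. It disappears because the curvature p is zero at s = 1: the fixed end has no
    acceleration, so (tau v)' = 0 there, and tau' = 0 with tau > 0 leave p = 0. As x_tt has no value
    at a single point, this is obtained from averages near the end. *)

Lemma filterS_ae {R : realType} (P Q : R -> Prop) :
  {ae @lebesgue_measure R, forall x, P x} -> (forall x, P x -> Q x) ->
  {ae @lebesgue_measure R, forall x, Q x}.
Proof.
move=> [N [mN N0 hN]] PQ; exists N; split => // x /= nQ; apply: hN => /= Px.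
exact: nQ (PQ x Px).
Qed.

Lemma ae_and {R : realType} (P Q : R -> Prop) :
  {ae @lebesgue_measure R, forall x, P x} ->
  {ae @lebesgue_measure R, forall x, Q x} ->
  {ae @lebesgue_measure R, forall x, P x /\ Q x}.
Proof.
by move=> hP hQ; have := negligibleU hP hQ; rewrite -setCI.
Qed.

Lemma ae_all {R : realType} (P : nat -> R -> Prop) :
  (forall n, {ae @lebesgue_measure R, forall x, P n x}) ->
  {ae @lebesgue_measure R, forall x, forall n, P n x}.
Proof. by move=> hP; apply/ae_foralln. Qed.

Lemma ae_all_ord {R : realType} m (P : 'I_m -> R -> Prop) :
  (forall n, {ae @lebesgue_measure R, forall x, P n x}) ->
  {ae @lebesgue_measure R, forall x, forall n, P n x}.
Proof.
move=> hP; have := @ae_all R (fun n x => forall i : 'I_m, nat_of_ord i = n -> P i x).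
have h n : {ae @lebesgue_measure R, forall x, forall i : 'I_m, nat_of_ord i = n -> P i x}.
  have [nm|mn] := ltnP n m.
    apply: (filterS_ae (hP (Ordinal nm))) => x Px i iE.
    by rewrite (_ : i = Ordinal nm)//; exact/val_inj.
  apply: (filterS_ae (P := fun=> True)); first by exists set0; split => // x /=.
  by move=> x _ i iE; have := ltn_ord i; rewrite iE ltnNge mn.
by move=> /(_ h) h'; apply: (filterS_ae h') => x Px i; exact: (Px i).
Qed.

(** * Integration on the unit interval *)

Section Integration.
Context {R : realType}.
Local Notation mu := (@lebesgue_measure R).
Local Notation itg D f := (mu.-integrable D (EFin \o f)).
Implicit Types (D : set R) (f g : R -> R).

Lemma itg_meas D f : itg D f -> measurable_fun D f.
Proof. by move=> /integrableP[/measurable_EFinP]. Qed.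

Lemma itgD D f g : measurable D -> itg D f -> itg D g -> itg D (fun x => f x + g x).
Proof.
move=> mD hf hg; apply: (@eq_integrable _ _ _ mu _ mD) (@integrableD _ _ _ mu _ mD _ _ hf hg) => //.
Qed.

Lemma itgN D f : measurable D -> itg D f -> itg D (fun x => - f x).
Proof.
move=> mD hf; have H : mu.-integrable D (-%E \o (EFin \o f)) by exact: integrableN.
by apply: (@eq_integrable _ _ _ mu _ mD) H.
Qed.

Lemma itgB D f g : measurable D -> itg D f -> itg D g -> itg D (fun x => f x - g x).
Proof. by move=> mD hf hg; apply: itgD => //; exact: itgN. Qed.

Lemma itgZ D f (c : R) : measurable D -> itg D f -> itg D (fun x => c * f x).
Proof.
by move=> mD hf; apply: (@eq_integrable _ _ _ mu _ mD) (@integrableZl _ _ _ mu _ mD c _ hf) => // x _; rewrite /= EFinM.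
Qed.

Lemma itg_norm D f : itg D f -> itg D (fun x => `|f x|).
Proof. by move=> hf; exact: (@integrable_norm _ _ _ mu _ _ hf). Qed.

Lemma itg_le D f g : measurable D -> measurable_fun D f ->
  (forall x, D x -> `|f x| <= g x) -> itg D g -> itg D f.
Proof.
move=> mD mf fg hg; apply: (@le_integrable _ _ _ mu _ mD) hg => /=.
  exact/measurable_EFinP.
by move=> x Dx; rewrite lee_fin (le_trans (fg _ Dx))// ler_norm.
Qed.

Lemma itg_eq D f g : measurable D -> (forall x, D x -> f x = g x) ->
  itg D f -> itg D g.
Proof.
by move=> mD fg; apply: (@eq_integrable _ _ _ mu _ mD) => // x /set_mem Dx /=; rewrite fg.
Qed.

Lemma itg_sum D n (f : 'I_n -> R -> R) : measurable D ->
  (forall i, itg D (f i)) -> itg D (fun x => \sum_i f i x).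
Proof.
move=> mD hf.
apply: (@eq_integrable _ _ _ mu _ mD (fun x => \sum_(i < n) (f i x)%:E)%E).
  by move=> x _; rewrite sumEFin.
by apply: (@integrable_sum _ _ _ mu) => // i _; exact: hf.
Qed.

Lemma Rint_sum D n (f : 'I_n -> R -> R) : measurable D ->
  (forall i, itg D (f i)) ->
  \int[mu]_(x in D) (\sum_i f i x) = \sum_i \int[mu]_(x in D) f i x.
Proof.
move=> mD; elim: n f => [|n ih] f hf.
  rewrite big_ord0 (@eq_Rintegral _ _ _ _ _ (cst 0)).
    by rewrite Rintegral_cst// mul0r.
  by move=> x _; rewrite big_ord0.
rewrite big_ord_recl -ih; last by move=> i; exact: hf.
rewrite -RintegralD//; last by apply: itg_sum => // i; exact: hf.
by apply: eq_Rintegral => x _; rewrite big_ord_recl.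
Qed.

Lemma itg_sub D E f : measurable D -> measurable E -> E `<=` D ->
  itg D f -> itg E f.
Proof. by move=> mD mE ED; exact: (@integrableS _ _ _ mu). Qed.

Lemma Rint_sub D E f : measurable D -> measurable E -> E `<=` D ->
  itg D f -> (forall x, D x -> 0 <= f x) ->
  \int[mu]_(x in E) f x <= \int[mu]_(x in D) f x.
Proof.
move=> mD mE ED hf f0; rewrite /Rintegral fine_le//.
- by apply: integrable_fin_num => //; exact: (itg_sub mD).
- exact: integrable_fin_num.
- apply: ge0_subset_integral => //; first by case/integrableP: hf.
Qed.

Lemma itg_cst D (c : R) : measurable D -> (mu D < +oo)%E -> itg D (fun=> c).
Proof.
move=> mD Dfin; apply: (@measurable_bounded_integrable _ _ _ mu) => //.
exists `|c|; split; first exact: num_real.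
by move=> M cM x _ /=; exact: ltW.
Qed.

Lemma Rint_ae_eq D f g : measurable D -> measurable_fun D f ->
  measurable_fun D g -> {ae mu, forall x, D x -> f x = g x} ->
  \int[mu]_(x in D) f x = \int[mu]_(x in D) g x.
Proof.
move=> mD mf mg fg; rewrite /Rintegral; congr fine.
apply: ae_eq_integral => //; [exact/measurable_EFinP|exact/measurable_EFinP|].
by apply: (filterS_ae fg) => x h Dx /=; rewrite h.
Qed.

Lemma itg_ae_eq D f g : measurable D -> measurable_fun D g ->
  {ae mu, forall x, D x -> f x = g x} -> itg D f -> itg D g.
Proof.
move=> mD mg fg hf; have mf := itg_meas hf.
apply/integrableP; split; first exact/measurable_EFinP.
case/integrableP: hf => _; congr (_ < _)%E.
apply: ae_eq_integral => //.
- by apply/measurable_EFinP; apply: measurableT_comp.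
- by apply/measurable_EFinP; apply: measurableT_comp.
- by apply: (filterS_ae fg) => x h Dx /=; rewrite h.
Qed.

Lemma Rint_norm_le D f g : measurable D -> itg D f -> itg D g ->
  (forall x, D x -> `|f x| <= g x) ->
  `|\int[mu]_(x in D) f x| <= \int[mu]_(x in D) g x.
Proof.
move=> mD hf hg fg; apply: le_trans (@le_normr_Rintegral _ _ _ mu _ _ mD hf) _.
by apply: le_Rintegral => //; exact: itg_norm.
Qed.

Lemma RintN D f : measurable D -> itg D f ->
  \int[mu]_(x in D) - f x = - \int[mu]_(x in D) f x.
Proof.
move=> mD hf; rewrite -[RHS]mulN1r -RintegralZl//.
by apply: eq_Rintegral => x _; rewrite mulN1r.
Qed.

Lemma EFin_Rint D f : measurable D -> itg D f ->
  (\int[mu]_(x in D) (f x)%:E)%E = (\int[mu]_(x in D) f x)%:E.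
Proof.
by move=> mD hf; rewrite /Rintegral fineK//; exact: (@integrable_fin_num _ _ _ mu D mD _ hf).
Qed.

Definition L2 D f := measurable_fun D f /\ itg D (fun x => f x ^+ 2).

Lemma L2_mul D f g : measurable D -> L2 D f -> L2 D g -> itg D (fun x => f x * g x).
Proof.
move=> mD [mf hf] [mg hg].
apply: (itg_le (g := fun x => f x ^+ 2 + g x ^+ 2)) => //.
- exact: measurable_funM.
- move=> x _; rewrite normrM.
  rewrite -(real_normK (num_real (f x))) -(real_normK (num_real (g x))).
  by snra.
- exact: itgD.
Qed.

Lemma L2D D f g : measurable D -> L2 D f -> L2 D g -> L2 D (fun x => f x + g x).
Proof.
move=> mD hf hg; have hfg := L2_mul mD hf hg.
case: hf hg => mf hf [mg hg]; split; first exact: measurable_funD.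
apply: (itg_eq (f := fun x => f x ^+ 2 + 2 * (f x * g x) + g x ^+ 2)) => //.
  by move=> x _; ring.
by apply: itgD => //; apply: itgD => //; exact: itgZ.
Qed.

Lemma L2Z D f (c : R) : measurable D -> L2 D f -> L2 D (fun x => c * f x).
Proof.
move=> mD [mf hf]; split; first exact: measurable_funM.
apply: (itg_eq (f := fun x => c ^+ 2 * f x ^+ 2)) => //.
  by move=> x _; ring.
exact: itgZ.
Qed.

Lemma L2N D f : measurable D -> L2 D f -> L2 D (fun x => - f x).
Proof.
move=> mD hf; have := L2Z (-1) mD hf.
by under eq_fun do rewrite mulN1r.
Qed.

Lemma L2B D f g : measurable D -> L2 D f -> L2 D g -> L2 D (fun x => f x - g x).
Proof. by move=> mD hf hg; apply: L2D => //; exact: L2N. Qed.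

Lemma L2_norm D f : measurable D -> L2 D f -> L2 D (fun x => `|f x|).
Proof.
move=> mD [mf hf]; split; first exact: measurableT_comp.
by apply: itg_eq hf => // x _; rewrite real_normK// num_real.
Qed.

Lemma L2_le D f g : measurable D -> measurable_fun D f ->
  (forall x, D x -> `|f x| <= `|g x|) -> L2 D g -> L2 D f.
Proof.
move=> mD mf fg [mg hg]; split => //.
apply: itg_le hg => //; first exact: measurable_funX.
move=> x Dx; rewrite normrX -(real_normK (num_real (g x))).
by rewrite lerXn2r// ?nnegrE// fg.
Qed.

Lemma L2_ae_eq D f g : measurable D -> measurable_fun D g ->
  {ae mu, forall x, D x -> f x = g x} -> L2 D f -> L2 D g.
Proof.
move=> mD mg fg [mf hf]; split => //; apply: itg_ae_eq hf => //.
  exact: measurable_funX.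
by apply: (filterS_ae fg) => x h Dx; rewrite h.
Qed.

Lemma L2_bnd D f (M : R) : measurable D -> (mu D < +oo)%E -> measurable_fun D f ->
  (forall x, D x -> `|f x| <= M) -> L2 D f.
Proof.
move=> mD Dfin mf fM; split => //.
apply: (itg_le (g := fun=> M ^+ 2)) => //; first exact: measurable_funX.
  move=> x Dx; rewrite normrX lerXn2r// ?nnegrE// ?fM//.
  by rewrite (le_trans _ (fM x Dx)).
exact: itg_cst.
Qed.

Lemma L2_bndM D f g (M : R) : measurable D -> measurable_fun D g ->
  (forall x, D x -> `|g x| <= M) -> L2 D f -> L2 D (fun x => g x * f x).
Proof.
move=> mD mg gM hf; apply: (L2_le _ _ _ (L2Z M mD hf)) => //.
  by apply: measurable_funM => //; case: hf.
by move=> x Dx; rewrite !normrM ler_wpM2r// (le_trans (gM _ Dx))// ler_norm.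
Qed.

Lemma L2_itg D f : measurable D -> (mu D < +oo)%E -> L2 D f -> itg D f.
Proof.
move=> mD Dfin hf.
have h1 : L2 D (fun=> 1).
  by apply: (L2_bnd (M := 1)) => // x _; rewrite normr1.
by apply: itg_eq (L2_mul mD hf h1) => // x _; rewrite mulr1.
Qed.

(** A quadratic polynomial in [l] that stays nonnegative has nonpositive discriminant. For [B > 0]
    its minimum is at [l = C / B]; for [B = 0] and [C] nonzero it is affine, and the chosen [l]
    makes it equal to -1. *)
Lemma sqr_le_mulP (A B C : R) : 0 <= A -> 0 <= B ->
  (forall l : R, 0 <= A - 2 * l * C + l ^+ 2 * B) -> C ^+ 2 <= A * B.
Proof.
move=> A0 B0 h; have [B00|Bn] := eqVneq B 0.
  have : C = 0; last by move=> ->; rewrite B00 expr0n/= mulr0.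
  apply/eqP; apply: contraT => Cn.
  have := h ((A + 1) / (2 * C)); rewrite B00 mulr0 addr0.
  rewrite (_ : 2 * _ * C = A + 1); first by move=> ?; slra.
  by field.
have Bp : 0 < B by rewrite lt0r Bn.
have := h (C / B).
rewrite (_ : A - _ + _ = (A * B - C ^+ 2) / B); last by field.
by rewrite pmulr_lge0 ?invr_gt0// subr_ge0.
Qed.

Lemma cauchy_schwarz D f g : measurable D -> L2 D f -> L2 D g ->
  (\int[mu]_(x in D) (f x * g x)) ^+ 2 <=
  \int[mu]_(x in D) (f x ^+ 2) * \int[mu]_(x in D) (g x ^+ 2).
Proof.
move=> mD hf hg; apply: sqr_le_mulP.
- by apply: Rintegral_ge0 => x _; rewrite sqr_ge0.
- by apply: Rintegral_ge0 => x _; rewrite sqr_ge0.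
move=> l; have hfg := L2_mul mD hf hg; case: hf hg => mf hf [mg hg].
rewrite -!RintegralZl// -RintegralB//; last exact: itgZ.
rewrite -RintegralD//; [|by apply: itgB => //; exact: itgZ|exact: itgZ].
apply: Rintegral_ge0 => x _.
rewrite (_ : _ + _ = (f x - l * g x) ^+ 2); first exact: sqr_ge0.
by ring.
Qed.

Lemma cauchy_schwarz_norm D f g : measurable D -> L2 D f -> L2 D g ->
  `|\int[mu]_(x in D) (f x * g x)| <=
  Num.sqrt (\int[mu]_(x in D) (f x ^+ 2)) * Num.sqrt (\int[mu]_(x in D) (g x ^+ 2)).
Proof.
move=> mD hf hg; rewrite -sqrtrM; last by apply: Rintegral_ge0 => x _; exact: sqr_ge0.
rewrite -sqrtr_sqr ler_sqrt; first exact: cauchy_schwarz.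
by rewrite mulr_ge0//; apply: Rintegral_ge0 => x _; exact: sqr_ge0.
Qed.

End Integration.

(** * Primitives *)

Section Primitives.
Context {R : realType}.
Local Notation mu := (@lebesgue_measure R).
Local Notation itg D f := (mu.-integrable D (EFin \o f)).
Local Notation I01 := (`]@GRing.zero R, @GRing.one R[%classic).
Implicit Types (D : set R) (f g u v : R -> R).

Lemma within_ctsP (a b : R) f : {within `[a, b], continuous f} <->
  (forall x, a <= x <= b -> forall e : R, 0 < e -> exists2 d : R, 0 < d &
     forall y, a <= y <= b -> `|y - x| < d -> `|f y - f x| < e).
Proof.
split=> [cf x xab e e0|h].
  have /(_ x) := (subspace_continuousP _ _).1 cf.
  rewrite /= in_itv/= => /(_ xab) /cvgrPdist_lt /(_ e e0).
  rewrite near_withinE => /nbhs_ballP[d /= d0 hd]; exists d => // y yab yx.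
  by rewrite distrC; apply: hd; rewrite /= ?in_itv//= /ball/= distrC.
apply/subspace_continuousP => x /=; rewrite in_itv/= => xab.
apply/cvgrPdist_lt => e e0; have [d d0 hd] := h x xab e e0.
rewrite near_withinE; apply/nbhs_ballP; exists d => //= y; rewrite /ball/= => yx.
by rewrite in_itv/= => yab; rewrite distrC; apply: hd => //; rewrite distrC.
Qed.

(** Real induction: let c be the supremum of the points up to which [g] stays below [g a].
    Continuity puts c itself in this set, and the hypothesis at c carries it further unless c = b.
    Only right increments occur, so the lemma serves as a mean value inequality for functions that
    are not known to be differentiable. *)
Lemma dini_nonincr g (a b : R) : a <= b -> {within `[a, b], continuous g} ->
  (forall x, a <= x < b -> exists2 d : R, 0 < d &
     forall y : R, x <= y <= x + d -> y <= b -> g y <= g x) ->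
  g b <= g a.
Proof.
move=> ab /within_ctsP cg hg.
pose S := [set x | a <= x <= b /\ forall y, a <= y <= x -> g y <= g a].
have Sa : S a.
  split; first by rewrite lexx.
  by move=> y; rewrite -eq_le => /eqP <-.
have Sb : ubound S b by move=> x [/andP[]].
have supS : has_sup S by split; [exists a|exists b].
set c := sup S.
have ac : a <= c by exact: sup_upper_bound.
have cb : c <= b by apply: ge_sup => //; exists a.
have lt_c y : a <= y -> y < c -> g y <= g a.
  move=> ay yc; have [x [_ Sx] yx] : exists2 x, S x & y < x.
    by have := sup_adherent (eps := c - y) _ supS; rewrite subr_gt0 subKr => /(_ yc).
  by apply: Sx; rewrite ay ltW.
have gc : g c <= g a.
  rewrite leNgt; apply/negP => gac.
  have [ac'|ca] := ltP a c; last first.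
    by move: gac; rewrite (_ : c = a) ?ltxx//; apply/eqP; rewrite eq_le ca.
  have [d d0 hd] := cg c (introT andP (conj ac cb)) (g c - g a) (ltac:(by rewrite subr_gt0)).
  pose y := Num.max a (c - d / 2).
  have yc : y < c by rewrite /y gt_max ac' ltrBlDr ltrDl divr_gt0.
  have ay : a <= y by rewrite /y le_max lexx.
  have := hd y; rewrite ay (le_trans (ltW yc) cb) => /(_ isT).
  have -> : `|y - c| < d.
    rewrite ltr0_norm ?subr_lt0// opprB.
    have : c - d / 2 <= y by rewrite /y le_max lexx orbT.
    by slra.
  move=> /(_ isT); have := lt_c y ay yc; rewrite ltr_norml => h1 /andP[h2 _].
  by slra.
have Sc : forall y, a <= y <= c -> g y <= g a.
  move=> y /andP[ay]; rewrite le_eqVlt => /predU1P[->//|]; exact: lt_c.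
have [cb'|bc] := ltP c b; last first.
  by rewrite (_ : b = c)//; apply/eqP; rewrite eq_le bc.
have [d d0 hd] := hg c (introT andP (conj ac cb')).
pose y := Num.min b (c + d).
have yS : S y.
  split; first by rewrite /y ge_min lexx le_min ab/= (le_trans ac)// lerDl ltW.
  move=> z /andP[az zy]; have [zc|cz] := leP z c; first by apply: Sc; rewrite az.
  move: zy; rewrite /y le_min => /andP[zb zcd].
  by apply: le_trans (hd z _ zb) gc; rewrite (ltW cz).
have : y <= c by exact: sup_upper_bound.
by rewrite /y ge_min => /orP[]; [rewrite leNgt cb'|rewrite leNgt ltrDl d0].
Qed.

Lemma Rint_cat f (a b c : R) : a <= c -> c <= b -> itg `[a, b] f ->
  \int[mu]_(x in `[a, b]) f x =
  \int[mu]_(x in `[a, c]) f x + \int[mu]_(x in `[c, b]) f x.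
Proof.
move=> ac cb hf.
have := @Rintegral_itvB R f (BLeft a) (BRight b) c hf.
rewrite !bnd_simp => /(_ ac cb) E.
rewrite -(@Rintegral_itv_obnd_cbnd R c (BRight b)); last first.
  by apply: (itg_sub _ _ _ hf) => //; apply: subset_itvr; rewrite bnd_simp.
by rewrite -E addrC subrK.
Qed.

Lemma itg_seg_sub f (a b c d : R) : a <= c -> d <= b -> itg `[a, b] f -> itg `[c, d] f.
Proof.
move=> ac db; apply: itg_sub => // x; rewrite /= !in_itv/= => /andP[cx xd].
by rewrite (le_trans ac cx) (le_trans xd db).
Qed.

Lemma Rint_cts f (a b : R) : a <= b -> itg `[a, b] f ->
  {within `[a, b], continuous (fun x => \int[mu]_(t in `[a, x]) f t)}.
Proof. by move=> ab hf; exact: parameterized_integral_continuous. Qed.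

(* u is a primitive of v on ]0, 1[; nothing is required at the end points. *)
Definition prim u v := forall a b : R, 0 < a -> a <= b -> b < 1 ->
  itg `[a, b] v /\ u b - u a = \int[mu]_(s in `[a, b]) v s.

Lemma prim_itg u v (a b : R) : prim u v -> 0 < a -> a <= b -> b < 1 -> itg `[a, b] v.
Proof. by move=> h a0 ab b1; have [] := h a b a0 ab b1. Qed.

Lemma prim_int u v (a b : R) : prim u v -> 0 < a -> a <= b -> b < 1 ->
  u b - u a = \int[mu]_(s in `[a, b]) v s.
Proof. by move=> h a0 ab b1; have [] := h a b a0 ab b1. Qed.

Lemma prim_cts u v (a b : R) : prim u v -> 0 < a -> a <= b -> b < 1 ->
  {within `[a, b], continuous u}.
Proof.
move=> h a0 ab b1; have hv := prim_itg h a0 ab b1.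
have /within_ctsP c := Rint_cts ab hv.
apply/within_ctsP => x /andP[ax xb] e e0.
have [d d0 hd] := c x (introT andP (conj ax xb)) e e0.
exists d => // y /andP[ay yb] yx.
have := hd y (introT andP (conj ay yb)) yx.
rewrite -(prim_int h a0 ax (le_lt_trans xb b1)) -(prim_int h a0 ay (le_lt_trans yb b1)).
by rewrite opprB addrA subrK.
Qed.

Lemma prim_continuous_at u v (x : R) : prim u v -> 0 < x < 1 -> {for x, continuous u}.
Proof.
move=> h /andP[x0 x1].
have cu : {within `[x / 2, (x + 1) / 2], continuous u}.
  by apply: (prim_cts h); slra.
apply: (within_continuous_continuous (a := x / 2) (b := (x + 1) / 2)) => //.
  slra.
by rewrite in_itv/=; slra.
Qed.

Lemma cts_comp (a b : R) f (G : R -> R) : {within `[a, b], continuous f} ->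
  continuous G -> {within `[a, b], continuous (G \o f)}.
Proof.
move=> cf cG; apply/subspace_continuousP => x xab; apply: continuous_cvg => //.
  exact: cG.
exact: ((subspace_continuousP _ _).1 cf).
Qed.

Lemma within_cts_itg (a b : R) f : {within `[a, b], continuous f} -> itg `[a, b] f.
Proof. by move=> cf; apply: continuous_compact_integrable => //; exact: segment_compact. Qed.

Lemma within_cts_bnd (a b : R) f : {within `[a, b], continuous f} ->
  exists M : R, forall x, a <= x <= b -> `|f x| <= M.
Proof.
move=> cf; have [ab|ba] := leP a b; last by exists 0 => x; slra.
have [c _ hc] := EVT_max ab (cts_comp cf (@norm_continuous _ _)).
by exists `|f c| => x xab; apply: hc; rewrite in_itv.
Qed.

Lemma within_cts_meas (a b : R) f : {within `[a, b], continuous f} ->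
  measurable_fun `[a, b] f.
Proof. by move=> /within_cts_itg/itg_meas. Qed.

Lemma itg_cts_mul (a b : R) f g : {within `[a, b], continuous f} -> itg `[a, b] g ->
  itg `[a, b] (fun x => f x * g x).
Proof.
move=> cf hg; have [M hM] := within_cts_bnd cf.
apply: (itg_le (g := fun x => M * `|g x|)) => //.
- by apply: measurable_funM; [exact: within_cts_meas|exact: itg_meas].
- by move=> x; rewrite /= in_itv/= => xab; rewrite normrM ler_wpM2r// hM.
- by apply: itgZ => //; exact: itg_norm.
Qed.

(** The chain rule is obtained without differentiating [u]. On a short interval [x, y] the mean
    value theorem gives G(u y) - G(u x) = G'(xi) (u y - u x), and continuity of [G'] makes this
    differ from the integral of G'(u) v by at most e times that of |v|. So the defect minus e times
    the integral of |v| has nonpositive right increments; the sign [sg] gives the two bounds of the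
    defect. *)
Lemma prim_comp (G G' : R -> R) u v :
  (forall y : R, is_derive y (1 : R) G (G' y)) -> continuous G' ->
  prim u v -> prim (fun s => G (u s)) (fun s => G' (u s) * v s).
Proof.
move=> dG cG' h a b a0 ab b1.
have hv := prim_itg h a0 ab b1; have cu := prim_cts h a0 ab b1.
have cG : continuous G.
  by move=> y; apply/differentiable_continuous/derivable1_diffP; have [] := dG y.
have hf : itg `[a, b] (fun s => G' (u s) * v s).
  by apply: itg_cts_mul => //; exact: cts_comp.
have hav := itg_norm hv.
split=> //.
have key (sg : R) : `|sg| = 1 -> forall e, 0 < e ->
    sg * (G (u b) - G (u a) - \int[mu]_(s in `[a, b]) (G' (u s) * v s)) <=
    e * \int[mu]_(s in `[a, b]) `|v s|.
  move=> sg1 e e0.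
  pose k y := sg * (G (u y) - \int[mu]_(s in `[a, y]) (G' (u s) * v s)) -
     e * \int[mu]_(s in `[a, y]) `|v s|.
  suff : k b <= k a.
    rewrite /k !set_itv1 !Rintegral_set1 subr0 mulr0 subr0.
    by rewrite !mulrBr; slra.
  apply: dini_nonincr => //.
    apply/subspace_continuousP => x xab; apply: cvgB.
      apply: cvgM; first exact: cvg_cst.
      apply: cvgB.
        by have /subspace_continuousP := cts_comp cu cG; apply.
      by have /subspace_continuousP := Rint_cts ab hf; apply.
    apply: cvgM; first exact: cvg_cst.
    by have /subspace_continuousP := Rint_cts ab hav; apply.
  move=> x /andP[ax xb].
  have /cvgrPdist_lt /(_ (e / 2) (divr_gt0 e0 (ltr0Sn _ 1))) := cG' (u x).
  move=> /nbhs_ballP[eta /= eta0 heta].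
  have /within_ctsP /(_ x _ (eta) eta0) := cu.
  rewrite ax (ltW xb) => /(_ isT)[d d0 hd].
  exists (d / 2); first by rewrite divr_gt0.
  move=> y /andP[xy yd] yb.
  have ay := le_trans ax xy.
  have near_s s : x <= s -> s <= y -> `|u s - u x| < eta.
    move=> xs sy; apply: hd; first by rewrite (le_trans ax xs) (le_trans sy yb).
    by rewrite ger0_norm ?subr_ge0//; slra.
  have [xi hxi E] : exists2 xi, `|xi - u x| < eta &
      G (u y) - G (u x) = G' xi * (u y - u x).
    have cGw (p q : R) : {within `[p, q], continuous G} by exact: continuous_subspaceT.
    have uy := near_s y xy (lexx _); move: uy; rewrite ltr_norml => /andP[uy1 uy2].
    have [uxy|uyx] := leP (u x) (u y).
      have [c] := MVT_segment uxy (fun z _ => dG z) (cGw _ _).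
      rewrite in_itv/= => /andP[c1 c2] ->; exists c => //.
      by rewrite ltr_norml; slra.
    have [c] := MVT_segment (ltW uyx) (fun z _ => dG z) (cGw _ _).
    rewrite in_itv/= => /andP[c1 c2] E; exists c; first by rewrite ltr_norml; slra.
    by rewrite -opprB E -mulrN opprB.
  rewrite -subr_le0.
  have x0 : 0 < x by exact: lt_le_trans ax.
  have y1 : y < 1 by exact: le_lt_trans b1.
  have ivxy := prim_itg h x0 xy y1.
  have ifxy : itg `[x, y] (fun s => G' (u s) * v s) by exact: itg_seg_sub hf.
  have -> : k y - k x = sg * \int[mu]_(s in `[x, y]) ((G' xi - G' (u s)) * v s) -
      e * \int[mu]_(s in `[x, y]) `|v s|.
    rewrite /k (Rint_cat ax xy); last exact: itg_seg_sub hf.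
    rewrite (Rint_cat ax xy); last exact: itg_seg_sub hav.
    have -> : \int[mu]_(s in `[x, y]) ((G' xi - G' (u s)) * v s) =
       G (u y) - G (u x) - \int[mu]_(s in `[x, y]) (G' (u s) * v s).
      rewrite E (prim_int h x0 xy y1) -RintegralZl// -RintegralB//; last exact: itgZ.
      by apply: eq_Rintegral => s _; rewrite mulrBl.
    ring.
  rewrite subr_le0; apply: le_trans (ler_norm _) _; rewrite normrM sg1 mul1r.
  rewrite -RintegralZl//; last exact: itg_norm.
  apply: Rint_norm_le => //.
  - apply: (itg_eq (f := fun s => G' xi * v s - G' (u s) * v s)) => //.
      by move=> s _; rewrite mulrBl.
    by apply: itgB => //; exact: itgZ.
  - by apply: itgZ => //; exact: itg_norm.
  move=> s; rewrite /= in_itv/= => /andP[xs sy]; rewrite normrM ler_wpM2r//.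
  have h1 := heta xi; rewrite /ball/= distrC in h1; have := h1 hxi.
  have h2 := heta (u s); rewrite /ball/= distrC in h2; have := h2 (near_s s xs sy).
  move=> h3 h4; rewrite (_ : G' xi - _ = (G' (u x) - G' (u s)) - (G' (u x) - G' xi)); last by ring.
  by apply: le_trans (ler_normB _ _) _; slra.
have key2 (sg : R) : `|sg| = 1 ->
    sg * (G (u b) - G (u a) - \int[mu]_(s in `[a, b]) (G' (u s) * v s)) <= 0.
  move=> sg1; apply/ler_addgt0Pr => e e0; rewrite add0r.
  have I0 : 0 <= \int[mu]_(s in `[a, b]) `|v s| by apply: Rintegral_ge0.
  apply: le_trans (key sg sg1 (e / (\int[mu]_(s in `[a, b]) `|v s| + 1)) _) _.
    by rewrite divr_gt0// ltr_wpDl.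
  by rewrite mulrAC ler_pdivrMr ?ltr_wpDl// ler_wpM2l ?(ltW e0)// lerDl.
have := key2 1 (normr1 _); have := key2 (-1) (ltac:(by rewrite normrN1)).
by slra.
Qed.

Lemma primD u v u' v' : prim u v -> prim u' v' ->
  prim (fun s => u s + u' s) (fun s => v s + v' s).
Proof.
move=> h h' a b a0 ab b1; have [i e] := h a b a0 ab b1; have [i' e'] := h' a b a0 ab b1.
split; first exact: itgD.
by rewrite RintegralD// -e -e'; ring.
Qed.

Lemma primZ (c : R) u v : prim u v -> prim (fun s => c * u s) (fun s => c * v s).
Proof.
move=> h a b a0 ab b1; have [i e] := h a b a0 ab b1.
split; first exact: itgZ.
by rewrite RintegralZl// -e; ring.
Qed.

Lemma primN u v : prim u v -> prim (fun s => - u s) (fun s => - v s).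
Proof. by move=> /(primZ (-1)); under eq_fun do rewrite mulN1r; under [X in prim _ X]eq_fun do rewrite mulN1r. Qed.

Lemma primB u v u' v' : prim u v -> prim u' v' ->
  prim (fun s => u s - u' s) (fun s => v s - v' s).
Proof. by move=> h h'; apply: primD => //; exact: primN. Qed.

Lemma prim_eq u v u' v' : (forall s, 0 < s < 1 -> u s = u' s) ->
  (forall s, 0 < s < 1 -> v s = v' s) -> prim u v -> prim u' v'.
Proof.
move=> uu vv h a b a0 ab b1; have [i e] := h a b a0 ab b1.
have vab s : `[a, b]%classic s -> v s = v' s.
  by rewrite /= in_itv/= => sab; apply: vv; slra.
split; first exact: itg_eq i.
rewrite -!uu; try slra.
rewrite e; apply: eq_Rintegral => s /set_mem; exact: vab.
Qed.

Lemma prim_ae u v v' : measurable_fun I01 v' ->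
  {ae mu, forall s, I01 s -> v s = v' s} -> prim u v -> prim u v'.
Proof.
move=> mv' vv h a b a0 ab b1; have [i e] := h a b a0 ab b1.
have sub : `[a, b] `<=` I01.
  by move=> x; rewrite /= !in_itv/=; slra.
have mv'2 : measurable_fun `[a, b] v' by exact: measurable_funS mv'.
have vv' : {ae mu, forall s, `[a, b]%classic s -> v s = v' s}.
  by apply: (filterS_ae vv) => s hs /sub; exact: hs.
split; first exact: (itg_ae_eq _ _ vv').
by rewrite e; apply: Rint_ae_eq => //; exact: itg_meas.
Qed.

Lemma prim_cst (c : R) : prim (fun=> c) (fun=> 0).
Proof.
move=> a b a0 ab b1; split; last by rewrite subrr Rintegral_cst// mul0r.
by apply: itg_cst => //; rewrite lebesgue_measure_itv/=; case: ifP => _; rewrite -?EFinB ?ltry.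
Qed.

(** Polarisation: the product is half of (u + u')^2 - u^2 - u'^2, and [prim_comp] applies to each
    square. *)
Lemma primM u v u' v' : prim u v -> prim u' v' ->
  prim (fun s => u s * u' s) (fun s => v s * u' s + u s * v' s).
Proof.
move=> h h'.
have sq w w' : prim w w' -> prim (fun s => w s ^+ 2) (fun s => 2 * w s * w' s).
  apply: (prim_comp (G := fun y => y ^+ 2) (G' := fun y => 2 * y)).
    move=> y; apply: is_derive_eq; rewrite /GRing.scale/=; ring.
  by move=> y; apply: cvgM; [exact: cvg_cst|exact: cvg_id].
have := primZ (2^-1) (primB (sq _ _ (primD h h')) (primD (sq _ _ h) (sq _ _ h'))).
by apply: prim_eq => s _; field.
Qed.

Lemma prim_sum n (u v : 'I_n -> R -> R) : (forall i, prim (u i) (v i)) ->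
  prim (fun s => \sum_i u i s) (fun s => \sum_i v i s).
Proof.
move=> h a b a0 ab b1; split.
  by apply: itg_sum => // i; exact: (prim_itg (h i)).
rewrite Rint_sum//; last by move=> i; exact: (prim_itg (h i)).
rewrite -sumrB; apply: eq_bigr => i _; exact: (prim_int (h i)).
Qed.

Lemma prim_le u v (a b : R) : prim u v -> (forall s, 0 < s < 1 -> v s <= 0) ->
  0 < a -> a <= b -> b < 1 -> u b <= u a.
Proof.
move=> h v0 a0 ab b1; have [i e] := h a b a0 ab b1.
rewrite -subr_le0 e -oppr_ge0 -RintN//; apply: Rintegral_ge0 => s.
by rewrite /= in_itv/= => sab; rewrite oppr_ge0; apply: v0; slra.
Qed.

Lemma prim_C1 (u u' : R -> R) : (forall s : R, 0 < s < 1 -> is_derive s (1 : R) u (u' s)) ->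
  (forall s : R, 0 < s < 1 -> {for s, continuous u'}) -> prim u u'.
Proof.
move=> du cu' a b a0 ab b1.
have cw : {within `[a, b], continuous u'}.
  apply: continuous_in_subspaceT => s /set_mem; rewrite /= in_itv/= => sab.
  by apply: cu'; slra.
split; first exact: within_cts_itg.
have [abl|ba] := ltP a b; last first.
  have -> : b = a by slra.
  by rewrite subrr set_itv1 Rintegral_set1.
rewrite /Rintegral (continuous_FTC2 abl cw (F := u)) ?fineB//.
- have cu s : 0 < s < 1 -> {for s, continuous u}.
    by move=> s01; apply/differentiable_continuous/derivable1_diffP; have [] := du s s01.
  split.
  + by move=> s; rewrite in_itv/= => sab; have [] := du s ltac:(slra).
  + by apply: cvg_at_right_filter; apply: cu; slra.
  + by apply: cvg_at_left_filter; apply: cu; slra.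
- by move=> s; rewrite in_itv/= => sab; rewrite derive1E; have [_ ->] := du s ltac:(slra).
Qed.

Lemma mu01 : mu I01 = 1%E.
Proof. by rewrite lebesgue_measure_itv/= lte_fin ltr01 oppr0 adde0. Qed.

Lemma mu01_lty : (mu I01 < +oo)%E.
Proof. by rewrite mu01 ltry. Qed.

Lemma prim_id : prim (fun s => s) (fun=> 1).
Proof.
by apply: prim_C1 => s _; exact: cvg_cst.
Qed.

Lemma prim_inv : prim (fun s => s^-1) (fun s => - s ^- 2).
Proof.
apply: prim_C1 => s /andP[s0 _]; have sn : s != 0 by rewrite gt_eqF.
  have := @is_deriveV R id s 1 1 sn (is_derive_id _ _); rewrite /GRing.scale/= mulr1; exact.
apply: cvgN; apply: cvgV; first by rewrite expf_neq0.
by apply: cvgM; exact: cvg_id.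
Qed.

Lemma Rint01_cst (c : R) : \int[mu]_(s in I01) (fun=> c) s = c.
Proof. by rewrite Rintegral_cst// [X in fine X](_ : _ = 1%E) ?mulr1//; exact: mu01. Qed.

Lemma near01_0 : \forall s \near (0 : R)^'+, 0 < s < 1.
Proof.
near=> s; apply/andP; split; near: s; first exact: nbhs_right_gt.
exact: nbhs_right_lt.
Unshelve. all: by end_near. Qed.

Lemma near01_1 : \forall s \near (1 : R)^'-, 0 < s < 1.
Proof.
near=> s; apply/andP; split; near: s; first exact: nbhs_left_gt.
exact: nbhs_left_lt.
Unshelve. all: by end_near. Qed.

Lemma near_left1 (P : R -> Prop) : (\forall s \near (1 : R)^'-, P s) ->
  exists2 b : R, 0 < b < 1 & forall s : R, b < s < 1 -> P s.
Proof.
move=> /nbhs_ballP[e /= e0 he]; exists (Num.max (1 - e) 2^-1).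
  by rewrite lt_max gt_max; slra.
move=> s; rewrite gt_max => /andP[/andP[s0 se] s1]; apply: he => //.
by rewrite /ball/= gtr0_norm ?subr_gt0//; slra.
Qed.

Lemma itg01 v : itg I01 v -> itg `[0, 1] v.
Proof.
move=> /integrableP[mv iv]; have mv' : measurable_fun I01 v by exact/measurable_EFinP.
have mv2 : measurable_fun (`[0, 1] : set R) v by exact: measurable_fun_itv_cc mv'.
apply/integrableP; split; first exact/measurable_EFinP.
rewrite integral_itv_bndoo//; apply/measurable_EFinP.
by do 2 apply: measurableT_comp => //.
Qed.

Lemma Rint01 v : measurable_fun I01 v -> \int[mu]_(s in I01) v s = \int[mu]_(s in `[0, 1]) v s.
Proof.
move=> mv; have mv' : measurable_fun I01 (EFin \o v) by exact/measurable_EFinP.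
by rewrite /Rintegral [in RHS]integral_itv_bndoo.
Qed.

Lemma itg_seg01 v (a b : R) : itg I01 v -> 0 <= a -> b <= 1 -> itg `[a, b] v.
Proof. by move=> /itg01 iv a0 b1; exact: itg_seg_sub iv. Qed.

Lemma prim_int0 v : itg I01 v -> prim (fun s => \int[mu]_(r in `[0, s]) v r) v.
Proof.
move=> iv a b a0 ab b1; split; first by apply: (itg_seg01 iv); slra.
rewrite (@Rint_cat v 0 b a) ?(ltW a0)//; first by ring.
by apply: (itg_seg01 iv); slra.
Qed.

Lemma int0_cvg0 v : itg I01 v -> \int[mu]_(r in `[0, s]) v r @[s --> 0^'+] --> 0.
Proof.
move=> /itg01 iv; have /within_ctsP h := Rint_cts ler01 iv.
apply/cvgrPdist_lt => e e0; have [d d0 hd] := h 0 (ltac:(by rewrite lexx ler01)) e e0.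
near=> s; rewrite distrC.
have := hd s; rewrite set_itv1 Rintegral_set1; apply.
  have : 0 < s < 1 by near: s; exact: near01_0.
  by move=> /andP[/ltW -> /ltW ->].
rewrite subr0 gtr0_norm; last by near: s; exact: nbhs_right_gt.
by near: s; exact: nbhs_right_lt.
Unshelve. all: by end_near. Qed.

Lemma int0_cvg1 v : itg I01 v ->
  \int[mu]_(r in `[0, s]) v r @[s --> 1^'-] --> \int[mu]_(r in `[0, 1]) v r.
Proof.
move=> /itg01 iv; have /within_ctsP h := Rint_cts ler01 iv.
apply/cvgrPdist_lt => e e0; have [d d0 hd] := h 1 (ltac:(by rewrite lexx ler01)) e e0.
near=> s; rewrite distrC; apply: hd.
  have : 0 < s < 1 by near: s; exact: near01_1.
  by move=> /andP[/ltW -> /ltW ->].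
rewrite distrC gtr0_norm ?subr_gt0; last by near: s; exact: nbhs_left_lt.
by rewrite ltrBlDr -ltrBlDl; near: s; apply: nbhs_left_gt; rewrite ltrBlDr ltrDl.
Unshelve. all: by end_near. Qed.

Lemma prim_uniq u u' v (a b : R) : prim u v -> prim u' v -> 0 < a < 1 -> 0 < b < 1 ->
  u a - u' a = u b - u' b.
Proof.
move=> h h'; wlog ab : a b / a <= b.
  move=> H a1 b1; have [ab|/ltW ba] := leP a b; first exact: H.
  by rewrite (H b a).
move=> /andP[a0 _] /andP[_ b1].
by have := prim_int h a0 ab b1; rewrite -(prim_int h' a0 ab b1); slra.
Qed.

Lemma prim_int1 v : itg I01 v -> prim (fun s => \int[mu]_(r in `[s, 1]) v r) (fun s => - v s).
Proof.
move=> iv a b a0 ab b1; have i : itg `[a, b] v by apply: (itg_seg01 iv); slra.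
split; first exact: itgN.
rewrite RintN// (@Rint_cat v a 1 b) ?(ltW b1)//; first by ring.
by apply: (itg_seg01 iv); slra.
Qed.

(** Integrability of [v] up to the end points is what gives [u] limits there; the point 1/2 only
    fixes the constant of integration [l0]. *)
Lemma prim_limits u v : prim u v -> itg I01 v -> exists l0 l1,
  [/\ u s @[s --> 0^'+] --> l0, u s @[s --> 1^'-] --> l1,
   l1 - l0 = \int[mu]_(s in I01) v s,
   (forall s, 0 < s < 1 -> u s = l0 + \int[mu]_(r in `[0, s]) v r) &
   (forall s, 0 < s < 1 -> u s = l1 - \int[mu]_(r in `[s, 1]) v r)].
Proof.
move=> h iv; set U := fun s => \int[mu]_(r in `[0, s]) v r.
have hU : prim U v by exact: prim_int0.
have h2 : 0 < (2^-1 : R) < 1 by slra.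
pose l0 := u 2^-1 - U 2^-1.
have E s : 0 < s < 1 -> u s = l0 + U s.
  by move=> s01; have := prim_uniq h hU s01 h2; rewrite /l0 => <-; rewrite subrK.
exists l0, (l0 + \int[mu]_(r in `[0, 1]) v r); split => //.
- rewrite -[X in _ --> X]addr0.
  apply: (@cvg_trans _ ((l0 + U s) @[s --> 0^'+])).
    apply: near_eq_cvg; near=> s; rewrite E//; near: s; exact: near01_0.
  by apply: cvgD; [exact: cvg_cst|exact: int0_cvg0].
- apply: (@cvg_trans _ ((l0 + U s) @[s --> 1^'-])).
    apply: near_eq_cvg; near=> s; rewrite E//; near: s; exact: near01_1.
  by apply: cvgD; [exact: cvg_cst|exact: int0_cvg1].
- by rewrite (Rint01 (itg_meas iv)) addrC addKr.
- move=> s s01; rewrite E// (@Rint_cat v 0 1 s); [rewrite /U; ring|slra|slra|exact: itg01].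
Unshelve. all: by end_near. Qed.

Lemma prim_right u v (l : R) : prim u v -> itg I01 v -> u s @[s --> 1^'-] --> l ->
  forall s, 0 < s < 1 -> u s = l - \int[mu]_(r in `[s, 1]) v r.
Proof.
move=> h iv ul; have [l0 [l1 [_ h1 _ _ E]]] := prim_limits h iv.
by rewrite (_ : l = l1)//; exact: (cvg_unique _ ul h1).
Qed.

Lemma prim_parts u v (l0 l1 : R) : prim u v -> itg I01 v -> u s @[s --> 0^'+] --> l0 ->
  u s @[s --> 1^'-] --> l1 -> \int[mu]_(s in I01) v s = l1 - l0.
Proof.
move=> h iv u0 u1; have [k0 [k1 [h0 h1 E _ _]]] := prim_limits h iv.
by rewrite -E; congr (_ - _); [exact: (cvg_unique _ h1 u1)|exact: (cvg_unique _ h0 u0)].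
Qed.

Lemma int1_cvg1 v : itg I01 v -> \int[mu]_(r in `[s, 1]) v r @[s --> 1^'-] --> 0.
Proof.
move=> iv; have i1 := itg01 iv.
apply: (@cvg_trans _ ((\int[mu]_(r in `[0, 1]) v r - \int[mu]_(r in `[0, s]) v r) @[s --> 1^'-])).
  apply: near_eq_cvg; near=> s.
  have s01 : 0 < s < 1 by near: s; exact: near01_1.
  by rewrite (@Rint_cat v 0 1 s) 1?addrC ?addKr//; slra.
have := @cvgB _ _ _ _ _ _ _ _ _ (cvg_cst (\int[mu]_(r in `[0, 1]) v r)) (int0_cvg1 iv).
by rewrite subrr; exact.
Unshelve. all: by end_near. Qed.

Lemma prim_meas u v : prim u v -> measurable_fun I01 u.
Proof.
move=> h; apply: open_continuous_measurable_fun => //.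
move=> x /set_mem; rewrite /= in_itv/=; exact: prim_continuous_at h.
Qed.

(** A uniform bound on compact segments passes to (0, 1) by monotone convergence. This yields
    integrability at the end points for functions that are only known to be locally integrable. *)
Lemma exhaust01 (f : R -> R) (C : R) : measurable_fun I01 f ->
  (forall s, I01 s -> 0 <= f s) ->
  (forall a b, 0 < a -> a <= b -> b < 1 -> itg `[a, b] f /\ \int[mu]_(s in `[a, b]) f s <= C) ->
  itg I01 f /\ \int[mu]_(s in I01) f s <= C.
Proof.
move=> mf f0 hC.
(* The shift by 3 gives 1/(n+3) <= 1/3, so that every segment is nondegenerate. *)
pose F (n : nat) : set R := `[n.+3%:R^-1, 1 - n.+3%:R^-1]%classic.
have n3 n : 0 < (n.+3%:R : R)^-1 <= 3^-1.
  by rewrite invr_gt0 ltr0n/= lef_pV2 ?posrE ?ltr0n// ler_nat.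
have Fsub n : F n `<=` I01.
  move=> x; rewrite /F /= !in_itv/=; have := n3 n; move: (n.+3%:R^-1) => c.
  by slra.
have hF n : itg (F n) f /\ \int[mu]_(s in F n) f s <= C.
  by apply: hC; have := n3 n; move: (n.+3%:R^-1) => c; slra.
have EF : \bigcup_n F n = I01.
  apply/seteqP; split => [x [n _ /Fsub]//|x]; rewrite /= in_itv/= => /andP[x0 x1].
  have m0 : 0 < Num.min x (1 - x) by rewrite lt_min x0 subr_gt0.
  have [n hn] : exists n : nat, (n.+3%:R : R)^-1 <= Num.min x (1 - x).
    exists (Num.truncn (Num.min x (1 - x))^-1).
    rewrite -[leRHS]invrK lef_pV2 ?posrE ?invr_gt0 ?ltr0n//.
    apply: le_trans (ltW (truncnS_gt _)) _.
    by rewrite ler_nat; do 2 apply: leqW.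
  exists n => //; rewrite /F/= in_itv/=.
  move: hn; rewrite le_min => /andP[]; move: (n.+3%:R^-1) => c h1 h2; slra.
have mE : measurable_fun I01 (EFin \o f) by exact/measurable_EFinP.
have cv : (\int[mu]_(x in F n) (f x)%:E @[n --> \oo] --> \int[mu]_(x in I01) (f x)%:E)%E.
  rewrite -EF; apply: ge0_nondecreasing_set_cvg_integral => //.
  - apply/nondecreasing_seqP => n; rewrite subsetEset /F => x; rewrite /= !in_itv/=.
    have : (n.+4%:R : R)^-1 <= n.+3%:R^-1 by rewrite lef_pV2 ?posrE ?ltr0n// ler_nat.
    by move: (n.+4%:R^-1) (n.+3%:R^-1) => c c'; slra.
  - by move=> n; exact: measurable_itv.
  - by move=> n; apply: measurable_funS mE.
  - by move=> n x /Fsub/f0; rewrite lee_fin.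
have le : (\int[mu]_(x in I01) (f x)%:E <= C%:E)%E.
  rewrite -(cvg_lim _ cv)//; apply: lime_le; first by apply/cvg_ex; eexists; exact: cv.
  apply: nearW => n; have [i hn] := hF n.
  by rewrite EFin_Rint ?lee_fin//; exact: measurable_itv.
have i : itg I01 f.
  apply/integrableP; split => //; apply: le_lt_trans (ltry C).
  apply: le_trans le; rewrite le_eqVlt; apply/orP; left; apply/eqP.
  by apply: eq_integral => x /set_mem x01; rewrite /= ger0_norm ?f0.
by split => //; rewrite -lee_fin -EFin_Rint.
Qed.

(** Two values of [f] differ by at most the integral of |f'|. Averaging this comparison over [r], in
    an interval of length 1, gives the bound. *)
Lemma prim_sup f f' (s : R) : prim f f' -> itg I01 f -> itg I01 f' -> 0 < s < 1 ->
  f s <= \int[mu]_(r in I01) f r + \int[mu]_(r in I01) `|f' r|.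
Proof.
move=> h fi f'i s01; set K := \int[mu]_(r in I01) `|f' r|.
have an := itg_norm f'i.
have diff r : I01 r -> f s - K <= f r.
  rewrite /= in_itv/= => r01.
  suff : `|f s - f r| <= K by rewrite ler_norml; slra.
  have key x y : 0 < x -> x <= y -> y < 1 -> `|f y - f x| <= K.
    move=> x0 xy y1; rewrite (prim_int h x0 xy y1).
    have ixy := prim_itg h x0 xy y1.
    apply: le_trans (@le_normr_Rintegral _ _ _ mu _ _ _ ixy) _ => //.
    by apply: (Rint_sub _ _ _ an) => // z; rewrite /= !in_itv/=; slra.
  have [rs|/ltW sr] := leP r s; first by apply: key; slra.
  by rewrite distrC; apply: key; slra.
rewrite -lerBlDr; apply: le_trans (_ : \int[mu]_(r in I01) (fun=> f s - K) r <= _).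
  by rewrite Rint01_cst.
apply: le_Rintegral => //; apply: itg_cst => //; exact: mu01_lty.
Qed.

End Primitives.

(** * The two-point boundary value problem *)

Section BoundaryValueProblem.
Context {R : realType}.
Local Notation mu := (@lebesgue_measure R).
Local Notation itg D f := (mu.-integrable D (EFin \o f)).
Local Notation I01 := (`]@GRing.zero R, @GRing.one R[%classic).
Implicit Types (D : set R) (f g u v w : R -> R).

Lemma Rint_seg_cst (a b c : R) : a <= b -> \int[mu]_(s in `[a, b]) (fun=> c) s = c * (b - a).
Proof.
move=> ab; rewrite Rintegral_cst//; congr (_ * _).
rewrite [X in fine X](_ : _ = lebesgue_measure (`[a, b]%classic : set R))//.
rewrite lebesgue_measure_itv/= lte_fin.
by case: ltgtP ab => //= -> _; rewrite subrr.
Qed.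

Lemma itg_seg_cst (a b c : R) : itg `[a, b] (fun=> c).
Proof. by apply: itg_cst => //; rewrite lebesgue_measure_itv/=; case: ifP => _; rewrite -?EFinB ?ltry. Qed.

Lemma cvg_gt0_le u (l : R) (F : set_system R) {FF : ProperFilter F} (c : R) :
  u s @[s --> F] --> l -> (\forall s \near F, c <= u s) -> c <= l.
Proof. by move=> ul h; rewrite -(cvg_lim _ ul)//; apply: limr_ge => //; apply/cvg_ex; exists l. Qed.

Lemma cvg_le_le u (l : R) (F : set_system R) {FF : ProperFilter F} (c : R) :
  u s @[s --> F] --> l -> (\forall s \near F, u s <= c) -> l <= c.
Proof. by move=> ul h; rewrite -(cvg_lim _ ul)//; apply: limr_le => //; apply/cvg_ex; exists l. Qed.

(** The squared negative part is C^1, unlike the negative part itself, so that [prim_comp] can be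
    applied to it. *)
Definition negsq (y : R) := Num.min y 0 ^+ 2.

Lemma is_derive_negsq (y : R) : is_derive y (1 : R) negsq (2 * Num.min y 0).
Proof.
have [y0|y0|->] := ltgtP y 0.
- have : is_derive y (1 : R) (fun z => z ^+ 2) (2 * y).
    by apply: is_derive_eq; rewrite /GRing.scale/=; ring.
  apply: near_eq_is_derive.
  near=> z; rewrite /negsq min_l//; apply: ltW; near: z; exact: lt_nbhsl.
- rewrite mulr0; have := is_derive_cst (0 : R) y (1 : R).
  apply: near_eq_is_derive.
  near=> z; rewrite /negsq min_r ?expr0n//=; apply: ltW; near: z; exact: lt_nbhsr.
- rewrite mulr0.
  have L : `|h| @[h --> (0 : R)^'] --> (0 : R).
    have := @norm_continuous _ R 0; rewrite /continuous_at normr0 => H.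
    by apply: (cvg_trans _ H); apply: cvg_app; exact: nbhs_dnbhs.
  have H : h^-1 *: ((negsq \o shift 0) (h *: (1 : R)) - negsq 0) @[h --> 0^'] --> (0 : R).
    apply: (@squeeze_cvgr _ _ _ _ (fun h : R => - `|h|) (fun h : R => `|h|)).
    + near=> h; have h0 : h != 0 by near: h; exact: nbhs_dnbhs_neq.
      rewrite -ler_norml /negsq /shift/= addr0 /GRing.scale/= mulr1 minxx expr0n/= subr0.
      rewrite normrM normfV ler_pdivrMl ?normr_gt0// -expr2 normrX lerXn2r ?nnegrE//.
      by rewrite /Num.min; case: ifP => // _; rewrite normr0.
    + by rewrite -[X in _ --> X]oppr0; apply: cvgN.
    + exact: L.
  split; first by apply/cvg_ex; exists 0.
  exact: cvg_lim.
Unshelve. all: by end_near. Qed.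

(** Let M be the squared negative part of [w]. The hypothesis makes M w1 nonincreasing; it cannot be
    negative anywhere, because w1 tends to 0 at 1 while M would stay bounded there. Hence w1 >= 0
    wherever w < 0, so M is nonincreasing, and it starts from 0. *)
Lemma max_principle w w1 w2 : prim w w1 -> prim w1 w2 ->
  (forall s : R, 0 < s < 1 -> w s < 0 -> w2 s <= 0) ->
  w s @[s --> 0^'+] --> (0 : R) -> w1 s @[s --> 1^'-] --> (0 : R) ->
  forall s, 0 < s < 1 -> 0 <= w s.
Proof.
move=> h h1 w2le w0 w11.
have cmin : continuous (fun y : R => 2 * Num.min y 0).
  move=> y; apply: cvgM; first exact: cvg_cst.
  apply: continuous_min; [exact: cvg_id|exact: cvg_cst].
have hM := prim_comp is_derive_negsq cmin h.
set M := fun s => negsq (w s); rewrite -/M in hM.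
have M0 s : 0 <= M s by exact: sqr_ge0.
have Mpos s : M s <> 0 -> w s < 0.
  rewrite /M /negsq; have [//|w0'] := ltP (w s) 0.
  by rewrite expr0n.
have hf := primM hM h1.
have fle : forall a b, 0 < a -> a <= b -> b < 1 -> M b * w1 b <= M a * w1 a.
  move=> a b; apply: (prim_le hf) => s s01.
  have m0 : Num.min (w s) 0 <= 0 by rewrite ge_min lexx orbT.
  have [Ms|Ms] := eqVneq (M s) 0.
    rewrite Ms mul0r addr0 -mulrA -expr2.
    by have := sqr_ge0 (w1 s); snra.
  have wn := Mpos s (elimN eqP Ms); have := w2le s s01 wn.
  have := M0 s; have := sqr_ge0 (w1 s); snra.
have f0 s : 0 < s < 1 -> 0 <= M s * w1 s.
  move=> /andP[s0 s1]; rewrite leNgt; apply/negP => fs.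
  have [b0 b001 hb] := near_left1 ((cvgr0Pnorm_lt _).1 w11 1 ltr01).
  pose b := Num.max s ((b0 + 1) / 2).
  have sb : s <= b by rewrite le_max lexx.
  have b0b : b0 < b by rewrite lt_max; slra.
  have b1 : b < 1 by rewrite gt_max; slra.
  have fb r : b <= r -> r < 1 -> M r * w1 r <= M s * w1 s.
    by move=> br r1; apply: fle => //; exact: le_trans br.
  have w1n r : b <= r -> r < 1 -> w1 r < 0 /\ w r < 0.
    move=> br r1; have := fb r br r1; have := M0 r; have := @Mpos r.
    case: (eqVneq (M r) 0) => [-> _ _|Mr /(_ (elimN eqP Mr)) wr]; first by rewrite mul0r; slra.
    by move=> ? ?; split => //; snra.
  have wge r : b <= r -> r < 1 -> w b - 1 <= w r.
    move=> br r1; have b0' : 0 < b by slra.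
    have ibr := prim_itg h b0' br r1.
    suff : `|w r - w b| <= 1 by rewrite ler_norml; slra.
    rewrite (prim_int h b0' br r1).
    apply: le_trans (Rint_norm_le (g := fun=> 1) _ ibr _ _) _ => //.
    + exact: itg_seg_cst.
    + move=> x; rewrite /= in_itv/= => xbr; apply: ltW; apply: hb; slra.
    + by rewrite Rint_seg_cst// mul1r; slra.
  (* Beyond [b] one has |w1| < 1, so [w] stays above [w b - 1]; being negative, it has square at
     most [K]. *)
  pose K := (w b - 1) ^+ 2.
  have MK r : b <= r -> r < 1 -> M r <= K.
    move=> br r1; have [_ wr] := w1n r br r1; have := wge r br r1.
    by rewrite /M /negsq min_l ?(ltW wr)// /K; snra.
  have wc : K * w1 r @[r --> 1^'-] --> K * 0 by apply: cvgM => //; exact: cvg_cst.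
  rewrite mulr0 in wc.
  suff : 0 <= M s * w1 s by slra.
  apply: (cvg_le_le wc); near=> r.
  have br : b <= r by apply: ltW; near: r; exact: nbhs_left_gt.
  have r1 : r < 1 by near: r; exact: nbhs_left_lt.
  apply: le_trans (fb r br r1); have := MK r br r1; have [] := w1n r br r1.
  snra.
move=> s s01; rewrite leNgt; apply/negP => ws.
have Mle r : 0 < r -> r <= s -> M s <= M r.
  move=> r0 rs; apply: (prim_le hM) => //; last by slra.
  move=> x x01; have [wx|wx] := ltP (w x) 0; last by rewrite mulr0 mul0r.
  have : 0 < M x by rewrite lt0r M0 andbT /M /negsq min_l ?(ltW wx)// sqrf_eq0 lt_eqF.
  by have := f0 x x01; snra.
have cM : M r @[r --> 0^'+] --> (0 : R).
  rewrite -[X in _ --> X](_ : negsq 0 = _); last by rewrite /negsq minxx expr0n.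
  apply: continuous_cvg => //.
  by apply/differentiable_continuous/derivable1_diffP; have [] := is_derive_negsq 0.
have : M s <= 0.
  apply: (cvg_gt0_le cM); near=> r; apply: Mle.
    by near: r; exact: nbhs_right_gt.
  by near: r; apply: nbhs_right_le; lra.
by rewrite /M /negsq min_l ?(ltW ws)//; snra.
Unshelve. all: by end_near. Qed.

Lemma itg_bnd01 f (C : R) : measurable_fun I01 f -> (forall s, 0 < s < 1 -> `|f s| <= C) ->
  itg I01 f.
Proof.
move=> mf fC; apply: (itg_le (g := fun=> C)) => //; last first.
  by apply: itg_cst => //; exact: mu01_lty.
Qed.

Lemma Rint_seg01_le g (a b : R) : itg I01 g -> (forall s, 0 < s < 1 -> 0 <= g s) ->
  0 <= a -> b <= 1 -> \int[mu]_(s in `[a, b]) g s <= \int[mu]_(s in I01) g s.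
Proof.
move=> ig g0 a0 b1; have [ab|ba] := leP a b; last first.
  rewrite set_itv_ge; last by rewrite bnd_simp -ltNge.
  by rewrite Rintegral_set0; apply: Rintegral_ge0 => x; rewrite /= in_itv/=; exact: g0.
have -> : \int[mu]_(s in `[a, b]) g s = \int[mu]_(s in `]a, b[) g s.
  rewrite /Rintegral integral_itv_bndoo//; apply/measurable_EFinP.
  apply: measurable_funS (itg_meas ig) => // x; rewrite /= !in_itv/=; slra.
apply: (Rint_sub _ _ _ ig) => //; by move=> x; rewrite /= !in_itv/=; slra.
Qed.

Lemma Rint_seg01_ge0 g (a b : R) : itg I01 g -> (forall s, 0 < s < 1 -> 0 <= g s) ->
  0 <= a -> b <= 1 -> 0 <= \int[mu]_(s in `[a, b]) g s.
Proof.
move=> ig g0 a0 b1; have [ab|ba] := leP a b; last first.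
  rewrite set_itv_ge; last by rewrite bnd_simp -ltNge.
  by rewrite Rintegral_set0.
have -> : \int[mu]_(s in `[a, b]) g s = \int[mu]_(s in `]a, b[) g s.
  rewrite /Rintegral integral_itv_bndoo//; apply/measurable_EFinP.
  apply: measurable_funS (itg_meas ig) => // x; rewrite /= !in_itv/=; slra.
apply: Rintegral_ge0 => x; rewrite /= in_itv/= => xab; apply: g0; slra.
Qed.

(** The barrier W with -W'' = g, W(0) = 0 and W'(1) = 0 satisfies W <= s int g, and the maximum
    principle applies to W - u and W + u: where one of them is negative, q u has the favourable
    sign. *)
Lemma bvp_bound u u1 q k g : prim u u1 -> prim u1 (fun s => q s * u s + k s) ->
  (forall s, 0 < s < 1 -> 0 <= q s) -> (forall s, 0 < s < 1 -> `|k s| <= g s) ->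
  itg I01 g -> u s @[s --> 0^'+] --> (0 : R) -> u1 s @[s --> 1^'-] --> (0 : R) ->
  forall s, 0 < s < 1 -> `|u s| <= s * \int[mu]_(r in I01) g r.
Proof.
move=> h h1 q0 kg ig u0 u11.
set C := \int[mu]_(r in I01) g r.
have g0 s : 0 < s < 1 -> 0 <= g s by move=> /kg; exact: le_trans.
pose W1 r := \int[mu]_(s in `[r, 1]) g s.
have pW1 : prim W1 (fun s => - g s) by exact: prim_int1.
have W1ge r : 0 < r < 1 -> 0 <= W1 r by move=> r01; apply: Rint_seg01_ge0 => //; slra.
have W1le r : 0 < r < 1 -> W1 r <= C by move=> r01; apply: Rint_seg01_le => //; slra.
have iW1 : itg I01 W1.
  apply: (itg_bnd01 (C := C)); first exact: prim_meas pW1.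
  by move=> s s01; rewrite ger0_norm ?W1ge// W1le.
pose W s := \int[mu]_(r in `[0, s]) W1 r.
have pW : prim W W1 by exact: prim_int0.
have Wge s : 0 < s < 1 -> 0 <= W s by move=> s01; apply: Rint_seg01_ge0 => //; slra.
have Wle s : 0 < s < 1 -> W s <= s * C.
  move=> s01.
  have ps : prim (fun r => W r - r * C) (fun r => W1 r - C).
    apply: (primB pW); apply: (prim_eq _ _ (primZ C prim_id)) => r _.
      by rewrite mulrC.
    by rewrite mulr1.
  suff : W s - s * C <= 0 by slra.
  have c0 : W r - r * C @[r --> 0^'+] --> (0 : R) - 0 * C.
    apply: cvgB; first exact: int0_cvg0.
    apply: cvgM; last exact: cvg_cst.
    exact: (@cvg_within_filter _ _ _ (nbhs 0)).
  rewrite mul0r subrr in c0.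
  apply: (cvg_gt0_le c0); near=> r.
  apply: (prim_le ps) => //; last by slra.
  - by move=> x x01; rewrite subr_le0 W1le.
  - by near: r; apply: nbhs_right_le; lra.
have main (e : R) : `|e| = 1 -> forall s, 0 < s < 1 -> 0 <= W s - e * u s.
  move=> e1; apply: (max_principle (primB pW (primZ e h)) (primB pW1 (primZ e h1))).
  - move=> s s01 neg; have := q0 s s01; have := Wge s s01.
    have : `|e * k s| <= g s by rewrite normrM e1 mul1r kg.
    rewrite ler_norml mulrDr => /andP[k1 k2] W0 qs.
    have : q s * (e * u s) >= 0 by apply: mulr_ge0 => //; slra.
    slra.
  - rewrite -[X in _ --> X](_ : 0 - e * 0 = 0); last by rewrite mulr0 subrr.
    by apply: cvgB; [exact: int0_cvg0|apply: cvgM => //; exact: cvg_cst].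
  - rewrite -[X in _ --> X](_ : 0 - e * 0 = 0); last by rewrite mulr0 subrr.
    by apply: cvgB; [exact: int1_cvg1|apply: cvgM => //; exact: cvg_cst].
move=> s s01; rewrite ler_norml.
have := main 1 (normr1 _) s s01; have := main (-1) (normrN1 _) s s01; have := Wle s s01.
by slra.
Unshelve. all: by end_near. Qed.

Lemma bvp_ge0 u u1 q k : prim u u1 -> prim u1 (fun s => q s * u s + k s) ->
  (forall s, 0 < s < 1 -> 0 <= q s) -> (forall s, 0 < s < 1 -> k s <= 0) ->
  u s @[s --> 0^'+] --> (0 : R) -> u1 s @[s --> 1^'-] --> (0 : R) ->
  forall s, 0 < s < 1 -> 0 <= u s.
Proof.
move=> h h1 q0 k0 u0 u11; apply: (max_principle h h1) => // s s01 us.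
by have := q0 s s01; have := k0 s s01; snra.
Qed.

(* With n(s) = s^(-2) int_0^s r^2 q, the function j = s u' - u - s n u satisfies
   (exp(N) j)' <= 0 for N' = n, so exp(- N) u / s is nonincreasing. *)
Lemma bvp_lower u u1 q h (M : R) : prim u u1 -> prim u1 (fun s => q s * u s - h s) ->
  (forall s, 0 < s < 1 -> 0 <= q s) -> (forall s, 0 < s < 1 -> 0 <= h s) ->
  measurable_fun I01 q -> itg I01 (fun s => s * q s) ->
  \int[mu]_(s in I01) (s * q s) <= M -> itg I01 h ->
  u s @[s --> 0^'+] --> (0 : R) -> u1 s @[s --> 1^'-] --> (0 : R) ->
  forall s, 0 < s < 1 ->
  s * (expR (- M) ^+ 2 / (1 + M) * \int[mu]_(r in I01) (r * h r)) <= u s.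
Proof.
move=> pu pu1 q0 h0 mq iq qM ih u0 u11.
have mh := itg_meas ih.
have uge : forall s, 0 < s < 1 -> 0 <= u s.
  by apply: (bvp_ge0 pu pu1 q0 _ u0 u11) => s s01; rewrite oppr_le0 h0.
have ule : forall s, 0 < s < 1 -> u s <= s * \int[mu]_(r in I01) h r.
  move=> s s01; apply: le_trans (ler_norm _) _.
  apply: (bvp_bound pu pu1 q0 _ ih u0 u11) => // r r01.
  by rewrite normrN ger0_norm// h0.
set H1 := \int[mu]_(r in I01) h r in ule.
have mu' := prim_meas pu.
have sq0 s : 0 < s < 1 -> 0 <= s * q s.
  by move=> s01; rewrite mulr_ge0 ?q0//; slra.
have M0 : 0 <= M by apply: le_trans qM; apply: Rintegral_ge0 => s; rewrite /= in_itv/=; exact: sq0.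
have iu1' : itg I01 (fun s => q s * u s - h s).
  apply: itgB => //; apply: (itg_le (g := fun s => H1 * (s * q s))) => //.
  - exact: measurable_funM.
  - move=> s; rewrite /= in_itv/= => s01; rewrite ger0_norm ?mulr_ge0 ?q0 ?uge//.
    by have := q0 s s01; have := ule s s01; snra.
  - exact: itgZ.
have [l0 [_ [u10 _ _ _ _]]] := prim_limits pu1 iu1'.
have isq : itg I01 (fun s => s ^+ 2 * q s).
  apply: (itg_le (g := fun s => s * q s)) => //.
  - by apply: measurable_funM => //; exact: measurable_funX.
  - move=> s; rewrite /= in_itv/= => s01; have hs : 0 <= s ^+ 2 * q s by apply: mulr_ge0; [exact: sqr_ge0|exact: q0].
    by rewrite ger0_norm//; have := q0 s s01; snra.
pose a1 s := \int[mu]_(r in `[0, s]) (r * q r).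
pose a2 s := \int[mu]_(r in `[0, s]) (r ^+ 2 * q r).
have p1 : prim a1 (fun s => s * q s) by exact: prim_int0.
have p2 : prim a2 (fun s => s ^+ 2 * q s) by exact: prim_int0.
have a1le s : 0 < s < 1 -> a1 s <= M.
  by move=> s01; apply: le_trans qM; apply: Rint_seg01_le => //; slra.
have a2ge s : 0 < s < 1 -> 0 <= a2 s.
  by move=> s01; apply: Rint_seg01_ge0 => // [r r01|]; [rewrite mulr_ge0 ?sqr_ge0 ?q0//|slra].
have a2le s : 0 < s < 1 -> a2 s <= s * a1 s.
  move=> s01; rewrite /a1 /a2 -RintegralZl//; last by apply: (itg_seg01 iq); slra.
  apply: le_Rintegral => //.
  - by apply: (itg_seg01 isq); slra.
  - by apply: itgZ => //; apply: (itg_seg01 iq); slra.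
  move=> x; rewrite /= in_itv/= => xs; rewrite mulrA expr2.
  have [x0|x0] := eqVneq x 0; first by rewrite x0 mulr0 mulr0.
  have : 0 < x by rewrite lt0r x0; slra.
  by move=> xp; rewrite ler_wpM2r ?q0//; snra.
pose n s := a2 s * s ^- 2.
(* This primitive of n is obtained by integrating by parts; [a2 s <= s * a1 s] gives 0 <= N <= M. *)
pose N s := a1 s - a2 s * s^-1.
have pN : prim N n.
  apply: (prim_eq _ _ (primB p1 (primM p2 prim_inv))) => s s01 //.
  have sn : s != 0 by rewrite gt_eqF//; slra.
  by rewrite /n; field.
have N0 s : 0 < s < 1 -> 0 <= N s.
  move=> s01; rewrite subr_ge0 ler_pdivrMr; last by slra.
  by rewrite mulrC a2le.
have NM s : 0 < s < 1 -> N s <= M.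
  move=> s01; have : 0 <= a2 s * s^-1 by rewrite mulr_ge0 ?a2ge// invr_ge0; slra.
  by have := a1le s s01; rewrite /N; slra.
have n0 s : 0 < s < 1 -> 0 <= n s.
  by move=> s01; rewrite mulr_ge0 ?a2ge// invr_ge0 sqr_ge0.
have dexp (y : R) : is_derive y (1 : R) (@expR R) (expR y) by exact: is_derive_expR.
have pe : prim (fun s => expR (N s)) (fun s => expR (N s) * n s).
  by apply: (prim_comp dexp _ pN); exact: continuous_expR.
have pe' : prim (fun s => expR (- N s)) (fun s => - expR (- N s) * n s).
  have pe2 : prim (fun s => expR (- N s)) (fun s => expR (- N s) * - n s).
    by apply: (prim_comp dexp _ (primN pN)); exact: continuous_expR.
  by apply: prim_eq pe2 => // s _; rewrite mulrN mulNr.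
pose J s := s * u1 s - u s - a2 s * s^-1 * u s.
have pJ : prim J (fun s => n s * u s - s * n s * u1 s - s * h s).
  apply: (prim_eq _ _ (primB (primB (primM prim_id pu1) pu) (primM (primM p2 prim_inv) pu))) => s s01 //.
  have sn : s != 0 by rewrite gt_eqF//; slra.
  by rewrite /n; field.
pose H s := \int[mu]_(r in `[0, s]) (r * h r).
have irh : itg I01 (fun r => r * h r).
  apply: (itg_le (g := h)) => //; first exact: measurable_funM.
  move=> s; rewrite /= in_itv/= => s01; rewrite ger0_norm ?mulr_ge0 ?h0//; last by slra.
  by have := h0 s s01; snra.
have pH : prim H (fun s => s * h s) by exact: prim_int0.
have pK := primD (primM pe pJ) pH.
(* exp(N) J + H is nonincreasing, so it suffices to bound it near 0. There J is at most |s u1|,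
   which tends to 0 because [u1] has a limit at 0. *)
have eJ : forall s, 0 < s < 1 -> expR (N s) * J s + H s <= 0.
  move=> s s01.
  have lim : expR M * (r * u1 r) + H r @[r --> 0^'+] --> expR M * (0 * l0) + 0.
    apply: cvgD; last exact: int0_cvg0.
    apply: cvgM; first exact: cvg_cst.
    apply: cvgM => //; exact: (@cvg_within_filter _ _ _ (nbhs 0)).
  rewrite mul0r mulr0 addr0 in lim.
  have lim2 : expR M * `|r * u1 r| + H r @[r --> 0^'+] --> expR M * `|0 * l0| + 0.
    apply: cvgD; last exact: int0_cvg0.
    apply: cvgM; first exact: cvg_cst.
    apply: cvg_norm; apply: cvgM => //; exact: (@cvg_within_filter _ _ _ (nbhs 0)).
  rewrite mul0r normr0 mulr0 addr0 in lim2.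
  apply: (cvg_gt0_le lim2); near=> r.
  have r0 : 0 < r by near: r; exact: nbhs_right_gt.
  have rs : r <= s by near: r; apply: nbhs_right_le; slra.
  have r01 : 0 < r < 1 by slra.
  apply: le_trans (prim_le pK _ r0 rs _) _; [|by slra|].
    move=> x x01.
    have xn : x != 0 by rewrite gt_eqF//; slra.
    have e1 : 1 <= expR (N x) by apply: le_trans (expR_ge1Dx _); rewrite lerDl N0.
    have -> : expR (N x) * n x * J x + expR (N x) * (n x * u x - x * n x * u1 x - x * h x) + x * h x =
       - (expR (N x) * (x * n x ^+ 2 * u x)) - (expR (N x) - 1) * (x * h x).
      by rewrite /J /n; field.
    have : 0 <= x * n x ^+ 2 * u x by rewrite mulr_ge0 ?uge// mulr_ge0 ?sqr_ge0//; slra.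
    have : 0 <= x * h x by rewrite mulr_ge0 ?h0//; slra.
    by snra.
  rewrite lerD2r.
  have : J r <= `|r * u1 r|.
    have : 0 <= a2 r * r^-1 * u r by rewrite mulr_ge0 ?uge// mulr_ge0 ?a2ge// invr_ge0; slra.
    by have := uge r r01; have := ler_norm (r * u1 r); rewrite /J; slra.
  have e1 : expR (N r) <= expR M by rewrite ler_expR NM.
  have := normr_ge0 (r * u1 r); have := expR_gt0 (N r); snra.
have H0 s : 0 < s < 1 -> 0 <= H s.
  move=> s01; apply: Rint_seg01_ge0 => // [r r01|]; [|slra].
  by rewrite mulr_ge0 ?h0//; slra.
have Jle s : 0 < s < 1 -> J s <= - (expR (- M) * H s).
  move=> s01; have := eJ s s01; have := H0 s s01.
  have : expR (- M) <= expR (- N s) by rewrite ler_expR lerN2 NM.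
  have := expRxMexpNx_1 (N s); have := expR_gt0 (- N s); have := expR_gt0 (N s).
  move: (expR (N s)) (expR (- N s)) (expR (- M)) => A B C A0 B0 AB CB HH HJ.
  have : B * (A * J s + H s) <= 0 by rewrite pmulr_rle0.
  rewrite mulrDr mulrA (mulrC B) AB mul1r; snra.
have pL := primM (primM pe' prim_inv) pu.
(* The derivative of exp(-N) u / s is exp(-N) J / s^2, so its sign is that of J. *)
have Lle a b : 0 < a -> a <= b -> b < 1 ->
    expR (- N b) * b^-1 * u b <= expR (- N a) * a^-1 * u a.
  apply: (prim_le pL) => x x01.
  have xn : x != 0 by rewrite gt_eqF//; slra.
  have -> : (- expR (- N x) * n x * x^-1 + expR (- N x) * (- x ^- 2)) * u x +
      expR (- N x) * x^-1 * u1 x = expR (- N x) * x ^- 2 * J x.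
    by rewrite /J /n; field.
  rewrite mulr_ge0_le0 ?mulr_ge0 ?expR_ge0 ?invr_ge0 ?sqr_ge0//.
  apply: le_trans (Jle x x01) _; rewrite oppr_le0 mulr_ge0 ?expR_ge0 ?H0//.
move=> s s01.
have e0 := expR_ge0 (- M).
(* As r tends to 1 the term r u1 disappears, and the bound of J becomes a lower bound of (1 + M) u r
   by exp(-M) H r. The monotonicity of exp(-N) u / s carries it from r back to s, at the cost of the
   second factor exp(-M). *)
have key r : s <= r -> r < 1 ->
    expR (- M) * (expR (- M) * H r + r * u1 r) <= (1 + M) * (u s / s).
  move=> sr r1; have r01 : 0 < r < 1 by slra.
  have us0 : 0 <= u s / s by rewrite divr_ge0 ?uge//; slra.
  have h1 : expR (- M) * u r <= u s / s.
    apply: (@le_trans _ _ (expR (- N r) * r^-1 * u r)).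
      rewrite -mulrA ler_pM ?mulr_ge0 ?invr_ge0 ?uge// ?ler_expR ?lerN2 ?NM//; try slra.
      by rewrite ler_peMl ?uge// -[leLHS]invr1 lef_pV2 ?posrE; slra.
    apply: le_trans (Lle s r _ sr r1) _; first by slra.
    rewrite -mulrA (mulrC s^-1) ler_piMl// -expR0 ler_expR oppr_le0 N0//.
  have h2 : expR (- M) * H r + r * u1 r <= (1 + M) * u r.
    have := Jle r r01; rewrite /J.
    have : a2 r * r^-1 * u r <= M * u r.
      rewrite ler_wpM2r ?uge// ler_pdivrMr; last by slra.
      by have := a2le r r01; have := a1le r r01; snra.
    by slra.
  by snra.
have lim : expR (- M) * (expR (- M) * H r + r * u1 r) @[r --> 1^'-] -->
    expR (- M) * (expR (- M) * \int[mu]_(r in `[0, 1]) (r * h r) + 1 * 0).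
  apply: cvgM; first exact: cvg_cst.
  apply: cvgD.
    by apply: cvgM; [exact: cvg_cst|exact: int0_cvg1].
  by apply: cvgM => //; apply: cvg_at_left_filter; exact: cvg_id.
rewrite mulr0 addr0 -Rint01 in lim; last exact: itg_meas.
have fin : expR (- M) * (expR (- M) * \int[mu]_(r in I01) (r * h r)) <= (1 + M) * (u s / s).
  apply: (cvg_le_le lim); near=> r; apply: key.
    by near: r; apply: nbhs_left_ge; slra.
  by near: r; exact: nbhs_left_lt.
have M1 : 0 < 1 + M by slra.
rewrite mulrC -ler_pdivlMr; last by slra.
by rewrite mulrAC ler_pdivrMr// [leRHS]mulrC expr2 -mulrA.
Unshelve. all: by end_near. Qed.

End BoundaryValueProblem.

(** * Test functions *)

Section SmoothStep.
Context {R : realType}.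
Local Notation mu := (@lebesgue_measure R).
Local Notation itg D f := (mu.-integrable D (EFin \o f)).
Implicit Types f g : R -> R.

(** Differentiation stays within this family, so that flatness at 0 is a single statement for all
    n. *)
Definition expinv (n : nat) (x : R) : R := if 0 < x then x ^- n * expR (- x^-1) else 0.

(** A syntactic class that is closed under differentiation by [smooth_derive]; derivability of all
    iterated derivatives follows by iteration, without computing any of them. [smooth_primitive]
    admits functions known through their derivative, such as [trap]. *)
Inductive smooth : (R -> R) -> Prop :=
| smooth_expinv n : smooth (expinv n)
| smooth_cst c : smooth (fun=> c)
| smoothD f g : smooth f -> smooth g -> smooth (fun x => f x + g x)
| smoothM f g : smooth f -> smooth g -> smooth (fun x => f x * g x)
| smooth_affine f a b : smooth f -> smooth (fun x => f (a * x + b))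
| smooth_primitive f g : (forall x : R, is_derive x (1 : R) f (g x)) ->
    smooth g -> smooth f.

Lemma expinv_ge0 n x : 0 <= expinv n x.
Proof.
rewrite /expinv; case: ifP => // x0.
by rewrite mulr_ge0 ?expR_ge0// invr_ge0 exprn_ge0// ltW.
Qed.

(** One term of the exponential series beats the negative power. The factor x^2 makes the difference
    quotient at 0 vanish. *)
Lemma expinv_le n x : 0 <= x -> expinv n x <= n.+2`!%:R * x ^+ 2.
Proof.
rewrite le_eqVlt => /predU1P[<-|x0]; first by rewrite /expinv ltxx expr0n mulr0.
rewrite /expinv x0.
have h : x ^- n.+2 / n.+2`!%:R <= expR x^-1.
  have := @expR_ge1Dxn R x^-1 n.+1; rewrite invr_ge0 (ltW x0) => /(_ isT).
  by rewrite exprVn; slra.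
have f0 : 0 < n.+2`!%:R :> R by rewrite ltr0n fact_gt0.
rewrite expRN ler_pdivrMr ?expR_gt0//.
apply: le_trans (ler_wpM2l (_ : 0 <= n.+2`!%:R * x ^+ 2) h); last first.
  by rewrite mulr_ge0 ?sqr_ge0// ltW.
have -> : n.+2`!%:R * x ^+ 2 * (x ^- n.+2 / n.+2`!%:R) = x ^- n.
  have xn : x != 0 by rewrite gt_eqF.
  have fn : n.+2`!%:R != 0 :> R by rewrite gt_eqF.
  have -> : x ^- n.+2 = x ^- n * x ^- 2 by rewrite -!exprVn -exprD addn2.
  by move: (x ^- n) (n.+2`!%:R) fn => y F fn; field; rewrite fn xn.
exact: lexx.
Qed.

Lemma is_derive_expinv n (x : R) :
  is_derive x (1 : R) (expinv n) (- n%:R * expinv n.+1 x + expinv n.+2 x).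
Proof.
have [x0|x0|->] := ltgtP x 0.
- have -> : - n%:R * expinv n.+1 x + expinv n.+2 x = 0.
    by rewrite /expinv ltNge (ltW x0)/= mulr0 addr0.
  have := is_derive_cst (0 : R) x (1 : R); apply: near_eq_is_derive.
  near=> z; rewrite /expinv ifF//; apply/negbTE; rewrite -leNgt; apply: ltW.
  by near: z; exact: lt_nbhsl.
- have xn : x != 0 by rewrite gt_eqF.
  have xN : x ^+ n != 0 by rewrite expf_neq0.
  have d1 : is_derive x (1 : R) (fun y => y^-1) (- x ^- 2).
    have := @is_deriveV R id x 1 1 xn (is_derive_id _ _).
    by rewrite /GRing.scale/= mulr1; exact.
  have d2 : is_derive x (1 : R) (fun y => y^-1 ^+ n) (- n%:R * x^-1 ^+ n.+1).
    elim: n {xN} => [|n IH]; first by rewrite oppr0 mul0r; exact: is_derive_cst.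
    rewrite (_ : (fun y => _) = (fun y : R => y^-1 * y^-1 ^+ n)); last first.
      by apply/funext => y; rewrite exprS.
    apply: (is_derive_eq (is_deriveM d1 IH)); rewrite /GRing.scale/= -exprVn.
    by rewrite 2![in RHS]exprSr [x^-1 ^+ n.+1]exprSr -[n.+1%:R]natr1; ring.
  have d3 : is_derive x (1 : R) (fun y => expR (- y^-1)) (expR (- x^-1) * x ^- 2).
    have e1 : is_derive (- x^-1) (1 : R) (@expR R) (expR (- x^-1)) by exact: is_derive_expR.
    have := @is_derive1_comp R (@expR R) (fun y => - y^-1) x _ _ e1 (is_deriveN d1).
    by rewrite opprK mulrC; exact.
  have d4 := is_deriveM d2 d3.
  have : is_derive x (1 : R) (fun y => y^-1 ^+ n * expR (- y^-1))
     (- n%:R * expinv n.+1 x + expinv n.+2 x).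
    apply: (is_derive_eq d4); rewrite /expinv x0 /GRing.scale/= -!exprVn.
    by rewrite expr2 !exprSr; ring.
  apply: near_eq_is_derive; near=> z; rewrite /expinv ifT ?exprVn//.
  by near: z; exact: lt_nbhsr.
- have -> : - n%:R * expinv n.+1 0 + expinv n.+2 0 = 0.
    by rewrite /expinv ltxx mulr0 addr0.
  have L : n.+2`!%:R * `|h| @[h --> (0 : R)^'] --> (0 : R).
    rewrite -[X in _ --> X](mulr0 (n.+2`!%:R)); apply: cvgM; first exact: cvg_cst.
    have := @norm_continuous _ R 0; rewrite /continuous_at normr0 => H.
    by apply: (cvg_trans _ H); apply: cvg_app; exact: nbhs_dnbhs.
  have H : h^-1 *: ((expinv n \o shift 0) (h *: (1 : R)) - expinv n 0) @[h --> 0^'] --> (0 : R).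
    apply: (@squeeze_cvgr _ _ _ _ (fun h : R => - (n.+2`!%:R * `|h|)) (fun h : R => n.+2`!%:R * `|h|)).
    + near=> h; have h0 : h != 0 by near: h; exact: nbhs_dnbhs_neq.
      rewrite -ler_norml /shift/= addr0 /GRing.scale/= mulr1.
      rewrite [expinv n 0]/expinv ltxx subr0.
      have [hp|hp] := ltP 0 h; last by rewrite /expinv ltNge hp/= mulr0 normr0 mulr_ge0.
      rewrite normrM normfV ler_pdivrMl ?normr_gt0// ger0_norm ?expinv_ge0//.
      by apply: le_trans (expinv_le n (ltW hp)) _; rewrite (gtr0_norm hp) expr2; slra.
    + by rewrite -[X in _ --> X]oppr0; apply: cvgN.
    + exact: L.
  split; first by apply/cvg_ex; exists 0.
  exact: cvg_lim.
Unshelve. all: by end_near. Qed.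

Lemma is_derive_affine (a b x : R) : is_derive x (1 : R) (fun y : R => a * y + b) a.
Proof. by apply: is_derive_eq; rewrite /GRing.scale/= ?mulr1 ?mulr0 ?addr0. Qed.

Lemma smooth_derive f : smooth f -> exists2 g, smooth g & forall x : R, is_derive x (1 : R) f (g x).
Proof.
elim=> {f} [n|c|f g sf [f' sf' df] sg [g' sg' dg]|f g sf [f' sf' df] sg [g' sg' dg]|f a b sf [f' sf' df]|f g df sg _].
- exists (fun x => - n%:R * expinv n.+1 x + expinv n.+2 x).
    apply: smoothD; last exact: smooth_expinv.
    by apply: (smoothM (smooth_cst (- n%:R))); exact: smooth_expinv.
  exact: is_derive_expinv.
- by exists (fun=> 0) => [|x]; [exact: smooth_cst|exact: is_derive_cst].
- exists (fun x => f' x + g' x) => [|x]; first exact: smoothD.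
  exact: (is_deriveD (df x) (dg x)).
- exists (fun x => f' x * g x + f x * g' x) => [|x].
    by apply: smoothD; exact: smoothM.
  by apply: (is_derive_eq (is_deriveM (df x) (dg x))); rewrite /GRing.scale/=; ring.
- exists (fun x => a * f' (a * x + b)) => [|x].
    by apply: (smoothM (smooth_cst a)); exact: smooth_affine.
  have d1 := is_derive_affine a b x.
  by have := @is_derive1_comp R f (fun y => a * y + b) x _ _ (df _) d1; rewrite mulrC; exact.
- by exists g.
Qed.

Lemma smooth_derivable f : smooth f -> forall k (x : R), derivable (derive1n k f) x 1.
Proof.
move=> sf k; have : smooth (derive1n k f).
  elim: k => [//|k /smooth_derive[g sg dg]]; rewrite derive1nS.
  rewrite (_ : derive1 _ = g)//; apply/funext => x; rewrite derive1E.
  by have [_ ->] := dg x.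
by move=> /smooth_derive[g _ dg] x; have [] := dg x.
Qed.

Lemma smooth_continuous f : smooth f -> continuous f.
Proof.
move=> /smooth_derive[g _ dg] x.
by apply/differentiable_continuous/derivable1_diffP; have [] := dg x.
Qed.

Definition bump0 (x : R) : R := expinv 0 x * expinv 0 (- 1 * x + 1).

Lemma smooth_bump0 : smooth bump0.
Proof. by apply: smoothM; [|apply: (smooth_affine _ _)]; exact: smooth_expinv. Qed.

Lemma expinv0_le1 x : expinv 0 x <= 1.
Proof.
rewrite /expinv; case: ifP => // x0.
by rewrite expr0 invr1 mul1r -expR0 ler_expR oppr_le0 invr_ge0 ltW.
Qed.

Lemma bump0_ge0 x : 0 <= bump0 x.
Proof. by rewrite mulr_ge0 ?expinv_ge0. Qed.

Lemma bump0_le1 x : bump0 x <= 1.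
Proof. by rewrite -[leRHS]mulr1 ler_pM ?expinv_ge0 ?expinv0_le1. Qed.

Lemma bump0_out x : ~~ (0 < x < 1) -> bump0 x = 0.
Proof.
rewrite /bump0 /expinv; case: ltP => x0; last by rewrite mul0r.
by move=> /= x1; rewrite ifF ?mulr0//; apply/negbTE; rewrite -leNgt; move: x1; rewrite -leNgt; slra.
Qed.

Lemma bump0_itg : itg [set: R] bump0.
Proof.
apply: (itg_le (g := \1_(`[0%R, 1%R]%classic : set R))) => //.
- by apply: measurable_funTS; apply: continuous_measurable_fun; exact: smooth_continuous smooth_bump0.
- move=> x _; rewrite ger0_norm ?bump0_ge0// indicE.
  have [h|h] := boolP (0 < x < 1); last by rewrite bump0_out.
  rewrite mem_set ?bump0_le1//=; rewrite in_itv/=; slra.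
- exact: integrable_indic_itv.
Qed.

(** The total mass of [bump0], written on the half-line that occurs in [step 1], so that
    [step 1 = 1] is immediate. *)
Definition bumpc : R := \int[mu]_(x in `]-oo, 1]) bump0 x.

Lemma bumpc_gt0 : 0 < bumpc.
Proof.
have m x : 4^-1 <= x -> expR (- 4) <= expinv 0 x.
  move=> x4; rewrite /expinv (_ : 0 < x); last by slra.
  rewrite expr0 invr1 mul1r ler_expR lerN2 -[leRHS]invrK lef_pV2 ?posrE; slra.
apply: (@lt_le_trans _ _ (expR (- 4) * expR (- 4) * (3 / 4 - 4^-1))).
  by rewrite mulr_gt0 ?mulr_gt0 ?expR_gt0//; slra.
rewrite -Rint_seg_cst; last by slra.
have h : itg `]-oo, 1] bump0 by apply: (itg_sub _ _ _ bump0_itg).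
apply: (@le_trans _ _ (\int[mu]_(x in `[4^-1, 3 / 4]) bump0 x)).
  apply: le_Rintegral => //; first exact: itg_seg_cst.
    by apply: (itg_sub _ _ _ bump0_itg).
  move=> x; rewrite /= in_itv/= => x4; rewrite /bump0 ler_pM ?expR_ge0 ?m//; slra.
apply: (Rint_sub _ _ _ h) => // [x|x _]; last exact: bump0_ge0.
by rewrite /= !in_itv/=; slra.
Qed.

Definition bump (x : R) : R := bumpc^-1 * bump0 x.

Definition step (x : R) : R := bumpc^-1 * \int[mu]_(y in `]-oo, x]) bump0 y.

Lemma is_derive_step (x : R) : is_derive x (1 : R) step (bump x).
Proof.
have h : derivable (fun x : R => \int[mu]_(y in `]-oo, x]) bump0 y) x 1 /\
  derive1 (fun x : R => \int[mu]_(y in `]-oo, x]) bump0 y) x = bump0 x.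
  apply: (@continuous_FTC1 R bump0 -oo%O x (x + 1)); [by slra| |by rewrite ltNyr|].
    by apply: (itg_sub _ _ _ bump0_itg).
  exact: smooth_continuous smooth_bump0 _.
have d : is_derive x (1 : R) (fun x : R => \int[mu]_(y in `]-oo, x]) bump0 y) (bump0 x).
  by case: h => h1 h2; apply: (DeriveDef h1); rewrite -derive1E; exact: h2.
exact: (is_deriveZ bumpc^-1 d).
Qed.

Lemma smooth_bump : smooth bump.
Proof. by apply: (smoothM (smooth_cst _)); exact: smooth_bump0. Qed.

Lemma step_mono x y : x <= y -> step x <= step y.
Proof.
move=> xy; rewrite ler_wpM2l ?invr_ge0 ?(ltW bumpc_gt0)//.
have h : itg `]-oo, y] bump0 by apply: (itg_sub _ _ _ bump0_itg).
apply: (Rint_sub _ _ _ h) => // [z|z _]; last exact: bump0_ge0.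
by rewrite /= !in_itv/=; slra.
Qed.

Lemma step0 x : x <= 0 -> step x = 0.
Proof.
move=> x0; rewrite /step (@eq_Rintegral _ _ _ mu _ (cst 0)) ?Rintegral_cst ?mul0r ?mulr0//.
move=> y /set_mem; rewrite /= in_itv/= => yx; rewrite bump0_out//; slra.
Qed.

Lemma step1 x : 1 <= x -> step x = 1.
Proof.
move=> x1; have e : step 1 = 1 by rewrite /step mulVf// gt_eqF ?bumpc_gt0.
rewrite -e /step; congr (_ * _); apply/eqP; rewrite -subr_eq0.
have := @Rintegral_itvB R bump0 -oo%O (BRight x) 1.
move=> -> //; last by apply: (itg_sub _ _ _ bump0_itg).
apply/eqP; rewrite (@eq_Rintegral _ _ _ mu _ (cst 0)) ?Rintegral_cst ?mul0r//.
move=> y /set_mem; rewrite /= in_itv/= => yx; rewrite bump0_out//; slra.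
Qed.

Lemma step_ge0 x : 0 <= step x.
Proof.
have [x0|/ltW x0] := leP 0 x; first by rewrite -(step0 (lexx 0)) step_mono.
by rewrite step0.
Qed.

Lemma step_le1 x : step x <= 1.
Proof.
have [x1|/ltW x1] := leP x 1; first by rewrite -(step1 (lexx 1)) step_mono.
by rewrite step1.
Qed.

Lemma bump_ge0 x : 0 <= bump x.
Proof. by rewrite mulr_ge0 ?bump0_ge0// invr_ge0 ltW ?bumpc_gt0. Qed.

Lemma bump_le x : bump x <= bumpc^-1.
Proof. by rewrite -[leRHS]mulr1 ler_wpM2l ?bump0_le1// invr_ge0 ltW ?bumpc_gt0. Qed.

Lemma bump_out x : ~~ (0 < x < 1) -> bump x = 0.
Proof. by move=> x01; rewrite /bump bump0_out// mulr0. Qed.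

(* A mollified indicator function of [[a, b]], of transition width [d]; its
   derivative is the difference of two mollifiers, concentrated at [a] and [b]. *)
Definition trap (a b d x : R) : R := step (d^-1 * x + - (d^-1 * a)) - step (d^-1 * x + - (d^-1 * b)).

(** The mass sits in [a, a + d], to the right of [a]: right Lebesgue points are the matching
    notion. *)
Definition molli (a d x : R) : R := d^-1 * bump (d^-1 * x + - (d^-1 * a)).

Lemma is_derive_molli (a d : R) (x : R) :
  is_derive x (1 : R) (fun x => step (d^-1 * x + - (d^-1 * a))) (molli a d x).
Proof.
have d1 := is_derive_affine d^-1 (- (d^-1 * a)) x.
apply: (is_derive_eq (@is_derive1_comp R step _ x _ _ (is_derive_step _) d1)).
by rewrite /molli mulrC.
Qed.

Lemma is_derive_trap a b d (x : R) :
  is_derive x (1 : R) (trap a b d) (molli a d x - molli b d x).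
Proof. exact: (is_deriveB (is_derive_molli a d x) (is_derive_molli b d x)). Qed.

Lemma derive1_trap a b d : derive1 (trap a b d) = fun x => molli a d x - molli b d x.
Proof. by apply/funext => x; rewrite derive1E; have [_ ->] := is_derive_trap a b d x. Qed.

Lemma smooth_molli a d : smooth (molli a d).
Proof.
apply: (smoothM (smooth_cst _)); apply: (@smooth_affine bump); exact: smooth_bump.
Qed.

Lemma smooth_trap a b d : smooth (trap a b d).
Proof.
apply: smooth_primitive (is_derive_trap a b d) _.
apply: smoothD; first exact: smooth_molli.
have := smoothM (smooth_cst (-1)) (smooth_molli b d).
by under eq_fun do rewrite mulN1r.
Qed.

Lemma scaleE (a d x : R) : d^-1 * x + - (d^-1 * a) = (x - a) / d.
Proof. by rewrite -mulrBr mulrC. Qed.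

Lemma molli_ge0 a d x : 0 < d -> 0 <= molli a d x.
Proof. by move=> d0; rewrite mulr_ge0 ?bump_ge0// invr_ge0 ltW. Qed.

Lemma molli_le a d x : 0 < d -> molli a d x <= bumpc^-1 / d.
Proof. by move=> d0; rewrite /molli mulrC ler_wpM2r ?bump_le// invr_ge0 ltW. Qed.

Lemma molli_out a d x : 0 < d -> ~~ (a <= x <= a + d) -> molli a d x = 0.
Proof.
move=> d0 ax; rewrite /molli (scaleE a d x) bump_out ?mulr0//.
by apply: contra ax; rewrite ltr_pdivlMr// ltr_pdivrMr//; slra.
Qed.

Lemma trap_ge0 a b d x : 0 < d -> a <= b -> 0 <= trap a b d x.
Proof.
move=> d0 ab; rewrite /trap subr_ge0 step_mono// !scaleE ler_pM2r ?invr_gt0//.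
by rewrite lerB.
Qed.

Lemma trap_le1 a b d x : trap a b d x <= 1.
Proof.
rewrite /trap lerBlDr; apply: le_trans (step_le1 _) _; by rewrite lerDl step_ge0.
Qed.

Lemma trap1 a b d x : 0 < d -> a + d <= x <= b -> trap a b d x = 1.
Proof.
move=> d0 axb; rewrite /trap (scaleE a d x) (scaleE b d x) step1 ?step0 ?subr0//.
  by rewrite pmulr_lle0 ?invr_gt0//; slra.
by rewrite ler_pdivlMr//; slra.
Qed.

Lemma trap_out a b d x : 0 < d -> a <= b -> ~~ (a <= x <= b + d) -> trap a b d x = 0.
Proof.
move=> d0 ab; rewrite negb_and -!ltNge => /orP[xa|bx]; rewrite /trap (scaleE a d x) (scaleE b d x).
  by rewrite [step _]step0 ?[step _]step0 ?subrr// pmulr_lle0 ?invr_gt0//; slra.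
by rewrite [step _]step1 ?[step _]step1 ?subrr// ler_pdivlMr//; slra.
Qed.

Lemma trap_test (l r a b d : R) : 0 < d -> l < a -> a <= b -> b + d < r ->
  test_function l r (trap a b d).
Proof.
move=> d0 la ab br; split; first exact: smooth_derivable (smooth_trap _ _ _).
exists a, (b + d); split => // x; rewrite /= in_itv/= => /negP.
exact: trap_out.
Qed.

Lemma molli_int a d : 0 < d -> \int[mu]_(x in `[a, a + d]) molli a d x = 1.
Proof.
move=> d0; have ad : a < a + d by slra.
have cm : continuous (molli a d) by exact: smooth_continuous (smooth_molli _ _).
have cs (x : R) : {for x, continuous (fun x => step (d^-1 * x + - (d^-1 * a)))}.
  by apply/differentiable_continuous/derivable1_diffP; have [] := is_derive_molli a d x.
rewrite /Rintegral (continuous_FTC2 ad (F := fun x => step (d^-1 * x + - (d^-1 * a)))).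
- rewrite fineB// (scaleE a d (a + d)) (scaleE a d a) step1 ?step0 ?subrr ?mul0r ?subr0//.
  by rewrite ler_pdivlMr//; slra.
- exact: continuous_subspaceT.
- split.
  + by move=> x _; have [] := is_derive_molli a d x.
  + by apply: cvg_at_right_filter; exact: cs.
  + by apply: cvg_at_left_filter; exact: cs.
- by move=> x _; rewrite derive1E; have [_ ->] := is_derive_molli a d x.
Qed.

End SmoothStep.

(** * Weak derivatives in space *)

Section WeakDerivatives.
Context {R : realType}.
Local Notation mu := (@lebesgue_measure R).
Local Notation itg D f := (mu.-integrable D (EFin \o f)).
Local Notation I01 := (`]@GRing.zero R, @GRing.one R[%classic).
Implicit Types (D : set R) (f g u v w : R -> R).

Lemma ae_dense (P : R -> Prop) (a b : R) : a < b -> {ae mu, forall s, P s} ->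
  exists2 s, a < s < b & P s.
Proof.
move=> ab [N [mN N0 sub]]; apply: contrapT => h.
have : (mu (`]a, b[%classic : set R) <= mu N)%E.
  apply: le_measure; [by rewrite inE; exact: measurable_itv|by rewrite inE|].
  move=> x; rewrite /= in_itv/= => xab; apply: sub => /= Px; apply: h.
  by exists x.
rewrite N0 lebesgue_measure_itv/= lte_fin ab -EFinB lee_fin; slra.
Qed.

(* A right Lebesgue point of u. *)
Definition lpt u (x : R) := forall e : R, 0 < e -> exists2 d0 : R, 0 < d0 &
  forall d : R, 0 < d -> d < d0 ->
  \int[mu]_(y in `[x, x + d]) `|u y - u x| <= e * d.

Lemma loc_itg u (a b : R) : locally_integrable I01 u -> 0 < a -> b < 1 -> itg `[a, b] u.
Proof.
move=> [mu' _ h] a0 b1.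
have sub : `[a, b]%classic `<=` I01 by move=> x; rewrite /= !in_itv/=; slra.
apply/integrableP; split; first by apply/measurable_EFinP; exact: measurable_funS mu'.
exact: (h _ sub (@segment_compact _ a b)).
Qed.

Lemma lebesgue_pt_lpt u (a b x : R) : itg `[a, b] u -> a < x < b ->
  lebesgue_pt (u \_ `[a, b]) x -> lpt u x.
Proof.
move=> iu xab h e e0.
have [r0 r00 hr] : exists2 r0 : R, 0 < r0 & forall r, 0 < r < r0 ->
    (davg (u \_ `[a, b]) x r < (e / 4)%:E)%E.
  have e4 : (0 < (e / 4)%:E)%E by rewrite lte_fin divr_gt0.
  have : \forall r \near (0:R)^'+, (davg (u \_ `[a, b]) x r < (e / 4)%:E)%E.
    have H : nbhs (0 : \bar R)%E [set y | (y < (e / 4)%:E)%E].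
      by apply: open_nbhs_nbhs; split; [exact: open_ereal_lt_ereal|exact: e4].
    exact: (h _ H).
  move=> /nbhs_ballP[d /= d0 hd]; exists d => // r /andP[r0 rd]; apply: hd => //.
  by rewrite /ball/= sub0r normrN gtr0_norm.
pose d0 := Num.min (r0 / 2) (b - x).
exists d0; first by rewrite lt_min; slra.
move=> d dp; rewrite lt_min => /andP[d1 d2].
(* The interval [x, x + d] lies in the ball of radius 2 d, whose measure is 4 d; this explains the
   threshold e / 4. *)
have := hr (2 * d) ltac:(slra).
have sub : `[x, x + d]%classic `<=` ball x (2 * d).
  by move=> y; rewrite /= in_itv/= /ball/= => yx; rewrite ltr_norml; slra.
have mball : measurable (ball x (2 * d)) by exact: measurable_ball.
have ucst : u x = (u \_ `[a, b]) x by rewrite patchE mem_set//= in_itv/=; slra.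
have iuab : itg `[x, x + d] (fun y => `|u y - u x|).
  apply: itg_norm; apply: itgB => //; last exact: itg_seg_cst.
  by apply: itg_seg_sub iu; slra.
rewrite /davg /iavg.
have -> : mu (ball x (2 * d)) = (4 * d)%:E.
  by rewrite lebesgue_measure_ball; [congr EFin; rewrite mulr2n; ring|slra].
rewrite inver gt_eqF; last by slra.
rewrite lte_pdivrMl; last by slra.
rewrite -EFinM (_ : 4 * d * (e / 4) = e * d); last by field.
have le : ((\int[mu]_(y in `[x, (x + d)%R]) `|u y - u x|%:E) <=
   \int[mu]_(y in ball x (2 * d)) `|((center ((u \_ `[a, b]) x) \o (u \_ `[a, b])) y)%:E|)%E.
  have -> : (\int[mu]_(y in `[x, (x + d)%R]) `|u y - u x|%:E =
     \int[mu]_(y in `[x, (x + d)%R]) `|((center ((u \_ `[a, b]) x) \o (u \_ `[a, b])) y)%:E|)%E.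
    apply: eq_integral => y /set_mem; rewrite /= in_itv/= => yx.
    by rewrite -ucst /= patchE mem_set//= in_itv/=; slra.
  apply: ge0_subset_integral => //.
  apply/measurable_EFinP/measurableT_comp => //; apply: measurable_funB => //.
  apply: measurable_funTS; apply/(measurable_restrictT _ _).1 => //.
  exact: itg_meas iu.
move=> /(le_lt_trans le)/ltW; rewrite -lee_fin /Rintegral fineK//.
exact: (@integrable_fin_num _ _ _ mu _ (measurable_itv _) _ iuab).
Qed.

Lemma lpt_ae (l r : R) u : (forall a b : R, l < a -> b < r -> itg `[a, b] u) ->
  {ae mu, forall s, `]l, r[%classic s -> lpt u s}.
Proof.
move=> lu.
pose a n : R := l + n.+3%:R^-1; pose b n : R := r - n.+3%:R^-1.
have ab n : l < a n /\ b n < r.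
  have : 0 < (n.+3%:R : R)^-1 by rewrite invr_gt0 ltr0n.
  by rewrite /a /b; move: (n.+3%:R^-1) => c; slra.
have h n : {ae mu, forall s, a n < s < b n -> lpt u s}.
  have iu : itg `[a n, b n] u by apply: lu; have [] := ab n.
  have := lebesgue_differentiation (integrable_locally (measurable_itv _) iu).
  move=> H; apply: (filterS_ae H) => s hs asb; exact: (lebesgue_pt_lpt iu asb hs).
apply: (filterS_ae (ae_all h)) => s hs; rewrite /= in_itv/= => /andP[s0 s1].
have m0 : 0 < Num.min (s - l) (r - s) by rewrite lt_min !subr_gt0 s0.
have [n] : exists n : nat, (n.+3%:R : R)^-1 < Num.min (s - l) (r - s).
  exists (Num.truncn (Num.min (s - l) (r - s))^-1).
  rewrite -[ltRHS]invrK ltf_pV2 ?posrE ?invr_gt0 ?ltr0n//.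
  apply: lt_le_trans (truncnS_gt _) _.
  by rewrite ler_nat; do 2 apply: leqW.
rewrite lt_min => /andP[n1 n2]; apply: (hs n).
by rewrite /a /b; move: (n.+3%:R^-1) n1 n2 => c; slra.
Qed.

(** The mollifier is at most a constant over d, so its average of |u - u x| is controlled by the
    mean oscillation in the definition of [lpt]. *)
Lemma lpt_molli u (x b e : R) : x < b -> itg `[x, b] u -> lpt u x -> 0 < e ->
  exists2 d0 : R, 0 < d0 & forall d : R, 0 < d -> d < d0 ->
  `|\int[mu]_(y in `[x, x + d]) (u y * molli x d y) - u x| <= e.
Proof.
move=> xb iub ux e0; have c0 := bumpc_gt0 (R := R).
have [d0 d00 hd0] := ux (e * bumpc) (mulr_gt0 e0 c0).
exists (Num.min d0 (b - x)); first by rewrite lt_min d00/=; slra.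
move=> d dp; rewrite lt_min => /andP[dd0 d1].
have iu : itg `[x, x + d] u by apply: itg_seg_sub iub; slra.
have im : itg `[x, x + d] (molli x d).
  by apply: within_cts_itg; apply: continuous_subspaceT; exact: smooth_continuous (smooth_molli _ _).
have ium : itg `[x, x + d] (fun y => u y * molli x d y).
  apply: (itg_eq (f := fun y => molli x d y * u y)) => //; first by move=> y _; rewrite mulrC.
  apply: itg_cts_mul => //; apply: continuous_subspaceT; exact: smooth_continuous (smooth_molli _ _).
have -> : \int[mu]_(y in `[x, x + d]) (u y * molli x d y) - u x =
    \int[mu]_(y in `[x, x + d]) ((u y - u x) * molli x d y).
  rewrite -[X in _ - X]mulr1 -(molli_int x dp) -RintegralZl// -RintegralB//; last exact: itgZ.
  by apply: eq_Rintegral => y _; rewrite mulrBl.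
have iu1 : itg `[x, x + d] (fun y => `|u y - u x|).
  by apply: itg_norm; apply: itgB => //; exact: itg_seg_cst.
apply: (@le_trans _ _ (\int[mu]_(y in `[x, x + d]) (bumpc^-1 / d * `|u y - u x|))).
  apply: Rint_norm_le => //.
  - apply: (itg_eq (f := fun y => u y * molli x d y - u x * molli x d y)) => //.
      by move=> y _; rewrite mulrBl.
    by apply: itgB => //; exact: itgZ.
  - exact: itgZ.
  - by move=> y _; rewrite normrM mulrC ler_wpM2r// ger0_norm ?molli_ge0// molli_le.
rewrite RintegralZl//.
apply: le_trans (ler_wpM2l _ (hd0 d dp dd0)) _; first by rewrite divr_ge0// ?invr_ge0; exact: ltW.
by rewrite le_eqVlt; apply/orP; left; apply/eqP; field; rewrite gt_eqF// gt_eqF.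
Qed.

Lemma Rint_supp (f : R -> R) D (a b : R) : measurable D -> measurable_fun D f ->
  `[a, b]%classic `<=` D ->
  (forall x, D x -> ~~ (a <= x <= b) -> f x = 0) ->
  \int[mu]_(x in D) f x = \int[mu]_(x in `[a, b]) f x.
Proof.
move=> mD mf sub f0; rewrite -[in RHS](setIidr sub) Rintegral_mkcondr.
apply: eq_Rintegral => x /set_mem Dx; rewrite patchE.
case: ifPn => //; rewrite notin_setE /= in_itv/= => /negP h.
exact: f0.
Qed.

Lemma itg_supp (f : R -> R) D (a b : R) : measurable D -> measurable_fun D f ->
  `[a, b]%classic `<=` D ->
  (forall x, D x -> ~~ (a <= x <= b) -> f x = 0) ->
  itg `[a, b] f -> itg D f.
Proof.
move=> mD mf sub f0 /integrableP[_ fi]; apply/integrableP; split; first exact/measurable_EFinP.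
move: fi; congr (_ < _)%E; rewrite -[in LHS](setIidr sub) integral_mkcondr.
apply: eq_integral => x /set_mem Dx; rewrite patchE.
case: ifPn => //; rewrite notin_setE /= in_itv/= => /negP h.
by rewrite f0// normr0.
Qed.

Lemma int_small v (a b x e : R) : itg `[a, b] v -> a <= x -> x < b -> 0 < e ->
  exists2 d0 : R, 0 < d0 & forall d : R, 0 < d -> d < d0 ->
    \int[mu]_(y in `[x, x + d]) `|v y| <= e.
Proof.
move=> iv ax xb e0; have ian : itg `[x, b] (fun y => `|v y|).
  by apply: itg_norm; apply: itg_seg_sub iv.
have /within_ctsP c := Rint_cts (ltW xb) ian.
have [d0 d00 hd] := c x (ltac:(by rewrite lexx ltW)) e e0.
exists (Num.min d0 (b - x)); first by rewrite lt_min d00 subr_gt0.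
move=> d dp; rewrite lt_min => /andP[dd0 db].
have := hd (x + d); rewrite set_itv1 Rintegral_set1 subr0 => H; apply: ltW.
apply: le_lt_trans (ler_norm _) _; apply: H; first by slra.
by rewrite gtr0_norm; slra.
Qed.

(* Du Bois-Reymond: test against a mollified indicator of [[a, b]] and let its transition width
   tend to 0. *)
Lemma wderiv_lpt u v (a b : R) : is_wderiv u v -> 0 < a -> a < b -> b < 1 ->
  lpt u a -> lpt u b -> u b - u a = \int[mu]_(s in `[a, b]) v s.
Proof.
move=> [lu lv h] a0 ab b1 ua ub.
have [mu' mv] : measurable_fun I01 u /\ measurable_fun I01 v by case: lu; case: lv.
have [b' bb' b'1] : exists2 b', b < b' & b' < 1 by exists ((b + 1) / 2); slra.
have ab' := lt_trans ab bb'.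
have ivb : itg `[a, b'] v by apply: loc_itg.
(* The error 4 e consists of e for each mollified value of [u] and of 2 e for the two transition
   zones in the integral of [v]. *)
suff : forall e, 0 < e -> `|u b - u a - \int[mu]_(s in `[a, b]) v s| <= 4 * e.
  move=> H; apply/eqP; rewrite -subr_eq0 -normr_le0.
  apply/ler_addgt0Pr => e e0; rewrite add0r.
  have := H (e / 4) ltac:(slra); by rewrite (_ : 4 * (e / 4) = e); [|field].
move=> e e0.
have iub (x : R) : 0 < x -> itg `[x, b'] u by move=> x0; apply: loc_itg.
have [d1 d10 h1] := lpt_molli (b := b') ab' (iub _ a0) ua e0.
have [d2 d20 h2] := lpt_molli (b := b') bb' (iub _ (lt_trans a0 ab)) ub e0.
clear iub.
have [d3 d30 h3] := @int_small v a b' a e ivb (lexx _) ab' e0.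
have [d4 d40 h4] := @int_small v a b' b e ivb (ltW ab) bb' e0.
pose d := Num.min (Num.min (Num.min d1 d2) (Num.min d3 d4)) (Num.min (b - a) (b' - b)) / 2.
have dpos : 0 < d.
  by rewrite divr_gt0// !lt_min d10 d20 d30 d40/=; slra.
have [dd1 dd2 dd3 dd4] : [/\ d < d1, d < d2, d < d3 & d < d4].
  have hm : d < Num.min (Num.min (Num.min d1 d2) (Num.min d3 d4)) (Num.min (b - a) (b' - b)).
    by rewrite /d; move: dpos; rewrite /d; move: (Num.min _ _) => m; slra.
  by move: hm; rewrite !lt_min => /andP[/andP[/andP[-> ->] /andP[-> ->]] _].
have [dba dbb] : d < b - a /\ d < b' - b.
  have hm : d < Num.min (Num.min (Num.min d1 d2) (Num.min d3 d4)) (Num.min (b - a) (b' - b)).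
    by rewrite /d; move: dpos; rewrite /d; move: (Num.min _ _) => m; slra.
  by move: hm; rewrite !lt_min => /andP[_ /andP[-> ->]].
have bd1 : b + d < 1 by slra.
have abd : b + d <= b' by slra.
clearbody d.
have := h (trap a b d) (trap_test dpos a0 (ltW ab) bd1).
rewrite derive1_trap.
have mm x : measurable_fun I01 (molli x d).
  by apply: measurable_funTS; apply: continuous_measurable_fun; exact: smooth_continuous (smooth_molli _ _).
have mt : measurable_fun I01 (trap a b d).
  by apply: measurable_funTS; apply: continuous_measurable_fun; exact: smooth_continuous (smooth_trap _ _ _).
have supp x : 0 < x -> x + d < 1 -> itg I01 (fun s => u s * molli x d s) /\
    \int[mu]_(s in I01) (u s * molli x d s) = \int[mu]_(s in `[x, x + d]) (u s * molli x d s).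
  move=> x0 xd.
  have sub : `[x, x + d]%classic `<=` I01 by move=> y; rewrite /= !in_itv/=; slra.
  have out y : ~~ (x <= y <= x + d) -> u y * molli x d y = 0 by move=> ?; rewrite molli_out ?mulr0.
  split; last by apply: Rint_supp => //; [exact: measurable_funM|move=> y _; exact: out].
  have i1 : itg `[x, x + d] (fun s => molli x d s * u s).
    apply: itg_cts_mul; first by apply: continuous_subspaceT; exact: smooth_continuous (smooth_molli _ _).
    by apply: loc_itg => //; slra.
  apply: (itg_supp _ _ sub) => //; first exact: measurable_funM.
    by move=> y _; exact: out.
  by apply: itg_eq i1 => // y _; rewrite mulrC.
have [ia ea] := supp a a0 ltac:(slra).
have [ib eb] := supp b ltac:(slra) bd1.
have -> : \int[mu]_(s in I01) (u s * (molli a d s - molli b d s)) =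
    \int[mu]_(s in `[a, a + d]) (u s * molli a d s) - \int[mu]_(s in `[b, b + d]) (u s * molli b d s).
  rewrite -ea -eb -RintegralB//; apply: eq_Rintegral => s _; rewrite mulrBr//.
clear ea eb ia ib supp.
have -> : \int[mu]_(s in I01) (v s * trap a b d s) = \int[mu]_(s in `[a, b + d]) (v s * trap a b d s).
  apply: Rint_supp => //; first exact: measurable_funM.
    by move=> y; rewrite /= !in_itv/=; slra.
  by move=> y _ ny; rewrite trap_out ?mulr0// ltW.
have ivt : itg `[a, b + d] (fun s => trap a b d s * v s).
  apply: itg_cts_mul; first by apply: continuous_subspaceT; exact: smooth_continuous (smooth_trap _ _ _).
  by apply: itg_seg_sub ivb => //; slra.
have ivbd : itg `[a, b + d] v by apply: itg_seg_sub ivb; slra.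
have close : `|\int[mu]_(s in `[a, b + d]) (v s * trap a b d s) - \int[mu]_(s in `[a, b]) v s| <= 2 * e.
  have E : \int[mu]_(s in `[a, b + d]) (v s * trap a b d s) = \int[mu]_(s in `[a, b + d]) (trap a b d s * v s).
    by apply: eq_Rintegral => s _; rewrite mulrC.
  rewrite E (@Rint_cat _ _ a (b + d) b)//; [|slra|slra].
  have -> : \int[mu]_(s in `[a, b]) (trap a b d s * v s) = \int[mu]_(s in `[a, a + d]) (trap a b d s * v s) +
     \int[mu]_(s in `[a + d, b]) v s.
    rewrite (@Rint_cat _ _ a b (a + d)); [congr (_ + _)|slra|slra|by apply: itg_seg_sub ivt; slra].
    apply: eq_Rintegral => s /set_mem; rewrite /= in_itv/= => sab.
    by rewrite trap1 ?mul1r.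
  rewrite (@Rint_cat _ v a b (a + d)); [|slra|slra|by apply: itg_seg_sub ivb; slra].
  have A : `|\int[mu]_(s in `[a, a + d]) (trap a b d s * v s) - \int[mu]_(s in `[a, a + d]) v s| <= e.
    have iv1 : itg `[a, a + d] v by apply: itg_seg_sub ivb; slra.
    have ivt1 : itg `[a, a + d] (fun s => trap a b d s * v s) by apply: itg_seg_sub ivt; slra.
    rewrite -RintegralB//; apply: le_trans _ (h3 d dpos dd3).
    apply: Rint_norm_le => //; [exact: itgB|exact: itg_norm|].
    move=> s _; rewrite -[X in _ - X]mul1r -mulrBl normrM ler_piMl//.
    by rewrite ler0_norm ?subr_le0 ?trap_le1//; have := trap_ge0 s dpos (ltW ab); slra.
  have B : `|\int[mu]_(s in `[b, b + d]) (trap a b d s * v s)| <= e.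
    have iv1 : itg `[b, b + d] v by apply: itg_seg_sub ivb; slra.
    apply: le_trans _ (h4 d dpos dd4).
    apply: Rint_norm_le => //; [by apply: itg_seg_sub ivt; slra|exact: itg_norm|].
    move=> s _; rewrite normrM ler_piMl// ger0_norm ?trap_ge0 ?trap_le1//; exact: ltW.
  clear -A B; apply: (@le_trans _ _ (e + e)); last by slra.
  move: A B; move: (Rintegral _ _ _) (Rintegral _ _ _) (Rintegral _ _ _) (Rintegral _ _ _) => ? ? ? ?.
  by rewrite !ler_norml; slra.
move=> E; move: close E (h1 d dpos dd1) (h2 d dpos dd2).
move: (Rintegral _ _ _) (Rintegral _ _ _) (Rintegral _ _ _) (Rintegral _ _ _) (u a) (u b) => ? ? ? ? ? ?.
clear; rewrite !ler_norml; slra.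
Qed.

(** The base point [c] is interior because [v] need not be integrable near 0. At least one of the
    two integrals is over a null set. *)
Lemma prim_of_loc v (c : R) : locally_integrable I01 v -> 0 < c < 1 ->
  prim (fun s => \int[mu]_(r in `[c, s]) v r - \int[mu]_(r in `[s, c]) v r) v.
Proof.
move=> lv c01 a b a0 ab b1; have iv x y : 0 < x -> y < 1 -> itg `[x, y] v by exact: loc_itg.
split; first exact: iv.
have z x y : y <= x -> \int[mu]_(r in `[x, y]) v r = 0.
  rewrite le_eqVlt => /predU1P[->|yx]; first by rewrite set_itv1 Rintegral_set1.
  by rewrite set_itv_ge ?Rintegral_set0// bnd_simp -ltNge.
have [ac|ca] := orP (le_total a c); have [bc|cb] := orP (le_total b c).
- rewrite (z c b)// (z c a)// (@Rint_cat _ v a c b)//; [ring|apply: iv; slra].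
- rewrite (z b c)// (z c a)// (@Rint_cat _ v a b c)//; [ring|apply: iv; slra].
- rewrite (z c b)// (z a c)// (z a b) ?(le_trans bc)//.
  have -> : a = b by slra.
  rewrite !z//; [ring|slra].
- rewrite (z b c)// (z a c)// (@Rint_cat _ v c b a)//; [ring|apply: iv; slra].
Qed.

(** The base point is a Lebesgue point of [u]; almost every other point is one as well, and
    [wderiv_lpt] compares [u] there with the primitive of [v]. *)
Lemma wderiv_prim u v : is_wderiv u v ->
  exists2 w, prim w v & {ae mu, forall s, I01 s -> u s = w s}.
Proof.
move=> huv; have [lu lv _] := huv; have L := @lpt_ae 0 1 _ (fun a b => @loc_itg _ a b lu).
have [c c01 hc] := ae_dense (@ltr01 R) L.
have uc : lpt u c by apply: hc; rewrite /= in_itv/=.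
have hV := prim_of_loc lv c01.
exists (fun s => u c + (\int[mu]_(r in `[c, s]) v r - \int[mu]_(r in `[s, c]) v r)).
  by apply: (prim_eq _ _ (primD (prim_cst (u c)) hV)) => s _ //; rewrite add0r.
apply: (filterS_ae L) => s hs s01; have us := hs s01; move: s01; rewrite /= in_itv/= => s01.
have z x y : y < x -> \int[mu]_(r in `[x, y]) v r = 0.
  by move=> yx; rewrite set_itv_ge ?Rintegral_set0// bnd_simp -ltNge.
have [cs|sc|<-] := ltgtP c s.
- by rewrite (z s c)// subr0 -(wderiv_lpt huv _ cs _ uc us); slra.
- by rewrite (z c s)// sub0r -(wderiv_lpt huv _ sc _ us uc); slra.
- by rewrite subrr addr0.
Qed.

Lemma prim_ae_eq u v u' v' : prim u v -> prim u' v' ->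
  {ae mu, forall s, I01 s -> u s = u' s} -> forall s, 0 < s < 1 -> u s = u' s.
Proof.
move=> h h' uu s s01; have hd := primB h h'.
apply/eqP; rewrite -subr_eq0 -normr_le0; apply/ler_addgt0Pr => e e0; rewrite add0r.
have := prim_continuous_at hd s01 => /cvgrPdist_lt /(_ e e0) /nbhs_ballP[d /= d0 H].
have lt : s < Num.min (s + d) 1 by rewrite lt_min; slra.
have [r + Hr] := ae_dense lt uu; rewrite lt_min => /and3P[sr rd r1].
have := H r; rewrite /ball/= distrC gtr0_norm ?subr_gt0// => /(_ ltac:(slra)).
by rewrite [u r]Hr ?subrr ?subr0; [move=> /ltW|rewrite /= in_itv/=; slra].
Qed.

Lemma prim_deriv_ae u v v' : prim u v -> prim u v' ->
  measurable_fun I01 v -> measurable_fun I01 v' ->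
  {ae mu, forall s, I01 s -> v s = v' s}.
Proof.
move=> h h' mv mv'.
pose g s := v s - v' s.
have ig a b : 0 < a -> b < 1 -> itg `[a, b] g.
  move=> a0 b1; have [ab|ba] := leP a b.
    by apply: itgB => //; [exact: (prim_itg h)|exact: (prim_itg h')].
  by rewrite set_itv_ge ?bnd_simp -?ltNge//; exact: integrable_set0.
have g0 a b : 0 < a -> a <= b -> b < 1 -> \int[mu]_(s in `[a, b]) g s = 0.
  move=> a0 ab b1; have [iv ev] := h a b a0 ab b1; have [iv' ev'] := h' a b a0 ab b1.
  by rewrite /g RintegralB// -ev -ev' subrr.
apply: (filterS_ae (@lpt_ae 0 1 _ ig)) => s hs s01; have := hs s01.
move: s01; rewrite /= in_itv/= => s01 L.
suff : g s = 0 by rewrite /g; slra.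
apply/eqP; rewrite -normr_le0; apply/ler_addgt0Pr => e e0; rewrite add0r.
have [d0 d00 hd] := L e e0; pose d := Num.min d0 (1 - s) / 2.
have dm : 0 < Num.min d0 (1 - s) by rewrite lt_min d00/=; slra.
have dp : 0 < d by rewrite divr_gt0.
have : d < Num.min d0 (1 - s) by rewrite /d; move: (Num.min _ _) dm => m; slra.
rewrite lt_min => /andP[dd0 ds].
rewrite -(ler_pM2r dp); apply: le_trans _ (hd d dp dd0).
have i1 : itg `[s, s + d] g by apply: ig; slra.
have -> : `|g s| * d = `|\int[mu]_(y in `[s, s + d]) (g y - g s)|.
  rewrite RintegralB//; last exact: itg_seg_cst.
  rewrite g0; [|slra|slra|slra].
  rewrite sub0r normrN Rint_seg_cst; last by slra.
  by rewrite normrM addrC addKr (gtr0_norm dp).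
by apply: le_normr_Rintegral => //; apply: itgB => //; exact: itg_seg_cst.
Qed.

Lemma wderivP u : has_wderiv u -> is_wderiv u (wderiv u).
Proof. by move=> [v hv]; rewrite /wderiv; exact: (xgetI _ hv). Qed.

Lemma wderiv_rep u : has_wderiv u ->
  exists2 w, prim w (wderiv u) & {ae mu, forall s, I01 s -> u s = w s}.
Proof. by move=> /wderivP/wderiv_prim. Qed.

Lemma wderiv_meas u : has_wderiv u -> measurable_fun I01 (wderiv u).
Proof. by move=> /wderivP[_ []]. Qed.

Lemma wderiv_primE u w w' : has_wderiv u -> prim w w' -> measurable_fun I01 w' ->
  {ae mu, forall s, I01 s -> u s = w s} -> {ae mu, forall s, I01 s -> wderiv u s = w' s}.
Proof.
move=> hu pw mw' uw; have [w2 pw2 uw2] := wderiv_rep hu.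
have E := prim_ae_eq pw2 pw _.
apply: (prim_deriv_ae _ pw (wderiv_meas hu) mw').
apply: (prim_eq _ _ pw2) => // s s01; apply: E => //.
by apply: (filterS_ae (ae_and uw uw2)) => x [e e'] x01; rewrite -e// -e'.
Qed.

End WeakDerivatives.

(** * Weak derivatives in time *)

Section WeakTimeDerivative.
Context {R : realType}.
Local Notation mu := (@lebesgue_measure R).
Local Notation itg D f := (mu.-integrable D (EFin \o f)).
Local Notation I01 := (`]@GRing.zero R, @GRing.one R[%classic).
Implicit Types (D : set R) (f g u v w : R -> R).

Import HBNNSimple.

(* The integral of a nonnegative function is a supremum over simple functions,
   hence monotone without any measurability assumption. *)
Lemma ge0_int_ae_le D (f g : R -> \bar R) : (forall x, D x -> 0 <= f x)%E ->
  (forall x, D x -> 0 <= g x)%E ->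
  {ae mu, forall x, D x -> (f x <= g x)%E} ->
  (\int[mu]_(x in D) f x <= \int[mu]_(x in D) g x)%E.
Proof.
move=> f0 g0 [N [mN N0 sub]].
rewrite [leLHS]integral_mkcond [leRHS]integral_mkcond !ge0_integralTE; last 2 first.
- by move=> x; rewrite patchE; case: ifPn => // /set_mem; exact: g0.
- by move=> x; rewrite patchE; case: ifPn => // /set_mem; exact: f0.
apply: ge_ereal_sup => _ [h hf <-].
(* Cutting the simple function off on the null set does not change its integral and puts it below
   [g] everywhere. *)
pose h' := proj_nnsfun h (measurableC mN).
have -> : sintegral mu h = sintegral mu h'.
  rewrite -!integralT_nnsfun; apply: ge0_ae_eq_integral => //.
  - exact/measurable_EFinP.
  - exact/measurable_EFinP.
  - by move=> x _; rewrite lee_fin.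
  - by move=> x _; rewrite lee_fin.
  exists N; split => // x /= hx; apply: contrapT => xN; apply: hx => _.
  by rewrite /h'/= mindicE mem_set ?mulr1.
apply: ereal_sup_ubound; exists h' => // x; rewrite /h'/= mindicE.
have [xN|xN] := boolP (x \in ~` N); last first.
  rewrite mulr0 patchE; case: ifPn => // /set_mem; exact: g0.
rewrite mulr1; apply: le_trans (hf x) _; rewrite !patchE; case: ifPn => // /set_mem Dx.
apply: contrapT => nfg; move/set_mem: xN; apply; apply: sub => /= H.
exact: nfg (H Dx).
Qed.

(** The middle function is not assumed measurable, which lets the pairings in the weak formulation
    be estimated from pointwise bounds alone. The positive and negative parts are compared
    separately. *)
Lemma Rint_ae_between D (L G U : R -> R) : measurable D -> itg D L -> itg D U ->
  {ae mu, forall x, D x -> L x <= G x <= U x} ->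
  \int[mu]_(x in D) L x <= \int[mu]_(x in D) G x <= \int[mu]_(x in D) U x.
Proof.
move=> mD iL iU h.
have hLG : {ae mu, forall x, D x -> (L x <= G x)} by apply: (filterS_ae h) => x hx /hx/andP[].
have hGU : {ae mu, forall x, D x -> (G x <= U x)} by apply: (filterS_ae h) => x hx /hx/andP[].
have pos (A B : R -> R) : {ae mu, forall x, D x -> A x <= B x} ->
    (\int[mu]_(x in D) (EFin \o A)^\+ x <= \int[mu]_(x in D) (EFin \o B)^\+ x)%E.
  move=> AB; apply: ge0_int_ae_le => //.
  apply: (filterS_ae AB) => x hx /hx; rewrite !funeposE /= => le.
  by rewrite ge_max !le_max !lee_fin lexx orbT le.
have neg (A B : R -> R) : {ae mu, forall x, D x -> A x <= B x} ->
    (\int[mu]_(x in D) (EFin \o B)^\- x <= \int[mu]_(x in D) (EFin \o A)^\- x)%E.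
  move=> AB; apply: ge0_int_ae_le => //.
  apply: (filterS_ae AB) => x hx /hx; rewrite !funenegE /= => le.
  by rewrite ge_max !le_max !lee_fin lexx orbT lerN2 le.
have p1 := pos _ _ hLG; have p2 := pos _ _ hGU; have n1 := neg _ _ hLG; have n2 := neg _ _ hGU.
have fp (A : R -> R) : itg D A -> (\int[mu]_(x in D) (EFin \o A)^\+ x \is a fin_num)%E.
  exact: (@integrable_pos_fin_num _ _ _ mu _ mD).
have fn (A : R -> R) : itg D A -> (\int[mu]_(x in D) (EFin \o A)^\- x \is a fin_num)%E.
  exact: (@integrable_neg_fin_num _ _ _ mu _ mD).
have pge0 (A : R -> R) : (0 <= \int[mu]_(x in D) (EFin \o A)^\+ x)%E.
  by apply: integral_ge0 => x _; exact: funepos_ge0.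
have nge0 (A : R -> R) : (0 <= \int[mu]_(x in D) (EFin \o A)^\- x)%E.
  by apply: integral_ge0 => x _; exact: funeneg_ge0.
have fG : (\int[mu]_(x in D) (EFin \o G)^\+ x \is a fin_num)%E.
  by rewrite ge0_fin_numE//; apply: le_lt_trans p2 _; rewrite -ge0_fin_numE// fp.
have gG : (\int[mu]_(x in D) (EFin \o G)^\- x \is a fin_num)%E.
  by rewrite ge0_fin_numE//; apply: le_lt_trans n1 _; rewrite -ge0_fin_numE// fn.
have E (A : R -> R) : \int[mu]_(x in D) A x =
    fine (\int[mu]_(x in D) (EFin \o A)^\+ x - \int[mu]_(x in D) (EFin \o A)^\- x)%E.
  by rewrite /Rintegral (integralE mu D (EFin \o A)).
rewrite (E L) (E G) (E U) (fineB (fp _ iL) (fn _ iL)) (fineB fG gG) (fineB (fp _ iU) (fn _ iU)).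
by apply/andP; split; apply: lerB; [exact: fine_le (fp _ iL) fG p1|exact: fine_le gG (fn _ iL) n1|
  exact: fine_le fG (fp _ iU) p2|exact: fine_le (fn _ iU) gG n2].
Qed.

(** A mean value inequality for weak derivatives: testing with a mollified indicator of an interval
    inside ]t1, t2[ turns the left-hand side into a difference of two averages of [P], close to t1
    and to t2. *)
Lemma weak_dt_bound (T : R) (P Q : R -> R) (K1 K2 t1 t2 : R) : 0 < t1 -> t1 <= t2 -> t2 < T ->
  (forall t : R, 0 < t < T -> {for t, continuous P}) ->
  (forall phi, test_function 0 T phi ->
     \int[mu]_(t in `]0, T[) (derive1 phi t * P t) = - \int[mu]_(t in `]0, T[) (phi t * Q t)) ->
  {ae mu, forall t, t1 < t < t2 -> K1 <= Q t <= K2} ->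
  K1 * (t2 - t1) <= P t2 - P t1 <= K2 * (t2 - t1).
Proof.
move=> t10 + t2T cP hPQ hQ; rewrite le_eqVlt => /predU1P[->|t12].
  by rewrite !subrr !mulr0 lexx.
pose D : set R := `]0, T[%classic.
have mD : measurable D by exact: measurable_itv.
have mP : measurable_fun D P.
  apply: open_continuous_measurable_fun => //.
  by move=> x /set_mem; rewrite /D/= in_itv/=; exact: cP.
pose K := `|K1| + `|K2|.
suff key e : 0 < e -> K1 * (t2 - t1) - e <= P t2 - P t1 <= K2 * (t2 - t1) + e.
  apply/andP; split; apply/ler_addgt0Pr => e e0; have := key e e0; slra.
move=> e0; pose e1 := e / 4.
have e10 : 0 < e1 by rewrite divr_gt0.
have [d1 d10 h1] : exists2 d : R, 0 < d & forall y, `|t1 - y| < d -> `|P t1 - P y| < e1.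
  have := cP t1 ltac:(slra) => /cvgrPdist_lt/(_ e1 e10)/nbhs_ballP[d /= d0 hd].
  by exists d.
have [d2 d20 h2] : exists2 d : R, 0 < d & forall y, `|t2 - y| < d -> `|P t2 - P y| < e1.
  have := cP t2 ltac:(slra) => /cvgrPdist_lt/(_ e1 e10)/nbhs_ballP[d /= d0 hd].
  by exists d.
have K0 : 0 < 4 * K + 1 by rewrite /K; have := normr_ge0 K1; have := normr_ge0 K2; slra.
pose m := Num.min (Num.min (d1 / 3) (d2 / 3)) (Num.min ((t2 - t1) / 4) (e1 / (4 * K + 1))).
have m0 : 0 < m by rewrite !lt_min !divr_gt0//=; slra.
have [d [d0 dd1 dd2 d12 dK]] : exists d, [/\ 0 < d, d * 3 <= d1, d * 3 <= d2, d * 4 <= t2 - t1 & d * (4 * K + 1) <= e1].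
  exists m; split => //; rewrite -ler_pdivlMr// /m ?ge_min ?lexx ?orbT//.
clear m m0.
(* The support [a, b + d] = [t1 + d, t2 - d] stays where the bounds of [Q] hold, and the integral of
   the test function lies between t2 - t1 - 4 d and t2 - t1 - 2 d. *)
pose a := t1 + d; pose b := t2 - 2 * d.
have ab : a <= b by rewrite /a /b; slra.
have bT : b + d < T by rewrite /b; slra.
have a0 : 0 < a by rewrite /a; slra.
have := hPQ _ (trap_test d0 a0 ab bT); rewrite derive1_trap.
have cm x : continuous (molli x d) by exact: smooth_continuous (smooth_molli _ _).
have mm x : measurable_fun D (molli x d).
  by apply: measurable_funTS; exact: continuous_measurable_fun.
have ct : continuous (trap a b d) by exact: smooth_continuous (smooth_trap _ _ _).
have cPw x y : 0 < x -> y < T -> {within `[x, y], continuous P}.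
  move=> x0 yT; apply: continuous_in_subspaceT => s /set_mem; rewrite /= in_itv/= => sab.
  by apply: cP; slra.
have supp x c : 0 < x -> x + d < T -> (forall y, x <= y <= x + d -> `|c - P y| <= e1) ->
    itg D (fun t => P t * molli x d t) /\
    `|\int[mu]_(t in D) (P t * molli x d t) - c| <= e1.
  move=> x0 xd hc.
  have sub : `[x, x + d]%classic `<=` D by move=> y; rewrite /D /= !in_itv/=; slra.
  have out y : ~~ (x <= y <= x + d) -> P y * molli x d y = 0 by move=> ?; rewrite molli_out ?mulr0.
  have im : itg `[x, x + d] (molli x d).
    by apply: within_cts_itg; apply: continuous_subspaceT; exact: cm.
  have i1 : itg `[x, x + d] (fun s => P s * molli x d s).
    by apply: itg_cts_mul => //; apply: cPw.
  have mPm : measurable_fun D (fun s => P s * molli x d s) by exact: measurable_funM.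
  split; first by apply: (itg_supp mD mPm sub) => // y _; exact: out.
  rewrite (Rint_supp mD mPm sub) => //; last by move=> y _; exact: out.
  rewrite -[X in _ - X]mulr1 -(molli_int x d0) -RintegralZl// -RintegralB//; last exact: itgZ.
  rewrite -[leRHS]mulr1 -(molli_int x d0) -RintegralZl//.
  apply: Rint_norm_le => //; [by apply: itgB => //; exact: itgZ|exact: itgZ|].
  move=> y; rewrite /= in_itv/= => yx.
  by rewrite -mulrBl normrM (ger0_norm (molli_ge0 _ _ d0)) ler_wpM2r ?molli_ge0// distrC hc.
have [i1 A1] := @supp a (P t1) a0 ltac:(rewrite /a; slra) ltac:(move=> y; rewrite /a => hy; apply: ltW; apply: h1; rewrite ler0_norm; slra).
have [i2 A2] := @supp b (P t2) ltac:(rewrite /b; slra) bT ltac:(move=> y; rewrite /b => hy; apply: ltW; apply: h2; rewrite ger0_norm; slra).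
have -> : \int[mu]_(t in D) ((molli a d t - molli b d t) * P t) =
    \int[mu]_(t in D) (P t * molli a d t) - \int[mu]_(t in D) (P t * molli b d t).
  by rewrite -RintegralB//; apply: eq_Rintegral => s _; rewrite mulrC mulrBr.
have sub : `[a, b + d]%classic `<=` D by move=> y; rewrite /D /= !in_itv/=; slra.
have mt : measurable_fun D (trap a b d).
  by apply: measurable_funTS; exact: continuous_measurable_fun.
have out y : ~~ (a <= y <= b + d) -> trap a b d y = 0 by exact: trap_out.
have it1 : itg `[a, b + d] (trap a b d).
  by apply: within_cts_itg; apply: continuous_subspaceT.
have it : itg D (trap a b d) by apply: (itg_supp mD mt sub) => // y _; exact: out.
have Et : \int[mu]_(t in D) trap a b d t = \int[mu]_(t in `[a, b + d]) trap a b d t.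
  by apply: Rint_supp => // y _; exact: out.
have Tle : \int[mu]_(t in `[a, b + d]) trap a b d t <= b + d - a.
  rewrite -[leRHS]mul1r -Rint_seg_cst; last by slra.
  apply: le_Rintegral => //; first exact: itg_seg_cst.
  by move=> x _; exact: trap_le1.
have Tge : b - a - d <= \int[mu]_(t in `[a, b + d]) trap a b d t.
  have -> : b - a - d = \int[mu]_(t in `[a + d, b]) (fun=> 1) t.
    by rewrite Rint_seg_cst ?mul1r; rewrite /a /b; slra.
  apply: (@le_trans _ _ (\int[mu]_(t in `[a + d, b]) trap a b d t)).
    apply: le_Rintegral => //; [exact: itg_seg_cst|by apply: itg_seg_sub it1; slra|].
    by move=> x; rewrite /= in_itv/= => xab; rewrite trap1.
  apply: (Rint_sub _ _ _ it1) => //; first by move=> x; rewrite /= !in_itv/=; slra.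
  by move=> x _; exact: trap_ge0.
have := @Rint_ae_between D (fun t => K1 * trap a b d t) (fun t => trap a b d t * Q t)
   (fun t => K2 * trap a b d t) mD (itgZ _ mD it) (itgZ _ mD it).
have hae : {ae mu, forall x, D x -> K1 * trap a b d x <= trap a b d x * Q x <= K2 * trap a b d x}.
  apply: (filterS_ae hQ) => t ht _.
  have [tab|tab] := boolP (a <= t <= b + d); last by rewrite out// !(mulr0, mul0r) lexx.
  have /andP[q1 q2] := ht ltac:(rewrite /a /b in tab *; slra).
  by rewrite mulrC ler_wpM2l ?trap_ge0//= mulrC ler_wpM2r ?trap_ge0.
move=> /(_ hae); rewrite !RintegralZl// Et.
move: Tle Tge A1 A2; rewrite !ler_norml -/D.
move: (\int[mu]_(t in `[a, b + d]) trap a b d t) (\int[mu]_(t in D) (P t * molli a d t))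
  (\int[mu]_(t in D) (P t * molli b d t)) (\int[mu]_(t in D) (trap a b d t * Q t)).
move=> J A B C Tle Tge A1 A2 hC EA.
have J1 : `|J - (t2 - t1)| <= 4 * d by rewrite ler_norml; rewrite /a /b in Tle Tge; slra.
have kJ (k : R) : `|k| <= K -> `|k * (J - (t2 - t1))| <= e1.
  move=> kK; rewrite normrM; apply: le_trans (ler_pM (normr_ge0 _) (normr_ge0 _) kK J1) _.
  by move: dK d0; clearbody K; clear; lra.
have k1 : `|K1 * (J - (t2 - t1))| <= e1 by apply: kJ; rewrite lerDl.
have k2 : `|K2 * (J - (t2 - t1))| <= e1 by apply: kJ; rewrite lerDr.
have e4 : e = 4 * e1 by rewrite /e1 mulrC divfK.
move/eqP: EA; rewrite eq_le e4; move: k1 k2 A1 A2 hC; rewrite !ler_norml !mulrBr; clearbody e1; clear; lra.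
Qed.

End WeakTimeDerivative.

(** * Norms and coordinates *)

Section Norms.
Context {R : realType}.
Local Notation mu := (@lebesgue_measure R).
Local Notation itg D f := (mu.-integrable D (EFin \o f)).
Local Notation I01 := (`]@GRing.zero R, @GRing.one R[%classic).
Context {n : nat}.
Implicit Types (u v : R -> 'rV[R]_n) (r t d e : R).

Definition meas_coords u := forall i, measurable_fun I01 (fun s => u s 0 i).

Lemma enorm_sqr (v : 'rV[R]_n) : enorm v ^+ 2 = \sum_i v 0 i ^+ 2.
Proof.
rewrite /enorm sqr_sqrtr; first by apply: eq_bigr => i _; rewrite expr2.
by apply: sumr_ge0 => i _; rewrite -expr2 sqr_ge0.
Qed.

(** A coordinate is below the Euclidean norm pointwise, and [ge0_int_ae_le] compares the integrals
    without having to prove the norm measurable. *)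
Lemma wsq_le k u (c : R) : meas_coords u -> (wsq k u <= c%:E)%E ->
  forall i, itg I01 (fun s => s ^+ k * u s 0 i ^+ 2) /\
    \int[mu]_(s in I01) (s ^+ k * u s 0 i ^+ 2) <= c.
Proof.
move=> mu' hk i.
have mi : measurable_fun I01 (fun s => s ^+ k * u s 0 i ^+ 2).
  by apply: measurable_funM; apply: measurable_funX => //; exact: mu'.
have le : (\int[mu]_(s in I01) (s ^+ k * u s 0 i ^+ 2)%:E <= c%:E)%E.
  apply: le_trans hk; apply: ge0_int_ae_le => [s||].
  - rewrite /= in_itv/= => s01; rewrite lee_fin mulr_ge0 ?sqr_ge0// exprn_ge0//; slra.
  - move=> s; rewrite /= in_itv/= => s01; rewrite lee_fin mulr_ge0 ?sqr_ge0// exprn_ge0//; slra.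
  exists set0; split => // s /= h; exfalso; apply: h; rewrite in_itv/= => s01.
  rewrite lee_fin ler_wpM2l ?exprn_ge0//; first by slra.
  by rewrite enorm_sqr (bigD1 i)//= lerDl; apply: sumr_ge0 => j _; exact: sqr_ge0.
have f0 s : I01 s -> 0 <= s ^+ k * u s 0 i ^+ 2.
  by rewrite /= in_itv/= => s01; rewrite mulr_ge0 ?sqr_ge0// exprn_ge0//; slra.
have ii : itg I01 (fun s => s ^+ k * u s 0 i ^+ 2).
  apply/integrableP; split; first exact/measurable_EFinP.
  apply: le_lt_trans (ltry c); apply: le_trans le; rewrite le_eqVlt; apply/orP; left; apply/eqP.
  by apply: eq_integral => x /set_mem x01; rewrite /= ger0_norm ?f0.
by split => //; rewrite -lee_fin -EFin_Rint.
Qed.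

Lemma wsq_ge0 k u : (0 <= wsq k u)%E.
Proof.
apply: integral_ge0 => s; rewrite /= in_itv/= => s01.
by rewrite lee_fin mulr_ge0 ?sqr_ge0// exprn_ge0//; slra.
Qed.

Lemma sqrte_le (a : \bar R) (c : R) : (0 <= a)%E -> (sqrte a <= c%:E)%E -> 0 <= c /\ (a <= (c ^+ 2)%:E)%E.
Proof.
case: a => [a| |] //=; rewrite !lee_fin => a0 ac.
have c0 : 0 <= c by apply: le_trans ac; exact: sqrtr_ge0.
by split=> //; rewrite -(sqr_sqrtr a0) lerXn2r ?nnegrE ?sqrtr_ge0.
Qed.

Lemma L2norm_le u (e : R) : meas_coords u -> (L2norm u <= e%:E)%E ->
  forall i, L2 I01 (fun s => u s 0 i) /\ \int[mu]_(s in I01) (u s 0 i ^+ 2) <= e ^+ 2.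
Proof.
move=> mu' /sqrte_le[|e0 h i]; first exact: wsq_ge0.
have [ii le] := wsq_le mu' h i.
have E s : s ^+ 0 * u s 0 i ^+ 2 = u s 0 i ^+ 2 by rewrite expr0 mul1r.
split; last by under eq_Rintegral do rewrite -E.
by split => //; apply: itg_eq ii => // s _.
Qed.

Lemma wderivv_meas u : has_wderivv u -> meas_coords (wderivv u).
Proof.
move=> h i; rewrite (_ : (fun s => _) = wderiv (fun r => u r 0 i)).
  exact: wderiv_meas.
by apply/funext => s; rewrite mxE.
Qed.

Lemma wderivvE u i : (fun s => wderivv u s 0 i) = wderiv (fun r => u r 0 i).
Proof. by apply/funext => s; rewrite mxE. Qed.

Lemma X1norm_le u (e : R) : meas_coords u -> (X1norm u <= e%:E)%E ->
  forall i, [/\ L2 I01 (fun s => u s 0 i), \int[mu]_(s in I01) (u s 0 i ^+ 2) <= e ^+ 2,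
    has_wderiv (fun s => u s 0 i),
    itg I01 (fun s => s * wderiv (fun r => u r 0 i) s ^+ 2) &
    \int[mu]_(s in I01) (s * wderiv (fun r => u r 0 i) s ^+ 2) <= e ^+ 2].
Proof.
move=> mu'; rewrite /X1norm; case: asboolP => // hw /sqrte_le[|e0 h i].
  by apply: adde_ge0; exact: wsq_ge0.
have h0 : (wsq 0 u <= (e ^+ 2)%:E)%E by apply: le_trans h; rewrite leeDl ?wsq_ge0.
have h1 : (wsq 1 (wderivv u) <= (e ^+ 2)%:E)%E by apply: le_trans h; rewrite leeDr ?wsq_ge0.
have [i0 l0] := wsq_le mu' h0 i.
have [i1 l1] := wsq_le (wderivv_meas hw) h1 i.
have E s : s ^+ 0 * u s 0 i ^+ 2 = u s 0 i ^+ 2 by rewrite expr0 mul1r.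
have E1 s : s ^+ 1 * wderivv u s 0 i ^+ 2 = s * wderiv (fun r => u r 0 i) s ^+ 2.
  by rewrite expr1 mxE.
split=> //.
- by split => //; apply: itg_eq i0 => // s _.
- by under eq_Rintegral do rewrite -E.
- by apply: itg_eq i1 => // s _.
- by under eq_Rintegral do rewrite -E1.
Qed.

Lemma X2norm_le u (e : R) : meas_coords u -> (X2norm u <= e%:E)%E ->
  forall i, let p := wderiv (fun r => u r 0 i) in
   [/\ has_wderiv (fun s => u s 0 i), has_wderiv p,
    L2 I01 p /\ \int[mu]_(s in I01) (p s ^+ 2) <= e ^+ 2 &
    itg I01 (fun s => s ^+ 2 * wderiv p s ^+ 2) /\
    \int[mu]_(s in I01) (s ^+ 2 * wderiv p s ^+ 2) <= e ^+ 2].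
Proof.
move=> mu'; rewrite /X2norm; case: asboolP => // -[hw hw2] /sqrte_le[|e0 h i].
  by apply: adde_ge0; [apply: adde_ge0|]; exact: wsq_ge0.
set p := wderiv (fun r => u r 0 i).
have h1 : (wsq 0 (wderivv u) <= (e ^+ 2)%:E)%E.
  by apply: le_trans h; rewrite -addeA [leRHS]addeCA leeDl// adde_ge0 ?wsq_ge0.
have h2 : (wsq 2 (wderivv (wderivv u)) <= (e ^+ 2)%:E)%E.
  by apply: le_trans h; rewrite leeDr// adde_ge0 ?wsq_ge0.
have [i1 l1] := wsq_le (wderivv_meas hw) h1 i.
have [i2 l2] := wsq_le (wderivv_meas hw2) h2 i.
have E1 s : s ^+ 0 * wderivv u s 0 i ^+ 2 = p s ^+ 2 by rewrite expr0 mul1r mxE.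
have E2 s : s ^+ 2 * wderivv (wderivv u) s 0 i ^+ 2 = s ^+ 2 * wderiv p s ^+ 2.
  by rewrite mxE wderivvE.
have hp : has_wderiv p by have := hw2 i; rewrite wderivvE.
split=> //.
- split; last by apply: le_trans l1; rewrite le_eqVlt; apply/orP; left; apply/eqP; apply: eq_Rintegral => s _; rewrite E1.
  split; first exact: wderiv_meas.
  by apply: itg_eq i1 => // s _.
- split; first by apply: itg_eq i2 => // s _.
  by apply: le_trans l2; rewrite le_eqVlt; apply/orP; left; apply/eqP; apply: eq_Rintegral => s _; rewrite E2.
Qed.

Lemma nspace_meas N u : nspace N u -> meas_coords u.
Proof. by case. Qed.

Lemma nspace_L2 N u : nspace N u -> forall i, L2 I01 (fun s => u s 0 i).
Proof.
move=> [mu' h _] i.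
have [e he] : exists e : R, (L2norm u <= e%:E)%E.
  move: h; have : (0 <= L2norm u)%E by rewrite /L2norm sqrte_ge0.
  by case: (L2norm u) => // r _ _; exists r.
by have [] := L2norm_le mu' he i.
Qed.

Lemma L2_nspace u : (forall i, L2 I01 (fun s => u s 0 i)) -> nspace L2norm u.
Proof.
move=> h; have mu' : meas_coords u by move=> i; case: (h i).
suff fin : (L2norm u < +oo)%E by split.
rewrite /L2norm /wsq.
have -> : (\int[mu]_(s in `]0%R, 1%R[) (s ^+ 0 * enorm (u s) ^+ 2)%:E)%E =
    (\int[mu]_(s in I01) (\sum_i u s 0 i ^+ 2))%:E.
  rewrite -EFin_Rint//; last by apply: itg_sum => // i; case: (h i).
  by apply: eq_integral => s _; rewrite expr0 mul1r enorm_sqr.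
exact: ltry.
Qed.

Lemma cvg_norm_ball {T : Type} {F : set_system T} {FF : Filter F} (f : T -> \bar R) (e : R) :
  f x @[x --> F] --> 0%E -> 0 < e -> \forall x \near F, (f x <= e%:E)%E.
Proof.
move=> h e0.
have H : nbhs (0 : \bar R)%E [set y | (y < e%:E)%E].
  by apply: open_nbhs_nbhs; split; [exact: open_ereal_lt_ereal|rewrite /= lte_fin].
by apply: (@filterS _ F FF _ _ _ (h _ H)) => x /= /ltW.
Qed.

Lemma near_within_itv (T t : R) (f : R -> \bar R) (e : R) :
  f r @[r --> within `[0, T]%classic (nbhs t)] --> 0%E -> 0 < e ->
  exists2 d : R, 0 < d & forall r, 0 <= r <= T -> `|r - t| < d -> (f r <= e%:E)%E.
Proof.
move=> h e0; have H : \forall x \near within `[0, T]%classic (nbhs t), (f x <= e%:E)%E.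
  by apply: cvg_norm_ball.
move: H; rewrite near_withinE => /nbhs_ballP[d /= d0 hd]; exists d => // r rT rt.
by apply: hd; rewrite /ball/= 1?distrC// in_itv.
Qed.

Lemma near_dwithin_itv (T t : R) (f : R -> \bar R) (e : R) :
  f r @[r --> within `[0, T]%classic t^'] --> 0%E -> 0 < e ->
  exists2 d : R, 0 < d & forall r, 0 <= r <= T -> r != t -> `|r - t| < d -> (f r <= e%:E)%E.
Proof.
move=> h e0; have H : \forall x \near within `[0, T]%classic t^', (f x <= e%:E)%E.
  by apply: cvg_norm_ball.
move: H; rewrite /dnbhs !near_withinE => /nbhs_ballP[d /= d0 hd]; exists d => // r rT rn rt.
by apply: hd; rewrite /ball/= 1?distrC// in_itv.
Qed.

Lemma C0time_L2 (T : R) (U : R -> R -> 'rV[R]_n) : C0time L2norm T U ->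
  (forall (t : R) i, 0 <= t <= T -> L2 I01 (fun s => U t s 0 i)) /\
  forall (t : R), 0 <= t <= T -> forall (e : R), 0 < e -> exists2 d : R, 0 < d &
    forall (r : R), 0 <= r <= T -> `|r - t| < d -> forall i,
      \int[mu]_(s in I01) ((U r s 0 i - U t s 0 i) ^+ 2) <= e.
Proof.
move=> [h1 h2]; have hL t i : 0 <= t <= T -> L2 I01 (fun s => U t s 0 i).
  by move=> tT; apply: (nspace_L2 (h1 t _)); rewrite /= in_itv.
split => // t tT e e0; have tT' : `[0, T]%classic t by rewrite /= in_itv.
have e0' : 0 < Num.sqrt e by rewrite sqrtr_gt0.
have [d d0 hd] := near_within_itv (h2 t tT') e0'; exists d => // r rT rt i.
have mU : meas_coords (U r \- U t).
  move=> j; rewrite (_ : (fun s => _) = (fun s => U r s 0 j - U t s 0 j)).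
    by apply: measurable_funB; [case: (hL r j rT)|case: (hL t j tT)].
  by apply/funext => s; rewrite !mxE.
have [_] := L2norm_le mU (hd r rT rt) i; rewrite sqr_sqrtr ?(ltW e0)//.
by under eq_Rintegral do rewrite !mxE.
Qed.

Lemma C0time_X1 (T : R) (U : R -> R -> 'rV[R]_n) : C0time X1norm T U ->
  (forall (t : R) i, 0 <= t <= T -> [/\ L2 I01 (fun s => U t s 0 i), has_wderiv (fun s => U t s 0 i)
     & itg I01 (fun s => s * wderiv (fun s => U t s 0 i) s ^+ 2)]) /\
  forall (t : R), 0 <= t <= T -> forall (e : R), 0 < e -> exists2 d : R, 0 < d &
    forall (r : R), 0 <= r <= T -> `|r - t| < d -> forall i,
      \int[mu]_(s in I01) ((U r s 0 i - U t s 0 i) ^+ 2) <= e /\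
      \int[mu]_(s in I01) (s * (wderiv (fun s => U r s 0 i) s - wderiv (fun s => U t s 0 i) s) ^+ 2) <= e.
Proof.
move=> [h1 h2].
have hX t i : 0 <= t <= T -> [/\ L2 I01 (fun s => U t s 0 i), has_wderiv (fun s => U t s 0 i)
     & itg I01 (fun s => s * wderiv (fun s => U t s 0 i) s ^+ 2)].
  move=> tT; have tT' : `[0, T]%classic t by rewrite /= in_itv.
  have [mU _ hN] := h1 t tT'.
  have [c hc] : exists c : R, (X1norm (U t) <= c%:E)%E.
    move: hN; have : (0 <= X1norm (U t))%E.
      by rewrite /X1norm; case: ifP => _; rewrite ?leey// sqrte_ge0.
    by case: (X1norm (U t)) => // c _ _; exists c.
  by have [] := X1norm_le mU hc i.
split => // t tT e e0; have tT' : `[0, T]%classic t by rewrite /= in_itv.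
have e0' : 0 < Num.sqrt e by rewrite sqrtr_gt0.
have [d d0 hd] := near_within_itv (h2 t tT') e0'; exists d => // r rT rt i.
have EU j : (fun s => (U r \- U t) s 0 j) = (fun s => U r s 0 j - U t s 0 j).
  by apply/funext => s; rewrite !mxE.
have mU : meas_coords (U r \- U t).
  by move=> j; rewrite EU; apply: measurable_funB; [have [[]] := hX r j rT|have [[]] := hX t j tT].
have [_ + hw iw] := X1norm_le mU (hd r rT rt) i; rewrite sqr_sqrtr ?(ltW e0)//.
rewrite EU in hw iw * => le0 le1; split.
  by apply: le_trans le0; under [leRHS]eq_Rintegral do rewrite !mxE.
have [Lr wr ir] := hX r i rT; have [Lt wt it] := hX t i tT.
have [ur pr er] := wderiv_rep wr; have [ut pt et] := wderiv_rep wt.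
(* [X1norm] of the difference contains the chosen weak derivative of the difference, which agrees
   almost everywhere with the difference of the chosen ones. *)
have ae := wderiv_primE hw (primB pr pt) _ _.
apply: le_trans le1; rewrite le_eqVlt; apply/orP; left; apply/eqP.
have m1 := wderiv_meas wr; have m2 := wderiv_meas wt.
apply: Rint_ae_eq => //.
- by apply: measurable_funM => //; apply: measurable_funX; exact: measurable_funB.
- by apply: measurable_funM => //; apply: measurable_funX; exact: wderiv_meas.
have {}ae := ae (measurable_funB m1 m2) _.
have eq : {ae mu, forall s, I01 s -> U r s 0 i - U t s 0 i = ur s - ut s}.
  by apply: (filterS_ae (ae_and er et)) => s [a b] s01; rewrite a// b.
by apply: (filterS_ae (ae eq)) => s hs s01; rewrite hs.
Qed.

Lemma is_dt_coords (T : R) (U : R -> R -> 'rV[R]_n) (t : R) v :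
  (forall (r : R) i, 0 <= r <= T -> L2 I01 (fun s => U r s 0 i)) -> 0 <= t <= T ->
  is_dt T U t v ->
  (forall i, L2 I01 (fun s => v s 0 i)) /\
  forall (e : R), 0 < e -> exists2 d : R, 0 < d &
    forall (r : R), 0 <= r <= T -> r != t -> `|r - t| < d -> forall i,
      \int[mu]_(s in I01) (((r - t)^-1 * (U r s 0 i - U t s 0 i) - v s 0 i) ^+ 2) <= e.
Proof.
move=> hU tT [nv hv]; have Lv := nspace_L2 nv; split => // e e0.
have e0' : 0 < Num.sqrt e by rewrite sqrtr_gt0.
have [d d0 hd] := near_dwithin_itv hv e0'; exists d => // r rT rn rt i.
pose g s := (r - t)^-1 *: (U r s - U t s) - v s.
have Eg j : (fun s => g s 0 j) = (fun s => (r - t)^-1 * (U r s 0 j - U t s 0 j) - v s 0 j).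
  by apply/funext => s; rewrite /g !mxE.
have mg : meas_coords g.
  move=> j; rewrite Eg; apply: measurable_funB; last by case: (Lv j).
  apply: measurable_funM => //; apply: measurable_funB; [by case: (hU r j rT)|by case: (hU t j tT)].
have [_] := L2norm_le mg (hd r rT rn rt) i; rewrite sqr_sqrtr ?(ltW e0)//.
apply: le_trans; rewrite le_eqVlt; apply/orP; left; apply/eqP.
by apply: eq_Rintegral => s _; rewrite /g !mxE.
Qed.

Lemma C1time_coords (T : R) (U : R -> R -> 'rV[R]_n) : C1time T U ->
  [/\ forall (t : R) i, 0 <= t <= T -> L2 I01 (fun s => dt T U t s 0 i),
  forall (t : R), 0 <= t <= T -> forall (e : R), 0 < e -> exists2 d : R, 0 < d &
    forall (r : R), 0 <= r <= T -> `|r - t| < d -> forall i,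
      \int[mu]_(s in I01) ((dt T U r s 0 i - dt T U t s 0 i) ^+ 2) <= e &
  forall (t : R), 0 <= t <= T -> forall (e : R), 0 < e -> exists2 d : R, 0 < d &
    forall (r : R), 0 <= r <= T -> r != t -> `|r - t| < d -> forall i,
      \int[mu]_(s in I01) (((r - t)^-1 * (U r s 0 i - U t s 0 i) - dt T U t s 0 i) ^+ 2) <= e].
Proof.
move=> [h0 hd h1]; have [L0 _] := C0time_L2 h0; have [L1 c1] := C0time_L2 h1.
split=> // t tT.
have hdt : is_dt T U t (dt T U t).
  have tT' : `[0, T]%classic t by rewrite /= in_itv.
  have [v hv] := hd t tT'.
  by rewrite /dt; exact: (xgetI _ hv).
by have [] := is_dt_coords L0 tT hdt.
Qed.

End Norms.

(** * Weak and classical derivatives of functions of time *)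

Section WeakTime.
Context {R : realType}.
Local Notation mu := (@lebesgue_measure R).
Local Notation itg D f := (mu.-integrable D (EFin \o f)).

Lemma is_derive_eps (P : R -> R) (t l : R) :
  (forall e : R, 0 < e -> exists2 d : R, 0 < d & forall r : R, r != t -> `|r - t| < d ->
     `|(r - t)^-1 * (P r - P t) - l| <= e) -> is_derive t (1 : R) P l.
Proof.
move=> h.
have c : (fun h => h^-1 *: (P (h *: (1 : R) + t) - P t)) @ (0 : R)^' --> l.
  apply/cvgrPdist_le => e e0; have [d d0 hd] := h e e0.
  rewrite /dnbhs near_withinE; apply/nbhs_ballP; exists d => // r; rewrite /ball/= sub0r normrN => rd r0.
  have := hd (r + t); rewrite addrK distrC /GRing.scale/= mulr1; apply => //.
  by apply: contraNneq r0 => /eqP; rewrite -[X in _ == X]add0r => /eqP/addIr->.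
apply: DeriveDef; last exact: (cvg_lim _ c).
by apply/cvg_ex; exists l.
Qed.

Lemma test_parts (T : R) (P P' phi : R -> R) :
  (forall t : R, 0 < t < T -> is_derive t (1 : R) P (P' t)) ->
  (forall t : R, 0 < t < T -> {for t, continuous P'}) ->
  test_function 0 T phi ->
  \int[mu]_(t in `]0, T[) (derive1 phi t * P t) = - \int[mu]_(t in `]0, T[) (phi t * P' t).
Proof.
move=> dP cP' [sm [c [d [c0 dT out]]]].
have out' x : ~~ (c <= x <= d) -> phi x = 0.
  by move=> h; apply: out; rewrite /= in_itv/=; exact/negP.
have d1 x : is_derive x (1 : R) phi (derive1 phi x).
  by apply: (DeriveDef (sm 0%N x)); rewrite derive1E.
have cphi : continuous phi.
  by move=> x; apply/differentiable_continuous/derivable1_diffP; exact: (sm 0%N).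
have cphi' : continuous (derive1 phi).
  by move=> x; apply/differentiable_continuous/derivable1_diffP; exact: (sm 1%N).
have out1 x : ~~ (c <= x <= d) -> derive1 phi x = 0.
  move=> xcd; rewrite derive1E.
  transitivity ('D_(1 : R) (cst (0 : R)) x); last exact: derive_cst.
  apply: near_eq_derive.
  have [xc|cx] := ltP x c.
    by near=> y; apply: out'; rewrite negb_and -!ltNge; apply/orP; left; near: y; exact: lt_nbhsl.
  have dx : d < x by move: xcd; rewrite cx/= -ltNge.
  by near=> y; apply: out'; rewrite negb_and -!ltNge; apply/orP; right; near: y; exact: lt_nbhsr.
pose D : set R := `]0, T[%classic.
have mD : measurable D by exact: measurable_itv.
have cP t : 0 < t < T -> {for t, continuous P}.
  by move=> tT; apply/differentiable_continuous/derivable1_diffP; have [] := dP t tT.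
have mm (f : R -> R) : (forall t : R, 0 < t < T -> {for t, continuous f}) -> measurable_fun D f.
  move=> cf; apply: open_continuous_measurable_fun => //.
  by move=> x /set_mem; rewrite /D/= in_itv/=; exact: cf.
(* [c', d'] is a segment in ]0, T[ that surrounds [c, d], so that [phi] vanishes at its ends.
   Nothing orders [c] and [d], whence the maximum; if d' >= T, then c >= T and [phi] is zero on ]0,
   T[. *)
pose c' := c / 2; pose d' := Num.max c ((d + T) / 2).
have [dT'|Td'] := ltP d' T; last first.
  have cT : T <= c by move: Td'; rewrite /d' le_max => /orP[//|]; slra.
  have z t : D t -> phi t = 0 /\ derive1 phi t = 0.
    by rewrite /D/= in_itv/= => tT; split; [apply: out'|apply: out1]; rewrite negb_and -!ltNge; apply/orP; left; slra.
  rewrite (@eq_Rintegral _ _ _ _ _ (fun=> 0)); last by move=> t /set_mem/z[_ ->]; rewrite mul0r.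
  rewrite [in RHS](@eq_Rintegral _ _ _ _ _ (fun=> 0)); last by move=> t /set_mem/z[-> _]; rewrite mul0r.
  by rewrite [X in X = - X](_ : _ = 0) ?oppr0// /Rintegral integral0.
have [c'0 c'c cd' dd'] : [/\ 0 < c', c' < c, c <= d' & d < d'].
  by rewrite /c' /d' lt_max le_max lexx/=; split; first [slra|apply/orP; right; slra|by []].
clearbody c' d'.
have sub : `[c', d']%classic `<=` D by move=> t; rewrite /D/= !in_itv/=; slra.
have o' x : ~~ (c' <= x <= d') -> ~~ (c <= x <= d) by apply: contraNN; slra.
have m1 : measurable_fun D (fun t => derive1 phi t * P t).
  by apply: measurable_funM; [apply: mm => t _; exact: cphi'|exact: mm].
have m2 : measurable_fun D (fun t => phi t * P' t).
  by apply: measurable_funM; [apply: mm => t _; exact: cphi|exact: mm].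
rewrite [LHS](Rint_supp mD m1 sub); last by move=> x _ /o' xcd; rewrite out1// mul0r.
rewrite [in RHS](Rint_supp mD m2 sub); last by move=> x _ /o' xcd; rewrite out'// mul0r.
have cw (f : R -> R) : (forall t : R, 0 < t < T -> {for t, continuous f}) -> {within `[c', d'], continuous f}.
  by move=> cf; apply: continuous_in_subspaceT => s /set_mem; rewrite /= in_itv/= => sab; apply: cf; slra.
have c1 t : 0 < t < T -> {for t, continuous (fun t => derive1 phi t * P t)}.
  by move=> tT; apply: cvgM; [exact: cphi'|exact: cP].
have c2 t : 0 < t < T -> {for t, continuous (fun t => phi t * P' t)}.
  by move=> tT; apply: cvgM; [exact: cphi|exact: cP'].
have i1 := within_cts_itg (cw _ c1); have i2 := within_cts_itg (cw _ c2).
apply/eqP; rewrite -addr_eq0 -RintegralD//; apply/eqP.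
have cd : c' < d' by slra.
have dPhi t : 0 < t < T -> is_derive t (1 : R) (fun t => phi t * P t) (derive1 phi t * P t + phi t * P' t).
  move=> tT; have H1 := d1 t; have H2 := dP t tT.
  by apply: is_derive_eq; rewrite /GRing.scale/=; ring.
rewrite /Rintegral (continuous_FTC2 cd _ (F := fun t => phi t * P t)).
- have -> : phi c' = 0 by apply: out'; rewrite negb_and -!ltNge c'c.
  have -> : phi d' = 0 by apply: out'; rewrite negb_and -!ltNge dd' orbT.
  by rewrite !mul0r -EFinB subrr.
- by apply: cw => t tT; apply: cvgD; [exact: c1|exact: c2].
- have cu s : 0 < s < T -> {for s, continuous (fun t => phi t * P t)}.
    by move=> sT; apply: cvgM; [exact: cphi|exact: cP].
  split.
  + by move=> s; rewrite in_itv/= => sab; have [] := dPhi s ltac:(slra).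
  + by apply: cvg_at_right_filter; apply: cu; slra.
  + by apply: cvg_at_left_filter; apply: cu; slra.
- by move=> s; rewrite in_itv/= => sab; rewrite derive1E; have [_ ->] := dPhi s ltac:(slra).
Unshelve. all: by end_near. Qed.

(** At a right Lebesgue point the value of [g] is the limit of its averages against [molli], which
    are test functions. *)
Lemma test_ae0 (T : R) (g : R -> R) : measurable_fun (`]0, T[ : set R) g ->
  (forall a b : R, 0 < a -> b < T -> itg `[a, b] g) ->
  (forall phi, test_function 0 T phi -> \int[mu]_(t in `]0, T[) (phi t * g t) = 0) ->
  {ae mu, forall t, 0 < t < T -> g t = 0}.
Proof.
move=> mg ig h; apply: (filterS_ae (lpt_ae ig)) => x Lx x0T.
have {}Lx : lpt g x by apply: Lx; rewrite /= in_itv.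
apply/eqP; rewrite -normr_le0; apply/ler_addgt0Pr => e e0; rewrite add0r.
have xb : x < (x + T) / 2 by slra.
have [d0 d00 hd] := lpt_molli xb (ig x ((x + T) / 2) ltac:(slra) ltac:(slra)) Lx e0.
have [d dp [dd dT]] : exists2 d : R, 0 < d & d < d0 /\ x + d < T.
  exists (Num.min (d0 / 2) ((T - x) / 2)).
    by rewrite lt_min; slra.
  have : Num.min (d0 / 2) ((T - x) / 2) <= d0 / 2 by rewrite ge_min lexx.
  have : Num.min (d0 / 2) ((T - x) / 2) <= (T - x) / 2 by rewrite ge_min lexx orbT.
  by move: (Num.min _ _) => m; slra.
have := hd d dp dd.
suff -> : \int[mu]_(y in `[x, x + d]) (g y * molli x d y) = 0 by rewrite sub0r normrN.
have tm : test_function 0 T (molli x d).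
  split; first exact: smooth_derivable (smooth_molli _ _).
  exists x, (x + d); split => //; first by slra.
  by move=> y; rewrite /= in_itv/= => /negP; exact: molli_out.
have <- := h _ tm; rewrite [RHS](Rint_supp (a := x) (b := x + d))//.
- by apply: eq_Rintegral => y _; rewrite mulrC.
- apply: measurable_funM => //; apply: measurable_funTS; apply: continuous_measurable_fun.
  exact: smooth_continuous (smooth_molli _ _).
- by move=> y; rewrite /= !in_itv/=; slra.
- by move=> y _ hy; rewrite molli_out ?mul0r.
Qed.

(** [Q] is bounded and almost everywhere a limit of measurable functions, so it has a measurable
    modification [Q']. The integral of [phi * Q] is unchanged by [Rint_ae_between], and [test_ae0]
    identifies [Q'] with [P']. *)
Lemma weak_dt_ae_eq (T M : R) (P P' Q : R -> R) (G : nat -> R -> R) :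
  (forall t : R, 0 < t < T -> is_derive t (1 : R) P (P' t)) ->
  (forall t : R, 0 < t < T -> {for t, continuous P'}) ->
  (forall k, measurable_fun (`]0, T[ : set R) (G k)) ->
  {ae mu, forall t, 0 < t < T -> G k t @[k --> \oo] --> Q t} ->
  {ae mu, forall t, 0 < t < T -> `|Q t| <= M} ->
  (forall phi, test_function 0 T phi ->
     \int[mu]_(t in `]0, T[) (derive1 phi t * P t) = - \int[mu]_(t in `]0, T[) (phi t * Q t)) ->
  {ae mu, forall t, 0 < t < T -> Q t = P' t}.
Proof.
move=> dP cP' mG cG bQ hQ.
have [N [mN N0 sub]] := ae_and cG bQ.
pose D : set R := `]0, T[%classic.
have mD : measurable D by exact: measurable_itv.
pose Q' := fun t => \1_(~` N) t * Q t.
have mI : measurable_fun D (\1_(~` N) : R -> R).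
  by apply: measurable_indic; exact: measurableC.
have good t : ~ N t -> 0 < t < T -> (G k t @[k --> \oo] --> Q t) /\ `|Q t| <= M.
  by move=> Nt tT; have [//|] := pselect ((G k t @[k --> \oo] --> Q t) /\ `|Q t| <= M); move=> H;
    case: Nt; apply: sub => /= -[h1 h2]; apply: H; split; [exact: h1|exact: h2].
have mQ' : measurable_fun D Q'.
  apply: (@measurable_fun_cvg _ _ _ D (fun k t => \1_(~` N) t * G k t)).
    by move=> k; apply: measurable_funM.
  move=> t; rewrite /D/= in_itv/= => tT; rewrite /Q' indicE.
  have [Nt|Nt] := pselect (N t).
    by rewrite memNset; [rewrite !mul0r; under eq_fun do rewrite mul0r; exact: cvg_cst|move=> /(_ Nt)].
  rewrite mem_set// mul1r; under eq_fun do rewrite mul1r.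
  by have [] := good t Nt tT.
have M0 t : ~ N t -> 0 < t < T -> 0 <= M by move=> Nt tT; have [_] := good t Nt tT; exact: le_trans.
have bQ' t : 0 < t < T -> `|Q' t| <= `|M|.
  move=> tT; rewrite /Q' indicE; have [Nt|Nt] := pselect (N t).
    by rewrite memNset ?mul0r ?normr0//; move=> /(_ Nt).
  by rewrite mem_set// mul1r; have [_ h] := good t Nt tT; apply: le_trans h _; exact: ler_norm.
have aeN : {ae mu, forall t, 0 < t < T -> Q t = Q' t}.
  exists N; split => // t /=; apply: contra_notP => Nt tT.
  by rewrite /Q' indicE mem_set// mul1r.
have mc (f : R -> R) : (forall t : R, 0 < t < T -> {for t, continuous f}) -> measurable_fun D f.
  move=> cf; apply: open_continuous_measurable_fun => //.
  by move=> x /set_mem; rewrite /D/= in_itv/=; exact: cf.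
have mP' := mc _ cP'.
have iQ' (a b : R) : 0 < a -> b < T -> itg `[a, b] Q'.
  move=> a0 bT; have sub' : `[a, b]%classic `<=` D by move=> t; rewrite /D/= !in_itv/=; slra.
  apply: (itg_le (g := fun=> `|M|)) => //; last exact: itg_seg_cst.
    exact: measurable_funS mQ'.
  by move=> t /sub'; rewrite /D/= in_itv/=; exact: bQ'.
have iP' (a b : R) : 0 < a -> b < T -> itg `[a, b] P'.
  move=> a0 bT; apply: within_cts_itg; apply: continuous_in_subspaceT => s /set_mem.
  by rewrite /= in_itv/= => sab; apply: cP'; slra.
have H : {ae mu, forall t, 0 < t < T -> Q' t - P' t = 0}.
  apply: test_ae0; first exact: measurable_funB.
    by move=> a b a0 bT; apply: itgB => //; [exact: iQ'|exact: iP'].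
  move=> phi tphi; have [sm [c [d [c0 dT out]]]] := tphi.
  have cphi : continuous phi.
    by move=> x; apply/differentiable_continuous/derivable1_diffP; exact: (sm 0%N).
  have i f : measurable_fun D f -> (forall a b : R, 0 < a -> b < T -> itg `[a, b] f) -> itg D (fun t => phi t * f t).
    move=> mf lf; have [cd|dc] := leP c d; last first.
      apply: (itg_eq (f := fun=> 0)) => //; last first.
        exact: integrable0.
      by move=> x _; rewrite out ?mul0r//= in_itv/=; slra.
    apply: (itg_supp (a := c) (b := d)) => //.
    - by apply: measurable_funM => //; apply: mc => t _; exact: cphi.
    - by move=> t; rewrite /D/= !in_itv/=; slra.
    - by move=> x _ xcd; rewrite out ?mul0r//= in_itv/=; exact/negP.
    - by apply: itg_cts_mul; [exact: continuous_subspaceT|exact: lf].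
  have e1 : \int[mu]_(t in D) (phi t * Q t) = \int[mu]_(t in D) (phi t * Q' t).
    have := @Rint_ae_between R D (fun t => phi t * Q' t) (fun t => phi t * Q t) (fun t => phi t * Q' t) mD (i _ mQ' iQ') (i _ mQ' iQ').
    have ae : {ae mu, forall t, D t -> phi t * Q' t <= phi t * Q t <= phi t * Q' t}.
      by apply: (filterS_ae aeN) => t h; rewrite /D/= in_itv/= => /h->; rewrite lexx.
    by move=> /(_ ae); rewrite -eq_le => /eqP.
  have := hQ phi tphi; rewrite (test_parts dP cP' tphi) e1 => /oppr_inj e2.
  transitivity (\int[mu]_(t in D) (phi t * Q' t - phi t * P' t)).
    by apply: eq_Rintegral => t _; rewrite mulrBr.
  by rewrite RintegralB ?e2 ?subrr//; exact: i.
by apply: (filterS_ae (ae_and H aeN)) => t [h1 h2] tT; rewrite h2//; apply/eqP; rewrite -subr_eq0 h1.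
Qed.

End WeakTime.

(** * Identification of the weak time derivative with the one in L^2 *)

Section Identification.
Context {R : realType}.
Local Notation mu := (@lebesgue_measure R).
Local Notation itg D f := (mu.-integrable D (EFin \o f)).
Local Notation I01 := (`]@GRing.zero R, @GRing.one R[%classic).
Context {n : nat}.

Lemma ip_le D (f g : R -> R) (a b : R) : measurable D -> L2 D f -> L2 D g -> 0 <= a -> 0 <= b ->
  \int[mu]_(s in D) (f s ^+ 2) <= a ^+ 2 -> \int[mu]_(s in D) (g s ^+ 2) <= b ^+ 2 ->
  `|\int[mu]_(s in D) (f s * g s)| <= a * b.
Proof.
move=> mD Lf Lg a0 b0 fa gb; apply: le_trans (cauchy_schwarz_norm mD Lf Lg) _.
apply: ler_pM; rewrite ?sqrtr_ge0//.
- by rewrite -(ger0_norm a0) -sqrtr_sqr ler_wsqrtr.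
- by rewrite -(ger0_norm b0) -sqrtr_sqr ler_wsqrtr.
Qed.

Lemma L2dot_delta (u : R -> 'rV[R]_n) (f : R -> R) i :
  L2dot u (fun s => f s *: delta_mx 0 i) = \int[mu]_(s in I01) (u s 0 i * f s).
Proof.
apply: eq_Rintegral => s _; rewrite /dotv (bigD1 i)//= big1 ?addr0.
  by rewrite !mxE !eqxx mulr1.
by move=> j ji; rewrite !mxE eqxx (negbTE ji) mulr0 mulr0.
Qed.

Lemma nspace_delta (f : R -> R) i : L2 I01 f ->
  nspace L2norm (fun s => f s *: (delta_mx 0 i : 'rV[R]_n)).
Proof.
move=> Lf; apply: L2_nspace => j.
rewrite (_ : (fun s => _) = (fun s => (j == i)%:R * f s)); first exact: L2Z.
by apply/funext => s; rewrite !mxE eqxx/= mulrC.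
Qed.

Lemma L2_sum D m (f : 'I_m -> R -> R) : measurable D -> (forall j, L2 D (f j)) ->
  L2 D (fun s => \sum_j f j s).
Proof.
move=> mD; elim: m f => [|m ih] f hf.
  split; first by under eq_fun do rewrite big_ord0; exact: measurable_cst.
  by apply: (itg_eq (f := fun=> 0)) => //; [move=> s _; rewrite big_ord0 expr0n|exact: integrable0].
have := L2D mD (ih (fun j => f (widen_ord (leqnSn m) j)) (fun j => hf _)) (hf ord_max).
rewrite (_ : (fun s => _ + _) = (fun s => \sum_j f j s))//.
by apply/funext => s; rewrite big_ord_recr.
Qed.

(** This provides the measurable approximations [G] required by [weak_dt_ae_eq]: strong
    measurability supplies simple functions whose pairings converge. *)
Lemma simple_ip (N : (R -> 'rV[R]_n) -> \bar R) (U : R -> R -> 'rV[R]_n) (f : R -> R) i :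
  simple_vfun N U -> L2 I01 f ->
  (forall t i, L2 I01 (fun s => U t s 0 i)) /\
  measurable_fun [set: R] (fun t => \int[mu]_(s in I01) (U t s 0 i * f s)).
Proof.
move=> [m [A [w [mA nw EU]]]] Lf.
have Lw j k : L2 I01 (fun s => w j s 0 k) by exact: nspace_L2 (nw j) k.
have EUk t k s : U t s 0 k = \sum_j \1_(A j) t * w j s 0 k.
  by rewrite EU summxE; apply: eq_bigr => j _; rewrite !mxE.
have ii t j k : L2 I01 (fun s => \1_(A j) t * w j s 0 k) by exact: L2Z.
split.
  move=> t k; rewrite (_ : (fun s => _) = (fun s => \sum_j \1_(A j) t * w j s 0 k)); last exact/funext.
  exact: L2_sum.
rewrite (_ : (fun t => _) = (fun t => \sum_j \1_(A j) t * \int[mu]_(s in I01) (w j s 0 i * f s))).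
  apply: measurable_sum => j; apply: measurable_funM => //.
apply/funext => t.
transitivity (\int[mu]_(s in I01) (\sum_j \1_(A j) t * (w j s 0 i * f s))).
  by apply: eq_Rintegral => s _; rewrite EUk mulr_suml; apply: eq_bigr => j _; rewrite mulrA.
rewrite Rint_sum//; last by move=> j; apply: itgZ => //; exact: L2_mul.
by apply: eq_bigr => j _; rewrite RintegralZl//; exact: L2_mul.
Qed.

Lemma rat_dense_fun (u : R -> R) (c : R) : (forall s : R, 0 < s < 1 -> {for s, continuous u}) ->
  (forall q : rat, 0 < (ratr q : R) < 1 -> u (ratr q) = c) -> forall s : R, 0 < s < 1 -> u s = c.
Proof.
move=> cu hq s s01; apply/eqP; rewrite -subr_eq0 -normr_le0; apply/ler_addgt0Pr => e e0; rewrite add0r.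
have /cvgrPdist_lt /(_ e e0) /nbhs_ballP[d /= d0 H] := cu s s01.
have lt : s < Num.min (s + d) 1 by rewrite lt_min; slra.
have [q] := rat_in_itvoo lt; rewrite in_itv/= lt_min => /and3P[sq qd q1].
have := H (ratr q); rewrite /ball/= distrC gtr0_norm ?subr_gt0// => /(_ ltac:(slra)).
by rewrite hq; [exact: ltW|slra].
Qed.

(** Integrals over segments with rational end points determine a primitive of [g] on a dense set,
    hence [g]. That countably many tests suffice matters in [dt_ae_X1], where each of them costs a
    null set of times. *)
Lemma seg_ae0 (g : R -> R) : itg I01 g ->
  (forall p q : rat, 0 < (ratr p : R) < 1 -> 0 < (ratr q : R) < 1 ->
     \int[mu]_(s in I01) (g s * \1_(`[ratr p, ratr q]) s) = 0) ->
  {ae mu, forall s, I01 s -> g s = 0}.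
Proof.
move=> ig h; set u := fun s : R => \int[mu]_(r in `[0, s]) g r.
have pu : prim u g by exact: prim_int0.
have mg := itg_meas ig.
have h1 : ratr (1 / 2%:R : rat) = 1 / 2 :> R by rewrite rmorphM /= rmorph1 fmorphV /= ratr_nat.
have seg (p q : rat) : 0 < (ratr p : R) -> (ratr p : R) <= ratr q -> (ratr q : R) < 1 ->
    u (ratr q) - u (ratr p) = 0.
  move=> p0 pq q1; rewrite (prim_int pu)// -[RHS](h p q); [|slra|slra].
  rewrite [RHS](Rint_supp (a := ratr p) (b := ratr q))//.
  - by apply: eq_Rintegral => s sq; rewrite indicE sq mulr1.
  - by apply: measurable_funM.
  - by move=> x; rewrite /= !in_itv/=; slra.
  - by move=> x _ /negP xpq; rewrite indicE memNset ?mulr0// /= in_itv.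
have cst (s : R) : 0 < s < 1 -> u s = u (ratr (1 / 2%:R)).
  apply: rat_dense_fun; first by move=> r; exact: prim_continuous_at pu.
  move=> q q01; have [le|/ltW le] := leP (ratr q : R) (ratr (1 / 2%:R)).
    by have := seg q (1 / 2%:R) ltac:(slra) le ltac:(rewrite h1; slra); slra.
  by have := seg (1 / 2%:R) q ltac:(rewrite h1; slra) le ltac:(slra); slra.
apply: (prim_deriv_ae pu) => //.
by apply: (prim_eq _ _ (prim_cst (u (ratr (1 / 2%:R))))) => // s /cst.
Qed.

(** The class gives a weak time derivative V bounded in X^1, the time regularity a classical one,
    [dt T U], continuous in L^2. Their pairings with the indicator of a rational segment agree for
    almost every t, and countably many segments leave a single null set of times. *)
Lemma dt_ae_X1 (T : R) (U : R -> R -> 'rV[R]_n) : C1time T U -> W1infty X1norm T U ->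
  exists V : R -> R -> 'rV[R]_n, exists2 M : R, 0 <= M & {ae mu, forall t, 0 < t < T -> forall i,
    [/\ {ae mu, forall s, I01 s -> V t s 0 i = dt T U t s 0 i},
     has_wderiv (fun s => V t s 0 i), itg I01 (fun s => s * wderiv (fun s => V t s 0 i) s ^+ 2),
     \int[mu]_(s in I01) (V t s 0 i ^+ 2) <= M ^+ 2 &
     \int[mu]_(s in I01) (s * wderiv (fun s => V t s 0 i) s ^+ 2) <= M ^+ 2]}.
Proof.
move=> hC1 [_ [V [[[F [sF cF]] [M0 bV]] wk]]].
have [hC0 _ _] := hC1; have [LU _] := C0time_L2 hC0.
have [LA cA dA] := C1time_coords hC1.
pose M := `|M0|; exists V, M; first exact: normr_ge0.
have bV' : {ae mu, forall t, 0 < t < T -> nspace X1norm (V t) /\ (X1norm (V t) <= M%:E)%E}.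
  apply: (filterS_ae bV) => t h tT; have [|nV le] := h; first by rewrite /= in_itv.
  by split => //; apply: le_trans le _; rewrite lee_fin ler_norm.
pose chi (p q : rat) : R -> R := \1_(`[ratr p, ratr q]).
have mchi p q : measurable_fun I01 (chi p q).
  exact: measurable_indic (measurable_itv _).
have chi1 p q s : I01 s -> `|chi p q s| <= 1 by move=> _; rewrite /chi indicE; case: (_ \in _); rewrite ?normr0 ?normr1.
have Lchi p q : L2 I01 (chi p q) by apply: (L2_bnd (M := 1)) => //; [exact: mu01_lty|exact: chi1].
have chi2 p q : \int[mu]_(s in I01) (chi p q s ^+ 2) <= 1 ^+ 2.
  rewrite expr1n -[leRHS](Rint01_cst 1); apply: le_Rintegral => //; first by case: (Lchi p q).
    by apply: itg_cst => //; exact: mu01_lty.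
  by move=> s s01; rewrite -real_normK ?num_real// expr_le1 ?chi1.
have ipc p q (f : R -> R) (a : R) : L2 I01 f -> 0 <= a -> \int[mu]_(s in I01) (f s ^+ 2) <= a ^+ 2 ->
    `|\int[mu]_(s in I01) (f s * chi p q s)| <= a.
  by move=> Lf a0 fa; rewrite -[leRHS]mulr1; exact: ip_le.
have ipB p q (f g : R -> R) : L2 I01 f -> L2 I01 g ->
    \int[mu]_(s in I01) (f s * chi p q s) - \int[mu]_(s in I01) (g s * chi p q s) =
    \int[mu]_(s in I01) ((f s - g s) * chi p q s).
  move=> Lf Lg; rewrite -RintegralB//; [|exact: L2_mul|exact: L2_mul].
  by apply: eq_Rintegral => s _; rewrite mulrBl.
have key i (p q : rat) : {ae mu, forall t, 0 < t < T ->
    \int[mu]_(s in I01) (V t s 0 i * chi p q s) = \int[mu]_(s in I01) (dt T U t s 0 i * chi p q s)}.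
  apply: (@weak_dt_ae_eq _ T M (fun t => \int[mu]_(s in I01) (U t s 0 i * chi p q s))
    (fun t => \int[mu]_(s in I01) (dt T U t s 0 i * chi p q s)) _
    (fun k t => \int[mu]_(s in I01) (F k t s 0 i * chi p q s))).
  - move=> t tT; apply: is_derive_eps => e e0.
    have tT' : 0 <= t <= T by slra.
    have [d d0 hd] := dA t tT' (e ^+ 2) (exprn_gt0 _ e0).
    exists (Num.min d (Num.min t (T - t))); first by rewrite !lt_min d0; slra.
    move=> r rt; rewrite !lt_min => /and3P[rd r1 r2].
    have rT : 0 <= r <= T by move: r1 r2; rewrite !ltr_norml; slra.
    rewrite ipB; [|exact: LU|exact: LU].
    rewrite -RintegralZl//; last by apply: L2_mul => //; apply: L2B => //; exact: LU.
    rewrite [X in X - _](_ : _ = \int[mu]_(s in I01) ((r - t)^-1 * (U r s 0 i - U t s 0 i) * chi p q s)); last first.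
      by apply: eq_Rintegral => s _; rewrite mulrA.
    have Lq : L2 I01 (fun s => (r - t)^-1 * (U r s 0 i - U t s 0 i)).
      by apply: L2Z => //; apply: L2B => //; exact: LU.
    rewrite ipB//; last exact: LA.
    by apply: ipc; [apply: L2B => //; exact: LA|exact: ltW|exact: hd].
  - move=> t tT; apply/cvgrPdist_le => e e0.
    have tT' : 0 <= t <= T by slra.
    have [d d0 hd] := cA t tT' (e ^+ 2) (exprn_gt0 _ e0).
    apply/nbhs_ballP; exists (Num.min d (Num.min t (T - t))); first by rewrite /= !lt_min d0; slra.
    move=> r; rewrite /ball/= distrC !lt_min => /and3P[rd r1 r2].
    have rT : 0 <= r <= T by move: r1 r2; rewrite !ltr_norml; slra.
    rewrite distrC ipB; [|exact: LA|exact: LA].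
    by apply: ipc; [apply: L2B => //; exact: LA|exact: ltW|exact: hd].
  - move=> k; have [_] := simple_ip i (sF k) (Lchi p q); exact: measurable_funTS.
  - apply: (filterS_ae (ae_and cF bV')) => t [cFt bVt] tT.
    have {}cFt := cFt _; have {}bVt := bVt tT.
    have {cFt} := cFt ltac:(by rewrite /= in_itv).
    move=> cFt; apply/cvgrPdist_le => e e0.
    have H : \forall k \near \oo, (X1norm (F k t \- V t)%R <= e%:E)%E by apply: cvg_norm_ball.
    apply: filterS H => k hk.
    have [LF _] := simple_ip i (sF k) (Lchi p q).
    have LV j := nspace_L2 bVt.1 j.
    have EB j : (fun s => (F k t \- V t) s 0 j) = (fun s => F k t s 0 j - V t s 0 j).
      by apply/funext => s; rewrite !mxE.
    have mB : meas_coords (F k t \- V t) by move=> j; rewrite EB; case: (L2B _ (LF t j) (LV j)).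
    have [LB iB _ _ _] := X1norm_le mB hk i.
    rewrite distrC ipB//; apply: ipc => //; [exact: L2B|exact: ltW|].
    apply: le_trans iB; rewrite le_eqVlt; apply/orP; left; apply/eqP.
    by apply: eq_Rintegral => s _; rewrite !mxE.
  - apply: (filterS_ae bV') => t h tT; have [nV le] := h tT.
    have [LV iV _ _ _] := X1norm_le (nspace_meas nV) le i.
    by apply: ipc => //; rewrite /M normr_ge0.
  - move=> phi tphi; have E := wk phi _ tphi (nspace_delta i (Lchi p q)).
    apply: (eq_trans (eq_trans _ E)).
      by apply: eq_Rintegral => t _; rewrite L2dot_delta.
    by congr (- _); apply: eq_Rintegral => t _; congr (_ * _); rewrite L2dot_delta.
(* Pairs of rationals are enumerated through [unpickle]; a code that decodes to nothing gives the
   harmless pair (0, 0). *)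
have key2 : {ae mu, forall t, forall k : nat, forall i, 0 < t < T ->
    let pq := odflt (0, 0) (unpickle k : option (rat * rat)) in
    \int[mu]_(s in I01) (V t s 0 i * chi pq.1 pq.2 s) = \int[mu]_(s in I01) (dt T U t s 0 i * chi pq.1 pq.2 s)}.
  by apply: ae_all => k; apply: ae_all_ord => i; exact: key.
apply: (filterS_ae (ae_and key2 bV')) => t [ht bVt] tT i.
have [nV le] := bVt tT.
have [LV iV hw iw ew] := X1norm_le (nspace_meas nV) le i.
have LAt : L2 I01 (fun s => dt T U t s 0 i) by apply: LA; slra.
have ae : {ae mu, forall s, I01 s -> V t s 0 i - dt T U t s 0 i = 0}.
  apply: seg_ae0; first by apply: L2_itg => //; [exact: mu01_lty|exact: L2B].
  move=> p q p01 q01; have := ht (pickle (p, q)) i tT.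
  by rewrite pickleK/= => E; rewrite -[LHS](ipB p q)// E subrr.
split=> //.
by apply: (filterS_ae ae) => s h s01; apply/eqP; rewrite -subr_eq0 h.
Qed.

End Identification.

(** * The norm of L^2(0, 1) *)

Section L2Norm.
Context {R : realType}.
Local Notation mu := (@lebesgue_measure R).
Local Notation itg D f := (mu.-integrable D (EFin \o f)).
Local Notation I01 := (`]@GRing.zero R, @GRing.one R[%classic).
Local Notation L2I := (L2 I01).
Implicit Types (f g : R -> R).

Lemma Rint_eq f g : (forall s, 0 < s < 1 -> f s = g s) ->
  \int[mu]_(s in I01) f s = \int[mu]_(s in I01) g s.
Proof. by move=> fg; apply: eq_Rintegral => s /set_mem; rewrite /= in_itv/=; exact: fg. Qed.

Definition nm f : R := Num.sqrt (\int[mu]_(s in I01) (f s ^+ 2)).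

Lemma nm_ge0 f : 0 <= nm f. Proof. exact: sqrtr_ge0. Qed.

Lemma nm_sqr f : nm f ^+ 2 = \int[mu]_(s in I01) (f s ^+ 2).
Proof. by rewrite sqr_sqrtr//; apply: Rintegral_ge0 => s _; exact: sqr_ge0. Qed.

Lemma nm_leP f (c : R) : 0 <= c -> (nm f <= c) = (\int[mu]_(s in I01) (f s ^+ 2) <= c ^+ 2).
Proof. by move=> c0; rewrite -nm_sqr ler_pXn2r// nnegrE nm_ge0. Qed.

Lemma nm_ip f g : L2I f -> L2I g -> `|\int[mu]_(s in I01) (f s * g s)| <= nm f * nm g.
Proof. exact: cauchy_schwarz_norm. Qed.

Lemma nm_ext f g : (forall s, 0 < s < 1 -> f s = g s) -> nm f = nm g.
Proof.
by move=> fg; congr Num.sqrt; apply: eq_Rintegral => s /set_mem; rewrite /= in_itv/= => /fg->.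
Qed.

Lemma nm_ae f g : measurable_fun I01 f -> measurable_fun I01 g ->
  {ae mu, forall s, I01 s -> f s = g s} -> nm f = nm g.
Proof.
move=> mf mg fg; congr Num.sqrt; apply: Rint_ae_eq => //; try exact: measurable_funX.
by apply: (filterS_ae fg) => s h /h->.
Qed.

Lemma nm_le f g : L2I f -> L2I g -> (forall s, 0 < s < 1 -> `|f s| <= `|g s|) -> nm f <= nm g.
Proof.
move=> [_ Lf] [_ Lg] fg; rewrite ler_wsqrtr//; apply: le_Rintegral => // s.
rewrite /= in_itv/= => /fg h; rewrite -(real_normK (num_real (f s))) -(real_normK (num_real (g s))).
by rewrite lerXn2r ?nnegrE.
Qed.

Lemma nm_cst (c : R) : nm (fun=> c) = `|c|.
Proof. by rewrite /nm (Rint01_cst (c ^+ 2)) sqrtr_sqr. Qed.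

Lemma L2_cst01 (c : R) : L2I (fun=> c).
Proof. by apply: (L2_bnd (M := `|c|)) => //; exact: mu01_lty. Qed.

Lemma L2_bnd01 f (c : R) : measurable_fun I01 f -> (forall s, 0 < s < 1 -> `|f s| <= c) -> L2I f.
Proof.
by move=> mf h; apply: (L2_bnd (M := c)) => //; exact: mu01_lty.
Qed.

Lemma nm_bnd f (c : R) : measurable_fun I01 f -> (forall s, 0 < s < 1 -> `|f s| <= c) -> nm f <= `|c|.
Proof.
move=> mf h; rewrite -nm_cst; apply: nm_le; [exact: L2_bnd01 h|exact: L2_cst01|].
by move=> s /h/le_trans; apply; exact: ler_norm.
Qed.

Lemma nmZ (c : R) f : L2I f -> nm (fun s => c * f s) = `|c| * nm f.
Proof.
move=> [_ Lf]; rewrite /nm (Rint_eq (g := fun s => c ^+ 2 * f s ^+ 2)); last first.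
  by move=> s _; rewrite exprMn.
by rewrite RintegralZl// sqrtrM ?sqr_ge0// sqrtr_sqr.
Qed.

Lemma nmN f : nm (fun s => - f s) = nm f.
Proof. by congr Num.sqrt; apply: Rint_eq => s _; rewrite sqrrN. Qed.

Lemma nmBC f g : nm (fun s => f s - g s) = nm (fun s => g s - f s).
Proof. by rewrite -nmN; apply: nm_ext => s _; rewrite opprB. Qed.

Lemma nmD f g : L2I f -> L2I g -> nm (fun s => f s + g s) <= nm f + nm g.
Proof.
move=> Lf Lg; rewrite nm_leP ?addr_ge0 ?nm_ge0//.
have -> : \int[mu]_(s in I01) ((f s + g s) ^+ 2) =
    nm f ^+ 2 + 2 * \int[mu]_(s in I01) (f s * g s) + nm g ^+ 2.
  have ifg := L2_mul (measurable_itv _) Lf Lg.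
  rewrite !nm_sqr -RintegralZl// -RintegralD//; [|by case: Lf|exact: itgZ].
  rewrite -RintegralD//; [|by apply: itgD => //; [case: Lf|exact: itgZ]|by case: Lg].
  by apply: eq_Rintegral => s _; ring.
have := nm_ip Lf Lg; rewrite ler_norml => /andP[_].
by move: (Rintegral _ _ _) (nm f) (nm g) => x y z; snra.
Qed.

Lemma nmB_le f g : L2I f -> L2I g -> nm f <= nm g + nm (fun s => f s - g s).
Proof.
move=> Lf Lg; apply: le_trans (nmD Lg (L2B _ Lf Lg)) => //.
by rewrite (nm_ext (g := fun s => g s + (f s - g s)))// => s _; ring.
Qed.

Lemma nm_tri f g h : L2I f -> L2I g -> L2I h ->
  nm (fun s => f s - h s) <= nm (fun s => f s - g s) + nm (fun s => g s - h s).
Proof.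
move=> Lf Lg Lh; apply: le_trans (nmD (L2B _ Lf Lg) (L2B _ Lg Lh)) => //.
by rewrite (nm_ext (g := fun s => f s - g s + (g s - h s)))// => s _; ring.
Qed.

Lemma nm0_ae f : L2I f -> nm f = 0 -> {ae mu, forall s, I01 s -> f s = 0}.
Proof.
move=> [mf Lf] f0.
have h : (\int[mu]_(s in I01) `|(f s ^+ 2)%:E| = 0)%E.
  transitivity (\int[mu]_(s in I01) (f s ^+ 2)%:E)%E.
    by apply: eq_integral => s _; rewrite gee0_abs// lee_fin sqr_ge0.
  by rewrite EFin_Rint// -nm_sqr f0 expr0n.
have mf2 : measurable_fun I01 (EFin \o (fun s => f s ^+ 2)).
  by apply/measurable_EFinP; exact: measurable_funX.
have H := (ae_eq_integral_abs mu (measurable_itv `]0, 1[) mf2).1 h.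
by apply: (filterS_ae H) => s hs s01; have := hs s01 => /= -[] /eqP; rewrite sqrf_eq0 => /eqP.
Qed.

Lemma ip_small f g h (e : R) : L2I f -> L2I g -> L2I h -> nm (fun s => f s - g s) <= e ->
  `|\int[mu]_(s in I01) (f s * h s) - \int[mu]_(s in I01) (g s * h s)| <= e * nm h.
Proof.
move=> Lf Lg Lh fg; rewrite -RintegralB//; [|exact: L2_mul|exact: L2_mul].
rewrite (Rint_eq (g := fun s => (f s - g s) * h s)); last by move=> s _; rewrite mulrBl.
by apply: le_trans (nm_ip (L2B _ Lf Lg) Lh) _ => //; rewrite ler_wpM2r ?nm_ge0.
Qed.

End L2Norm.

(** * Bounds and conservation of energy *)

Section Evolution.
Context {R : realType}.
Local Notation mu := (@lebesgue_measure R).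
Local Notation itg D f := (mu.-integrable D (EFin \o f)).
Local Notation I01 := (`]@GRing.zero R, @GRing.one R[%classic).
Local Notation L2I := (L2 I01).
Local Notation rt := (@Num.sqrt R).

(** Continuity from [0, T] to L^2(0, 1). *)
Definition tcts (T : R) (g : R -> R -> R) := forall t : R, 0 <= t <= T -> forall e : R, 0 < e ->
  exists2 d : R, 0 < d & forall r : R, 0 <= r <= T -> `|r - t| < d -> nm (fun s => g r s - g t s) <= e.

(** The quantitative content of the class at one time: [p2] and [a1] stand for p' and a', with the
    weights of X^2 and X^1. It is available at almost every time, through [ev_good]. *)
Definition good_slice (M : R) (p a : R -> R) := exists p2 a1,
  [/\ prim p p2 /\ prim a a1, L2I p /\ nm p <= M, nm a <= M,
      L2I (fun s => s * p2 s) /\ nm (fun s => s * p2 s) <= M &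
      L2I (fun s => rt s * a1 s) /\ nm (fun s => rt s * a1 s) <= M].

(* The data extracted from a solution: v, p, w, a, tau and sig stand for x', x'', x_t, x'_t,
   tau and tau', each given at every time by its regular representative.  The equation of
   motion and v_t = a appear as bounds of the increments of w and v against a fixed psi, in
   ev_dw and ev_dv2. *)
Record evolution n (T M : R) (v p w a : 'I_n -> R -> R -> R) (tau sig : R -> R -> R) : Prop := Evolution {
  ev_T : 0 < T;
  ev_M : 0 <= M;
  ev_v : forall i t, 0 <= t <= T -> prim (v i t) (p i t);
  ev_pm : forall i t, 0 <= t <= T -> measurable_fun I01 (p i t);
  ev_p : forall i t, 0 <= t <= T -> L2I (fun s => rt s * p i t s);
  ev_pc : forall i, tcts T (fun t s => rt s * p i t s);
  ev_v1 : forall t s, 0 <= t <= T -> 0 < s < 1 -> \sum_i v i t s ^+ 2 = 1;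
  ev_a : forall i t, 0 <= t <= T -> L2I (a i t);
  ev_ac : forall i, tcts T (a i);
  ev_dv : forall i t, 0 <= t <= T -> forall e : R, 0 < e -> exists2 d : R, 0 < d &
    forall r, 0 <= r <= T -> r != t -> `|r - t| < d ->
      nm (fun s => (r - t)^-1 * (v i r s - v i t s) - a i t s) <= e;
  ev_w : forall i t, 0 <= t <= T -> prim (w i t) (a i t) /\ w i t s @[s --> 1^'-] --> (0 : R);
  ev_va : forall t, 0 <= t <= T -> {ae mu, forall s, I01 s -> \sum_i v i t s * a i t s = 0};
  ev_tau : forall t, 0 < t < T -> [/\ prim (tau t) (sig t),
    prim (sig t) (fun s => (\sum_i p i t s ^+ 2) * tau t s - \sum_i a i t s ^+ 2),
    tau t s @[s --> 0^'+] --> (0 : R) & sig t s @[s --> 1^'-] --> (0 : R)];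
  ev_good : {ae mu, forall t, 0 < t < T -> forall i, good_slice M (p i t) (a i t)};
  ev_dw : forall i psi, L2I psi -> forall t1 t2 K1 K2 : R, 0 < t1 -> t1 <= t2 -> t2 < T ->
    {ae mu, forall r, t1 < r < t2 ->
       K1 <= \int[mu]_(s in I01) ((sig r s * v i r s + tau r s * p i r s) * psi s) <= K2} ->
    K1 * (t2 - t1) <= \int[mu]_(s in I01) (w i t2 s * psi s) - \int[mu]_(s in I01) (w i t1 s * psi s)
      <= K2 * (t2 - t1);
  ev_dv2 : forall i psi, L2I psi -> forall t1 t2 K1 K2 : R, 0 < t1 -> t1 <= t2 -> t2 < T ->
    {ae mu, forall r, t1 < r < t2 -> K1 <= \int[mu]_(s in I01) (a i r s * psi s) <= K2} ->
    K1 * (t2 - t1) <= \int[mu]_(s in I01) (v i t2 s * psi s) - \int[mu]_(s in I01) (v i t1 s * psi s)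
      <= K2 * (t2 - t1) }.

(** The times at which the bound holds are dense, and the norm is continuous in time. *)
Lemma tcts_bnd (T c : R) (g : R -> R -> R) : 0 < T -> (forall t, 0 <= t <= T -> L2I (g t)) ->
  tcts T g -> {ae mu, forall t, 0 < t < T -> nm (g t) <= c} ->
  forall t, 0 <= t <= T -> nm (g t) <= c.
Proof.
move=> T0 Lg cg hg t tT; apply/ler_addgt0Pr => e e0; have [d d0 hd] := cg t tT e e0.
have ab : Num.max 0 (t - d) < Num.min T (t + d) by rewrite lt_min !gt_max; slra.
have [r + hr] := ae_dense ab hg; rewrite gt_max lt_min => /andP[/andP[r0 r1] /andP[r2 r3]].
have rT : 0 <= r <= T by slra.
apply: le_trans (nmB_le (Lg t tT) (Lg r rT)) _; apply: lerD; first by apply: hr; slra.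
by rewrite nmBC; apply: hd => //; rewrite ltr_norml; slra.
Qed.

Lemma cvg0_le (F : set_system R) {FF : Filter F} (f g : R -> R) (C : R) :
  (\forall s \near F, `|f s| <= C * g s) -> g s @[s --> F] --> (0 : R) -> f s @[s --> F] --> (0 : R).
Proof.
move=> h g0; have Cg : C * g s @[s --> F] --> (0 : R).
  by rewrite -(mulr0 C); apply: cvgM => //; exact: cvg_cst.
apply/cvgrPdist_le => e e0; have /cvgrPdist_le /(_ e e0) H := Cg.
near=> s; rewrite sub0r normrN; apply: (@le_trans _ _ (C * g s)); first by near: s.
have : `|0 - C * g s| <= e by near: s.
by rewrite sub0r normrN; apply: le_trans; exact: ler_norm.
Unshelve. all: by end_near. Qed.

Lemma sqdiff (f g : R -> R) (M e : R) : L2I f -> L2I g -> nm f <= M -> nm g <= M ->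
  nm (fun s => f s - g s) <= e ->
  itg I01 (fun s => `|f s ^+ 2 - g s ^+ 2|) /\ \int[mu]_(s in I01) `|f s ^+ 2 - g s ^+ 2| <= 2 * M * e.
Proof.
move=> Lf Lg fM gM fe; have m01 := measurable_itv `]@GRing.zero R, 1[.
have E s : 0 < s < 1 -> `|f s ^+ 2 - g s ^+ 2| = `|f s - g s| * `|f s + g s|.
  by move=> _; rewrite -normrM -subr_sqr.
have L1 := L2_norm m01 (L2B m01 Lf Lg); have L2' := L2_norm m01 (L2D m01 Lf Lg).
split.
  apply: itg_norm; apply: itgB => //; [by case: Lf|by case: Lg].
rewrite (Rint_eq E); apply: le_trans (ler_norm _) _; apply: le_trans (nm_ip L1 L2') _.
have -> : nm (fun s => `|f s - g s|) = nm (fun s => f s - g s).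
  by congr Num.sqrt; apply: Rint_eq => s _; rewrite real_normK ?num_real.
have -> : nm (fun s => `|f s + g s|) = nm (fun s => f s + g s).
  by congr Num.sqrt; apply: Rint_eq => s _; rewrite real_normK ?num_real.
have := nmD Lf Lg; have := nm_ge0 (fun s => f s - g s); have := nm_ge0 (fun s => f s + g s).
by move: fM gM fe; move: (nm _) (nm _) (nm _) (nm _) => x1 x2 x3 x4; snra.
Qed.

Lemma abs_int_le (f : R -> R) (s : R) : L2I f -> 0 <= s -> `|\int[mu]_(r in `[s, 1]) f r| <= nm f.
Proof.
move=> Lf s0; have i1 : itg I01 f by apply: L2_itg => //; exact: mu01_lty.
have i2 := itg_norm i1.
apply: (@le_trans _ _ (\int[mu]_(r in `[s, 1]) `|f r|)).
  by apply: le_normr_Rintegral => //; exact: itg_seg01 i1 s0 _.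
apply: le_trans (Rint_seg01_le i2 _ s0 (lexx _)) _ => //.
have L1 := L2_norm (measurable_itv _) Lf.
have := nm_ip L1 (L2_cst01 1); rewrite nm_cst normr1 mulr1 => h.
have E : nm (fun s => `|f s|) = nm f.
  by congr Num.sqrt; apply: Rint_eq => r _; rewrite real_normK ?num_real.
rewrite -E; apply: le_trans h; apply: le_trans (ler_norm _).
by rewrite (Rint_eq (g := fun r => `|f r| * 1))// => r _; rewrite mulr1.
Qed.

Lemma prim_right0 (u u' : R -> R) : prim u u' -> L2I u' -> u s @[s --> 1^'-] --> (0 : R) ->
  (forall s, 0 < s < 1 -> `|u s| <= nm u') /\ L2I u.
Proof.
move=> pu Lu u1; have i1 : itg I01 u' by apply: L2_itg => //; exact: mu01_lty.
have b s : 0 < s < 1 -> `|u s| <= nm u'.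
  move=> s01; rewrite (prim_right pu i1 u1 s01) sub0r normrN; apply: abs_int_le => //; slra.
split=> //; exact: L2_bnd01 (prim_meas pu) b.
Qed.

End Evolution.

Ltac slim ::= repeat match goal with H : ?P |- _ =>
  lazymatch P with
  | measurable _ => fail | evolution _ _ _ _ _ _ _ _ => fail
  | _ => tryif comparison P then fail else clear H
  end end.

(** * Bounds valid at every time *)

Section Bounds.
Context {R : realType}.
Local Notation mu := (@lebesgue_measure R).
Local Notation itg D f := (mu.-integrable D (EFin \o f)).
Local Notation I01 := (`]@GRing.zero R, @GRing.one R[%classic).
Local Notation L2I := (L2 I01).
Local Notation rt := (@Num.sqrt R).
Context {n : nat} {T M : R} {v p w a : 'I_n -> R -> R -> R} {tau sig : R -> R -> R}.
Context (ev : evolution T M v p w a tau sig).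

Let M0 : 0 <= M. Proof. exact: ev_M ev. Qed.
Let T0 : 0 < T. Proof. exact: ev_T ev. Qed.
Let m01 : measurable I01. Proof. exact: measurable_itv. Qed.

Definition psq t s := \sum_i p i t s ^+ 2.
Definition asq t s := \sum_i a i t s ^+ 2.
Definition flux i t s := tau t s * v i t s.
Definition dflux i t s := sig t s * v i t s + tau t s * p i t s.

Lemma psq_ge0 t s : 0 <= psq t s. Proof. by apply: sumr_ge0 => i _; exact: sqr_ge0. Qed.
Lemma asq_ge0 t s : 0 <= asq t s. Proof. by apply: sumr_ge0 => i _; exact: sqr_ge0. Qed.

Lemma rt_sqr s : 0 < s < 1 -> rt s ^+ 2 = s.
Proof. by move=> s01; rewrite sqr_sqrtr//; slra. Qed.

Lemma meas_rt : measurable_fun I01 rt.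
Proof. by apply: measurable_funTS; apply: continuous_measurable_fun; exact: sqrt_continuous. Qed.

Lemma a_bnd i t : 0 <= t <= T -> nm (a i t) <= M.
Proof.
apply: (tcts_bnd T0 (ev_a ev i) (ev_ac ev i)).
by apply: (filterS_ae (ev_good ev)) => r h rT; have [p2 [a1 []]] := h rT i.
Qed.

(** The class bounds p itself at almost every time, but p is continuous in time only with the weight
    s^(1/2), so it is the weighted bound that passes to every time. *)
Lemma p_bnd i t : 0 <= t <= T -> nm (fun s => rt s * p i t s) <= M.
Proof.
apply: (tcts_bnd T0 (ev_p ev i) (ev_pc ev i)).
apply: (filterS_ae (ev_good ev)) => r h rT; have [p2 [a1 [_ [Lp pM] _ _ _]]] := h rT i.
apply: le_trans pM; apply: nm_le => //; first by apply: (ev_p ev i); slra.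
move=> s s01; rewrite normrM ler_piMl// ger0_norm ?sqrtr_ge0//.
by rewrite -[leRHS]sqrtr1 ler_wsqrtr//; slra.
Qed.

Lemma asq_int t : 0 <= t <= T -> itg I01 (asq t) /\ \int[mu]_(s in I01) asq t s <= n%:R * M ^+ 2.
Proof.
move=> tT; have ia i : itg I01 (fun s => a i t s ^+ 2) by case: (ev_a ev i tT).
split; first exact: itg_sum.
rewrite Rint_sum//.
apply: (@le_trans _ _ (\sum_(i < n) M ^+ 2)); last by rewrite sumr_const card_ord mulr_natl.
by apply: ler_sum => i _; rewrite -nm_leP// a_bnd.
Qed.

Lemma psq_int t : 0 <= t <= T -> measurable_fun I01 (psq t) /\
  itg I01 (fun s => s * psq t s) /\ \int[mu]_(s in I01) (s * psq t s) <= n%:R * M ^+ 2.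
Proof.
move=> tT; split.
  by apply: measurable_sum => i; apply: measurable_funX; exact: ev_pm ev i t tT.
have ip i : itg I01 (fun s => (rt s * p i t s) ^+ 2) by case: (ev_p ev i tT).
have E s : 0 < s < 1 -> \sum_i (rt s * p i t s) ^+ 2 = s * psq t s.
  by move=> s01; rewrite /psq mulr_sumr; apply: eq_bigr => i _; rewrite exprMn rt_sqr.
split.
  by apply: itg_eq (itg_sum m01 ip) => // s; rewrite /= in_itv/=; exact: E.
rewrite -(Rint_eq E) Rint_sum//.
apply: (@le_trans _ _ (\sum_(i < n) M ^+ 2)); last by rewrite sumr_const card_ord mulr_natl.
by apply: ler_sum => i _; rewrite -nm_leP// p_bnd.
Qed.

(** A bound of both int |a|^2 and int s |p|^2, and therefore of tau / s by [bvp_bound]. *)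
Definition C1 := n%:R * M ^+ 2.
(** A bound of tau', integrated from s = 1: int q tau <= C1 int s q <= C1 * C1, and int |a|^2 <=
    C1. *)
Definition C2 := C1 * C1 + C1.

Lemma C1_ge0 : 0 <= C1. Proof. by rewrite mulr_ge0 ?sqr_ge0. Qed.
Lemma C2_ge0 : 0 <= C2. Proof. by rewrite addr_ge0 ?mulr_ge0 ?C1_ge0. Qed.

Lemma Rint_ge0 (f : R -> R) : (forall s, 0 < s < 1 -> 0 <= f s) -> 0 <= \int[mu]_(s in I01) f s.
Proof. by move=> f0; apply: Rintegral_ge0 => s; rewrite /= in_itv/=; exact: f0. Qed.

Lemma tau_bnd t s : 0 < t < T -> 0 < s < 1 -> 0 <= tau t s <= C1 * s.
Proof.
move=> tT s01; have tT' : 0 <= t <= T by slra.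
have [pt ps t0 s1] := ev_tau ev tT; have [ih hh] := asq_int tT'.
have ps' : prim (sig t) (fun s => psq t s * tau t s + - asq t s) by [].
apply/andP; split.
  apply: (bvp_ge0 pt ps') => // r _; [exact: psq_ge0|by rewrite oppr_le0 asq_ge0].
have := bvp_bound pt ps' (fun r _ => psq_ge0 t r) (g := asq t).
move=> /(_ _ ih t0 s1 s s01) H.
apply: le_trans (ler_norm _) _; apply: le_trans (H _) _.
  by move=> r _; rewrite normrN ger0_norm// asq_ge0.
rewrite mulrC ler_wpM2r//; slra.
Qed.

Lemma sig_bnd t s : 0 < t < T -> 0 < s < 1 -> `|sig t s| <= C2.
Proof.
move=> tT s01; have tT' : 0 <= t <= T by slra.
have [pt ps t0 s1] := ev_tau ev tT; have [ih hh] := asq_int tT'; have [mq [iq qq]] := psq_int tT'.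
have mt := prim_meas pt.
have iqt : itg I01 (fun s => psq t s * tau t s).
  apply: (itg_le (g := fun s => C1 * (s * psq t s))) => //; [exact: measurable_funM| |exact: itgZ].
  move=> r; rewrite /= in_itv/= => r01; have := tau_bnd tT r01 => tb.
  rewrite ger0_norm ?mulr_ge0 ?psq_ge0//; last by slra.
  by rewrite mulrA mulrC ler_wpM2r ?psq_ge0//; slra.
have i1 := itgB m01 iqt ih.
rewrite (prim_right ps i1 s1 s01) sub0r normrN.
have i2 : itg I01 (fun s => C1 * (s * psq t s) + asq t s) by apply: itgD => //; exact: itgZ.
have le r : 0 < r < 1 -> `|psq t r * tau t r - asq t r| <= C1 * (r * psq t r) + asq t r.
  move=> r01; have := tau_bnd tT r01 => tb; have := psq_ge0 t r; have := asq_ge0 t r => h0 q0.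
  apply: le_trans (ler_normB _ _) _; rewrite !ger0_norm ?mulr_ge0//; last by slra.
  by rewrite lerD2r mulrA mulrC ler_wpM2r//; slra.
apply: (@le_trans _ _ (\int[mu]_(r in `[s, 1]) `|psq t r * tau t r - asq t r|)).
  by apply: le_normr_Rintegral => //; apply: (itg_seg01 i1); slra.
apply: le_trans (Rint_seg01_le (itg_norm i1) _ _ _) _ => //; [slra|].
apply: (@le_trans _ _ (\int[mu]_(r in I01) (C1 * (r * psq t r) + asq t r))).
  by apply: le_Rintegral => //; exact: itg_norm.
rewrite RintegralD//; last exact: itgZ.
rewrite RintegralZl// /C2; apply: lerD => //.
by rewrite ler_wpM2l// C1_ge0.
Qed.

Lemma v_le1 i t s : 0 <= t <= T -> 0 < s < 1 -> `|v i t s| <= 1.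
Proof.
move=> tT s01; rewrite -(@expr_le1 _ 2)// real_normK ?num_real// -(ev_v1 ev tT s01).
by rewrite (bigD1 i)//= lerDl; apply: sumr_ge0 => j _; exact: sqr_ge0.
Qed.

Lemma v_L2 i t : 0 <= t <= T -> L2I (v i t).
Proof. by move=> tT; apply: (L2_bnd01 (c := 1) (prim_meas (ev_v ev i tT))) => s s01; exact: v_le1. Qed.

Lemma w_L2 i t : 0 <= t <= T -> (forall s, 0 < s < 1 -> `|w i t s| <= nm (a i t)) /\ L2I (w i t).
Proof. by move=> tT; have [pw w1] := ev_w ev i tT; exact: prim_right0 pw (ev_a ev i tT) w1. Qed.

(** The difference of the tensions at two times solves a two-point problem with coefficient [psq r].
    Its source contains (psq r - psq t) tau, where tau <= C1 s supplies the weight that the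
    comparison of p needs. *)
Lemma tau_comp (e t r : R) : 0 < t < T -> 0 < r < T ->
  (forall i, nm (fun s => rt s * p i r s - rt s * p i t s) <= e) ->
  (forall i, nm (fun s => a i r s - a i t s) <= e) ->
  forall s, 0 < s < 1 -> `|tau r s - tau t s| <= s * (n%:R * ((C1 + 1) * (2 * M * e))).
Proof.
move=> tT rT pe ae s s01; have tT' : 0 <= t <= T by slra.
have rT' : 0 <= r <= T by slra.
have [pt ps t0 s1] := ev_tau ev tT; have [pt' ps' t0' s1'] := ev_tau ev rT.
pose gi i s := C1 * `|(rt s * p i r s) ^+ 2 - (rt s * p i t s) ^+ 2| + `|a i r s ^+ 2 - a i t s ^+ 2|.
have igi i : itg I01 (gi i) /\ \int[mu]_(s in I01) gi i s <= (C1 + 1) * (2 * M * e).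
  have [i1 l1] := sqdiff (ev_p ev i rT') (ev_p ev i tT') (p_bnd i rT') (p_bnd i tT') (pe i).
  have [i2 l2] := sqdiff (ev_a ev i rT') (ev_a ev i tT') (a_bnd i rT') (a_bnd i tT') (ae i).
  split; first by apply: itgD => //; exact: itgZ.
  rewrite RintegralD//; last exact: itgZ.
  by rewrite RintegralZl// mulrDl mul1r lerD// ler_wpM2l ?C1_ge0.
pose k s := (psq r s - psq t s) * tau t s - (asq r s - asq t s).
have pd : prim (fun s => sig r s - sig t s) (fun s => psq r s * (tau r s - tau t s) + k s).
  by apply: prim_eq (primB ps' ps) => // x _; rewrite /k /psq /asq; ring.
apply: le_trans (bvp_bound (primB pt' pt) pd (fun x _ => psq_ge0 r x) (g := fun s => \sum_i gi i s) _ _ _ _ s01) _.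
- move=> x x01; have tb := tau_bnd tT x01.
  apply: (@le_trans _ _ (C1 * (x * `|psq r x - psq t x|) + `|asq r x - asq t x|)).
    apply: le_trans (ler_normB _ _) _; rewrite lerD2r normrM mulrCA mulrC mulrA.
    by rewrite ler_wpM2r// ger0_norm; slra.
  rewrite /gi big_split/= -mulr_sumr; apply: lerD.
    rewrite ler_wpM2l ?C1_ge0// /psq -sumrB; apply: le_trans (ler_wpM2l _ (ler_norm_sum _ _ _)) _.
      by slra.
    rewrite mulr_sumr; apply: ler_sum => i _.
    by rewrite !exprMn !rt_sqr// -mulrBr normrM (gtr0_norm (_ : 0 < x))//; slra.
  by rewrite /asq -sumrB; exact: ler_norm_sum.
- by apply: itg_sum => // i; case: (igi i).
- by have := @cvgB _ _ _ _ _ _ _ _ _ t0' t0; rewrite subr0; exact.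
- by have := @cvgB _ _ _ _ _ _ _ _ _ s1' s1; rewrite subr0; exact.
rewrite ler_wpM2l//; first by slra.
rewrite Rint_sum//; last by move=> i; case: (igi i).
apply: (@le_trans _ _ (\sum_(i < n) ((C1 + 1) * (2 * M * e)))); last first.
  by rewrite sumr_const card_ord -[leLHS]mulr_natl.
by apply: ler_sum => i _; case: (igi i).
Qed.

Lemma prim_F i t : 0 < t < T -> prim (flux i t) (dflux i t).
Proof.
move=> tT; have [pt _ _ _] := ev_tau ev tT; have pv := ev_v ev i (ltac:(slra) : 0 <= t <= T).
exact: primM.
Qed.

Lemma F_bnd i t s : 0 < t < T -> 0 < s < 1 -> `|flux i t s| <= C1 * s.
Proof.
move=> tT s01; have tb := tau_bnd tT s01.
have vb := v_le1 i (ltac:(slra) : 0 <= t <= T) s01.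
case/andP: tb => t0 tb; rewrite normrM (ger0_norm t0); apply: le_trans tb.
by rewrite -[leRHS]mulr1 ler_wpM2l.
Qed.

Lemma F_L2 i t : 0 < t < T -> L2I (flux i t).
Proof.
move=> tT; apply: (L2_bnd01 (c := C1) (prim_meas (prim_F i tT))) => s s01.
by apply: le_trans (F_bnd i tT s01) _; rewrite ler_piMr ?C1_ge0//; slra.
Qed.

Lemma F1_L2 i t : 0 < t < T -> L2I (dflux i t).
Proof.
move=> tT; have tT' : 0 <= t <= T by slra.
have [pt ps _ _] := ev_tau ev tT; have pv := ev_v ev i tT'.
have mp := ev_pm ev i tT'.
apply: L2D => //.
  apply: (L2_bnd01 (c := C2)); first by apply: measurable_funM; [exact: prim_meas ps|exact: prim_meas pv].
  move=> s s01; rewrite normrM -[leRHS]mulr1 ler_pM//; [exact: sig_bnd|exact: v_le1].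
apply: (L2_le _ _ _ (L2Z C1 m01 (ev_p ev i tT'))) => //.
  by apply: measurable_funM => //; exact: prim_meas pt.
move=> s; rewrite /= in_itv/= => s01; have tb := tau_bnd tT s01.
rewrite [`|C1 * _|]normrM (ger0_norm C1_ge0) [`|rt s * _|]normrM normrM mulrA ler_wpM2r//.
rewrite ger0_norm; last by slra.
rewrite ger0_norm ?sqrtr_ge0//; apply: (@le_trans _ _ (C1 * s)); first by slra.
rewrite ler_wpM2l ?C1_ge0// -{1}(rt_sqr s01) expr2 ler_piMl ?sqrtr_ge0//.
by rewrite -[leRHS]sqrtr1 ler_wsqrtr//; slra.
Qed.

Lemma cvg_id0 : (fun s : R => s) @ (0 : R)^'+ --> (0 : R).
Proof. by apply: cvg_at_right_filter; exact: cvg_id. Qed.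

(** The boundary term at 0 vanishes because the flux is at most C1 s there, the one at 1 because
    [psi] does. *)
Lemma F1_parts i t (psi psi' : R -> R) : 0 < t < T -> prim psi psi' -> L2I psi' ->
  psi s @[s --> 1^'-] --> (0 : R) ->
  \int[mu]_(s in I01) (dflux i t s * psi s) = - \int[mu]_(s in I01) (flux i t s * psi' s).
Proof.
move=> tT pp Lp p1; have [pb Lpsi] := prim_right0 pp Lp p1.
have L1 := F1_L2 i tT; have L0 := F_L2 i tT.
have i1 := L2_mul m01 L1 Lpsi; have i2 := L2_mul m01 L0 Lp.
have := prim_parts (primM (prim_F i tT) pp) (itgD m01 i1 i2) (l0 := 0) (l1 := 0).
rewrite subrr RintegralD// => H; apply/eqP; rewrite -addr_eq0; apply/eqP; apply: H.
- apply: (cvg0_le (C := C1 * nm psi') _ cvg_id0).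
  near=> s; have s01 : 0 < s < 1 by near: s; exact: near01_0.
  by rewrite normrM mulrAC ler_pM// ?F_bnd// pb.
- apply: (cvg0_le (C := C1) _ (_ : (fun s => `|psi s|) @ 1^'- --> (0 : R))).
    near=> s; have s01 : 0 < s < 1 by near: s; exact: near01_1.
    rewrite normrM ler_wpM2r//; apply: le_trans (F_bnd i tT s01) _.
    by rewrite ler_piMr ?C1_ge0//; slra.
  by rewrite -(normr0 R); exact: cvg_norm.
Unshelve. all: by end_near. Qed.

(** The difference quotient at t stays within 1 of a, so the increment is at most (K + 1) |r - t|
    with K the norm of a. *)
Lemma v_tcts i : tcts T (v i).
Proof.
move=> t tT e e0; have [d d0 hd] := ev_dv ev i tT ltr01.
have K0 := nm_ge0 (a i t); set K := nm (a i t) in K0.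
exists (Num.min d (e / (K + 1))); first by rewrite lt_min d0/= divr_gt0//; slra.
move=> r rT; rewrite lt_min => /andP[rd re].
have [->|rt0] := eqVneq r t.
  by rewrite (nm_ext (g := fun=> 0)) ?nm_cst ?normr0 ?(ltW e0)// => s _; rewrite subrr.
have := hd r rT rt0 rd; have Lv j := v_L2 i (t := j).
have Lq : L2I (fun s => (r - t)^-1 * (v i r s - v i t s)).
  by apply: L2Z => //; apply: L2B => //; exact: Lv.
move=> H; have := nmB_le Lq (ev_a ev i tT); rewrite -/K => H2.
have rt1 : r - t != 0 by rewrite subr_eq0.
rewrite (nm_ext (g := fun s => (r - t) * ((r - t)^-1 * (v i r s - v i t s)))); last first.
  by move=> s _; rewrite mulrA divff// mul1r.
rewrite nmZ//; move: re; rewrite ltr_pdivlMr; last by slra.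
move: H H2; move: (nm _) (nm _) => x y; have := normr_ge0 (r - t); move: `|r - t| => z.
by snra.
Qed.

End Bounds.

(** * Conservation of the kinetic energy and lower bound of the tension *)

Section Energy.
Context {R : realType}.
Local Notation mu := (@lebesgue_measure R).
Local Notation itg D f := (mu.-integrable D (EFin \o f)).
Local Notation I01 := (`]@GRing.zero R, @GRing.one R[%classic).
Local Notation L2I := (L2 I01).
Local Notation rt := (@Num.sqrt R).

Lemma fin_near m (t : R) (Q : 'I_m -> R -> Prop) :
  (forall i, exists2 d : R, 0 < d & forall r : R, `|r - t| < d -> Q i r) ->
  exists2 d : R, 0 < d & forall r : R, `|r - t| < d -> forall i, Q i r.
Proof.
move=> h; have H : \forall r \near t, forall i, Q i r.
  apply: (@filter_forall _ _ (fun i r => Q i r) (nbhs t) _) => i; have [d d0 hd] := h i; apply/nbhs_ballP; exists d => // r.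
  by rewrite /ball/= distrC; exact: hd.
have /nbhs_ballP[d /= d0 hd] := H; exists d => // r rd.
by apply: hd; rewrite /ball/= distrC.
Qed.

(** Right increments that are small compared with y - x: [dini_nonincr] applies to c f - e' x for c
    = 1 and c = -1. *)
Lemma slow_const (f : R -> R) (a b : R) : a <= b -> {within `[a, b], continuous f} ->
  (forall x, a <= x < b -> forall e : R, 0 < e -> exists2 d : R, 0 < d &
     forall y : R, x <= y <= x + d -> y <= b -> `|f y - f x| <= e * (y - x)) -> f b = f a.
Proof.
move=> ab cf h.
have D (c : R) : c ^+ 2 = 1 -> c * f b <= c * f a.
  move=> c1; apply/ler_addgt0Pr => e e0; pose e' := e / (b - a + 1).
  have e'0 : 0 < e' by rewrite divr_gt0//; slra.
  suff : c * f b - e' * b <= c * f a - e' * a.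
    have : e' * (b - a) <= e.
      by rewrite /e' mulrAC ler_pdivrMr; [rewrite ler_wpM2l ?(ltW e0)//|]; slra.
    by rewrite mulrBr; slra.
  apply: (dini_nonincr (g := fun x => c * f x - e' * x)) => //.
    apply/subspace_continuousP => x xab; apply: cvgB; apply: cvgM; try exact: cvg_cst.
      exact: ((subspace_continuousP _ _).1 cf).
    by apply: cvg_within_filter; exact: cvg_id.
  move=> x xab; have [d d0 hd] := h x xab e' e'0; exists d => // y yx yb.
  have := hd y yx yb; have c11 : c = 1 \/ c = -1.
    by have /eqP := c1; rewrite sqrf_eq1 => /orP[/eqP|/eqP]; [left|right].
  by rewrite ler_norml mulrBr; case: c11 => ->; slra.
by have := D 1 ltac:(by rewrite expr1n); have := D (-1) ltac:(by rewrite sqrrN expr1n); slra.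
Qed.

Context {n : nat} {T M : R} {v p w a : 'I_n -> R -> R -> R} {tau sig : R -> R -> R}.
Context (ev : evolution T M v p w a tau sig).

Let M0 : 0 <= M. Proof. exact: ev_M ev. Qed.
Let T0 : 0 < T. Proof. exact: ev_T ev. Qed.
Let m01 : measurable I01. Proof. exact: measurable_itv. Qed.
Local Notation C1 := (@C1 R n M).
Local Notation flux := (flux (v := v) (tau := tau)).
Local Notation dflux := (dflux (v := v) (p := p) (tau := tau) (sig := sig)).

Lemma near_all (e t : R) : 0 <= t <= T -> 0 < e -> exists2 d : R, 0 < d &
  forall r, 0 <= r <= T -> `|r - t| < d -> forall i,
   [/\ nm (fun s => rt s * p i r s - rt s * p i t s) <= e, nm (fun s => a i r s - a i t s) <= e
     & nm (fun s => v i r s - v i t s) <= e].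
Proof.
move=> tT e0.
have [d d0 hd] : exists2 d : R, 0 < d & forall r : R, `|r - t| < d -> forall i, 0 <= r <= T ->
   [/\ nm (fun s => rt s * p i r s - rt s * p i t s) <= e, nm (fun s => a i r s - a i t s) <= e
     & nm (fun s => v i r s - v i t s) <= e].
  apply: fin_near => i.
  have [d1 d10 h1] := ev_pc ev i tT e0; have [d2 d20 h2] := ev_ac ev i tT e0.
  have [d3 d30 h3] := v_tcts ev i tT e0.
  exists (Num.min d1 (Num.min d2 d3)); first by rewrite !lt_min d10 d20.
  move=> r; rewrite !lt_min => /and3P[r1 r2 r3] rT.
  by split; [exact: h1|exact: h2|exact: h3].
by exists d => // r rT rd i; exact: hd.
Qed.

Lemma near_tau (e t : R) : 0 < t < T -> 0 < e -> exists2 d : R, 0 < d &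
  forall r, 0 < r < T -> `|r - t| < d -> forall s, 0 < s < 1 -> `|tau r s - tau t s| <= s * e.
Proof.
move=> tT e0; have tT' : 0 <= t <= T by slra.
pose K := n%:R * ((C1 + 1) * (2 * M)).
have K0 : 0 <= K by rewrite !mulr_ge0// addr_ge0// C1_ge0.
have e1 : 0 < e / (K + 1) by rewrite divr_gt0//; slra.
have [d d0 hd] := near_all tT' e1; exists d => // r rT rd s s01.
have rT' : 0 <= r <= T by slra.
apply: le_trans (tau_comp ev (e := e / (K + 1)) tT rT _ _ s01) _.
- by move=> i; have [] := hd r rT' rd i.
- by move=> i; have [] := hd r rT' rd i.
rewrite ler_wpM2l//; first by slra.
rewrite (_ : n%:R * _ = K * (e / (K + 1))); last by rewrite /K; ring.
by rewrite mulrCA ler_piMr// ?(ltW e0)// ler_pdivrMr; slra.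
Qed.

Lemma F_cts (e t : R) : 0 < t < T -> 0 < e -> exists2 d : R, 0 < d &
  forall r, 0 < r < T -> `|r - t| < d -> forall i, nm (fun s => flux i r s - flux i t s) <= e.
Proof.
move=> tT e0; have tT' : 0 <= t <= T by slra.
have K0 := C1_ge0 (R := R) (n := n) (M := M).
have e1 : 0 < e / (C1 + 1) by rewrite divr_gt0//; slra.
have [d d0 hd] := near_all tT' e1; have [d' d'0 hd'] := near_tau tT e1.
exists (Num.min d d'); first by rewrite lt_min d0.
move=> r rT; rewrite lt_min => /andP[rd rd'] i; have rT' : 0 <= r <= T by slra.
have [_ _ vv] := hd r rT' rd i; have tt := hd' r rT rd'.
have [pt _ _ _] := ev_tau ev tT; have [pr _ _ _] := ev_tau ev rT.
have pvt := ev_v ev i tT'; have pvr := ev_v ev i rT'.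
have mt := prim_meas pt; have mr := prim_meas pr; have mvt := prim_meas pvt; have mvr := prim_meas pvr.
have b1 s : 0 < s < 1 -> `|(tau r s - tau t s) * v i r s| <= e / (C1 + 1).
  move=> s01; rewrite normrM -[leRHS]mulr1 ler_pM//; last exact: (v_le1 ev).
  by apply: le_trans (tt s s01) _; rewrite ler_piMl// ?(ltW e1)//; slra.
have Lv : L2I (fun s => v i r s - v i t s) by apply: L2B => //; exact: (v_L2 ev).
have tb s : 0 < s < 1 -> `|tau t s| <= C1.
  move=> s01; have tb := tau_bnd ev tT s01; rewrite ger0_norm; last by slra.
  by apply: (@le_trans _ _ (C1 * s)); [slra|rewrite ler_piMr//; slra].
have m1 : measurable_fun I01 (fun s => (tau r s - tau t s) * v i r s).
  by apply: measurable_funM => //; exact: measurable_funB.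
have L2' : L2I (fun s => tau t s * (v i r s - v i t s)) by apply: (L2_bndM (M := C1)) => // s; rewrite /= in_itv/=; exact: tb.
rewrite (nm_ext (g := fun s => (tau r s - tau t s) * v i r s + tau t s * (v i r s - v i t s))); last first.
  by move=> s _; rewrite /flux; ring.
apply: le_trans (nmD (L2_bnd01 m1 b1) L2') _.
have n1 := nm_bnd m1 b1; rewrite ger0_norm in n1; last exact: ltW.
have n2 : nm (fun s => tau t s * (v i r s - v i t s)) <= C1 * (e / (C1 + 1)).
  apply: (@le_trans _ _ (nm (fun s => C1 * (v i r s - v i t s)))).
    apply: nm_le => //; first exact: L2Z.
    by move=> s s01; rewrite [leLHS]normrM [leRHS]normrM ler_wpM2r// (ger0_norm K0) tb.
  by rewrite nmZ// (ger0_norm K0) ler_wpM2l.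
apply: le_trans (lerD n1 n2) _; rewrite -{1}(mul1r (e / _)) -mulrDl mulrCA addrC divff ?mulr1//.
by rewrite gt_eqF//; slra.
Qed.

(** The equation of motion to first order in r - t. The error is uniform in [psi] through the norm
    of psi', so that [psi] may depend on [r], as in the choice psi = w r + w t. *)
Lemma w_eq (e t : R) : 0 < t < T -> 0 < e -> exists2 d : R, 0 < d &
  forall r, t <= r -> r < T -> r < t + d -> forall i psi psi', prim psi psi' -> L2I psi' ->
    psi s @[s --> 1^'-] --> (0 : R) ->
    `|\int[mu]_(s in I01) (w i r s * psi s) - \int[mu]_(s in I01) (w i t s * psi s)
      + (r - t) * \int[mu]_(s in I01) (flux i t s * psi' s)| <= (r - t) * (e * nm psi').
Proof.
move=> tT e0; have [d d0 hd] := F_cts tT e0; exists d => // r tr rT rd i psi psi' pp Lp p1.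
have [_ Lpsi] := prim_right0 pp Lp p1.
set I := \int[mu]_(s in I01) (flux i t s * psi' s).
have t0 : 0 < t by slra.
have := @ev_dw _ _ _ _ _ _ _ _ _ _ ev i psi Lpsi t r (- I - e * nm psi') (- I + e * nm psi') t0 tr rT.
have A : {ae mu, forall x, t < x < r ->
    - I - e * nm psi' <= \int[mu]_(s in I01) ((sig x s * v i x s + tau x s * p i x s) * psi s) <= - I + e * nm psi'}.
  exists set0; split => // x /=; apply: contra_notP => _ xtr.
  have xT : 0 < x < T by slra.
  have xd : `|x - t| < d by rewrite ltr_norml; slra.
  have E := F1_parts ev i xT pp Lp p1; rewrite /dflux in E; rewrite E.
  have := ip_small (F_L2 ev i xT) (F_L2 ev i tT) Lp (hd x xT xd i).
  by rewrite -/I; move: (Rintegral _ _ _) I (e * nm psi') => x1 x2 x3; rewrite ler_norml; slra.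
move=> /(_ A); clear A; move: (Rintegral _ _ _) (Rintegral _ _ _) I (e * nm psi') => x1 x2 x3 x4.
by rewrite ler_norml => H; snra.
Qed.

(** Since w vanishes at s = 1, its increments are bounded pointwise by the L^2 norm of those of
    a. *)
Lemma w_tcts i : tcts T (w i).
Proof.
move=> t tT e e0; have [d d0 hd] := ev_ac ev i tT e0; exists d => // r rT rd.
apply: le_trans (hd r rT rd).
have [pw w1] := ev_w ev i tT; have [pw' w1'] := ev_w ev i rT.
have La := L2B m01 (ev_a ev i rT) (ev_a ev i tT).
have w0 : w i r s - w i t s @[s --> 1^'-] --> (0 : R).
  by have := @cvgB _ _ _ _ _ _ _ _ _ w1' w1; rewrite subr0; exact.
have [b L] := prim_right0 (primB pw' pw) La w0.
have := nm_bnd (prim_meas (primB pw' pw)) b; by rewrite ger0_norm ?nm_ge0.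
Qed.

Definition energy t := \sum_i nm (w i t) ^+ 2.

Lemma sqr_nm_diff (f g : R -> R) : L2I f -> L2I g ->
  nm f ^+ 2 - nm g ^+ 2 = \int[mu]_(s in I01) ((f s - g s) * (f s + g s)).
Proof.
move=> Lf Lg; rewrite !nm_sqr -RintegralB//; [|by case: Lf|by case: Lg].
by apply: Rint_eq => s _; ring.
Qed.

Lemma tcts_energy (g : 'I_n -> R -> R -> R) (K t e : R) : (forall i r, 0 <= r <= T -> L2I (g i r)) ->
  (forall i r, 0 <= r <= T -> nm (g i r) <= K) -> (forall i, tcts T (g i)) -> 0 <= t <= T -> 0 < e ->
  exists2 d : R, 0 < d & forall r, 0 <= r <= T -> `|r - t| < d ->
   `|\sum_i nm (g i r) ^+ 2 - \sum_i nm (g i t) ^+ 2| <= e.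
Proof.
move=> Lg gK cg tT e0.
pose N := n%:R * (2 * `|K|) + 1 : R.
have N0 : 0 < N by rewrite ltr_pwDr// !mulr_ge0.
have e1 : 0 < e / N by rewrite divr_gt0.
have [d d0 hd] : exists2 d : R, 0 < d & forall r : R, `|r - t| < d -> forall i, 0 <= r <= T ->
    nm (fun s => g i r s - g i t s) <= e / N.
  by apply: fin_near => i; have [d d0 hd] := cg i t tT _ e1; exists d => // r rd rT; exact: hd.
exists d => // r rT rd; rewrite -sumrB; apply: le_trans (ler_norm_sum _ _ _) _.
apply: (@le_trans _ _ (\sum_(i < n) (2 * `|K| * (e / N)))); last first.
  rewrite sumr_const card_ord -[leLHS]mulr_natl.
  have -> : n%:R * (2 * `|K| * (e / N)) = N * (e / N) - e / N by rewrite /N; ring.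
  by rewrite mulrCA divff ?gt_eqF// mulr1; slra.
apply: ler_sum => i _.
have k1 := le_trans (gK i r rT) (ler_norm K); have k2 := le_trans (gK i t tT) (ler_norm K).
have [Lr Lt] := (Lg i r rT, Lg i t tT).
rewrite sqr_nm_diff//; apply: le_trans (nm_ip (L2B m01 Lr Lt) (L2D m01 Lr Lt)) _.
have := nmD Lr Lt; have := hd r rd i rT; have := nm_ge0 (fun s => g i r s - g i t s).
have := nm_ge0 (fun s => g i r s + g i t s).
by move: k1 k2; move: (nm _) (nm _) (nm _) (nm _) (e / N) `|K| => x1 x2 x3 x4 x5 x6; snra.
Qed.

Lemma F_nm i t : 0 < t < T -> nm (flux i t) <= C1.
Proof.
move=> tT; have K0 := C1_ge0 (R := R) (n := n) (M := M).
rewrite -[leRHS]ger0_norm//; apply: nm_bnd; first exact: prim_meas (prim_F ev i tT).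
by move=> s s01; apply: le_trans (F_bnd ev i tT s01) _; rewrite ler_piMr//; slra.
Qed.

Lemma F_orth t : 0 < t < T -> \sum_i \int[mu]_(s in I01) (flux i t s * a i t s) = 0.
Proof.
move=> tT; have tT' : 0 <= t <= T by slra.
have i1 i := L2_mul m01 (F_L2 ev i tT) (ev_a ev i tT').
rewrite -Rint_sum// -[RHS](Rint01_cst 0); apply: Rint_ae_eq => //.
  exact: itg_meas (itg_sum m01 i1).
apply: (filterS_ae (ev_va ev tT')) => s H s01.
transitivity (tau t s * \sum_i v i t s * a i t s); last by rewrite H// mulr0.
by rewrite mulr_sumr; apply: eq_bigr => i _; rewrite mulrA.
Qed.

(** Factor |w r|^2 - |w t|^2 and test the equation with w r + w t, whose derivative is 2 a t up to a
    small error. The leading term is the pairing of the flux with a t, which is zero by [F_orth]. *)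
Lemma energy_slow t (e : R) : 0 < t < T -> 0 < e -> exists2 d : R, 0 < d &
  forall r, t <= r <= t + d -> r < T -> `|energy r - energy t| <= e * (r - t).
Proof.
move=> tT e0; have tT' : 0 <= t <= T by slra.
have K0 := C1_ge0 (R := R) (n := n) (M := M).
pose N : R := n%:R * (2 * M + C1) + 1.
have N0 : 0 < N by rewrite ltr_pwDr// mulr_ge0// addr_ge0// mulr_ge0.
have e1 : 0 < e / N by rewrite divr_gt0.
have [d1 d10 h1] := near_all tT' e1; have [d2 d20 h2] := w_eq tT e1.
exists (Num.min d1 d2 / 2); first by rewrite divr_gt0// lt_min d10.
move=> r rtd rT; have m0 : 0 < Num.min d1 d2 by rewrite lt_min d10.
have : r - t < Num.min d1 d2 by move: (Num.min _ _) m0 rtd => m; slra.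
rewrite lt_min => /andP[rd1 rd2]; clear m0.
have tr : t <= r by slra.
have rT' : 0 <= r <= T by slra.
have rd : `|r - t| < d1 by rewrite ger0_norm//; slra.
rewrite /energy -sumrB.
(* The leading terms cancel only after summation over the coordinates, so they are added before the
   triangle inequality. *)
have <- : \sum_i (nm (w i r) ^+ 2 - nm (w i t) ^+ 2 + 2 * (r - t) * \int[mu]_(s in I01) (flux i t s * a i t s)) =
    \sum_i (nm (w i r) ^+ 2 - nm (w i t) ^+ 2).
  by rewrite big_split/= -mulr_sumr F_orth// mulr0 addr0.
apply: le_trans (ler_norm_sum _ _ _) _.
apply: (@le_trans _ _ (\sum_(i < n) ((r - t) * (e / N * (2 * M + C1))))); last first.
  rewrite sumr_const card_ord -[leLHS]mulr_natl.
  have -> : n%:R * ((r - t) * (e / N * (2 * M + C1))) = (N * (e / N) - e / N) * (r - t) by rewrite /N; ring.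
  by rewrite ler_wpM2r ?subr_ge0// mulrCA divff ?gt_eqF// mulr1; slra.
apply: ler_sum => i _.
have [pw w1] := ev_w ev i tT'; have [pw' w1'] := ev_w ev i rT'.
have [La La'] := (ev_a ev i tT', ev_a ev i rT').
have [_ Lw] := w_L2 ev i tT'; have [_ Lw'] := w_L2 ev i rT'.
have c0 : w i r s + w i t s @[s --> 1^'-] --> (0 : R).
  by have := @cvgD _ _ _ _ _ _ _ _ _ w1' w1; rewrite addr0; exact.
have H := h2 r tr rT (ltac:(slra)) i _ _ (primD pw' pw) (L2D m01 La' La) c0.
have [_ aa _] := h1 r rT' rd i.
have LF := F_L2 ev i tT.
have E1 : nm (w i r) ^+ 2 - nm (w i t) ^+ 2 =
    \int[mu]_(s in I01) (w i r s * (w i r s + w i t s)) - \int[mu]_(s in I01) (w i t s * (w i r s + w i t s)).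
  rewrite sqr_nm_diff// -RintegralB//; try by (apply: L2_mul => //; exact: L2D).
  by apply: Rint_eq => s _; rewrite mulrBl.
have E2 : \int[mu]_(s in I01) (flux i t s * (a i r s + a i t s)) =
    \int[mu]_(s in I01) (flux i t s * (a i r s - a i t s)) + 2 * \int[mu]_(s in I01) (flux i t s * a i t s).
  rewrite -RintegralZl//; last exact: L2_mul.
  rewrite -RintegralD//; [|by apply: L2_mul => //; exact: L2B|by apply: itgZ => //; exact: L2_mul].
  by apply: Rint_eq => s _; ring.
have B1 := nm_ip LF (L2B m01 La' La).
have B2 := F_nm i tT; have B3 := nm_ge0 (flux i t).
have B4 := nmD La' La; have B5 := a_bnd ev i tT'; have B6 := a_bnd ev i rT'.
have B7 := nm_ge0 (fun s => a i r s - a i t s).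
rewrite E2 -E1 in H.
have {B4 B5 B6} B4 : nm (fun s => a i r s + a i t s) <= 2 * M by slra.
have {B1 B2 B3 B7 aa} B1 : `|\int[mu]_(s in I01) (flux i t s * (a i r s - a i t s))| <= C1 * (e / N).
  by apply: le_trans B1 _; apply: ler_pM.
have {}H := le_trans H (ler_wpM2l (_ : 0 <= r - t) (ler_wpM2l (ltW e1) B4)).
move: H B1 e1 => /(_ ltac:(slra)); clear -tr.
move: (nm _ ^+ 2 - _) (Rintegral _ _ _) (Rintegral _ _ _) (e / N) C1 => x1 x2 x3 x4 c.
rewrite !ler_norml => /andP[H1 H2] /andP[H3 H4] e1.
have H5 : (r - t) * (- (c * x4)) <= (r - t) * x3 by apply: ler_wpM2l => //; slra.
have H6 : (r - t) * x3 <= (r - t) * (c * x4) by apply: ler_wpM2l => //; slra.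
by apply/andP; split; slra.
Qed.

Lemma energy_const t : 0 < t < T -> energy t = energy 0.
Proof.
move=> tT; have ce r e : 0 <= r <= T -> 0 < e -> exists2 d : R, 0 < d & forall r', 0 <= r' <= T -> `|r' - r| < d ->
    `|energy r' - energy r| <= e.
  move=> rT e0; apply: (tcts_energy (K := M)) => //; [by move=> i x xT; have [] := w_L2 ev i xT| |exact: w_tcts].
  move=> i x xT; have [b Lw] := w_L2 ev i xT.
  have [pw _] := ev_w ev i xT; apply: le_trans (nm_bnd (prim_meas pw) b) _.
  by rewrite ger0_norm ?nm_ge0// (a_bnd ev).
have cst r : 0 < r <= t -> energy t = energy r.
  move=> rt0; apply: slow_const; first by slra.
    apply/within_ctsP => x xrt e e0; have [d d0 hd] := ce x (e / 2) ltac:(slra) ltac:(slra).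
    exists d => // y yrt yx; apply: le_lt_trans (hd y _ yx) _; slra.
  move=> x xrt e e0; have [d d0 hd] := @energy_slow x e ltac:(slra) e0; exists d => // y yx yt.
  by apply: hd => //; slra.
apply/eqP; rewrite -subr_eq0 -normr_le0; apply/ler_addgt0Pr => e e0; rewrite add0r.
have [d d0 hd] := ce 0 e ltac:(slra) e0.
have m0 : 0 < Num.min (d / 2) t by rewrite lt_min; slra.
have m1 : Num.min (d / 2) t <= d / 2 by rewrite ge_min lexx.
have m2 : Num.min (d / 2) t <= t by rewrite ge_min lexx orbT.
rewrite (cst (Num.min (d / 2) t)); last by rewrite m0 m2.
apply: hd; first by slra.
by rewrite subr0 gtr0_norm//; slra.
Qed.

(** Integrate (s u^2)' = u^2 + 2 u (s u'): the boundary terms vanish, and the norms satisfy |u|^2 <=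
    2 |u| |s u'|. Then s^2 <= s weakens the weight to the stated one. *)
Lemma hardy (u u' : R -> R) : prim u u' -> L2I u' -> u s @[s --> 1^'-] --> (0 : R) ->
  nm u ^+ 2 <= 4 * \int[mu]_(s in I01) (s * u' s ^+ 2).
Proof.
move=> pu Lu u1; have [b L] := prim_right0 pu Lu u1.
have mid : measurable_fun I01 (fun s : R => s) by [].
have Lsu : L2I (fun s => s * u' s).
  apply: (L2_bndM (M := 1)) => // s; rewrite /= in_itv/= => s01; rewrite ger0_norm; slra.
have i1 : itg I01 (fun s => u s ^+ 2) by case: L.
have i2 := L2_mul m01 L Lsu.
have pp : prim (fun s => s * u s ^+ 2) (fun s => u s ^+ 2 + 2 * (u s * (s * u' s))).
  by apply: prim_eq (primM prim_id (primM pu pu)) => s _; ring.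
have ii := itgD m01 i1 (itgZ 2 m01 i2).
have := prim_parts pp ii (l0 := 0) (l1 := 0).
have c0 : s * u s ^+ 2 @[s --> 0^'+] --> (0 : R).
  apply: (cvg0_le (C := nm u' ^+ 2) _ cvg_id0); near=> s.
  have s01 : 0 < s < 1 by near: s; exact: near01_0.
  have s0 : 0 <= s by slra.
  rewrite (ger0_norm (mulr_ge0 s0 (sqr_ge0 _))) mulrC ler_wpM2r//.
  by rewrite -real_normK ?num_real// lerXn2r ?nnegrE ?nm_ge0// b.
have c1 : s * u s ^+ 2 @[s --> 1^'-] --> (0 : R).
  apply: (cvg0_le (C := nm u') (g := fun s => `|u s|)); last by rewrite -(normr0 R); exact: cvg_norm.
  near=> s; have s01 : 0 < s < 1 by near: s; exact: near01_1.
  rewrite normrM normrX expr2 mulrA ler_wpM2r// -[leRHS]mul1r ler_pM// ?b//.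
  by rewrite ger0_norm; slra.
move=> /(_ c0 c1); rewrite subrr RintegralD//; last exact: itgZ.
rewrite RintegralZl// -nm_sqr => H.
have B := nm_ip L Lsu; have B0 := nm_ge0 u; have B1 := nm_ge0 (fun s => s * u' s).
have le : nm u <= 2 * nm (fun s => s * u' s).
  move: H B B0 B1; move: (nm _) (nm _) (Rintegral _ _ _) => x1 x2 x3; rewrite ler_norml => H /andP[B _] B0 B1.
  by rewrite leNgt; apply/negP => lt; snra.
have : nm u ^+ 2 <= 4 * nm (fun s => s * u' s) ^+ 2 by snra.
move=> /le_trans; apply; rewrite ler_pM2l// nm_sqr; apply: le_Rintegral => //.
- by case: Lsu.
- apply: (itg_le (g := fun s => u' s ^+ 2)) => //; last by case: Lu.
    by apply: measurable_funM => //; apply: measurable_funX; case: Lu.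
  move=> s; rewrite /= in_itv/= => s01; have s0 : 0 <= s by slra.
  rewrite (ger0_norm (mulr_ge0 s0 (sqr_ge0 _))).
  by rewrite ler_piMl ?sqr_ge0//; slra.
move=> s; rewrite /= in_itv/= => s01; rewrite exprMn ler_wpM2r ?sqr_ge0//.
by rewrite expr2 ler_piMl//; slra.
Unshelve. all: by end_near. Qed.

(** The constant of [bvp_lower] with M = C1; by [hardy] and the conservation of energy, int s |a|^2
    is at least a quarter of the initial energy. *)
Definition c0 := expR (- C1) ^+ 2 / (1 + C1) * (energy 0 / 4).

Lemma tau_low t s : 0 < t < T -> 0 < s < 1 -> s * c0 <= tau t s.
Proof.
move=> tT s01; have tT' : 0 <= t <= T by slra.
have [pt ps t0 s1] := ev_tau ev tT; have [ih hh] := asq_int ev tT'.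
have [mq [iq qC]] := psq_int ev tT'.
have := bvp_lower pt ps (fun s _ => psq_ge0 t s) (fun s _ => asq_ge0 (a := a) t s) mq iq qC ih t0 s1 s01.
apply: le_trans; rewrite ler_wpM2l//; first by slra.
have K0 := C1_ge0 (R := R) (n := n) (M := M).
rewrite /c0 ler_wpM2l//; first by rewrite divr_ge0 ?sqr_ge0// addr_ge0.
rewrite ler_pdivrMr// mulrC -(energy_const tT) /energy.
have ii i : itg I01 (fun s => s * a i t s ^+ 2).
  have [mai ai] := ev_a ev i tT'.
  apply: (itg_le (g := fun s => a i t s ^+ 2)) => //.
    by apply: measurable_funM => //; exact: measurable_funX.
  move=> r; rewrite /= in_itv/= => r01; have r0 : 0 <= r by slra.
  by rewrite (ger0_norm (mulr_ge0 r0 (sqr_ge0 _))) ler_piMl ?sqr_ge0//; slra.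
have -> : \int[mu]_(r in I01) (r * asq (a := a) t r) = \sum_i \int[mu]_(r in I01) (r * a i t r ^+ 2).
  by rewrite -(Rint_sum m01 ii); apply: Rint_eq => r _; rewrite mulr_sumr.
rewrite mulr_sumr; apply: ler_sum => i _; have [pw w1] := ev_w ev i tT'.
by apply: hardy => //; exact: ev_a ev i t tT'.
Qed.

End Energy.

(** * Weighted estimates at a fixed time *)

Section Slices.
Context {R : realType}.
Local Notation mu := (@lebesgue_measure R).
Local Notation itg D f := (mu.-integrable D (EFin \o f)).
Local Notation I01 := (`]@GRing.zero R, @GRing.one R[%classic).
Local Notation L2I := (L2 I01).
Local Notation rt := (@Num.sqrt R).

Let m01 : measurable I01. Proof. exact: measurable_itv. Qed.

Lemma rt_gt0 (s : R) : 0 < s < 1 -> 0 < rt s < 1 /\ s <= rt s.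
Proof.
move=> s01; have r0 : 0 < rt s by rewrite sqrtr_gt0; slra.
have r2 := rt_sqr s01; move: (rt s) r0 r2 => x x0 x2; snra.
Qed.

Lemma meas_rtV : measurable_fun I01 (fun s : R => (rt s)^-1).
Proof.
apply: open_continuous_measurable_fun => // s /set_mem; rewrite /= in_itv/= => s01.
apply: cvgV; last exact: sqrt_continuous.
by have [r0 _] := rt_gt0 s01; rewrite gt_eqF//; slra.
Qed.

Lemma prim_rt : prim rt (fun s : R => (2 * rt s)^-1).
Proof.
apply: prim_C1 => s s01; have [r0 _] := rt_gt0 s01.
  have s0 : 0 < s by slra.
  by have := is_derive1_sqrt s0.
apply: cvgV; first by rewrite mulf_neq0// gt_eqF//; slra.
by apply: cvgM; [exact: cvg_cst|exact: sqrt_continuous].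
Qed.

Lemma ip_abs (f g : R -> R) : L2I f -> L2I g ->
  itg I01 (fun s => `|f s * g s|) /\ \int[mu]_(s in I01) `|f s * g s| <= nm f * nm g.
Proof.
move=> Lf Lg; split; first by apply: itg_norm; exact: L2_mul.
have E (u : R -> R) : nm (fun s => `|u s|) = nm u.
  by congr Num.sqrt; apply: Rint_eq => r _; rewrite real_normK ?num_real.
rewrite -(E f) -(E g) (Rint_eq (g := fun s => `|f s| * `|g s|)); last by move=> s _; rewrite normrM.
by apply: le_trans (ler_norm _) _; apply: nm_ip; exact: L2_norm.
Qed.

(** [prim_sup] applies to s f^2, whose derivative is f^2 + 2 f (s f'); the contributions are M^2
    from the function, M^2 and 2 M^2 from the derivative. *)
Lemma sqr_sup (f f' : R -> R) (M : R) (s : R) : prim f f' -> L2I f -> L2I (fun s => s * f' s) ->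
  nm f <= M -> nm (fun s => s * f' s) <= M -> 0 < s < 1 -> s * f s ^+ 2 <= 4 * M ^+ 2.
Proof.
move=> pf Lf Lf' fM f'M s01.
have pp : prim (fun s => s * f s ^+ 2) (fun s => f s ^+ 2 + 2 * (f s * (s * f' s))).
  by apply: prim_eq (primM prim_id (primM pf pf)) => r _; ring.
have i1 : itg I01 (fun s => f s ^+ 2) by case: Lf.
have i2 := L2_mul m01 Lf Lf'.
have [i3 n3] := ip_abs Lf Lf'.
have i0 : itg I01 (fun s => s * f s ^+ 2).
  apply: (itg_le (g := fun s => f s ^+ 2)) => //.
    by apply: measurable_funM => //; apply: measurable_funX; case: Lf.
  move=> r; rewrite /= in_itv/= => r01; have r0 : 0 <= r by slra.
  by rewrite (ger0_norm (mulr_ge0 r0 (sqr_ge0 _))) ler_piMl ?sqr_ge0//; slra.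
apply: le_trans (prim_sup pp i0 (itgD m01 i1 (itgZ 2 m01 i2)) s01) _.
have b0 : \int[mu]_(r in I01) (r * f r ^+ 2) <= nm f ^+ 2.
  rewrite nm_sqr; apply: le_Rintegral => // r; rewrite /= in_itv/= => r01.
  by rewrite ler_piMl ?sqr_ge0//; slra.
have b1 : \int[mu]_(r in I01) `|f r ^+ 2 + 2 * (f r * (r * f' r))| <=
    nm f ^+ 2 + 2 * (nm f * nm (fun s => s * f' s)).
  apply: (@le_trans _ _ (\int[mu]_(r in I01) (f r ^+ 2 + 2 * `|f r * (r * f' r)|))).
    apply: le_Rintegral => //; [|by apply: itgD => //; exact: itgZ|].
      by apply: itg_norm; apply: itgD => //; exact: itgZ.
    move=> r _; apply: le_trans (ler_normD _ _) _.
    by rewrite [`|2 * _|]normrM (ger0_norm (sqr_ge0 _)) (ger0_norm (ler0n _ 2)).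
  by rewrite RintegralD//; [rewrite RintegralZl// nm_sqr lerD2l ler_wpM2l|exact: itgZ].
have := nm_ge0 f; have := nm_ge0 (fun s => s * f' s).
move: (nm _) (nm _) (Rintegral _ _ _) (Rintegral _ _ _) fM f'M b0 b1 => x y I J xM yM b0 b1 y0 x0.
by snra.
Qed.

Context {M : R} {a a1 : R -> R}.
Context (M0 : 0 <= M) (pa : prim a a1) (La : L2I a) (nma : nm a <= M)
  (La1 : L2I (fun s => rt s * a1 s)) (nma1 : nm (fun s => rt s * a1 s) <= M).

Lemma sa_L2 : measurable_fun I01 a1 -> L2I (fun s => s * a1 s) /\ nm (fun s => s * a1 s) <= M.
Proof.
move=> m1; have le s : 0 < s < 1 -> `|s * a1 s| <= `|rt s * a1 s|.
  move=> s01; have [r01 sr] := rt_gt0 s01.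
  by rewrite !normrM ler_wpM2r// !ger0_norm; slra.
have L : L2I (fun s => s * a1 s).
  by apply: (L2_le _ _ _ La1) => //; exact: measurable_funM.
by split=> //; apply: le_trans nma1; exact: nm_le.
Qed.

Lemma a1_meas : measurable_fun I01 a1.
Proof.
have mr := meas_rtV.
have [m1 _] := La1.
apply: (eq_measurable_fun (fun s => (rt s)^-1 * (rt s * a1 s))); last exact: measurable_funM.
move=> s /set_mem; rewrite /= in_itv/= => s01; have [r0 _] := rt_gt0 s01.
by rewrite mulrA mulVf ?mul1r// gt_eqF//; slra.
Qed.

Lemma a_sup s : 0 < s < 1 -> s * a s ^+ 2 <= 4 * M ^+ 2.
Proof. by move=> s01; have [L l] := sa_L2 a1_meas; exact: (sqr_sup pa). Qed.

(* Integrate ((s^(1/2) - s) |a|^2)', whose boundary terms are harmless. *)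
Lemma a_wint : itg I01 (fun s => (rt s)^-1 * a s ^+ 2) /\
  \int[mu]_(s in I01) ((rt s)^-1 * a s ^+ 2) <= 14 * M ^+ 2.
Proof.
have mr := meas_rtV.
have ma : measurable_fun I01 a by case: La.
have mi : measurable_fun I01 (fun s => (rt s)^-1 * a s ^+ 2).
  by apply: measurable_funM => //; exact: measurable_funX.
have pos s : 0 < s < 1 -> 0 <= (rt s)^-1 * a s ^+ 2.
  by move=> s01; rewrite mulr_ge0 ?sqr_ge0// invr_ge0 sqrtr_ge0.
pose k s := (2 * rt s)^-1 * a s ^+ 2 - a s ^+ 2 + 2 * (((rt s - s) * a s) * a1 s).
have pk : prim (fun s => (rt s - s) * a s ^+ 2) k.
  by apply: prim_eq (primM (primB prim_rt prim_id) (primM pa pa)) => s _; rewrite /k; ring.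
have i1 : itg I01 (fun s => a s ^+ 2) by case: La.
have [i3 n3] := ip_abs La La1.
have loc (x y : R) : 0 < x -> y < 1 -> itg `[x, y] (fun s => (rt s)^-1 * a s ^+ 2).
  move=> x0 y1; apply: itg_cts_mul; last by apply: (itg_seg01 i1); slra.
  apply: continuous_in_subspaceT => s /set_mem; rewrite /= in_itv/= => sxy.
  apply: cvgV; last exact: sqrt_continuous.
  by rewrite gt_eqF// sqrtr_gt0; slra.
apply: exhaust01 => //.
move=> x y x0 xy y1; split; first exact: loc.
(* For z >= 1/4 one has sqrt z - z <= z, so the boundary term at z is at most 4 M^2 by [a_sup]. The
   remaining terms are at most 3 M^2, whence half of the integral is at most 7 M^2. *)
have key z : x <= z -> 4^-1 <= z < 1 -> \int[mu]_(s in `[x, z]) ((rt s)^-1 * a s ^+ 2) <= 14 * M ^+ 2.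
  move=> xz z1; have z01 : 0 < z < 1 by slra.
  have [iz ez] := pk x z x0 xz (ltac:(slra)).
  have iaz : itg `[x, z] (fun s => a s ^+ 2) by apply: (itg_seg01 i1); slra.
  have i3z : itg `[x, z] (fun s => `|a s * (rt s * a1 s)|) by apply: (itg_seg01 i3); slra.
  have lb : \int[mu]_(s in `[x, z]) (2^-1 * ((rt s)^-1 * a s ^+ 2) - (a s ^+ 2 + 2 * `|a s * (rt s * a1 s)|))
      <= \int[mu]_(s in `[x, z]) k s.
    apply: le_Rintegral => //.
      apply: itgB => //; first by apply: itgZ => //; apply: loc; slra.
      by apply: itgD => //; exact: itgZ.
    move=> s; rewrite /= in_itv/= => sxz; have [r0 sr] := @rt_gt0 s (ltac:(slra)).
    rewrite /k invfM; have : - `|a s * (rt s * a1 s)| <= (rt s - s) * a s * a1 s.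
      have : `|(rt s - s) * a s * a1 s| <= `|a s * (rt s * a1 s)|.
        rewrite !normrM mulrCA -mulrA ler_wpM2r ?mulr_ge0// !ger0_norm; slra.
      by rewrite ler_norml => /andP[].
    by slra.
  have iaa : itg `[x, z] (fun s => a s ^+ 2 + 2 * `|a s * (rt s * a1 s)|) by apply: itgD => //; exact: itgZ.
  move: lb; rewrite RintegralB//; last by apply: itgZ => //; apply: loc; slra.
  rewrite RintegralZl//; last by apply: loc; slra.
  have le2 : \int[mu]_(s in `[x, z]) (a s ^+ 2 + 2 * `|a s * (rt s * a1 s)|) <= 3 * M ^+ 2.
    apply: le_trans (Rint_seg01_le (itgD m01 i1 (itgZ 2 m01 i3)) _ (ltW x0) _) _.
    - by move=> s _; rewrite addr_ge0 ?sqr_ge0// mulr_ge0.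
    - by slra.
    rewrite RintegralD//; last exact: itgZ.
    rewrite RintegralZl// -nm_sqr; have := nm_ge0 a; have := nm_ge0 (fun s => rt s * a1 s).
    by move: n3 nma nma1; move: (nm _) (nm _) (Rintegral _ _ _) => u w I; snra.
  have ub : (rt z - z) * a z ^+ 2 - (rt x - x) * a x ^+ 2 <= 4 * M ^+ 2.
    have A := a_sup z01; have [r0 sr] := rt_gt0 z01; have r2 := rt_sqr z01.
    have [r0' sr'] := @rt_gt0 x (ltac:(slra)).
    have B : 0 <= (rt x - x) * a x ^+ 2 by rewrite mulr_ge0 ?sqr_ge0//; slra.
    have C : (rt z - z) * a z ^+ 2 <= z * a z ^+ 2.
      rewrite ler_wpM2r ?sqr_ge0//; move: (rt z) r0 sr r2 => u u01 zu u2; snra.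
    by slra.
  rewrite -ez => lb; move: (Rintegral _ _ _) (Rintegral _ _ _) lb le2 => I J; move: (M ^+ 2) ub => m; move: (_ * _ - _ * _) => u.
  by slra.
(* A segment that ends before 1/4 is first extended to 1/4. *)
have [y4|y4] := leP 4^-1 y; first by apply: key; slra.
have [x4|x4] := leP x 4^-1.
  apply: le_trans (key 4^-1 x4 _); last by slra.
  rewrite (Rint_cat (a := x) (b := 4^-1) (c := y))//; [|slra|by apply: loc; slra].
  rewrite lerDl; apply: Rintegral_ge0 => s; rewrite /= in_itv/= => s1; apply: pos; slra.
slra.
Qed.

(** [prim_sup] for s^(1/2) a^2: M^2 comes from the function, 7 M^2 and 2 M^2 from its derivative,
    the former by [a_wint]. *)
Lemma a_wsup s : 0 < s < 1 -> rt s * a s ^+ 2 <= 10 * M ^+ 2.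
Proof.
move=> s01; have [iw nw] := a_wint; have [i3 n3] := ip_abs La La1.
have i1 : itg I01 (fun s => a s ^+ 2) by case: La.
have i2 := L2_mul m01 La La1.
pose k s := 2^-1 * ((rt s)^-1 * a s ^+ 2) + 2 * (a s * (rt s * a1 s)).
have pk : prim (fun s => rt s * a s ^+ 2) k.
  by apply: (prim_eq _ _ (primM prim_rt (primM pa pa))) => r _ //; rewrite /k invfM; ring.
have i0 : itg I01 (fun s => rt s * a s ^+ 2).
  apply: (itg_le (g := fun s => a s ^+ 2)) => //.
    by apply: measurable_funM; [exact: meas_rt|apply: measurable_funX; case: La].
  move=> r; rewrite /= in_itv/= => r01; have [r0 sr] := rt_gt0 r01.
  by rewrite (ger0_norm (mulr_ge0 (sqrtr_ge0 _) (sqr_ge0 _))) ler_piMl ?sqr_ge0//; slra.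
have ik : itg I01 k by apply: itgD => //; exact: itgZ.
apply: le_trans (prim_sup pk i0 ik s01) _.
have b0 : \int[mu]_(r in I01) (rt r * a r ^+ 2) <= nm a ^+ 2.
  rewrite nm_sqr; apply: le_Rintegral => // r; rewrite /= in_itv/= => r01; have [r0 sr] := rt_gt0 r01.
  by rewrite ler_piMl ?sqr_ge0//; slra.
have b1 : \int[mu]_(r in I01) `|k r| <= 2^-1 * (14 * M ^+ 2) + 2 * (nm a * nm (fun s => rt s * a1 s)).
  apply: (@le_trans _ _ (\int[mu]_(r in I01) (2^-1 * ((rt r)^-1 * a r ^+ 2) + 2 * `|a r * (rt r * a1 r)|))).
    apply: le_Rintegral => //; [exact: itg_norm|by apply: itgD => //; exact: itgZ|].
    move=> r _; apply: le_trans (ler_normD _ _) _.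
    have z0 : 0 <= (rt r)^-1 * a r ^+ 2 by rewrite mulr_ge0 ?sqr_ge0// invr_ge0 sqrtr_ge0.
    by rewrite [`|2 * _|]normrM (ger0_norm (ler0n _ 2)) lerD2r ger0_norm// mulr_ge0.
  rewrite RintegralD//; [|exact: itgZ|exact: itgZ].
  by rewrite !RintegralZl// lerD// ler_wpM2l.
have := nm_ge0 a; have := nm_ge0 (fun s => rt s * a1 s).
move: nma nma1 b0 b1; move: (nm _) (nm _) (Rintegral _ _ _) (Rintegral _ _ _) => x y I J xM yM b0 b1 y0 x0.
by snra.
Qed.

(** a^4 = (s^(1/2) a^2)(s^(-1/2) a^2) has integral at most 10 * 14 M^4 <= (12 M^2)^2. This places
    the source |a|^2 of the tension equation in L^2. *)
Lemma a_sqr_L2 : L2I (fun s => a s ^+ 2) /\ nm (fun s => a s ^+ 2) <= 12 * M ^+ 2.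
Proof.
have [iw nw] := a_wint; have ma : measurable_fun I01 a by case: La.
have le s : 0 < s < 1 -> (a s ^+ 2) ^+ 2 <= 10 * M ^+ 2 * ((rt s)^-1 * a s ^+ 2).
  move=> s01; have A := a_wsup s01; have [r0 sr] := rt_gt0 s01.
  rewrite [leLHS](_ : _ = a s ^+ 2 * a s ^+ 2)// [leRHS]mulrA ler_wpM2r ?sqr_ge0//.
  by rewrite ler_pdivlMr 1?mulrC//; slra.
have m2 : measurable_fun I01 (fun s => (a s ^+ 2) ^+ 2) by do 2 apply: measurable_funX.
have i4 : itg I01 (fun s => (a s ^+ 2) ^+ 2).
  apply: (itg_le (g := fun s => 10 * M ^+ 2 * ((rt s)^-1 * a s ^+ 2))) => //; last exact: itgZ.
  by move=> s; rewrite /= in_itv/= => s01; rewrite ger0_norm ?sqr_ge0// le.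
split; first by split => //; exact: measurable_funX.
rewrite nm_leP ?mulr_ge0 ?sqr_ge0//.
apply: (@le_trans _ _ (\int[mu]_(s in I01) (10 * M ^+ 2 * ((rt s)^-1 * a s ^+ 2)))).
  by apply: le_Rintegral => //; exact: itgZ.
rewrite RintegralZl//; apply: le_trans (ler_wpM2l _ nw) _; first by rewrite mulr_ge0 ?sqr_ge0.
by have := sqr_ge0 (M ^+ 2); move: (M ^+ 2) => m; rewrite !expr2; lra.
Qed.

End Slices.

(** * Lipschitz dependence on time *)

Section Lipschitz.
Context {R : realType}.
Local Notation mu := (@lebesgue_measure R).
Local Notation itg D f := (mu.-integrable D (EFin \o f)).
Local Notation I01 := (`]@GRing.zero R, @GRing.one R[%classic).
Local Notation L2I := (L2 I01).
Local Notation rt := (@Num.sqrt R).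

Let m01 : measurable I01. Proof. exact: measurable_itv. Qed.

Lemma trap_meas (a b d : R) : measurable_fun I01 (trap a b d).
Proof. by apply: measurable_funTS; apply: continuous_measurable_fun; exact: smooth_continuous (smooth_trap _ _ _). Qed.

Lemma prim_trap (a b d : R) : prim (trap a b d) (fun s => molli a d s - molli b d s).
Proof.
apply: prim_C1 => s _; first exact: is_derive_trap.
by apply: cvgB; exact: (smooth_continuous (smooth_molli _ _)).
Qed.

(** For a cut-off chi with values in [0, 1], |chi f|^2 <= int chi f^2 <= K |chi f| in norm, so |chi
    f| <= K; then (0, 1) is exhausted. The cut-off is what makes test functions built from [f]
    itself admissible. *)
Lemma trap_nm (f : R -> R) (K : R) : L2I f -> 0 <= K ->
  (forall a b d : R, 0 < d -> 0 < a -> a <= b -> b + d < 1 ->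
     \int[mu]_(s in I01) (trap a b d s * f s ^+ 2) <= K * nm (fun s => trap a b d s * f s)) ->
  nm f <= K.
Proof.
move=> Lf K0 h; rewrite nm_leP//; have [mf if2] := Lf.
have := @exhaust01 _ (fun s => f s ^+ 2) (K ^+ 2) (measurable_funX 2 mf) (fun s _ => sqr_ge0 (f s)).
move=> H; suff /H[] : forall x y : R, 0 < x -> x <= y -> y < 1 -> itg `[x, y] (fun s => f s ^+ 2) /\
    \int[mu]_(s in `[x, y]) (f s ^+ 2) <= K ^+ 2 by [].
move=> x y x0 xy y1; split; first by apply: (itg_seg01 if2); slra.
pose d := Num.min (x / 2) ((1 - y) / 2).
have [d0 d1 d2] : [/\ 0 < d, d <= x / 2 & d <= (1 - y) / 2].
  by rewrite /d lt_min ge_min lexx ge_min lexx orbT; split => //; slra.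
clearbody d; set chi := trap (x - d) y d.
have c0 s : 0 <= chi s by apply: trap_ge0 => //; slra.
have c1 s : chi s <= 1 by exact: trap_le1.
have cxy s : x <= s <= y -> chi s = 1 by move=> sxy; apply: trap1 => //; slra.
have mc : measurable_fun I01 chi by exact: trap_meas.
have Lc : L2I (fun s => chi s * f s).
  by apply: (L2_bndM (M := 1)) => // s _; rewrite ger0_norm.
have ic : itg I01 (fun s => chi s * f s ^+ 2).
  apply: (itg_le (g := fun s => f s ^+ 2)) => //; first by apply: measurable_funM => //; exact: measurable_funX.
  by move=> s _; rewrite (ger0_norm (mulr_ge0 (c0 s) (sqr_ge0 _))) ler_piMl ?sqr_ge0.
have le1 : nm (fun s => chi s * f s) ^+ 2 <= \int[mu]_(s in I01) (chi s * f s ^+ 2).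
  rewrite nm_sqr; apply: le_Rintegral => //; first by case: Lc.
  by move=> s _; rewrite exprMn ler_wpM2r ?sqr_ge0// expr2 ler_piMl.
have le2 := h (x - d) y d d0 (ltac:(slra)) (ltac:(slra)) (ltac:(slra)).
have nK : nm (fun s => chi s * f s) <= K.
  move: (le_trans le1 le2); rewrite -/chi expr2; have := nm_ge0 (fun s => chi s * f s).
  by move: (nm _) => z z0 zz; rewrite leNgt; apply/negP => lt; snra.
apply: (@le_trans _ _ (nm (fun s => chi s * f s) ^+ 2)); last by rewrite lerXn2r ?nnegrE ?nm_ge0.
have [_ Lc2] := Lc.
have -> : \int[mu]_(s in `[x, y]) (f s ^+ 2) = \int[mu]_(s in `[x, y]) ((chi s * f s) ^+ 2).
  by apply: eq_Rintegral => s /set_mem; rewrite /= in_itv/= => /cxy->; rewrite mul1r.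
rewrite nm_sqr; apply: Rint_seg01_le => //; [by move=> s _; exact: sqr_ge0|slra|slra].
Qed.

Lemma parts_cpt (u u' phi phi' : R -> R) (x y : R) : 0 < x -> y < 1 -> prim u u' -> prim phi phi' ->
  (forall s, ~~ (x <= s <= y) -> phi s = 0) -> itg I01 (fun s => u s * phi' s) ->
  itg I01 (fun s => u' s * phi s) ->
  \int[mu]_(s in I01) (u s * phi' s) = - \int[mu]_(s in I01) (u' s * phi s).
Proof.
move=> x0 y1 pu pp out i1 i2; apply/eqP; rewrite -addr_eq0 addrC -RintegralD//; apply/eqP.
have := prim_parts (primM pu pp) (itgD m01 i2 i1) (l0 := 0) (l1 := 0).
rewrite subrr; apply.
  apply: (@cvg_trans _ ((fun=> 0 : R) @ (0 : R)^'+)); last exact: cvg_cst.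
  apply: near_eq_cvg; near=> s; rewrite out ?mulr0//.
  by rewrite negb_and -!ltNge; apply/orP; left; near: s; exact: nbhs_right_lt.
apply: (@cvg_trans _ ((fun=> 0 : R) @ (1 : R)^'-)); last exact: cvg_cst.
apply: near_eq_cvg; near=> s; rewrite out ?mulr0//.
by rewrite negb_and -!ltNge; apply/orP; right; near: s; exact: nbhs_left_gt.
Unshelve. all: by end_near. Qed.

(** Times satisfying [G] have full measure; both times are approximated by such times and the
    continuity of [g] is used. *)
Lemma lip_dense (T C : R) (G : R -> Prop) (g : R -> R -> R) : 0 <= C ->
  {ae mu, forall t, 0 < t < T -> G t} ->
  (forall t, 0 <= t <= T -> L2I (g t)) -> tcts T g ->
  (forall t r, 0 < t < T -> 0 < r < T -> G t -> G r -> t <= r -> nm (fun s => g r s - g t s) <= C * (r - t)) ->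
  forall t r, 0 < t < T -> 0 < r < T -> nm (fun s => g r s - g t s) <= C * `|r - t|.
Proof.
move=> C0 aeG Lg cg h t r tT rT; apply/ler_addgt0Pr => e e0.
(* Replacing the two times costs 2 e' in norm and lengthens |r - t| by at most 2 e'. *)
pose e' := e / (2 * C + 3).
have K0 : 0 < 2 * C + 3 by slra.
have e'0 : 0 < e' by rewrite divr_gt0.
have ap t1 : 0 < t1 < T -> exists2 t', 0 < t' < T /\ `|t' - t1| <= e' & G t' /\ nm (fun s => g t' s - g t1 s) <= e'.
  move=> t1T; have [d d0 hd] := cg t1 (ltac:(slra)) e' e'0.
  have lt : t1 < Num.min T (t1 + Num.min d e') by rewrite !lt_min ltrDl lt_min d0 e'0 andbT; slra.
  have [x + Gx] := ae_dense lt aeG; rewrite lt_min => /and3P[tx xT xd].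
  have m1 : Num.min d e' <= d by rewrite ge_min lexx.
  have m2 : Num.min d e' <= e' by rewrite ge_min lexx orbT.
  move: (Num.min d e') m1 m2 xd => m m1 m2 xd.
  exists x; first by rewrite ger0_norm; slra.
  by split; [apply: Gx; slra|apply: hd; [slra|rewrite gtr0_norm; slra]].
have [t' [t'T tt] [Gt' nt]] := ap t tT; have [r' [r'T rr] [Gr' nr]] := ap r rT.
have sym : nm (fun s => g r' s - g t' s) <= C * `|r' - t'|.
  have [le|/ltW le] := leP t' r'; first by rewrite ger0_norm ?subr_ge0//; exact: h.
  by rewrite nmBC distrC ger0_norm ?subr_ge0//; exact: h.
have [L1 L2' L3 L4] : [/\ L2I (g r), L2I (g r'), L2I (g t') & L2I (g t)] by split; apply: Lg; slra.
have T1 := nm_tri L1 L2' L4; have T2 := nm_tri L2' L3 L4; rewrite nmBC in nr.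
have N : `|r' - t'| <= `|r - t| + 2 * e'.
  by move: tt rr; rewrite !ler_norml => /andP[? ?] /andP[? ?]; have := ler_norm (r - t); have := ler_norm (t - r); rewrite (distrC t r); slra.
have N2 : C * `|r' - t'| <= C * (`|r - t| + 2 * e') by rewrite ler_wpM2l.
have E : e = (2 * C + 3) * e' by rewrite /e' mulrCA divff ?mulr1// gt_eqF.
rewrite E; clearbody e'; slra.
Qed.

(** The weight in s g' is harmless on the support of the cut-off, where s >= x. *)
Lemma cut_prim (g g' : R -> R) (x y d : R) : 0 < d -> 0 < x -> x <= y -> y + d < 1 ->
  prim g g' -> L2I g -> L2I (fun s => s * g' s) -> measurable_fun I01 g' ->
  let phi s := trap x y d s * g s in
  L2I phi /\ exists2 phi', prim phi phi' & L2I phi'.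
Proof.
move=> d0 x0 xy y1 pg Lg Lg' mg' phi; have mt := trap_meas x y d.
have t0 s : 0 <= trap x y d s by exact: trap_ge0.
have t1 s : trap x y d s <= 1 by exact: trap_le1.
split; first by apply: (L2_bndM (M := 1)) => // s _; rewrite ger0_norm.
exists (fun s => (molli x d s - molli y d s) * g s + trap x y d s * g' s).
  exact: primM (prim_trap x y d) pg.
have mm z : measurable_fun I01 (molli z d).
  by apply: measurable_funTS; apply: continuous_measurable_fun; exact: smooth_continuous (smooth_molli _ _).
apply: L2D => //.
  apply: (L2_bndM (M := 2 * (bumpc^-1 / d))) => //; first exact: measurable_funB.
  move=> s _; apply: le_trans (ler_normB _ _) _.
  have h z : `|molli z d s| <= bumpc^-1 / d by rewrite ger0_norm ?molli_ge0// molli_le.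
  by have := h x; have := h y; slra.
apply: (L2_le _ _ _ (L2Z x^-1 m01 Lg')) => //; first exact: measurable_funM.
move=> s; rewrite /= in_itv/= => s01; have [xs|sx] := leP x s; last first.
  by rewrite trap_out// ?mul0r ?normr0// negb_and -!ltNge sx.
rewrite mulrA [leLHS]normrM [leRHS]normrM ler_wpM2r// (ger0_norm (t0 s)); apply: le_trans (t1 s) _.
by rewrite ger0_norm ?mulr_ge0 ?invr_ge0 ?(ltW x0)//; [rewrite ler_pdivlMl// mulr1|slra].
Qed.

Lemma sqL2 (f : R -> R) : measurable_fun I01 f -> L2I (fun s => rt s * f s) -> L2I (fun s => s * f s).
Proof.
move=> mf L; apply: (L2_le _ _ _ L) => //; first exact: measurable_funM.
move=> s; rewrite /= in_itv/= => s01; have [r01 sr] := rt_gt0 s01.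
by rewrite !normrM ler_wpM2r// !ger0_norm; slra.
Qed.

Context {n : nat} {T M : R} {v p w a : 'I_n -> R -> R -> R} {tau sig : R -> R -> R}.
Context (ev : evolution T M v p w a tau sig).

Let M0 : 0 <= M. Proof. exact: ev_M ev. Qed.
Let T0 : 0 < T. Proof. exact: ev_T ev. Qed.
Local Notation C1 := (@C1 R n M).
Local Notation C2 := (@C2 R n M).
Local Notation flux := (flux (v := v) (tau := tau)).
Local Notation dflux := (dflux (v := v) (p := p) (tau := tau) (sig := sig)).
Local Notation good t := (forall i, good_slice M (p i t) (a i t)).

(** One summand for each of the terms q tau v, |a|^2 v, 2 tau' p and tau p' of (tau v)''. *)
Definition C4 : R := C1 * (n%:R * (4 * M ^+ 2)) + n%:R * (12 * M ^+ 2) + 2 * (C2 * M) + C1 * M.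

Lemma C4_ge0 : 0 <= C4.
Proof.
have K1 := C1_ge0 (R := R) (n := n) (M := M); have K2 := C2_ge0 ev.
by rewrite /C4; have := sqr_ge0 M; move=> m0; rewrite !addr_ge0// !mulr_ge0//.
Qed.

Lemma p_sup t s i : good t -> 0 < s < 1 -> s * p i t s ^+ 2 <= 4 * M ^+ 2.
Proof. by move=> /(_ i)[p2 [a1 [[pp _] [Lp np] _ [Lp2 np2] _]]]; exact: (sqr_sup pp Lp Lp2 np np2). Qed.

Lemma nm_sum_le m (f : 'I_m -> R -> R) (K : R) : (forall i, L2I (f i)) -> (forall i, nm (f i) <= K) ->
  nm (fun s => \sum_i f i s) <= m%:R * K.
Proof.
elim: m f => [|m ih] f Lf fK.
  by rewrite (nm_ext (g := fun=> 0)) ?nm_cst ?normr0 ?mul0r// => s _; rewrite big_ord0.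
rewrite (nm_ext (g := fun s => \sum_(i < m) f (widen_ord (leqnSn m) i) s + f ord_max s)); last first.
  by move=> s _; rewrite big_ord_recr.
apply: le_trans (nmD (L2_sum m01 (fun i => Lf _)) (Lf _)) _.
by rewrite mulrSr mulrDl mul1r lerD// ih.
Qed.

(** At a good time the degeneracy tau <= C1 s compensates for both singular factors: s |p|^2 is
    bounded and s p' is in L^2. *)
Lemma F2_good t i : 0 < t < T -> good t ->
  exists F2, [/\ prim (dflux i t) F2, L2I F2 & nm F2 <= C4].
Proof.
move=> tT gt; have tT' : 0 <= t <= T by slra.
have K1 := C1_ge0 (R := R) (n := n) (M := M); have K2 := C2_ge0 ev.
have [p2 [a1 [[pp _] [Lp np] _ [Lp2 np2] _]]] := gt i.
have [pt ps t0 s1] := ev_tau ev tT; have pv := ev_v ev i tT'.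
have mt := prim_meas pt; have ms := prim_meas ps; have mv := prim_meas pv.
have [mq _] := psq_int ev tT'.
have tb s : 0 < s < 1 -> 0 <= tau t s <= C1 * s by move=> s01; have H := tau_bnd ev tT s01; exact H.
(* (tau v)'' = (|p|^2 tau - |a|^2) v + 2 tau' p + tau p' *)
pose A s := (psq (p := p) t s * tau t s) * v i t s.
pose B s := asq (a := a) t s * v i t s.
pose D s := sig t s * p i t s.
pose E s := tau t s * p2 s.
have mA : measurable_fun I01 A by do 2 apply: measurable_funM => //.
have bA s : 0 < s < 1 -> `|A s| <= C1 * (n%:R * (4 * M ^+ 2)).
  move=> s01; have /andP[t1 t2] := tb s s01; have q0 := psq_ge0 (p := p) t s.
  have sq : s * psq (p := p) t s <= n%:R * (4 * M ^+ 2).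
    rewrite /psq mulr_sumr; apply: (@le_trans _ _ (\sum_(j < n) (4 * M ^+ 2))).
      by apply: ler_sum => j _; exact: p_sup.
    by rewrite sumr_const card_ord -[leLHS]mulr_natl.
  rewrite normrM -[leRHS]mulr1 ler_pM//; last exact: (v_le1 ev).
  rewrite (ger0_norm (mulr_ge0 q0 t1)); apply: le_trans (ler_wpM2l q0 t2) _.
  by rewrite mulrCA ler_wpM2l// mulrC.
have K3 : 0 <= C1 * (n%:R * (4 * M ^+ 2)) by rewrite !mulr_ge0 ?sqr_ge0.
have LA := L2_bnd01 mA bA; have nA := nm_bnd mA bA; rewrite (ger0_norm K3) in nA.
have Lai j : L2I (fun s => a j t s ^+ 2) /\ nm (fun s => a j t s ^+ 2) <= 12 * M ^+ 2.
  have [p2' [a1' [[_ pa] _ na _ [La1 na1]]]] := gt j.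
  exact: (a_sqr_L2 M0 pa (ev_a ev j tT') na La1 na1).
have Lh : L2I (asq (a := a) t) by apply: L2_sum => // j; have [] := Lai j.
have nh : nm (asq (a := a) t) <= n%:R * (12 * M ^+ 2) by apply: nm_sum_le => j; have [] := Lai j.
have LB : L2I B.
  apply: (L2_le _ _ _ Lh) => //; first by apply: measurable_funM => //; case: Lh.
  move=> s; rewrite /= in_itv/= => s01; rewrite normrM ler_piMr//; exact: (v_le1 ev).
have nB : nm B <= n%:R * (12 * M ^+ 2).
  apply: le_trans nh; apply: nm_le => // s s01; rewrite normrM ler_piMr//; exact: (v_le1 ev).
have mp : measurable_fun I01 (p i t) by case: Lp.
have LD : L2I D by apply: (L2_bndM (M := C2)) => // s; rewrite /= in_itv/=; exact: (sig_bnd ev).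
have nD : nm D <= C2 * M.
  apply: (@le_trans _ _ (nm (fun s => C2 * p i t s))).
    apply: nm_le => //; first exact: L2Z.
    by move=> s s01; rewrite [leLHS]normrM [leRHS]normrM ler_wpM2r// (ger0_norm K2); exact: (sig_bnd ev).
  by rewrite nmZ// (ger0_norm K2) ler_wpM2l.
have mp2 : measurable_fun I01 p2.
  have [m _] := Lp2; apply: (eq_measurable_fun (fun s : R => s^-1 * (s * p2 s))).
    by move=> s /set_mem; rewrite /= in_itv/= => s01; rewrite mulrA mulVf ?mul1r// gt_eqF//; slra.
  by apply: measurable_funM => //; exact: prim_meas prim_inv.
have bE s : 0 < s < 1 -> `|E s| <= `|C1 * (s * p2 s)|.
  move=> s01; have /andP[t1 t2] := tb s s01; rewrite mulrA [leLHS]normrM [leRHS]normrM ler_wpM2r//.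
  by rewrite (ger0_norm t1); apply: le_trans t2 _; exact: ler_norm.
have LE : L2I E.
  apply: (L2_le _ _ _ (L2Z C1 m01 Lp2)) => //; first exact: measurable_funM.
have nE : nm E <= C1 * M.
  apply: le_trans (nm_le LE (L2Z C1 m01 Lp2) bE) _.
  by rewrite nmZ// (ger0_norm K1) ler_wpM2l.
exists (fun s => A s - B s + 2 * D s + E s).
have LAB := L2B m01 LA LB; have L2D' := L2Z 2 m01 LD; have LABD := L2D m01 LAB L2D'.
split.
- by apply: (prim_eq _ _ (primD (primM ps pv) (primM pt pp))) => s _ //; rewrite /A /B /D /E /psq /asq; ring.
- exact: L2D.
- apply: le_trans (nmD LABD LE) _; apply: lerD nE; apply: le_trans (nmD LAB L2D') _.
  apply: lerD; last by rewrite nmZ// ger0_norm// ler_wpM2l.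
  apply: le_trans (nmD LA (L2N m01 LB)) _; rewrite nmN; exact: lerD.
Qed.

Lemma int_diff (f g phi : R -> R) : L2I f -> L2I g -> L2I phi ->
  \int[mu]_(s in I01) (f s * phi s) - \int[mu]_(s in I01) (g s * phi s) =
  \int[mu]_(s in I01) ((f s - g s) * phi s).
Proof.
move=> Lf Lg Lp; rewrite -RintegralB//; [|exact: L2_mul|exact: L2_mul].
by apply: Rint_eq => s _; rewrite mulrBl.
Qed.

(* By duality: the increment D of a between two good times is tested against D itself,
   cut off near the end points, and integration by parts turns the pairing
   with a into one with w. *)
Lemma lip_a i t r : 0 < t < T -> 0 < r < T -> nm (fun s => a i r s - a i t s) <= C4 * `|r - t|.
Proof.
have K4 := C4_ge0.
apply: (lip_dense K4 (ev_good ev) (ev_a ev i) (ev_ac ev i)) => {}t {}r tT rT gt gr tr.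
have [tT' rT'] : 0 <= t <= T /\ 0 <= r <= T by slra.
have [pt [at1 [[_ pat] _ _ _ [Lat _]]]] := gt i.
have [pr [ar1 [[_ par] _ _ _ [Lar _]]]] := gr i.
have [mat mar] := (a1_meas Lat, a1_meas Lar).
have [Lt Lr] := (ev_a ev i tT', ev_a ev i rT').
have LD := L2B m01 Lr Lt.
have LD' : L2I (fun s => s * (ar1 s - at1 s)).
  apply: sqL2; first exact: measurable_funB.
  apply: L2_ae_eq (L2B m01 Lar Lat) => //.
    by apply: measurable_funM; [exact: meas_rt|exact: measurable_funB].
  by exists set0; split => // s /=; apply: contra_notP => _ _; rewrite mulrBr.
have K5 : 0 <= C4 * (r - t) by rewrite mulr_ge0//; slra.
apply: trap_nm => // x y d d0 x0 xy y1.
have [Lphi [phi' pphi Lphi']] := cut_prim d0 x0 xy y1 (primB par pat) LD LD' (measurable_funB mar mat).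
set phi := fun s => trap x y d s * _ in Lphi pphi *.
have out s : ~~ (x <= s <= y + d) -> phi s = 0 by move=> h; rewrite /phi trap_out ?mul0r.
have parts (u u' : R -> R) : prim u u' -> L2I u -> L2I u' ->
    \int[mu]_(s in I01) (u s * phi' s) = - \int[mu]_(s in I01) (u' s * phi s).
  by move=> pu Lu Lu'; apply: (parts_cpt x0 y1 pu pphi out); exact: L2_mul.
have [t0 rT2] : 0 < t /\ r < T by slra.
have := @ev_dw _ _ _ _ _ _ _ _ _ _ ev i phi' Lphi' t r (- (C4 * nm phi)) (C4 * nm phi) t0 tr rT2.
have A : {ae mu, forall rho, t < rho < r -> - (C4 * nm phi) <=
    \int[mu]_(s in I01) ((sig rho s * v i rho s + tau rho s * p i rho s) * phi' s) <= C4 * nm phi}.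
  apply: (filterS_ae (ev_good ev)) => rho h rhoT; have rT0 : 0 < rho < T by slra.
  have [F2 [pF2 LF2 nF2]] := F2_good i rT0 (h rT0).
  rewrite -ler_norml; have E := parts _ _ pF2 (F1_L2 ev i rT0) LF2; rewrite /dflux in E.
  rewrite E normrN; apply: le_trans (nm_ip LF2 Lphi) _.
  by rewrite ler_wpM2r ?nm_ge0.
move=> /(_ A); clear A; have [pwt _] := ev_w ev i tT'; have [pwr _] := ev_w ev i rT'.
have [_ Lwt] := w_L2 ev i tT'; have [_ Lwr] := w_L2 ev i rT'.
rewrite (parts _ _ pwt Lwt Lt) (parts _ _ pwr Lwr Lr).
have -> : \int[mu]_(s in I01) (trap x y d s * (a i r s - a i t s) ^+ 2) =
    \int[mu]_(s in I01) (a i r s * phi s) - \int[mu]_(s in I01) (a i t s * phi s).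
  by rewrite int_diff//; apply: Rint_eq => s _; rewrite /phi; ring.
rewrite -/phi; move: (Rintegral _ _ _) (Rintegral _ _ _) (nm phi) C4 => I J z c; slra.
Qed.

(** The duality of [lip_a] one level lower: p is turned into v, whose increments are integrals of a,
    and a into a'. The test function is s times the increment of p, cut off; the factor s is shared
    as s^(1/2) between the two factors of the pairing, so that s^(1/2) a' in L^2 suffices. *)
Lemma lip_p i t r : 0 < t < T -> 0 < r < T ->
  nm (fun s => rt s * p i r s - rt s * p i t s) <= M * `|r - t|.
Proof.
apply: (lip_dense M0 (ev_good ev) (ev_p ev i) (ev_pc ev i)) => {}t {}r tT rT gt gr tr.
have [tT' rT'] : 0 <= t <= T /\ 0 <= r <= T by slra.
have [pt2 [at1 [[ppt _] [Lpt _] _ [Lpt2 _] _]]] := gt i.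
have [pr2 [ar1 [[ppr _] [Lpr _] _ [Lpr2 _] _]]] := gr i.
have [mpt mpr] := (ev_pm ev i tT', ev_pm ev i rT').
have m2 (f : R -> R) : L2I (fun s => s * f s) -> measurable_fun I01 f.
  move=> [m _]; apply: (eq_measurable_fun (fun s : R => s^-1 * (s * f s))).
    by move=> s /set_mem; rewrite /= in_itv/= => s01; rewrite mulrA mulVf ?mul1r// gt_eqF//; slra.
  by apply: measurable_funM => //; exact: prim_meas prim_inv.
have [mp2t mp2r] := (m2 _ Lpt2, m2 _ Lpr2).
pose D s := p i r s - p i t s; pose D' s := pr2 s - pt2 s.
have LD : L2I D by exact: L2B.
have LsD : L2I (fun s => s * D s).
  by apply: (L2_bndM (M := 1)) => // s; rewrite /= in_itv/= => s01; rewrite ger0_norm; slra.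
have LsD' : L2I (fun s => s * D' s).
  apply: L2_ae_eq (L2B m01 Lpr2 Lpt2) => //.
    by apply: measurable_funM => //; exact: measurable_funB.
  by exists set0; split => // s /=; apply: contra_notP => _ _; rewrite mulrBr.
have pg : prim (fun s => s * D s) (fun s => 1 * D s + s * D' s) by exact: primM prim_id (primB ppr ppt).
have Lg' : L2I (fun s => s * (1 * D s + s * D' s)).
  have L3 : L2I (fun s => s * (s * D' s)).
    by apply: (L2_bndM (M := 1)) => // s; rewrite /= in_itv/= => s01; rewrite ger0_norm; slra.
  have mD : measurable_fun I01 D by case: LD.
  apply: L2_ae_eq (L2D m01 LsD L3) => //.
    apply: measurable_funM => //; apply: measurable_funD; first exact: measurable_funM.
    by case: LsD'.
  by exists set0; split => // s /=; apply: contra_notP => _ _; ring.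
have mg' : measurable_fun I01 (fun s => 1 * D s + s * D' s).
  apply: measurable_funD; last by case: LsD'.
  by apply: measurable_funM => //; case: LD.
have K5 : 0 <= M * (r - t) by rewrite mulr_ge0//; slra.
have Lf := L2B m01 (ev_p ev i rT') (ev_p ev i tT').
apply: trap_nm => // x y d d0 x0 xy y1.
have [Lphi [phi' pphi Lphi']] := cut_prim d0 x0 xy y1 pg LsD Lg' mg'.
set phi := fun s => trap x y d s * _ in Lphi pphi *.
set f := fun s => trap x y d s * (rt s * p i r s - rt s * p i t s).
have Lff : L2I f.
  apply: (L2_bndM (M := 1)) => //; first exact: trap_meas.
  by move=> s _; rewrite ger0_norm ?trap_ge0 ?trap_le1.
have phiE s : 0 < s < 1 -> phi s = rt s * f s.
  by move=> s01; rewrite /phi /f /D -[X in _ * (X * _) = _](rt_sqr s01); ring.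
have out s : ~~ (x <= s <= y + d) -> phi s = 0 by move=> h; rewrite /phi trap_out ?mul0r.
have [t0 rT2] : 0 < t /\ r < T by slra.
have := @ev_dv2 _ _ _ _ _ _ _ _ _ _ ev i phi' Lphi' t r (- (M * nm f)) (M * nm f) t0 tr rT2.
have A : {ae mu, forall rho, t < rho < r -> - (M * nm f) <=
    \int[mu]_(s in I01) (a i rho s * phi' s) <= M * nm f}.
  apply: (filterS_ae (ev_good ev)) => rho h rhoT; have rT0 : 0 < rho < T by slra.
  have [p2 [a1 [[_ pa] _ _ _ [La1 na1]]]] := h rT0 i.
  have La : L2I (a i rho) by apply: (ev_a ev i); slra.
  have E s : 0 < s < 1 -> a1 s * phi s = (rt s * a1 s) * f s by move=> s01; rewrite phiE//; ring.
  have i2 : itg I01 (fun s => a1 s * phi s).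
    by apply: itg_eq (L2_mul m01 La1 Lff) => // s; rewrite /= in_itv/= => /E.
  rewrite -ler_norml (parts_cpt x0 y1 pa pphi out)//; last exact: L2_mul.
  rewrite normrN (Rint_eq E); apply: le_trans (nm_ip La1 Lff) _.
  by rewrite ler_wpM2r ?nm_ge0.
move=> /(_ A); clear A.
have parts z : 0 <= z <= T -> L2I (p i z) ->
    \int[mu]_(s in I01) (v i z s * phi' s) = - \int[mu]_(s in I01) (p i z s * phi s).
  move=> xT Lp; apply: (parts_cpt x0 y1 (ev_v ev i xT) pphi out); apply: L2_mul => //; exact: (v_L2 ev).
rewrite (parts t)// (parts r)//.
have -> : \int[mu]_(s in I01) (trap x y d s * (rt s * p i r s - rt s * p i t s) ^+ 2) =
    \int[mu]_(s in I01) (p i r s * phi s) - \int[mu]_(s in I01) (p i t s * phi s).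
  by rewrite int_diff//; apply: Rint_eq => s s01; rewrite phiE// /f; ring.
by move: (Rintegral _ _ _) (Rintegral _ _ _) (nm f) => I J z; slra.
Qed.

(** [tau_comp] for the increment (C4 + M) |r - t|, which dominates those of both [lip_a] and
    [lip_p]. *)
Definition C6 : R := n%:R * ((C1 + 1) * (2 * M * (C4 + M))).

Lemma C6_ge0 : 0 <= C6.
Proof.
have K1 := C1_ge0 (R := R) (n := n) (M := M); have K4 := C4_ge0.
have h1 : 0 <= C1 + 1 by slra.
by rewrite /C6; do ![apply: mulr_ge0 => //]; exact: addr_ge0.
Qed.

Lemma lip_tau t r s : 0 < t < T -> 0 < r < T -> 0 < s < 1 ->
  `|tau r s - tau t s| <= s * (C6 * `|r - t|).
Proof.
move=> tT rT s01; have K4 := C4_ge0; have d0 := normr_ge0 (r - t).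
have := tau_comp ev (e := (C4 + M) * `|r - t|) tT rT _ _ s01.
rewrite /C6 (_ : n%:R * ((C1 + 1) * (2 * M * (C4 + M))) * `|r - t| =
  n%:R * ((C1 + 1) * (2 * M * ((C4 + M) * `|r - t|)))); last by ring.
apply => i; first by apply: le_trans (lip_p i tT rT) _; rewrite ler_wpM2r// lerDr.
by apply: le_trans (lip_a i tT rT) _; rewrite ler_wpM2r// lerDl.
Qed.

End Lipschitz.

(** * The curvature at the fixed end *)

Section EndPoint.
Context {R : realType}.
Local Notation mu := (@lebesgue_measure R).
Local Notation itg D f := (mu.-integrable D (EFin \o f)).
Local Notation I01 := (`]@GRing.zero R, @GRing.one R[%classic).
Local Notation L2I := (L2 I01).
Local Notation rt := (@Num.sqrt R).

Let m01 : measurable I01. Proof. exact: measurable_itv. Qed.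

Lemma seg_cs (f : R -> R) (s : R) : L2I f -> 0 <= s <= 1 ->
  `|\int[mu]_(r in `[s, 1]) f r| <= rt (1 - s) * nm f.
Proof.
move=> [mf if2] s01; have i1 : itg I01 f by apply: L2_itg => //; exact: mu01_lty.
have is1 : itg `[s, 1] f by apply: (itg_seg01 i1); slra.
have is2 : itg `[s, 1] (fun r => f r ^+ 2) by apply: (itg_seg01 if2); slra.
have ms : measurable (`[s, 1]%classic : set R) by exact: measurable_itv.
have Ls : L2 `[s, 1] f by split => //; exact: itg_meas is1.
have Lc : L2 `[s, 1] (fun=> 1 : R) by split => //; exact: itg_seg_cst.
have H := cauchy_schwarz ms Ls Lc.
have E1 : \int[mu]_(r in `[s, 1]) (f r * 1) = \int[mu]_(r in `[s, 1]) f r.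
  by apply: eq_Rintegral => r _; rewrite mulr1.
have E2 : \int[mu]_(r in `[s, 1]) (1 ^+ 2) = 1 - s :> R.
  by rewrite Rint_seg_cst ?expr1n ?mul1r//; case/andP: s01.
rewrite E1 E2 in H; have le : \int[mu]_(r in `[s, 1]) (f r ^+ 2) <= nm f ^+ 2.
  by rewrite nm_sqr; apply: Rint_seg01_le => //; [move=> r _; exact: sqr_ge0|slra].
have r2 : rt (1 - s) ^+ 2 = 1 - s by rewrite sqr_sqrtr//; slra.
have r0 : 0 <= rt (1 - s) by exact: sqrtr_ge0.
rewrite -(ler_pXn2r (n := 2))// ?nnegrE ?mulr_ge0 ?nm_ge0//.
rewrite real_normK ?num_real// exprMn r2; apply: le_trans H _.
by rewrite mulrC ler_wpM2l//; slra.
Qed.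

Lemma molli_test (x d : R) : 0 < d -> 0 < x -> x + d < 1 -> exists psi',
  [/\ prim (molli x d) psi', L2I psi', L2I (molli x d), molli x d s @[s --> 1^'-] --> (0 : R) &
      \int[mu]_(s in I01) molli x d s = 1].
Proof.
move=> d0 x0 xd; have [g sg hg] := smooth_derive (smooth_molli x d).
have cg := smooth_continuous sg; have cm := smooth_continuous (smooth_molli x d).
have bnd (f : R -> R) : continuous f -> L2I f.
  move=> cf; have [B hB] := within_cts_bnd (continuous_subspaceT cf : {within `[0, 1], continuous f}).
  apply: (L2_bnd01 (c := B)); first by apply: measurable_funTS; exact: continuous_measurable_fun.
  by move=> s s01; apply: hB; slra.
have sub : `[x, x + d]%classic `<=` I01 by move=> s; rewrite /= !in_itv/=; slra.
exists g; split; [|exact: bnd|exact: bnd| |].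
- by apply: (prim_C1 (fun s _ => hg s)) => s _; exact: cg.
- apply: (@cvg_trans _ ((fun=> 0 : R) @ (1 : R)^'-)); last exact: cvg_cst.
  apply: near_eq_cvg; near=> s; rewrite molli_out//.
  by rewrite negb_and -!ltNge; apply/orP; right; near: s; exact: nbhs_left_gt.
- rewrite (Rint_supp _ _ sub)//; first exact: molli_int.
    by apply: measurable_funTS; exact: continuous_measurable_fun.
  by move=> s _; exact: molli_out.
Unshelve. all: by end_near. Qed.

Context {n : nat} {T M : R} {v p w a : 'I_n -> R -> R -> R} {tau sig : R -> R -> R}.
Context (ev : evolution T M v p w a tau sig).

Let M0 : 0 <= M. Proof. exact: ev_M ev. Qed.
Let T0 : 0 < T. Proof. exact: ev_T ev. Qed.
Local Notation flux := (flux (v := v) (tau := tau)).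
Local Notation dflux := (dflux (v := v) (p := p) (tau := tau) (sig := sig)).
Local Notation good t := (forall i, good_slice M (p i t) (a i t)).
Local Notation C4 := (@C4 R n M).

(** Since w vanishes at s = 1 and its derivative a is Lipschitz in time, Cauchy-Schwarz on [s, 1]
    makes the Lipschitz constant of w decay like (1 - s)^(1/2). *)
Lemma w_lip i t r s : 0 < t < T -> 0 < r < T -> 0 < s < 1 ->
  `|w i r s - w i t s| <= rt (1 - s) * (C4 * `|r - t|).
Proof.
move=> tT rT s01; have [tT' rT'] : 0 <= t <= T /\ 0 <= r <= T by slra.
have [pw w1] := ev_w ev i tT'; have [pw' w1'] := ev_w ev i rT'.
have La := L2B m01 (ev_a ev i rT') (ev_a ev i tT').
have c : w i r s - w i t s @[s --> 1^'-] --> (0 : R).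
  by have := @cvgB _ _ _ _ _ _ _ _ _ w1' w1; rewrite subr0; exact.
have i1 := L2_itg m01 mu01_lty La.
rewrite (prim_right (primB pw' pw) i1 c s01) sub0r normrN.
apply: le_trans (seg_cs La _) _; first by slra.
by rewrite ler_wpM2l ?sqrtr_ge0// (lip_a ev).
Qed.

(** Divide [w_eq] by r - t: up to a small error this pairing is a difference quotient in time of the
    average of w against [molli], and [w_lip] bounds it on the support, which lies to the right of
    [x]. *)
Lemma F1_test i t (x d : R) : 0 < t < T -> 0 < d -> 0 < x -> x + d < 1 ->
  `|\int[mu]_(s in I01) (dflux i t s * molli x d s)| <= rt (1 - x) * C4.
Proof.
move=> tT d0 x0 xd; have [psi' [pp Lp Lm m1 im]] := molli_test d0 x0 xd.
have K4 := C4_ge0 ev; rewrite (F1_parts ev i tT pp Lp m1) normrN.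
set psi := molli x d in pp Lm m1 im *; set I := Rintegral _ _ _.
have N0 := nm_ge0 psi'.
apply/ler_addgt0Pr => e e0; pose e' := e / (nm psi' + 1).
have e'0 : 0 < e' by rewrite divr_gt0//; slra.
have [dl dl0 hd] := w_eq ev tT e'0.
have [r [tr rT rd]] : exists r, [/\ t < r, r < T & r < t + dl].
  have m0 : 0 < Num.min dl (T - t) by rewrite lt_min dl0; slra.
  have m1' : Num.min dl (T - t) <= dl by rewrite ge_min lexx.
  have m2 : Num.min dl (T - t) <= T - t by rewrite ge_min lexx orbT.
  by exists (t + Num.min dl (T - t) / 2); move: (Num.min _ _) m0 m1' m2 => m; split; slra.
have := hd r (ltW tr) rT rd i psi psi' pp Lp m1; rewrite -/I.
have rT' : 0 < r < T by slra.
have [_ Lwt] := w_L2 ev i (ltac:(slra) : 0 <= t <= T); have [_ Lwr] := w_L2 ev i (ltac:(slra) : 0 <= r <= T).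
have -> : \int[mu]_(s in I01) (w i r s * psi s) - \int[mu]_(s in I01) (w i t s * psi s) =
    \int[mu]_(s in I01) ((w i r s - w i t s) * psi s) by exact: int_diff.
have p0 s : 0 <= psi s by exact: molli_ge0.
pose K := rt (1 - x) * (C4 * `|r - t|).
have K0 : 0 <= K by rewrite !mulr_ge0// sqrtr_ge0.
have B : `|\int[mu]_(s in I01) ((w i r s - w i t s) * psi s)| <= K.
  have iK : itg I01 (fun s => K * psi s) by apply: itgZ => //; apply: L2_itg => //; exact: mu01_lty.
  rewrite (_ : K = \int[mu]_(s in I01) (K * psi s)); last first.
    by rewrite RintegralZl ?im ?mulr1//; apply: L2_itg => //; exact: mu01_lty.
  apply: Rint_norm_le => //; first by apply: L2_mul => //; exact: L2B.
  move=> s; rewrite /= in_itv/= => s01; rewrite normrM (ger0_norm (p0 s)).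
  have [xs|sx] := leP x s; last first.
    by rewrite /psi molli_out ?mulr0// negb_and -!ltNge sx.
  rewrite ler_wpM2r//; apply: le_trans (w_lip i tT rT' s01) _.
  by rewrite ler_wpM2r ?mulr_ge0// ler_wsqrtr//; slra.
have E : e' * (nm psi' + 1) = e by rewrite /e' divfK// gt_eqF//; slra.
have e1 : e' * nm psi' <= e by rewrite -E ler_wpM2l ?(ltW e'0)//; slra.
move: B; rewrite /K (gtr0_norm (_ : 0 < r - t)); last by slra.
have rt1 : 0 < r - t by slra.
rewrite (mulrA (rt (1 - x))); move: (rt (1 - x) * C4) e1; move: (Rintegral _ _ _) (e' * nm psi') I rt1 => J z I.
move: (r - t) => h h0 c ze; rewrite !ler_norml => /andP[J1 J2] /andP[G1 G2].
apply/andP; split; rewrite -(ler_pM2l h0); have := ler_wpM2l (ltW h0) ze; slra.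
Qed.

(** At a good time (tau v)'' is in L^2, so (tau v)' has a limit at 1; by [F1_test] its averages
    close to 1 tend to 0. *)
Lemma F1_end i t : 0 < t < T -> good t -> dflux i t s @[s --> 1^'-] --> (0 : R).
Proof.
move=> tT gt; have [F2 [pF LF2 _]] := F2_good ev i tT gt.
have K4 := C4_ge0 ev.
have [l0 [l [_ Fl _ _ _]]] := prim_limits pF (L2_itg m01 mu01_lty LF2).
suff -> : 0 = l by [].
apply/esym/eqP; rewrite -normr_le0; apply/ler_addgt0Pr => e e0; rewrite add0r.
have e2 : 0 < e / 2 by slra.
have /cvgrPdist_le /(_ _ e2) /near_left1[b b01 hb] := Fl.
pose dl := e / 2 / (C4 + 1).
have dl0 : 0 < dl by rewrite divr_gt0//; slra.
have [x [bx x1 xd]] : exists x : R, [/\ b < x, x < 1 & 1 - x <= dl ^+ 2].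
  have D0 : 0 < dl ^+ 2 by rewrite exprn_gt0.
  have [m m0 [m1 m2]] : exists2 m : R, 0 < m & m <= 1 - b /\ m <= dl ^+ 2.
    exists (Num.min (1 - b) (dl ^+ 2)); first by rewrite lt_min D0 subr_gt0; slra.
    by rewrite !ge_min !lexx orbT.
  by exists (1 - m / 2); split; slra.
have [d0 x0 xd1] : [/\ 0 < (1 - x) / 2, 0 < x & x + (1 - x) / 2 < 1] by split; slra.
move: ((1 - x) / 2) d0 xd1 => d d0 xd1.
have [psi' [pp Lp Lm m1 im]] := molli_test d0 x0 xd1.
have A := F1_test i tT d0 x0 xd1.
have rx : rt (1 - x) <= dl by rewrite -(ger0_norm (ltW dl0)) -sqrtr_sqr ler_wsqrtr.
have A2 : rt (1 - x) * C4 <= e / 2.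
  apply: le_trans (ler_wpM2r K4 rx) _.
  by rewrite /dl mulrAC ler_pdivrMr; [rewrite ler_wpM2l ?(ltW e2)//|]; slra.
have LF1 := F1_L2 ev i tT.
have B : `|\int[mu]_(s in I01) ((l - dflux i t s) * molli x d s)| <= e / 2.
  rewrite (_ : e / 2 = \int[mu]_(s in I01) (e / 2 * molli x d s)); last first.
    by rewrite RintegralZl ?im ?mulr1//; apply: L2_itg => //; exact: mu01_lty.
  apply: Rint_norm_le => //.
  - by apply: L2_mul => //; apply: L2B => //; exact: L2_cst01.
  - by apply: itgZ => //; apply: L2_itg => //; exact: mu01_lty.
  move=> s; rewrite /= in_itv/= => s01; rewrite normrM (ger0_norm (molli_ge0 _ _ d0)).
  have [xs|sx] := leP x s; last first.
    by rewrite molli_out ?mulr0// negb_and -!ltNge sx.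
  by rewrite ler_wpM2r ?molli_ge0// hb//; slra.
have E : l = \int[mu]_(s in I01) ((l - dflux i t s) * molli x d s) + \int[mu]_(s in I01) (dflux i t s * molli x d s).
  rewrite -int_diff ?subrK//; last exact: L2_cst01.
  by rewrite RintegralZl ?im ?mulr1//; apply: L2_itg => //; exact: mu01_lty.
rewrite E; apply: le_trans (ler_normD _ _) _; slra.
Qed.

(** tau p = (tau v)' - tau' v, where both terms on the right tend to 0 and tau stays away from 0
    near s = 1. This is what makes B vanish at the fixed end in [J_bound]. *)
Lemma p_end i t : 0 < @c0 R n M w -> 0 < t < T -> good t -> p i t s @[s --> 1^'-] --> (0 : R).
Proof.
move=> c00 tT gt; have [pt ps _ s1] := ev_tau ev tT.
have F0 := F1_end i tT gt.
apply: (cvg0_le (C := 2 / @c0 R n M w) (g := fun s => `|dflux i t s| + `|sig t s|)); last first.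
  by rewrite -(addr0 0) -[X in _ --> X + X](normr0 R); apply: cvgD; exact: cvg_norm.
near=> s; have s01 : 0 < s < 1 by near: s; exact: near01_1.
have s2 : 2^-1 < s by near: s; apply: nbhs_left_gt; lra.
have tl := tau_low ev tT s01; have v1 := v_le1 ev i (ltac:(slra) : 0 <= t <= T) s01.
rewrite mulrAC ler_pdivlMr//.
have E : tau t s * p i t s = dflux i t s - sig t s * v i t s by rewrite /dflux; ring.
have t0 : 0 < tau t s by apply: lt_le_trans tl; rewrite mulr_gt0//; slra.
have H : tau t s * `|p i t s| <= `|dflux i t s| + `|sig t s|.
  rewrite -{1}(gtr0_norm t0) -normrM E; apply: le_trans (ler_normB _ _) _.
  by rewrite lerD2l normrM ler_piMr.
have H2 : 2^-1 * @c0 R n M w <= tau t s by apply: le_trans tl; rewrite ler_wpM2r ?(ltW c00)// ltW.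
have := ler_wpM2r (normr_ge0 (p i t s)) H2; slra.
Unshelve. all: by end_near. Qed.

End EndPoint.

(** * The difference of two tensions *)

Section WeightedEnergy.
Context {R : realType}.
Local Notation mu := (@lebesgue_measure R).
Local Notation itg D f := (mu.-integrable D (EFin \o f)).
Local Notation I01 := (`]@GRing.zero R, @GRing.one R[%classic).
Local Notation L2I := (L2 I01).
Local Notation rt := (@Num.sqrt R).

Let m01 : measurable I01. Proof. exact: measurable_itv. Qed.

(** Cauchy-Schwarz with the weights r^(1/2) and r^(-1/2), the latter integrating to 2 (s^(1/2) -
    e^(1/2)) on [e, s]; then e tends to 0. *)
Lemma wcs (u u' : R -> R) (X s : R) : prim u u' -> itg I01 (fun r => rt r * u' r ^+ 2) ->
  \int[mu]_(r in I01) (rt r * u' r ^+ 2) <= X -> u r @[r --> 0^'+] --> (0 : R) -> 0 < s < 1 ->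
  u s ^+ 2 <= 2 * X * rt s.
Proof.
move=> pu iX hX u0 s01.
have X0 : 0 <= X.
  apply: le_trans hX; apply: Rintegral_ge0 => r _; by rewrite mulr_ge0 ?sqr_ge0 ?sqrtr_ge0.
have key e : 0 < e < s -> (u s - u e) ^+ 2 <= 2 * X * rt s.
  move=> es; have [e0 es' s1] : [/\ 0 < e, e <= s & s < 1] by split; slra.
  have [iu eu] := pu e s e0 es' s1; have [ir er] := prim_rt e0 es' s1.
  have ms : measurable (`[e, s]%classic : set R) by exact: measurable_itv.
  have iXs : itg `[e, s] (fun r => rt r * u' r ^+ 2) by apply: (itg_seg01 iX); slra.
  rewrite eu; apply: (@le_trans _ _ (X * (2 * (rt s - rt e)))); last first.
    by have := mulr_ge0 X0 (sqrtr_ge0 e); slra.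
  apply: sqr_le_mulP => //; first by rewrite mulr_ge0// subr_ge0 ler_wsqrtr//; slra.
  move=> l.
  have I0 : 0 <= \int[mu]_(r in `[e, s]) (rt r * u' r ^+ 2 - 2 * l * u' r + l ^+ 2 * (2 * (2 * rt r)^-1)).
    apply: Rintegral_ge0 => r; rewrite /= in_itv/= => re; have [r0 _] := @rt_gt0 R r (ltac:(slra)).
    have rn : rt r != 0 by rewrite gt_eqF//; case/andP: r0.
    have -> : rt r * u' r ^+ 2 - 2 * l * u' r + l ^+ 2 * (2 * (2 * rt r)^-1) = (rt r * u' r - l) ^+ 2 / rt r by field.
    by rewrite divr_ge0 ?sqr_ge0 ?sqrtr_ge0.
  have i1 : itg `[e, s] (fun r => rt r * u' r ^+ 2 - 2 * l * u' r) by apply: itgB => //; exact: itgZ.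
  have i2 : itg `[e, s] (fun r => l ^+ 2 * (2 * (2 * rt r)^-1)) by do 2 apply: itgZ => //.
  move: I0; rewrite RintegralD// RintegralB//; last exact: itgZ.
  rewrite !RintegralZl//; last exact: itgZ.
  rewrite -er; have : \int[mu]_(r in `[e, s]) (rt r * u' r ^+ 2) <= X.
    apply: le_trans hX; apply: Rint_seg01_le => //; [|slra|slra].
    by move=> r _; rewrite mulr_ge0 ?sqr_ge0 ?sqrtr_ge0.
  by move: (Rintegral _ _ _) (Rintegral _ _ _) (rt s - rt e) => I J d; slra.
have c1 : (u s - u e) ^+ 2 @[e --> 0^'+] --> u s ^+ 2.
  have c2 : u s - u e @[e --> 0^'+] --> u s.
    by have := @cvgB _ _ _ _ _ _ _ _ _ (cvg_cst (u s)) u0; rewrite subr0; exact.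
  exact: (@cvgM _ _ _ _ _ _ _ _ c2 c2).
apply: (cvg_le_le c1); near=> e; apply: key; apply/andP; split; near: e; first exact: nbhs_right_gt.
by apply: nbhs_right_lt; slra.
Unshelve. all: by end_near. Qed.

(** The derivative is written with [rt s] and [s^-1] as separate factors, so that later identities
    hold without any relation between the root and s. *)
Lemma prim_rt2 : prim rt (fun s => rt s * s^-1 / 2).
Proof.
apply: (prim_eq _ _ prim_rt) => // s s01; have [r0 _] := rt_gt0 s01.
rewrite -[X in _ = _ * X^-1 / 2](rt_sqr s01); field.
by rewrite gt_eqF//; case/andP: r0.
Qed.

Lemma prim_inv2 : prim (fun s : R => s^-1) (fun s => - (s^-1 * s^-1)).
Proof. by apply: (prim_eq _ _ prim_inv) => // s s01; rewrite -exprVn expr2. Qed.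

(* Integrate the derivative of s^(1/2) (nu nu' + B nu) - s^(-1/2) nu^2 / 4. *)
Lemma weighted_energy (nu nus B B' g q : R -> R) (A b G s : R) : 0 <= A -> 0 <= G ->
  prim nu nus -> prim nus (fun r => q r * nu r - (B' r - g r)) -> prim B B' ->
  measurable_fun I01 q -> measurable_fun I01 g ->
  (forall r, 0 < r < 1 -> 0 <= q r) -> (forall r, 0 < r < 1 -> `|nu r| <= A * r) ->
  (forall r, 0 < r < 1 -> `|nus r| <= A) -> (forall r, 0 < r < 1 -> rt r * `|B r| <= A) ->
  itg I01 (fun r => r * q r) -> itg I01 (fun r => rt r * `|g r|) ->
  itg I01 (fun r => rt r * B r ^+ 2) ->
  nus r @[r --> 1^'-] --> (0 : R) -> B r @[r --> 1^'-] --> (0 : R) ->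
  \int[mu]_(r in I01) (rt r * B r ^+ 2) <= b -> \int[mu]_(r in I01) (rt r * `|g r|) <= G ->
  0 < s < 1 -> nu s ^+ 2 <= 2 * (3 * b + 4 * G ^+ 2) * rt s.
Proof.
move=> A0 G0 pn pns pB mq mg q0 nA nsA BA iq ig iB ns1 B1 hb hG s01.
have mr := @meas_rt R.
have [mn mns] := (prim_meas pn, prim_meas pns); have mB := prim_meas pB.
have mi : measurable_fun I01 (fun s : R => s^-1) by exact: prim_meas prim_inv.
(* K is the derivative of Psi. The term B nu of Psi cancels B', and its last term cancels s^(-1/2)
   nu nu' / 2 and leaves the positive s^(1/2) (nu / s)^2 / 8. *)
pose K r := rt r * (nus r ^+ 2 + 8^-1 * (r^-1 * nu r) ^+ 2 + q r * nu r ^+ 2 + nu r * g r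
  + 2^-1 * (B r * (r^-1 * nu r)) + B r * nus r).
pose Psi r := rt r * (nu r * nus r) + rt r * (B r * nu r) - 4^-1 * (rt r * (r^-1 * nu r ^+ 2)).
have pPsi : prim Psi K.
  apply: (prim_eq _ _ (primB (primD (primM prim_rt2 (primM pn pns)) (primM prim_rt2 (primM pB pn)))
    (primZ 4^-1 (primM prim_rt2 (primM prim_inv2 (primM pn pn)))))) => r r01.
    by rewrite /Psi; ring.
  by rewrite /K; field; slra.
have rb r : 0 < r < 1 -> 0 < rt r <= 1 by move=> r01; have [r0 _] := rt_gt0 r01; slra.
have yA r : 0 < r < 1 -> `|r^-1 * nu r| <= A.
  move=> r01; have r0 : 0 < r by slra.
  by rewrite normrM gtr0_norm ?invr_gt0// ler_pdivrMl// mulrC nA.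
have iK : itg I01 K.
  apply: (itg_le (g := fun r => (A ^+ 2 + 8^-1 * A ^+ 2 + 2^-1 * A ^+ 2 + A ^+ 2) + (A ^+ 2 * (r * q r) + A * (rt r * `|g r|)))) => //.
  - apply: measurable_funM => //.
    have my : measurable_fun I01 (fun r => r^-1 * nu r) by exact: measurable_funM.
    have m1 : measurable_fun I01 (fun r => nus r ^+ 2 + 8^-1 * (r^-1 * nu r) ^+ 2).
      apply: measurable_funD; first exact: measurable_funX.
      by apply: measurable_funM => //; exact: measurable_funX.
    have m2 : measurable_fun I01 (fun r => q r * nu r ^+ 2).
      by apply: measurable_funM => //; exact: measurable_funX.
    have m3 : measurable_fun I01 (fun r => nu r * g r) by exact: measurable_funM.
    have m4 : measurable_fun I01 (fun r => 2^-1 * (B r * (r^-1 * nu r))).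
      by apply: measurable_funM => //; exact: measurable_funM.
    have m5 : measurable_fun I01 (fun r => B r * nus r) by exact: measurable_funM.
    exact: (measurable_funD (measurable_funD (measurable_funD (measurable_funD m1 m2) m3) m4) m5).
  - move=> r; rewrite /= in_itv/= => r01; have /andP[r0 r1] := rb r r01; have Q0 := q0 r r01.
    have H1 := nsA r r01; have H2 := BA r r01; have H3 := yA r r01; have H4 := nA r r01.
    have sq (x : R) : `|x| <= A -> x ^+ 2 <= A ^+ 2.
      by move=> xA; rewrite -real_normK ?num_real// lerXn2r ?nnegrE.
    have T1 : `|rt r * nus r ^+ 2| <= A ^+ 2.
      rewrite (ger0_norm (mulr_ge0 (sqrtr_ge0 _) (sqr_ge0 _))); apply: le_trans (sq _ H1).
      by rewrite ler_piMl ?sqr_ge0.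
    have T2 : `|rt r * (8^-1 * (r^-1 * nu r) ^+ 2)| <= 8^-1 * A ^+ 2.
      rewrite ger0_norm; last by rewrite mulr_ge0 ?sqrtr_ge0// mulr_ge0// sqr_ge0.
      apply: (@le_trans _ _ (8^-1 * (r^-1 * nu r) ^+ 2)); first by rewrite ler_piMl// mulr_ge0// sqr_ge0.
      by rewrite ler_wpM2l// sq.
    have T3 : `|rt r * (q r * nu r ^+ 2)| <= A ^+ 2 * (r * q r).
      rewrite ger0_norm; last by rewrite mulr_ge0 ?sqrtr_ge0// mulr_ge0// sqr_ge0.
      apply: (@le_trans _ _ (q r * nu r ^+ 2)); first by rewrite ler_piMl// mulr_ge0// sqr_ge0.
      rewrite [leRHS]mulrA [leRHS]mulrC ler_wpM2l// -real_normK ?num_real//.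
      apply: (@le_trans _ _ ((A * r) ^+ 2)); first by rewrite lerXn2r ?nnegrE// mulr_ge0//; slra.
      by rewrite exprMn ler_wpM2l ?sqr_ge0// expr2 ler_piMl//; slra.
    have T4 : `|rt r * (nu r * g r)| <= A * (rt r * `|g r|).
      rewrite mulrCA normrM (normrM (rt r)) (ger0_norm (sqrtr_ge0 _)) ler_wpM2r ?mulr_ge0 ?sqrtr_ge0//.
      by apply: le_trans H4 _; rewrite ler_piMr//; slra.
    have T5 : `|rt r * (2^-1 * (B r * (r^-1 * nu r)))| <= 2^-1 * A ^+ 2.
      have -> : rt r * (2^-1 * (B r * (r^-1 * nu r))) = 2^-1 * ((rt r * B r) * (r^-1 * nu r)) by ring.
      rewrite normrM (ger0_norm (_ : 0 <= 2^-1 :> R))// ler_wpM2l// normrM expr2 ler_pM//.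
      by rewrite normrM (ger0_norm (sqrtr_ge0 _)).
    have T6 : `|rt r * (B r * nus r)| <= A ^+ 2.
      by rewrite mulrA normrM expr2 ler_pM// normrM (ger0_norm (sqrtr_ge0 _)).
    have -> : K r = rt r * nus r ^+ 2 + rt r * (8^-1 * (r^-1 * nu r) ^+ 2) + rt r * (q r * nu r ^+ 2)
      + rt r * (nu r * g r) + rt r * (2^-1 * (B r * (r^-1 * nu r))) + rt r * (B r * nus r) by rewrite /K; ring.
    apply: (@le_trans _ _ (A ^+ 2 + 8^-1 * A ^+ 2 + A ^+ 2 * (r * q r) + A * (rt r * `|g r|) + 2^-1 * A ^+ 2 + A ^+ 2)); last by slra.
    apply: le_trans (ler_normD _ _) (lerD _ T6); apply: le_trans (ler_normD _ _) (lerD _ T5).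
    apply: le_trans (ler_normD _ _) (lerD _ T4); apply: le_trans (ler_normD _ _) (lerD _ T3).
    exact: le_trans (ler_normD _ _) (lerD T1 T2).
  apply: itgD => //; first by apply: itg_cst => //; exact: mu01_lty.
  by apply: itgD => //; exact: itgZ.
have nA1 r : 0 < r < 1 -> `|nu r| <= A.
  by move=> r01; apply: le_trans (nA r r01) _; rewrite ler_piMr//; slra.
have Psi0 : Psi r @[r --> 0^'+] --> (0 : R).
  apply: (cvg0_le (C := 3 * A ^+ 2) _ (@cvg_id0 R)); near=> r.
  have r01 : 0 < r < 1 by near: r; exact: near01_0.
  have /andP[r0 r1] := rb r r01; have H1 := nsA r r01; have H2 := BA r r01; have H3 := yA r r01; have H4 := nA r r01.
  have T1 : `|rt r * (nu r * nus r)| <= A ^+ 2 * r.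
    rewrite normrM (ger0_norm (sqrtr_ge0 _)); apply: (@le_trans _ _ `|nu r * nus r|); first by rewrite ler_piMl.
    by rewrite normrM expr2 mulrAC ler_pM.
  have T2 : `|rt r * (B r * nu r)| <= A ^+ 2 * r.
    by rewrite mulrA normrM expr2 -mulrA ler_pM// normrM (ger0_norm (sqrtr_ge0 _)).
  have T3 : `|4^-1 * (rt r * (r^-1 * nu r ^+ 2))| <= A ^+ 2 * r.
    rewrite normrM (ger0_norm (_ : 0 <= 4^-1 :> R))//; apply: (@le_trans _ _ `|r^-1 * nu r ^+ 2|).
      rewrite normrM (ger0_norm (sqrtr_ge0 _)) mulrA ler_piMl//; slra.
    by rewrite expr2 mulrA normrM expr2 -mulrA ler_pM.
  rewrite /Psi -mulrA; move: T1 T2 T3; move: (rt r * _) (rt r * _) (4^-1 * _) (A ^+ 2 * r) => x1 x2 x3 y.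
  by clear; rewrite !ler_norml; slra.
have [l0 [l1 [P0 P1 E _ _]]] := prim_limits pPsi iK.
have l00 : l0 = 0 by exact: (cvg_unique _ P0 Psi0).
(* At s = 1 only the sign of the last term of Psi matters; the others vanish with [nus] and [B]. *)
have l10 : l1 <= 0.
  have R0 : A * (`|nus r| + `|B r|) @[r --> 1^'-] --> (0 : R).
    rewrite -(mulr0 A); apply: cvgM; first exact: cvg_cst.
    by rewrite -(addr0 0) -[X in _ --> X + X](normr0 R); apply: cvgD; exact: cvg_norm.
  have D0 : Psi r - A * (`|nus r| + `|B r|) @[r --> 1^'-] --> l1.
    by rewrite -[X in _ --> X]subr0; exact: (@cvgB _ _ _ _ _ _ _ _ _ P1 R0).
  apply: (cvg_le_le D0); near=> r; have r01 : 0 < r < 1 by near: r; exact: near01_1.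
  have /andP[r0 r1] := rb r r01; have H4 := nA1 r r01.
  have T1 : rt r * (nu r * nus r) <= A * `|nus r|.
    apply: le_trans (ler_norm _) _; rewrite normrM (ger0_norm (sqrtr_ge0 _)).
    by apply: (@le_trans _ _ `|nu r * nus r|); [rewrite ler_piMl|rewrite normrM ler_wpM2r].
  have T2 : rt r * (B r * nu r) <= A * `|B r|.
    apply: le_trans (ler_norm _) _; rewrite normrM (ger0_norm (sqrtr_ge0 _)).
    by apply: (@le_trans _ _ `|B r * nu r|); [rewrite ler_piMl|rewrite normrM mulrC ler_wpM2r].
  have T3 : 0 <= 4^-1 * (rt r * (r^-1 * nu r ^+ 2)).
    have ri : 0 <= r^-1 by rewrite invr_ge0; slra.
    exact: (mulr_ge0 (_ : 0 <= 4^-1) (mulr_ge0 (sqrtr_ge0 r) (mulr_ge0 ri (sqr_ge0 _)))).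
  by rewrite /Psi mulrDr; slra.
have IK : \int[mu]_(r in I01) K r <= 0 by rewrite -E l00 subr0.
have inus : itg I01 (fun r => rt r * nus r ^+ 2).
  apply: (itg_bnd01 (C := A ^+ 2)); first by apply: measurable_funM => //; exact: measurable_funX.
  move=> r r01; have /andP[r0 r1] := rb r r01; have H1 := nsA r r01.
  rewrite (ger0_norm (mulr_ge0 (sqrtr_ge0 _) (sqr_ge0 _))).
  apply: (@le_trans _ _ (nus r ^+ 2)); first by rewrite ler_piMl ?sqr_ge0.
  by rewrite -real_normK ?num_real// lerXn2r ?nnegrE.
pose X := \int[mu]_(r in I01) (rt r * nus r ^+ 2).
have X0 : 0 <= X by apply: Rintegral_ge0 => r _; rewrite mulr_ge0 ?sqr_ge0 ?sqrtr_ge0.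
have n0 : nu r @[r --> 0^'+] --> (0 : R).
  by apply: (cvg0_le (C := A) _ (@cvg_id0 R)); near=> r; apply: nA; near: r; exact: near01_0.
have nX r : 0 < r < 1 -> nu r ^+ 2 <= 2 * X * rt r by exact: wcs pn inus (lexx _) n0.
(* By [wcs], S bounds |nu|, so that the term with g, known only in a weighted L^1, can be
   absorbed. *)
pose S := rt (2 * X).
have S2 : S ^+ 2 = 2 * X by rewrite sqr_sqrtr// mulr_ge0.
have S0 : 0 <= S by exact: sqrtr_ge0.
have nS r : 0 < r < 1 -> `|nu r| <= S.
  move=> r01; rewrite -(ler_pXn2r (n := 2))// ?nnegrE// real_normK ?num_real// S2.
  have /andP[r0 r1] := rb r r01.
  by apply: le_trans (nX r r01) _; rewrite ler_piMr// mulr_ge0.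
have ing : itg I01 (fun r => S * (rt r * `|g r|)) by exact: itgZ.
(* Completing the squares (nu' / 2 + B)^2 and (nu / s + 2 B)^2 / 8 uses a quarter of nu'^2 and the
   whole of (nu / s)^2 / 8, and leaves - 3 B^2 / 2. *)
have lower : 3 / 4 * X - 3 / 2 * \int[mu]_(r in I01) (rt r * B r ^+ 2) - S * \int[mu]_(r in I01) (rt r * `|g r|) <= 0.
  apply: le_trans IK; rewrite -!RintegralZl// -!RintegralB//; try exact: itgZ; last first.
    by apply: itgB => //; exact: itgZ.
  apply: le_Rintegral => //; first by apply: itgB => //; apply: itgB => //; exact: itgZ.
  move=> r; rewrite /= in_itv/= => r01; have H := nS r r01; have Q0 := q0 r r01.
  have r0 : 0 <= rt r by exact: sqrtr_ge0.
  have T1 : - (S * `|g r|) <= nu r * g r.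
    have : `|nu r * g r| <= S * `|g r| by rewrite normrM ler_wpM2r.
    by rewrite ler_norml => /andP[].
  have T2 : 0 <= q r * nu r ^+ 2 by rewrite mulr_ge0 ?sqr_ge0.
  rewrite /K -subr_ge0; set y := r^-1 * nu r.
  have -> : rt r * (nus r ^+ 2 + 8^-1 * y ^+ 2 + q r * nu r ^+ 2 + nu r * g r + 2^-1 * (B r * y) + B r * nus r)
     - (3 / 4 * (rt r * nus r ^+ 2) - 3 / 2 * (rt r * B r ^+ 2) - S * (rt r * `|g r|)) =
     rt r * ((2^-1 * nus r + B r) ^+ 2 + 8^-1 * (y + 2 * B r) ^+ 2 + q r * nu r ^+ 2 + (nu r * g r + S * `|g r|)) by field.
  have T3 := sqr_ge0 (2^-1 * nus r + B r); have T4 := sqr_ge0 (y + 2 * B r).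
  by apply: mulr_ge0 => //; slra.
(* S G <= S^2 / 8 + 2 G^2 with S^2 = 2 X absorbs a quarter of X, and X / 2 <= 3 b / 2 + 2 G^2
   remains. *)
have XB : X <= 3 * b + 4 * G ^+ 2.
  have SG : S * \int[mu]_(r in I01) (rt r * `|g r|) <= S * G by rewrite ler_wpM2l.
  have : S * G <= 8^-1 * S ^+ 2 + 2 * G ^+ 2 by have := sqr_ge0 (S - 4 * G); rewrite sqrrB exprMn; slra.
  by rewrite S2; slra.
apply: le_trans (nX s s01) _; rewrite ler_wpM2r ?sqrtr_ge0// ler_wpM2l//.
Unshelve. all: by end_near. Qed.

End WeightedEnergy.

Ltac slim ::= repeat match goal with H : ?P |- _ =>
  lazymatch P with
  | measurable _ => fail | evolution _ _ _ _ _ _ _ _ => fail | forall _, _ => fail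
  | _ => tryif comparison P then fail else clear H
  end end.

(** * The difference of two solutions *)

Section Pair.
Context {R : realType}.
Local Notation mu := (@lebesgue_measure R).
Local Notation itg D f := (mu.-integrable D (EFin \o f)).
Local Notation I01 := (`]@GRing.zero R, @GRing.one R[%classic).
Local Notation L2I := (L2 I01).
Local Notation rt := (@Num.sqrt R).

Let m01 : measurable I01. Proof. exact: measurable_itv. Qed.

Lemma unit_ge0 (s : R) : 0 < s < 1 -> 0 <= s. Proof. by case/andP => /ltW. Qed.

Lemma weighted_sqrD (k x y b : R) : 0 <= k -> k * x ^+ 2 <= b -> k * y ^+ 2 <= b ->
  k * (x + y) ^+ 2 <= 4 * b.
Proof. by move=> k0 h1 h2; have := mulr_ge0 k0 (sqr_ge0 (x - y)); rewrite sqrrB sqrrD; slra. Qed.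

Lemma weighted_sqrB (k x y a b : R) : 0 <= k -> k * x ^+ 2 <= a -> k * y ^+ 2 <= b ->
  k * (x - y) ^+ 2 <= 2 * a + 2 * b.
Proof. by move=> k0 h1 h2; have := mulr_ge0 k0 (sqr_ge0 (x + y)); rewrite sqrrB sqrrD; slra. Qed.

Lemma norm_half_sum (x y b : R) : `|x| <= b -> `|y| <= b -> `|(x + y) / 2| <= b.
Proof. by rewrite !ler_norml => *; slra. Qed.

Lemma norm_diff_nneg (x y b : R) : 0 <= x <= b -> 0 <= y <= b -> `|x - y| <= 2 * b.
Proof. by rewrite ler_norml => *; slra. Qed.

Lemma addself_le (x y b : R) : x <= b -> y <= b -> x + y <= 2 * b. Proof. slra. Qed.

Lemma rt_halve (r x b : R) : 2^-1 <= r -> r * `|x| <= b -> `|x| <= 2 * b.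
Proof. by move=> h1 h2; have := ler_wpM2r (normr_ge0 x) h1; slra. Qed.

Lemma sum3_le (x y z : R) : 0 <= x -> 0 <= y -> 0 <= z ->
  [/\ 2 * x <= 2 * x + y + y + z, y + y <= 2 * x + y + y + z & z <= 2 * x + y + y + z].
Proof. by move=> *; split; slra. Qed.

Lemma wsum_le (a b x y : R) : 0 <= a -> 0 <= b -> 0 <= x -> 0 <= y ->
  80 * a * x + 32 * b * y <= (80 * a + 32 * b) * (x + y).
Proof. by move=> a0 b0 x0 y0; have := mulr_ge0 a0 y0; have := mulr_ge0 b0 x0; slra. Qed.

Lemma rt_half (s : R) : 4^-1 < s -> 0 < s < 1 -> 2^-1 <= rt s.
Proof.
by move=> s4 s01; have [r0 _] := rt_gt0 s01; have := rt_sqr s01; move: (rt s) r0 => x x0 x2; snra.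
Qed.

Lemma sqr_sum_le m (x : 'I_m -> R) : (\sum_i x i) ^+ 2 <= m%:R * \sum_i x i ^+ 2.
Proof.
elim: m x => [|m ih] x; first by rewrite !big_ord0 expr0n mulr0.
rewrite !big_ord_recr/=; have := ih (fun i => x (widen_ord (leqnSn m) i)).
have Q0 : 0 <= \sum_(i < m) x (widen_ord (leqnSn m) i) ^+ 2 by apply: sumr_ge0 => i _; exact: sqr_ge0.
rewrite -natr1; have m0 : 0 <= m%:R :> R by exact: ler0n.
move: (x ord_max) m0 Q0; move: (m%:R) (\sum_(i < m) _) (\sum_(i < m) _) => N S Q y N0 Q0 SQ.
have h : (2 * (S * y)) ^+ 2 <= (Q + N * y ^+ 2) ^+ 2.
  have h1 : S ^+ 2 * y ^+ 2 <= N * Q * y ^+ 2 by rewrite ler_wpM2r ?sqr_ge0.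
  have h2 := sqr_ge0 (Q - N * y ^+ 2).
  by rewrite !exprMn; move: h2; rewrite sqrrB sqrrD; slra.
have h3 : 0 <= Q + N * y ^+ 2 by rewrite addr_ge0// mulr_ge0 ?sqr_ge0.
have h4 : 2 * (S * y) <= Q + N * y ^+ 2.
  apply: le_trans (ler_norm _) _; rewrite -(ler_pXn2r (n := 2))// ?nnegrE//.
  by rewrite real_normK ?num_real.
by rewrite mulrDl mul1r sqrrD; slra.
Qed.

Lemma cvg_sum0 m (F : set_system R) {FF : Filter F} (f : 'I_m -> R -> R) :
  (forall i, f i s @[s --> F] --> (0 : R)) -> \sum_i f i s @[s --> F] --> (0 : R).
Proof.
elim: m f => [|m ih] f hf.
  by under eq_fun do rewrite big_ord0; exact: cvg_cst.
under eq_fun do rewrite big_ord_recr/=.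
have h1 := ih (fun i => f (widen_ord (leqnSn m) i)) (fun i => hf _).
by have := @cvgD _ _ _ _ _ _ _ _ _ h1 (hf ord_max); rewrite addr0; exact.
Qed.

Lemma meas_div (f : R -> R) : L2I (fun s => s * f s) -> measurable_fun I01 f.
Proof.
move=> [m _]; apply: (eq_measurable_fun (fun s : R => s^-1 * (s * f s))).
  by move=> s /set_mem; rewrite /= in_itv/= => s01; rewrite mulrA mulVf ?mul1r// gt_eqF//; slra.
by apply: measurable_funM => //; exact: prim_meas prim_inv.
Qed.

Context {n : nat} {T M c : R}.
Context {v1 p1 w1 a1 : 'I_n -> R -> R -> R} {tau1 sig1 : R -> R -> R}.
Context {v2 p2 w2 a2 : 'I_n -> R -> R -> R} {tau2 sig2 : R -> R -> R}.
Context (ev1 : evolution T M v1 p1 w1 a1 tau1 sig1) (ev2 : evolution T M v2 p2 w2 a2 tau2 sig2).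
Local Notation good1 t := (forall i, good_slice M (p1 i t) (a1 i t)).
Local Notation good2 t := (forall i, good_slice M (p2 i t) (a2 i t)).
Context (c_gt0 : 0 < c).
Context (tl1 : forall t s, 0 < t < T -> 0 < s < 1 -> s * c <= tau1 t s).
Context (tl2 : forall t s, 0 < t < T -> 0 < s < 1 -> s * c <= tau2 t s).
Context (pe1 : forall i t, 0 < t < T -> good1 t -> p1 i t s @[s --> 1^'-] --> (0 : R)).
Context (pe2 : forall i t, 0 < t < T -> good2 t -> p2 i t s @[s --> 1^'-] --> (0 : R)).

Local Notation C1 := (@C1 R n M).
Local Notation C2 := (@C2 R n M).
Let M0 : 0 <= M. Proof. exact: ev_M ev1. Qed.
Let K1 : 0 <= C1. Proof. exact: C1_ge0. Qed.
Let K2 : 0 <= C2. Proof. exact: C2_ge0 ev1. Qed.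

(** [zz], [ww], [nu], [tb], [dist2] and [J] are the z, e, nu, taubar, E and J of the opening
    description; [asum] is a1 + a2. *)
Definition zz i t s := v1 i t s - v2 i t s.
Definition ww i t s := w1 i t s - w2 i t s.
Definition nu t s := tau1 t s - tau2 t s.
Definition tb t s := (tau1 t s + tau2 t s) / 2.
Definition asum i t s := a1 i t s + a2 i t s.
Definition dist2 t := \sum_i (nm (ww i t) ^+ 2 + \int[mu]_(s in I01) (tb t s * zz i t s ^+ 2)).
Definition J t := \sum_i \int[mu]_(s in I01) (nu t s * asum i t s * zz i t s).

Lemma zz_bnd i t : 0 <= t <= T -> L2I (zz i t) /\ forall s, 0 < s < 1 -> `|zz i t s| <= 2.
Proof.
move=> tT; split; first by apply: L2B => //; [exact: (v_L2 ev1)|exact: (v_L2 ev2)].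
move=> s s01; apply: le_trans (ler_normB _ _) _.
by have := v_le1 ev1 i tT s01; have := v_le1 ev2 i tT s01; slra.
Qed.

Lemma tb_bnd t : 0 < t < T -> measurable_fun I01 (tb t) /\ forall s, 0 < s < 1 -> s * c <= tb t s <= C1 * s.
Proof.
move=> tT; have [pt _ _ _] := ev_tau ev1 tT; have [pt' _ _ _] := ev_tau ev2 tT; split.
  by apply: measurable_funM => //; apply: measurable_funD; [exact: prim_meas pt|exact: prim_meas pt'].
move=> s s01; have := tau_bnd ev1 tT s01; have := tau_bnd ev2 tT s01.
by have := tl1 tT s01; have := tl2 tT s01; rewrite /tb; slra.
Qed.

Lemma tb_ge0 t s : 0 < t < T -> 0 < s < 1 -> 0 <= tb t s.
Proof.
move=> tT s01; have [_ /(_ s s01) /andP[h _]] := tb_bnd tT; apply: le_trans h.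
by rewrite mulr_ge0 ?(ltW c_gt0)//; slra.
Qed.

Lemma tbz_itg i t : 0 < t < T -> itg I01 (fun s => tb t s * zz i t s ^+ 2) /\
  0 <= \int[mu]_(s in I01) (tb t s * zz i t s ^+ 2).
Proof.
move=> tT; have [mt bt] := tb_bnd tT; have [[mz iz] _] := zz_bnd i (ltac:(slra) : 0 <= t <= T).
split; last first.
  apply: Rint_ge0 => s s01; apply: mulr_ge0 (sqr_ge0 _); exact: tb_ge0.
apply: (itg_le (g := fun s => C1 * zz i t s ^+ 2)) => //; [|move=> s|exact: itgZ].
  by apply: measurable_funM => //; exact: measurable_funX.
rewrite /= in_itv/= => s01; have /andP[_ b] := bt s s01; have t0 := tb_ge0 tT s01.
rewrite (ger0_norm (mulr_ge0 t0 (sqr_ge0 _))) ler_wpM2r ?sqr_ge0//; apply: le_trans b _.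
by rewrite ler_piMr//; slra.
Qed.

Lemma dist2_ge0 t : 0 < t < T -> 0 <= dist2 t.
Proof.
by move=> tT; apply: sumr_ge0 => i _; rewrite addr_ge0 ?sqr_ge0//; have [] := tbz_itg i tT.
Qed.

Lemma ww_prim i t : 0 <= t <= T -> [/\ prim (ww i t) (fun s => a1 i t s - a2 i t s),
   L2I (fun s => a1 i t s - a2 i t s), ww i t s @[s --> 1^'-] --> (0 : R), L2I (ww i t) &
   forall s, 0 < s < 1 -> `|ww i t s| <= 2 * M].
Proof.
move=> tT; have [pw e1] := ev_w ev1 i tT; have [pw' e1'] := ev_w ev2 i tT.
have La := L2B m01 (ev_a ev1 i tT) (ev_a ev2 i tT).
have e0 : ww i t s @[s --> 1^'-] --> (0 : R).
  by have := @cvgB _ _ _ _ _ _ _ _ _ e1 e1'; rewrite subr0; exact.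
have [b L] := prim_right0 (primB pw pw') La e0.
split => //; first exact: primB.
move=> s s01; apply: le_trans (b s s01) _; apply: le_trans (nmD (ev_a ev1 i tT) (L2N m01 (ev_a ev2 i tT))) _.
by rewrite nmN; have := a_bnd ev1 i tT; have := a_bnd ev2 i tT; slra.
Qed.

Lemma dist2_part i t : 0 < t < T -> nm (ww i t) ^+ 2 <= dist2 t /\
  \int[mu]_(s in I01) (tb t s * zz i t s ^+ 2) <= dist2 t.
Proof.
move=> tT; have [_ z0] := tbz_itg i tT; have e0 := sqr_ge0 (nm (ww i t)).
have : nm (ww i t) ^+ 2 + \int[mu]_(s in I01) (tb t s * zz i t s ^+ 2) <= dist2 t.
  rewrite /dist2 (bigD1 i)//= lerDl; apply: sumr_ge0 => j _.
  by rewrite addr_ge0 ?sqr_ge0//; have [] := tbz_itg j tT.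
by split; slra.
Qed.

(** E sees z only through taubar, and taubar >= c s. *)
Lemma rtz_bnd i t : 0 < t < T -> L2I (fun s => rt s * zz i t s) /\
  nm (fun s => rt s * zz i t s) <= rt c^-1 * rt (dist2 t).
Proof.
move=> tT; have [Lz bz] := zz_bnd i (ltac:(slra) : 0 <= t <= T).
have L : L2I (fun s => rt s * zz i t s).
  apply: (L2_bndM (M := 1)) => //; first exact: meas_rt.
  by move=> s; rewrite /= in_itv/= => s01; have [r0 _] := rt_gt0 s01; rewrite ger0_norm; slra.
split=> //; have [itz _] := tbz_itg i tT; have [_ le] := dist2_part i tT; have [_ L2'] := L.
rewrite -sqrtrM ?invr_ge0 ?(ltW c_gt0)// -(ger0_norm (nm_ge0 _)) -sqrtr_sqr ler_wsqrtr//.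
rewrite ler_pdivlMl// nm_sqr -RintegralZl//; apply: le_trans le.
apply: le_Rintegral => //; first exact: itgZ.
move=> s; rewrite /= in_itv/= => s01; rewrite exprMn rt_sqr// mulrA ler_wpM2r ?sqr_ge0// mulrC.
by have [_ /(_ s s01) /andP[]] := tb_bnd tT.
Qed.

Lemma wa_bnd (a a' : R -> R) s : prim a a' -> L2I a -> nm a <= M -> L2I (fun s => rt s * a' s) ->
  nm (fun s => rt s * a' s) <= M -> 0 < s < 1 -> rt s * a s ^+ 2 <= 10 * M ^+ 2.
Proof. by move=> pa La na La' na' s01; exact: (a_wsup pa La na La' na'). Qed.

(** [weighted_energy] with int s^(1/2) B^2 <= kb E and int s^(1/2) |g| <= kg E^(1/2) gives nu^2 <=
    k3 E s^(1/2). The integrand of J is then the product of s^(-1/2) nu (a1 + a2), whose L^2 norm is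
    a multiple of E^(1/2) by [a_wint], and of s^(1/2) z. *)
Lemma J_bound : exists2 K : R, 0 <= K & forall t, 0 < t < T -> good1 t -> good2 t -> `|J t| <= K * dist2 t.
Proof.
pose kb : R := n%:R * (80 * M ^+ 2 + 32 * (C1 * M ^+ 2)).
pose kg : R := n%:R * (2 * M + (C2 + C1) * (2 * M * rt c^-1)).
pose k3 : R := 2 * (3 * kb + 4 * kg ^+ 2).
have m2 := sqr_ge0 M; have rc0 : 0 <= rt c^-1 by exact: sqrtr_ge0.
have kb0 : 0 <= kb by rewrite mulr_ge0// addr_ge0// mulr_ge0// mulr_ge0.
have kg0 : 0 <= kg by rewrite mulr_ge0// addr_ge0// mulr_ge0 ?addr_ge0// mulr_ge0// mulr_ge0.
have k30 : 0 <= k3 by rewrite mulr_ge0// addr_ge0// mulr_ge0// sqr_ge0.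
exists (n%:R * (rt (56 * M ^+ 2 * k3) * rt c^-1)).
  by rewrite mulr_ge0// mulr_ge0// sqrtr_ge0.
move=> t tT g1 g2; have tT' : 0 <= t <= T by slra.
have E0 := dist2_ge0 tT; pose S := rt (dist2 t).
have S0 : 0 <= S by exact: sqrtr_ge0.
have S2 : S ^+ 2 = dist2 t by rewrite sqr_sqrtr.
have nS i : nm (ww i t) <= S.
  rewrite -(ger0_norm (nm_ge0 _)) -sqrtr_sqr ler_wsqrtr//; by have [] := dist2_part i tT.
have [pt1 ps1 t01 s11] := ev_tau ev1 tT; have [pt2 ps2 t02 s12] := ev_tau ev2 tT.
pose slice (p a : R -> R) (f : (R -> R) * (R -> R)) := [/\ prim p f.1 /\ prim a f.2,
   L2I p /\ nm p <= M, nm a <= M, L2I (fun s => s * f.1 s) /\ nm (fun s => s * f.1 s) <= M &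
   L2I (fun s => rt s * f.2 s) /\ nm (fun s => rt s * f.2 s) <= M].
have /choice[f1 hf1] : forall i, exists f, slice (p1 i t) (a1 i t) f.
  by move=> i; have [x [y h]] := g1 i; exists (x, y).
have /choice[f2 hf2] : forall i, exists f, slice (p2 i t) (a2 i t) f.
  by move=> i; have [x [y h]] := g2 i; exists (x, y).
pose ps i s := p1 i t s + p2 i t s; pose dps i s := (f1 i).1 s + (f2 i).1 s.
pose das i s := (f1 i).2 s + (f2 i).2 s; pose sb s := (sig1 t s + sig2 t s) / 2.
(* With averages and differences, q1 tau1 - q2 tau2 = q nu + taubar (p1 + p2).z' and |a1|^2 - |a2|^2
   = (a1 + a2).e'. The derivatives of z and e are moved into B', and g collects the terms in which
   the other factors are differentiated. *)
pose q s := \sum_i (p1 i t s ^+ 2 + p2 i t s ^+ 2) / 2.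
pose B s := \sum_i (asum i t s * ww i t s - tb t s * ps i s * zz i t s).
pose g s := \sum_i (das i s * ww i t s - (sb s * ps i s + tb t s * dps i s) * zz i t s).
pose B' s := g s + \sum_i (asum i t s * (a1 i t s - a2 i t s) - tb t s * ps i s * (p1 i t s - p2 i t s)).
have pnu : prim (nu t) (fun s => sig1 t s - sig2 t s) by exact: primB.
have pnus : prim (fun s => sig1 t s - sig2 t s) (fun s => q s * nu t s - (B' s - g s)).
  apply: (prim_eq _ _ (primB ps1 ps2)) => // s s01.
  have -> : B' s - g s = \sum_i (asum i t s * (a1 i t s - a2 i t s) - tb t s * ps i s * (p1 i t s - p2 i t s)).
    by rewrite /B' addrAC subrr add0r.
  rewrite /q !mulr_suml -!sumrB; apply: eq_bigr => i _.
  by rewrite /nu /asum /tb /ps; field.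
have pB : prim B B'.
  have pi i : prim (fun s => asum i t s * ww i t s - tb t s * ps i s * zz i t s)
     (fun s => (das i s * ww i t s - (sb s * ps i s + tb t s * dps i s) * zz i t s) +
       (asum i t s * (a1 i t s - a2 i t s) - tb t s * ps i s * (p1 i t s - p2 i t s))).
    have [[pp1 pa1] _ _ _ _] := hf1 i; have [[pp2 pa2] _ _ _ _] := hf2 i.
    have [pe _ _ _ _] := ww_prim i tT'.
    have ptb : prim (tb t) sb.
      by apply: (prim_eq _ _ (primZ 2^-1 (primD pt1 pt2))) => s _; rewrite /tb /sb mulrC.
    apply: (prim_eq _ _ (primB (primM (primD pa1 pa2) pe) (primM (primM ptb (primD pp1 pp2)) (primB (ev_v ev1 i tT') (ev_v ev2 i tT'))))) => s _ //.
    by rewrite /das /dps /ps /zz /asum /ww; ring.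
  by apply: (prim_eq _ _ (prim_sum pi)) => s _ //; rewrite /B' /g big_split.
have D1 i : [/\ prim (p1 i t) (f1 i).1, prim (a1 i t) (f1 i).2, L2I (p1 i t), nm (p1 i t) <= M & nm (a1 i t) <= M] /\
   [/\ L2I (fun s => s * (f1 i).1 s), nm (fun s => s * (f1 i).1 s) <= M,
      L2I (fun s => rt s * (f1 i).2 s) & nm (fun s => rt s * (f1 i).2 s) <= M].
  by have [[? ?] [? ?] ? [? ?] [? ?]] := hf1 i.
have D2 i : [/\ prim (p2 i t) (f2 i).1, prim (a2 i t) (f2 i).2, L2I (p2 i t), nm (p2 i t) <= M & nm (a2 i t) <= M] /\
   [/\ L2I (fun s => s * (f2 i).1 s), nm (fun s => s * (f2 i).1 s) <= M,
      L2I (fun s => rt s * (f2 i).2 s) & nm (fun s => rt s * (f2 i).2 s) <= M].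
  by have [[? ?] [? ?] ? [? ?] [? ?]] := hf2 i.
clear hf1 hf2 slice.
have psb i s : 0 < s < 1 -> s * ps i s ^+ 2 <= 16 * M ^+ 2.
  move=> s01; have [[h1 _ h2 h3 _] [h4 h5 _ _]] := D1 i; have [[k1 _ k2 k3' _] [k4 k5 _ _]] := D2 i.
  have := weighted_sqrD (unit_ge0 s01) (sqr_sup h1 h2 h4 h3 h5 s01) (sqr_sup k1 k2 k4 k3' k5 s01).
  by rewrite mulrA -natrM.
have Lps i : L2I (ps i) /\ nm (ps i) <= 2 * M.
  have [[_ _ h2 h3 _] _] := D1 i; have [[_ _ k2 k3' _] _] := D2 i.
  by split; [exact: L2D|apply: le_trans (nmD h2 k2) _; exact: addself_le].
have asb i s : 0 < s < 1 -> rt s * asum i t s ^+ 2 <= 40 * M ^+ 2.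
  move=> s01; have [[_ h2 _ _ h3] [_ _ h4 h5]] := D1 i; have [[_ k2 _ _ k3'] [_ _ k4 k5]] := D2 i.
  have := weighted_sqrD (sqrtr_ge0 s) (wa_bnd h2 (ev_a ev1 i tT') h3 h4 h5 s01)
    (wa_bnd k2 (ev_a ev2 i tT') k3' k4 k5 s01).
  by rewrite mulrA -natrM.
have Las i : L2I (asum i t) by apply: L2D => //; [exact: (ev_a ev1)|exact: (ev_a ev2)].
have Ldps i : L2I (fun s => s * dps i s) /\ nm (fun s => s * dps i s) <= 2 * M.
  have [_ [h4 h5 _ _]] := D1 i; have [_ [k4 k5 _ _]] := D2 i.
  have E s : 0 < s < 1 -> s * (f1 i).1 s + s * (f2 i).1 s = s * dps i s by move=> _; rewrite /dps mulrDr.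
  split; last by rewrite -(nm_ext E); apply: le_trans (nmD h4 k4) _; exact: addself_le.
  apply: L2_ae_eq (L2D m01 h4 k4) => //.
    by apply: measurable_funM => //; apply: measurable_funD; exact: meas_div.
  by exists set0; split => // s /=; apply: contra_notP => _; rewrite in_itv/=; exact: E.
have Ldas i : L2I (fun s => rt s * das i s) /\ nm (fun s => rt s * das i s) <= 2 * M.
  have [_ [_ _ h4 h5]] := D1 i; have [_ [_ _ k4 k5]] := D2 i.
  have E s : 0 < s < 1 -> rt s * (f1 i).2 s + rt s * (f2 i).2 s = rt s * das i s by move=> _; rewrite /das mulrDr.
  split; last by rewrite -(nm_ext E); apply: le_trans (nmD h4 k4) _; exact: addself_le.
  apply: L2_ae_eq (L2D m01 h4 k4) => //.
    by apply: measurable_funM; [exact: meas_rt|apply: measurable_funD; exact: a1_meas].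
  by exists set0; split => // s /=; apply: contra_notP => _; rewrite in_itv/=; exact: E.
have mdas i : measurable_fun I01 (das i).
  by have [_ [_ _ h4 _]] := D1 i; have [_ [_ _ k4 _]] := D2 i; apply: measurable_funD; exact: a1_meas.
have mdps i : measurable_fun I01 (dps i) by apply: meas_div; case: (Ldps i).
have mps i : measurable_fun I01 (ps i) by case: (Lps i) => -[].
have [mtb tbb] := tb_bnd tT.
have msb : measurable_fun I01 sb.
  by apply: measurable_funM => //; apply: measurable_funD; [exact: prim_meas ps1|exact: prim_meas ps2].
have sbb s : 0 < s < 1 -> `|sb s| <= C2.
  by move=> s01; exact: norm_half_sum (sig_bnd ev1 tT s01) (sig_bnd ev2 tT s01).
have Lz i : L2I (zz i t) /\ forall s, 0 < s < 1 -> `|zz i t s| <= 2 by exact: zz_bnd.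
have mz i : measurable_fun I01 (zz i t) by case: (Lz i) => -[].
have rtz i := rtz_bnd i tT.
have Le i : L2I (ww i t) by have [] := ww_prim i tT'.
have me i : measurable_fun I01 (ww i t) by case: (Le i).
have eb i s : 0 < s < 1 -> `|ww i t s| <= 2 * M by have [_ _ _ _] := ww_prim i tT'; exact.
have mq : measurable_fun I01 q.
  apply: measurable_sum => i; apply: measurable_funM => //.
  by apply: measurable_funD; apply: measurable_funX; [exact: (ev_pm ev1)|exact: (ev_pm ev2)].
have mg : measurable_fun I01 g.
  apply: measurable_sum => i; apply: measurable_funB; first exact: measurable_funM.
  by apply: measurable_funM => //; apply: measurable_funD; exact: measurable_funM.
have rb s : 0 < s < 1 -> 0 < rt s <= 1 by move=> s01; have [/andP[-> /ltW ->] _] := rt_gt0 s01.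
have nub s : 0 < s < 1 -> `|nu t s| <= 2 * C1 * s.
  by move=> s01; rewrite -mulrA; exact: norm_diff_nneg (tau_bnd ev1 tT s01) (tau_bnd ev2 tT s01).
have rtas i s : 0 < s < 1 -> rt s * `|asum i t s| <= 7 * M.
  move=> s01; have /andP[r0 r1] := rb s s01; have H := asb i s s01.
  rewrite -(ler_pXn2r (n := 2))// ?nnegrE ?mulr_ge0 ?sqrtr_ge0//.
  rewrite !exprMn real_normK ?num_real// expr2 -mulrA.
  apply: (@le_trans _ _ (rt s * asum i t s ^+ 2)).
    by rewrite ler_piMl// mulr_ge0 ?sqrtr_ge0 ?sqr_ge0.
  by apply: le_trans H _; rewrite ler_wpM2r// -natrX ler_nat.
have rtps i s : 0 < s < 1 -> rt s * `|ps i s| <= 4 * M.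
  move=> s01; have H := psb i s s01.
  rewrite -(ler_pXn2r (n := 2))// ?nnegrE ?mulr_ge0 ?sqrtr_ge0//.
  by rewrite !exprMn real_normK ?num_real// rt_sqr// -natrX.
(* A crude pointwise bound that justifies integrability and boundary limits; the resulting estimate
   depends on kb and kg only. *)
pose A : R := 2 * C1 + C2 + C2 + n%:R * (16 * M ^+ 2 + 8 * (C1 * M)).
have z1 : 0 <= n%:R * (16 * M ^+ 2 + 8 * (C1 * M)) by rewrite mulr_ge0// addr_ge0// mulr_ge0// mulr_ge0.
have [A1 A2 A3] : [/\ 2 * C1 <= A, C2 + C2 <= A & n%:R * (16 * M ^+ 2 + 8 * (C1 * M)) <= A].
  exact: sum3_le K1 K2 z1.
have A0 : 0 <= A := le_trans z1 A3.
have BA s : 0 < s < 1 -> rt s * `|B s| <= A.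
  move=> s01; apply: (@le_trans _ _ (n%:R * (16 * M ^+ 2 + 8 * (C1 * M)))); last exact: A3.
  apply: le_trans (ler_wpM2l (sqrtr_ge0 s) (ler_norm_sum _ _ _)) _; rewrite mulr_sumr.
  apply: (@le_trans _ _ (\sum_(i < n) (16 * M ^+ 2 + 8 * (C1 * M)))); last by rewrite sumr_const card_ord -[leLHS]mulr_natl.
  apply: ler_sum => i _; have /andP[t0 t1] := tbb s s01.
  have tb0 := tb_ge0 tT s01; have /andP[_ /ltW s1] := s01.
  have h1 : rt s * `|asum i t s * ww i t s| <= 7 * M * (2 * M).
    have -> : rt s * `|asum i t s * ww i t s| = rt s * `|asum i t s| * `|ww i t s| by rewrite normrM mulrA.
    exact: (ler_pM (mulr_ge0 (sqrtr_ge0 s) (normr_ge0 _)) (normr_ge0 _) (rtas i s s01) (eb i s s01)).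
  have h2 : rt s * `|tb t s * ps i s * zz i t s| <= C1 * (4 * M) * 2.
    have -> : rt s * `|tb t s * ps i s * zz i t s| = tb t s * (rt s * `|ps i s|) * `|zz i t s|.
      by rewrite (normrM (tb t s * _)) (normrM (tb t s)) (ger0_norm tb0); ring.
    have [_ zb] := Lz i.
    have tC : tb t s <= C1 by apply: le_trans t1 _; rewrite ler_piMr.
    have r0 : 0 <= rt s * `|ps i s| by rewrite mulr_ge0 ?sqrtr_ge0.
    exact: (ler_pM (mulr_ge0 tb0 r0) (normr_ge0 _) (ler_pM tb0 r0 tC (rtps i s s01)) (zb s s01)).
  apply: le_trans (ler_wpM2l (sqrtr_ge0 s) (ler_normB _ _)) _; rewrite mulrDr.
  apply: le_trans (lerD h1 h2) _; rewrite (_ : C1 * (4 * M) * 2 = 8 * (C1 * M)); last by ring.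
  rewrite lerD2r (_ : 7 * M * (2 * M) = 14 * M ^+ 2); last by ring.
  by rewrite ler_wpM2r// ler_nat.
have mB : measurable_fun I01 B by exact: prim_meas pB.
(* The factor n comes from [sqr_sum_le], and (x - y)^2 <= 2 x^2 + 2 y^2 doubles 40 M^2 and 16 C1
   M^2. In the second term one factor taubar <= C1 s tames |p1 + p2|^2, and the other is kept for
   E. *)
pose bf s := n%:R * \sum_i (80 * M ^+ 2 * ww i t s ^+ 2 + 32 * (C1 * M ^+ 2) * (tb t s * zz i t s ^+ 2)).
have ie i : itg I01 (fun s => ww i t s ^+ 2) by case: (Le i).
have itz i : itg I01 (fun s => tb t s * zz i t s ^+ 2) by have [] := tbz_itg i tT.
have ibf0 i : itg I01 (fun s => 80 * M ^+ 2 * ww i t s ^+ 2 + 32 * (C1 * M ^+ 2) * (tb t s * zz i t s ^+ 2)).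
  by apply: itgD => //; exact: itgZ.
have ibf : itg I01 bf by apply: itgZ => //; exact: itg_sum.
have Bbf s : 0 < s < 1 -> rt s * B s ^+ 2 <= bf s.
  move=> s01; have /andP[r0 r1] := rb s s01; have /andP[t0 t1] := tbb s s01; have tb0 := tb_ge0 tT s01.
  apply: le_trans (ler_wpM2l (ltW r0) (sqr_sum_le _)) _; rewrite /bf mulrCA ler_wpM2l// mulr_sumr.
  apply: ler_sum => i _; have H1 := asb i s s01; have H2 := psb i s s01.
  have e0 := sqr_ge0 (ww i t s); have z0 := sqr_ge0 (zz i t s).
  have h1 : rt s * (asum i t s * ww i t s) ^+ 2 <= 40 * M ^+ 2 * ww i t s ^+ 2.
    by rewrite exprMn mulrA ler_wpM2r.
  have h2 : rt s * (tb t s * ps i s * zz i t s) ^+ 2 <= 16 * (C1 * M ^+ 2) * (tb t s * zz i t s ^+ 2).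
    apply: (@le_trans _ _ ((tb t s * ps i s * zz i t s) ^+ 2)); first by rewrite ler_piMl ?sqr_ge0.
    have -> : (tb t s * ps i s * zz i t s) ^+ 2 = (tb t s * ps i s ^+ 2) * (tb t s * zz i t s ^+ 2) by ring.
    apply: ler_wpM2r; first exact: mulr_ge0.
    apply: (@le_trans _ _ (C1 * s * ps i s ^+ 2)); first by rewrite ler_wpM2r ?sqr_ge0.
    by rewrite -[leLHS]mulrA [leRHS]mulrCA ler_wpM2l.
  apply: le_trans (weighted_sqrB (ltW r0) h1 h2) _.
  by rewrite le_eqVlt; apply/orP; left; apply/eqP; ring.
have iB : itg I01 (fun s => rt s * B s ^+ 2).
  apply: (itg_le (g := bf)) => //.
    by apply: measurable_funM; [exact: meas_rt|exact: measurable_funX].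
  by move=> s; rewrite /= in_itv/= => s01; rewrite (ger0_norm (mulr_ge0 (sqrtr_ge0 _) (sqr_ge0 _))); exact: Bbf.
have bB : \int[mu]_(s in I01) (rt s * B s ^+ 2) <= kb * dist2 t.
  apply: (@le_trans _ _ (\int[mu]_(s in I01) bf s)); first exact: le_Rintegral.
  rewrite RintegralZl//; last exact: itg_sum.
  rewrite /kb -mulrA ler_wpM2l// Rint_sum// /dist2 mulr_sumr; apply: ler_sum => i _.
  rewrite RintegralD//; [|exact: itgZ|exact: itgZ].
  rewrite !RintegralZl// -nm_sqr; have [_ z0] := tbz_itg i tT; have e0 := sqr_ge0 (nm (ww i t)).
  have mm : 0 <= C1 * M ^+ 2 by exact: mulr_ge0.
  exact: wsum_le.
pose gf s := \sum_i (`|rt s * das i s * ww i t s| + (C2 * `|ps i s * (rt s * zz i t s)| + C1 * `|s * dps i s * (rt s * zz i t s)|)).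
have igi i : itg I01 (fun s => `|rt s * das i s * ww i t s| + (C2 * `|ps i s * (rt s * zz i t s)| + C1 * `|s * dps i s * (rt s * zz i t s)|)) /\
   \int[mu]_(s in I01) (`|rt s * das i s * ww i t s| + (C2 * `|ps i s * (rt s * zz i t s)| + C1 * `|s * dps i s * (rt s * zz i t s)|))
     <= (2 * M + (C2 + C1) * (2 * M * rt c^-1)) * S.
  have [L1 n1] := Ldas i; have [L2' n2] := Lps i; have [L3 n3] := Ldps i; have [L4 n4] := rtz i.
  have [i1 l1] := ip_abs L1 (Le i); have [i2 l2] := ip_abs L2' L4; have [i3 l3] := ip_abs L3 L4.
  have iZ2 := itgZ C2 m01 i2; have iZ3 := itgZ C1 m01 i3; have i23 := itgD m01 iZ2 iZ3.
  split; first exact: itgD.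
  rewrite RintegralD// RintegralD// !RintegralZl//.
  have l1' := le_trans l1 (ler_pM (nm_ge0 _) (nm_ge0 _) n1 (nS i)).
  have l2' := ler_wpM2l K2 (le_trans l2 (ler_pM (nm_ge0 _) (nm_ge0 _) n2 n4)).
  have l3' := ler_wpM2l K1 (le_trans l3 (ler_pM (nm_ge0 _) (nm_ge0 _) n3 n4)).
  apply: le_trans (lerD l1' (lerD l2' l3')) _; rewrite -/S le_eqVlt; apply/orP; left; apply/eqP; ring.
have ggf s : 0 < s < 1 -> rt s * `|g s| <= gf s.
  move=> s01; have /andP[r0 r1] := rb s s01; have /andP[t0 t1] := tbb s s01; have tb0 := tb_ge0 tT s01.
  apply: le_trans (ler_wpM2l (ltW r0) (ler_norm_sum _ _ _)) _; rewrite /gf mulr_sumr; apply: ler_sum => i _.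
  have s0 := unit_ge0 s01.
  have h1 : rt s * `|das i s * ww i t s| = `|rt s * das i s * ww i t s|.
    by rewrite !normrM (gtr0_norm r0) mulrA.
  have h2 : rt s * `|sb s * ps i s * zz i t s| <= C2 * `|ps i s * (rt s * zz i t s)|.
    have -> : rt s * `|sb s * ps i s * zz i t s| = `|sb s| * `|ps i s * (rt s * zz i t s)|.
      by rewrite !normrM (gtr0_norm r0); ring.
    by rewrite ler_wpM2r// sbb.
  have h3 : rt s * `|tb t s * dps i s * zz i t s| <= C1 * `|s * dps i s * (rt s * zz i t s)|.
    have -> : rt s * `|tb t s * dps i s * zz i t s| = tb t s * (`|dps i s| * (rt s * `|zz i t s|)).
      by rewrite (normrM (tb t s * _)) (normrM (tb t s)) (ger0_norm tb0); ring.
    have -> : C1 * `|s * dps i s * (rt s * zz i t s)| = C1 * s * (`|dps i s| * (rt s * `|zz i t s|)).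
      by rewrite !normrM (gtr0_norm r0) (ger0_norm s0); ring.
    by rewrite ler_wpM2r// !mulr_ge0// ltW.
  apply: le_trans (ler_wpM2l (ltW r0) (ler_normB _ _)) _; rewrite mulrDr h1 lerD2l mulrDl.
  apply: le_trans (ler_wpM2l (ltW r0) (ler_normD _ _)) _; rewrite mulrDr; exact: lerD.
have igf : itg I01 gf by apply: itg_sum => // i; case: (igi i).
have ig : itg I01 (fun s => rt s * `|g s|).
  apply: (itg_le (g := gf)) => //.
    by apply: measurable_funM; [exact: meas_rt|exact: measurableT_comp].
  by move=> s; rewrite /= in_itv/= => s01; rewrite ger0_norm ?mulr_ge0 ?sqrtr_ge0//; exact: ggf.
have bG : \int[mu]_(s in I01) (rt s * `|g s|) <= kg * S.
  apply: (@le_trans _ _ (\int[mu]_(s in I01) gf s)); first exact: le_Rintegral.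
  rewrite Rint_sum//; last by move=> i; case: (igi i).
  apply: (@le_trans _ _ (\sum_(i < n) ((2 * M + (C2 + C1) * (2 * M * rt c^-1)) * S))).
    by apply: ler_sum => i _; case: (igi i).
  by rewrite sumr_const card_ord -[leLHS]mulr_natl /kg mulrA.
have q0 s : 0 < s < 1 -> 0 <= q s.
  by move=> _; apply: sumr_ge0 => i _; rewrite divr_ge0// addr_ge0 ?sqr_ge0.
have iq : itg I01 (fun s => s * q s).
  have [_ [iq1 _]] := psq_int ev1 tT'; have [_ [iq2 _]] := psq_int ev2 tT'.
  apply: (itg_eq (f := fun s => 2^-1 * (s * psq (p := p1) t s + s * psq (p := p2) t s))) => //.
    by move=> s _; rewrite /q /psq -mulr_suml big_split/=; ring.
  by apply: itgZ => //; exact: itgD.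
(* The first part of B vanishes at 1 with e, the second with p1 + p2. *)
have B1 : B s @[s --> 1^'-] --> (0 : R).
  apply: cvg_sum0 => i; have [_ _ e1 _ _] := ww_prim i tT'.
  have p0 : ps i s @[s --> 1^'-] --> (0 : R).
    by rewrite -(addr0 0); apply: cvgD; [exact: pe1|exact: pe2].
  apply: (cvg0_le (C := 1) (g := fun s => 2 * (7 * M) * `|ww i t s| + C1 * 2 * `|ps i s|)); last first.
    have -> : (0 : R) = 2 * (7 * M) * 0 + C1 * 2 * 0 by rewrite !mulr0 addr0.
    apply: cvgD; apply: cvgM; try exact: cvg_cst; rewrite -(normr0 R); exact: cvg_norm.
  near=> s; have s01 : 0 < s < 1 by near: s; exact: near01_1.
  have s4 : 4^-1 < s by near: s; apply: nbhs_left_gt; rewrite invf_lt1 ?ltr1n// ltr0n.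
  have /andP[t0 t1] := tbb s s01; have tb0 := tb_ge0 tT s01.
  have [r0 sr] := rt_gt0 s01; have r2 := rt_sqr s01.
  have rh := rt_half s4 s01.
  rewrite mul1r; apply: le_trans (ler_normB _ _) _; apply: lerD.
    by rewrite normrM ler_wpM2r//; exact: rt_halve rh (rtas i s s01).
  have [_ /(_ s s01) zb] := Lz i; rewrite (normrM (tb t s * _)) (normrM (tb t s)) (ger0_norm tb0) mulrAC ler_wpM2r//.
  by apply: ler_pM => //; apply: le_trans t1 _; rewrite ler_piMr//; case/andP: s01 => _ /ltW.
have ns1 : sig1 t s - sig2 t s @[s --> 1^'-] --> (0 : R).
  by have := @cvgB _ _ _ _ _ _ _ _ _ s11 s12; rewrite subr0; exact.
have nuE s : 0 < s < 1 -> nu t s ^+ 2 <= k3 * dist2 t * rt s.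
  move=> s01; apply: le_trans (weighted_energy A0 (mulr_ge0 kg0 S0) pnu pnus pB mq mg q0 _ _ BA iq ig iB ns1 B1 bB bG s01) _.
  - by move=> r r01; apply: le_trans (nub r r01) _; rewrite ler_wpM2r//; exact: unit_ge0.
  - move=> r r01; apply: le_trans (ler_normB _ _) _; apply: le_trans A2.
    by apply: lerD; [exact: (sig_bnd ev1)|exact: (sig_bnd ev2)].
  by rewrite exprMn S2 /k3 le_eqVlt; apply/orP; left; apply/eqP; ring.
have Ji i : `|\int[mu]_(s in I01) (nu t s * asum i t s * zz i t s)| <= rt (56 * M ^+ 2 * k3) * rt c^-1 * dist2 t.
  (* The constant 56 = 2 * 14 + 2 * 14 below is [a_wint] for both solutions, after splitting the
     square of a1 + a2. *)
  pose L s := nu t s * asum i t s * (rt s)^-1.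
  have mir := @meas_rtV R.
  have mnu : measurable_fun I01 (nu t) by exact: prim_meas pnu.
  have mas : measurable_fun I01 (asum i t) by case: (Las i).
  have mL : measurable_fun I01 L by do 2 apply: measurable_funM => //.
  have [[_ h2 _ _ h3] [_ _ h4 h5]] := D1 i; have [[_ k2 _ _ k3'] [_ _ k4 k5]] := D2 i.
  have [ia1 la1] := a_wint h2 (ev_a ev1 i tT') h3 h4 h5.
  have [ia2 la2] := a_wint k2 (ev_a ev2 i tT') k3' k4 k5.
  pose bL s := k3 * dist2 t * (2 * ((rt s)^-1 * a1 i t s ^+ 2) + 2 * ((rt s)^-1 * a2 i t s ^+ 2)).
  have ibL0 : itg I01 (fun s => 2 * ((rt s)^-1 * a1 i t s ^+ 2) + 2 * ((rt s)^-1 * a2 i t s ^+ 2)).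
    by apply: itgD => //; exact: itgZ.
  have ibL : itg I01 bL by exact: itgZ.
  have kE : 0 <= k3 * dist2 t by exact: mulr_ge0.
  have LbL s : 0 < s < 1 -> L s ^+ 2 <= bL s.
    move=> s01; have /andP[r0 r1] := rb s s01; have H := nuE s s01; have rn : rt s != 0 by rewrite gt_eqF.
    apply: (@le_trans _ _ (k3 * dist2 t * ((rt s)^-1 * asum i t s ^+ 2))).
      have -> : L s ^+ 2 = nu t s ^+ 2 * ((rt s)^-1 ^+ 2 * asum i t s ^+ 2) by rewrite /L; ring.
      apply: le_trans (ler_wpM2r _ H) _; first by rewrite mulr_ge0 ?sqr_ge0.
      by rewrite le_eqVlt; apply/orP; left; apply/eqP; field.
    rewrite /bL ler_wpM2l//; have r0' : 0 <= (rt s)^-1 by rewrite invr_ge0 ltW.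
    have := weighted_sqrB r0' (lexx _) (lexx ((rt s)^-1 * (- a2 i t s) ^+ 2)).
    by rewrite opprK sqrrN; exact.
  have LL : L2I L.
    split => //; apply: (itg_le (g := bL)) => //; first exact: measurable_funX.
    by move=> s; rewrite /= in_itv/= => s01; rewrite ger0_norm ?sqr_ge0// LbL.
  have k560 : 0 <= 56 * M ^+ 2 * k3 := mulr_ge0 (mulr_ge0 (ler0n _ _) m2) k30.
  have nL : nm L <= rt (56 * M ^+ 2 * k3) * S.
    rewrite -sqrtrM// -(ger0_norm (nm_ge0 _)) -sqrtr_sqr ler_wsqrtr// nm_sqr.
    have [_ L22] := LL; apply: (@le_trans _ _ (\int[mu]_(s in I01) bL s)); first exact: le_Rintegral.
    rewrite RintegralZl// RintegralD//; [|exact: itgZ|exact: itgZ].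
    rewrite !RintegralZl//; apply: (@le_trans _ _ (k3 * dist2 t * (2 * (14 * M ^+ 2) + 2 * (14 * M ^+ 2)))).
      by rewrite ler_wpM2l// lerD// ler_wpM2l.
    by rewrite le_eqVlt; apply/orP; left; apply/eqP; ring.
  have [L4 n4] := rtz i.
  have E s : 0 < s < 1 -> nu t s * asum i t s * zz i t s = L s * (rt s * zz i t s).
    move=> s01; have /andP[r0 _] := rb s s01; rewrite /L; field; by rewrite gt_eqF.
  rewrite (Rint_eq E); apply: le_trans (nm_ip LL L4) _.
  apply: le_trans (ler_pM (nm_ge0 _) (nm_ge0 _) nL n4) _.
  by rewrite -/S -S2 le_eqVlt; apply/orP; left; apply/eqP; ring.
rewrite /J; apply: le_trans (ler_norm_sum _ _ _) _.
apply: (@le_trans _ _ (\sum_(i < n) (rt (56 * M ^+ 2 * k3) * rt c^-1 * dist2 t))); first exact: ler_sum.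
by rewrite sumr_const card_ord -[leLHS]mulr_natl !mulrA.
Unshelve. all: by end_near. Qed.

End Pair.

(** * Gronwall's lemma for right increments *)

Section Gronwall.
Context {R : realType}.

(** (E + eps) exp(-(L + 1) x) is nonincreasing by [dini_nonincr]: the exponent L + 1 in place of L
    leaves room for an error (L + 1) eps in each increment. Starting close to 0, where E <= eps, one
    gets a bound by 2 eps, and eps is arbitrary. *)
Lemma gronwall (T L : R) (E : R -> R) : 0 <= L -> (forall t, 0 < t < T -> 0 <= E t) ->
  (forall t e, 0 < t < T -> 0 < e -> exists2 d : R, 0 < d &
     forall r, 0 < r < T -> `|r - t| < d -> `|E r - E t| <= e) ->
  (forall t e, 0 < t < T -> 0 < e -> exists2 d : R, 0 < d &
     forall r, t <= r < t + d -> r < T -> E r - E t <= (r - t) * (L * E t + e)) ->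
  (forall e, 0 < e -> exists2 d : R, 0 < d & forall r, 0 < r < d -> r < T -> E r <= e) ->
  forall t, 0 < t < T -> E t = 0.
Proof.
move=> L0 E0 cE dE iE t tT; apply/le_anti; rewrite E0// andbT.
have key (eps : R) : 0 < eps -> E t <= 2 * eps * expR ((L + 1) * T).
  move=> e0; have [d d0 hd] := iE eps e0; pose x0 := Num.min d t / 2.
  have [m1 m2 m3] : [/\ Num.min d t <= d, Num.min d t <= t & 0 < Num.min d t].
    by rewrite !ge_min !lt_min !lexx orbT d0; split => //; slra.
  have [x00 [x0t x0d]] : 0 < x0 /\ x0 < t /\ x0 < d by rewrite /x0; move: (Num.min d t) m1 m2 m3 => m; slra.
  clearbody x0; clear m1 m2 m3.
  have x0T : 0 < x0 < T by move: tT x00 x0t; clear; lra.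
  have x0E : E x0 <= eps by apply: hd; slra.
  pose g x := (E x + eps) * expR (- ((L + 1) * x)).
  have gg : g t <= g x0.
    apply: dini_nonincr; first by slra.
      apply/subspace_continuousP => x xt; apply: cvgM; last first.
        apply: cvg_within_filter; apply: (@continuous_comp _ _ _ (fun y : R => - ((L + 1) * y)) expR x); last exact: continuous_expR.
        by apply: cvgN; apply: cvgM; [exact: cvg_cst|exact: cvg_id].
      apply: cvgD; last exact: cvg_cst.
      move: x xt; apply/subspace_continuousP/within_ctsP => x xt e e1.
      have [d' d'0 hd'] := cE x (e / 2) ltac:(slra) ltac:(slra); exists d' => // y yt yx.
      by apply: le_lt_trans (hd' y _ yx) _; [move: yt tT x00|move: e1]; clear; lra.
    move=> x xt; have xT : 0 < x < T by move: xt x00 tT; clear; lra.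
    have Ex := E0 x xT; have [d' d'0 hd'] := dE x ((L + 1) * eps) xT (mulr_gt0 (ltr_wpDl L0 ltr01) e0).
    exists (d' / 2); first by slra.
    move=> y yx yt; have yT : x <= y < x + d' by move: yx yt d'0; clear; lra.
    have H := hd' y yT (le_lt_trans yt (proj2 (andP tT))).
    have -> : g x = (E x + eps) * expR ((L + 1) * (y - x)) * expR (- ((L + 1) * y)).
      by rewrite -mulrA -expRD /g; congr (_ * expR _); ring.
    apply: ler_wpM2r; first exact: expR_ge0.
    have H2 := expR_ge1Dx ((L + 1) * (y - x)).
    apply: le_trans (ler_wpM2l _ H2); last by move: Ex e0; clear; lra.
    have H3 : 0 <= (y - x) * E x by apply: mulr_ge0 => //; move: yx; clear; lra.
    by clear -H H3; lra.
  have Et := E0 t tT.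
  have h : E t + eps <= (E x0 + eps) * expR ((L + 1) * (t - x0)).
    rewrite -(ler_pM2r (expR_gt0 (- ((L + 1) * t)))) -mulrA -expRD.
    by rewrite (_ : (L + 1) * (t - x0) + - ((L + 1) * t) = - ((L + 1) * x0))//; ring.
  apply: (@le_trans _ _ (E t + eps)); first by slra.
  apply: le_trans h _; apply: ler_pM; [|exact: expR_ge0| |].
  - by have := E0 x0 x0T; move: e0; clear; lra.
  - by move: x0E; clear; lra.
  - by rewrite ler_expR ler_wpM2l//; move: tT x00 L0; clear; lra.
apply/ler_addgt0Pr => e e0; rewrite add0r; pose k := expR ((L + 1) * T); have k0 : 0 < k by exact: expR_gt0.
have := key (e / (2 * k)); rewrite divr_gt0// ?mulr_gt0// => /(_ isT).
by rewrite -/k (_ : 2 * (e / (2 * k)) * k = e)//; field; rewrite gt_eqF.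
Qed.

End Gronwall.

(** The final arithmetic of [ww_step]: g1 and g2 are the two flux pairings, x and y the increments
    of the two velocities against the test function. *)
Lemma duality_arith {R : realFieldType} (x y k g1 g2 g d e M C : R) : g1 - g2 = 2 * g + d ->
  `|d| <= 4 * C * e -> `|x + k * g1| <= k * (e * (4 * M)) -> `|y + k * g2| <= k * (e * (4 * M)) ->
  0 <= k -> x - y <= k * (- (2 * g) + (8 * M + 4 * C) * e).
Proof.
move=> E; have -> : g1 = g2 + 2 * g + d by slra.
rewrite !ler_norml => /andP[h1 _] /andP[_ h2] /andP[h3 _] k0.
have h4 : 0 <= k * (d + 4 * C * e) by rewrite mulr_ge0//; slra.
by slra.
Qed.

(** The final arithmetic of [tbz_step]: b1 is the contribution of the increment of taubar, x1 + x2
    that of the increment of z. *)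
Lemma quot_arith {R : realFieldType} (k b1 b2 b3 s0 s1 C6 C1 c M e x1 x2 x3 : R) :
  0 <= k -> 0 <= C6 -> b1 <= k * (C6 * s0) -> s0 <= s1 + 8 * e -> s1 <= c * b3 ->
  x1 <= k * (8 * C1 * e) -> x2 = k * (2 * b2 + x3) -> x3 <= 4 * (M * C1) * e ->
  b1 + (x1 + x2) <= k * (2 * b2 + C6 * c * b3 + (8 * C6 + 8 * C1 + 4 * (M * C1)) * e).
Proof.
move=> k0 c60 h1 h2 h3 h4 -> h5; have H1 := ler_wpM2l (mulr_ge0 k0 c60) (le_trans h2 (lerD h3 (lexx _))).
by have H2 := ler_wpM2l k0 h5; slra.
Qed.

(** * Evolution of the distance between two solutions *)

Section Distance.
Context {R : realType}.
Local Notation mu := (@lebesgue_measure R).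
Local Notation itg D f := (mu.-integrable D (EFin \o f)).
Local Notation I01 := (`]@GRing.zero R, @GRing.one R[%classic).
Local Notation L2I := (L2 I01).
Local Notation rt := (@Num.sqrt R).

Let m01 : measurable I01. Proof. exact: measurable_itv. Qed.

Context {n : nat} {T M c : R}.
Context {v1 p1 w1 a1 : 'I_n -> R -> R -> R} {tau1 sig1 : R -> R -> R}.
Context {v2 p2 w2 a2 : 'I_n -> R -> R -> R} {tau2 sig2 : R -> R -> R}.
Context (ev1 : evolution T M v1 p1 w1 a1 tau1 sig1) (ev2 : evolution T M v2 p2 w2 a2 tau2 sig2).
Local Notation good1 t := (forall i, good_slice M (p1 i t) (a1 i t)).
Local Notation good2 t := (forall i, good_slice M (p2 i t) (a2 i t)).
Context (c_gt0 : 0 < c).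
Context (tl1 : forall t s, 0 < t < T -> 0 < s < 1 -> s * c <= tau1 t s).
Context (tl2 : forall t s, 0 < t < T -> 0 < s < 1 -> s * c <= tau2 t s).

Local Notation C1 := (@C1 R n M).
Local Notation C2 := (@C2 R n M).
Local Notation C6 := (@C6 R n M).
Local Notation zz := (zz (v1 := v1) (v2 := v2)).
Local Notation ww := (ww (w1 := w1) (w2 := w2)).
Local Notation nu := (nu (tau1 := tau1) (tau2 := tau2)).
Local Notation tb := (tb (tau1 := tau1) (tau2 := tau2)).
Local Notation asum := (asum (a1 := a1) (a2 := a2)).
Local Notation dist2 := (dist2 (v1 := v1) (w1 := w1) (tau1 := tau1) (v2 := v2) (w2 := w2) (tau2 := tau2)).
Local Notation J := (J (v1 := v1) (a1 := a1) (tau1 := tau1) (v2 := v2) (a2 := a2) (tau2 := tau2)).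

Let M0 : 0 <= M. Proof. exact: ev_M ev1. Qed.
Let K1 : 0 <= C1. Proof. exact: C1_ge0. Qed.
Let T0 : 0 < T. Proof. exact: ev_T ev1. Qed.

(** Both the time derivative of [zz] and the s-derivative of [ww]. *)
Definition alpha i t s := a1 i t s - a2 i t s.
(** The difference of the fluxes equals taubar z + nu (v1 + v2) / 2, which is how J arises in
    [J_identity]. *)
Definition GG i t s := tau1 t s * v1 i t s - tau2 t s * v2 i t s.

Lemma alpha_L2 i t : 0 <= t <= T -> L2I (alpha i t) /\ nm (alpha i t) <= 2 * M.
Proof.
move=> tT; have La1 := ev_a ev1 i tT; have La2 := ev_a ev2 i tT; split; first exact: L2B.
apply: le_trans (nmD La1 (L2N m01 La2)) _; rewrite nmN.
exact: addself_le (a_bnd ev1 i tT) (a_bnd ev2 i tT).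
Qed.

Lemma pair_near (e t : R) : 0 <= t <= T -> 0 < e -> exists2 d : R, 0 < d &
  forall r, 0 <= r <= T -> `|r - t| < d -> forall i,
   [/\ nm (fun s => alpha i r s - alpha i t s) <= 2 * e, nm (fun s => asum i r s - asum i t s) <= 2 * e,
       nm (fun s => zz i r s - zz i t s) <= 2 * e & nm (fun s => ww i r s - ww i t s) <= 2 * e].
Proof.
move=> tT e0; have [d1 d10 h1] := near_all ev1 tT e0; have [d2 d20 h2] := near_all ev2 tT e0.
have [d3 d30 h3] : exists2 d : R, 0 < d & forall r, `|r - t| < d -> forall i, 0 <= r <= T -> nm (fun s => w1 i r s - w1 i t s) <= e.
  by apply: fin_near => i; have [d d0 hd] := w_tcts ev1 i tT e0; exists d => // r rd rT; exact: hd.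
have [d4 d40 h4] : exists2 d : R, 0 < d & forall r, `|r - t| < d -> forall i, 0 <= r <= T -> nm (fun s => w2 i r s - w2 i t s) <= e.
  by apply: fin_near => i; have [d d0 hd] := w_tcts ev2 i tT e0; exists d => // r rd rT; exact: hd.
exists (Num.min (Num.min d1 d2) (Num.min d3 d4)); first by rewrite !lt_min d10 d20 d30 d40.
move=> r rT; rewrite !lt_min => /andP[/andP[r1 r2] /andP[r3 r4]] i.
have [_ x1 y1] := h1 r rT r1 i; have [_ x2 y2] := h2 r rT r2 i.
have u1 := h3 r r3 i rT; have u2 := h4 r r4 i rT.
have [La1 La2] := (ev_a ev1 i rT, ev_a ev2 i rT); have [Lb1 Lb2] := (ev_a ev1 i tT, ev_a ev2 i tT).
have [Lv1 Lv2] := (v_L2 ev1 i rT, v_L2 ev2 i rT); have [Lu1 Lu2] := (v_L2 ev1 i tT, v_L2 ev2 i tT).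
have [[_ Lw1] [_ Lw2]] := (w_L2 ev1 i rT, w_L2 ev2 i rT); have [[_ Lx1] [_ Lx2]] := (w_L2 ev1 i tT, w_L2 ev2 i tT).
have B (f g f' g' : R -> R) : L2I f -> L2I g -> L2I f' -> L2I g' -> nm (fun s => f s - g s) <= e ->
    nm (fun s => f' s - g' s) <= e -> nm (fun s => (f s - f' s) - (g s - g' s)) <= 2 * e.
  move=> Lf Lg Lf' Lg' h h'.
  have Ln : L2I (fun s => g' s - f' s) by exact: L2B.
  rewrite nmBC in h'; apply: le_trans (addself_le h h').
  by apply: le_trans (nmD (L2B m01 Lf Lg) Ln); rewrite le_eqVlt; apply/orP; left; apply/eqP/nm_ext => s _; ring.
split; [exact: B| |exact: B|exact: B].
apply: le_trans (addself_le x1 x2).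
by apply: le_trans (nmD (L2B m01 La1 Lb1) (L2B m01 La2 Lb2)); rewrite le_eqVlt; apply/orP; left; apply/eqP/nm_ext => s _; rewrite /asum; ring.
Qed.

Lemma orth_alpha t : 0 <= t <= T ->
  {ae mu, forall s, I01 s -> \sum_i (v1 i t s + v2 i t s) * alpha i t s = - \sum_i zz i t s * asum i t s}.
Proof.
move=> tT; apply: (filterS_ae (ae_and (ev_va ev1 tT) (ev_va ev2 tT))) => s [h1 h2] s01.
apply/eqP; rewrite -subr_eq0 opprK -big_split/=.
transitivity (2 * (\sum_i v1 i t s * a1 i t s) - 2 * (\sum_i v2 i t s * a2 i t s) == 0); last by rewrite h1// h2// mulr0 subr0 eqxx.
rewrite !mulr_sumr -sumrB; congr (_ == _); apply: eq_bigr => i _; rewrite /alpha /zz /asum; ring.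
Qed.

Lemma GG_L2 i t : 0 < t < T -> L2I (GG i t) /\ nm (GG i t) <= 2 * C1.
Proof.
move=> tT; have L1 := F_L2 ev1 i tT; have L2 := F_L2 ev2 i tT; split; first exact: L2B.
apply: le_trans (nmD L1 (L2N m01 L2)) _; rewrite nmN.
exact: addself_le (F_nm ev1 i tT) (F_nm ev2 i tT).
Qed.

(** The terms with taubar cancel and leave - nu (v1 + v2).alpha, which [orth_alpha] turns into nu
    (a1 + a2).z. *)
Lemma J_identity t : 0 < t < T ->
  \sum_i (2 * \int[mu]_(s in I01) (tb t s * zz i t s * alpha i t s) - 2 * \int[mu]_(s in I01) (GG i t s * alpha i t s)) = J t.
Proof.
move=> tT; have tT' : 0 <= t <= T by slra.
have [mtb tbb] := tb_bnd ev1 ev2 tl1 tl2 tT.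
have Ltz i : L2I (fun s => tb t s * zz i t s).
  apply: (L2_bndM (M := C1)) => //; last by have [] := zz_bnd ev1 ev2 i tT'.
  move=> s; rewrite /= in_itv/= => s01; rewrite ger0_norm; last exact: (tb_ge0 ev1 ev2 c_gt0 tl1 tl2).
  by have /andP[_ h] := tbb s s01; apply: le_trans h _; rewrite ler_piMr//; case/andP: s01 => _ /ltW.
have i1 i := L2_mul m01 (Ltz i) (proj1 (alpha_L2 i tT')).
have i2 i := L2_mul m01 (proj1 (GG_L2 i tT)) (proj1 (alpha_L2 i tT')).
have Lnz i : L2I (fun s => nu t s * zz i t s).
  have -> : (fun s => nu t s * zz i t s) = (fun s => tau1 t s * zz i t s - tau2 t s * zz i t s).
    by apply/funext => s; rewrite /nu mulrBl.
  have [Lz _] := zz_bnd ev1 ev2 i tT'.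
  have [pt1 _ _ _] := ev_tau ev1 tT; have [pt2 _ _ _] := ev_tau ev2 tT.
  apply: L2B => //; apply: (L2_bndM (M := C1)) => //; try exact: prim_meas pt1; try exact: prim_meas pt2.
    move=> s; rewrite /= in_itv/= => s01; have := tau_bnd ev1 tT s01 => /andP[h0 h1].
    by rewrite ger0_norm//; apply: le_trans h1 _; rewrite ler_piMr//; case/andP: s01 => _ /ltW.
  move=> s; rewrite /= in_itv/= => s01; have := tau_bnd ev2 tT s01 => /andP[h0 h1].
  by rewrite ger0_norm//; apply: le_trans h1 _; rewrite ler_piMr//; case/andP: s01 => _ /ltW.
have Las i : L2I (asum i t) by apply: L2D => //; [exact: (ev_a ev1)|exact: (ev_a ev2)].
have i3 i : itg I01 (fun s => nu t s * asum i t s * zz i t s).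
  apply: (itg_eq (f := fun s => nu t s * zz i t s * asum i t s)) => //; last exact: L2_mul.
  by move=> s _; rewrite mulrAC.
have i4 i : itg I01 (fun s => 2 * (tb t s * zz i t s * alpha i t s) - 2 * (GG i t s * alpha i t s)).
  by apply: itgB => //; exact: itgZ.
rewrite /J -Rint_sum//; transitivity (\sum_i \int[mu]_(s in I01) (2 * (tb t s * zz i t s * alpha i t s) - 2 * (GG i t s * alpha i t s))).
  by apply: eq_bigr => i _; rewrite RintegralB//; [|exact: itgZ|exact: itgZ]; rewrite !RintegralZl.
rewrite -Rint_sum//; apply: Rint_ae_eq => //; try exact: itg_meas (itg_sum m01 i4); try exact: itg_meas (itg_sum m01 i3).
apply: (filterS_ae (orth_alpha tT')) => s H s01.
transitivity (- nu t s * \sum_i (v1 i t s + v2 i t s) * alpha i t s).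
  rewrite [RHS]mulr_sumr; apply: eq_bigr => i _; by rewrite /tb /zz /GG /nu; field.
have {}H := H s01; rewrite H mulrNN mulr_sumr; apply: eq_bigr => i _; ring.
Qed.

Lemma tb_L2 t (f : R -> R) : 0 < t < T -> L2I f ->
  L2I (fun s => tb t s * f s) /\ nm (fun s => tb t s * f s) <= C1 * nm f.
Proof.
move=> tT Lf; have [mtb tbb] := tb_bnd ev1 ev2 tl1 tl2 tT.
have b s : 0 < s < 1 -> `|tb t s| <= C1.
  move=> s01; rewrite ger0_norm; last exact: (tb_ge0 ev1 ev2 c_gt0 tl1 tl2).
  by have /andP[_ h] := tbb s s01; apply: le_trans h _; rewrite ler_piMr//; case/andP: s01 => _ /ltW.
have L : L2I (fun s => tb t s * f s).
  by apply: (L2_bndM (M := C1)) => // s; rewrite /= in_itv/=; exact: b.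
split => //; rewrite -[C1]ger0_norm// -nmZ//; apply: nm_le => //; first exact: L2Z.
by move=> s s01; rewrite (normrM (tb t s)) (normrM C1) ler_wpM2r// (ger0_norm K1); exact: b.
Qed.

Lemma tb_close (e t : R) : 0 < t < T -> 0 < e -> exists2 d : R, 0 < d &
  forall r, 0 < r < T -> `|r - t| < d -> forall s, 0 < s < 1 -> `|tb r s - tb t s| <= e /\ `|nu r s - nu t s| <= 2 * e.
Proof.
move=> tT e0; have [d1 d10 h1] := near_tau ev1 tT e0; have [d2 d20 h2] := near_tau ev2 tT e0.
exists (Num.min d1 d2); first by rewrite lt_min d10.
move=> r rT; rewrite lt_min => /andP[r1 r2] s s01.
have s1 : s * e <= e by rewrite ler_piMl ?(ltW e0)//; case/andP: s01 => _ /ltW.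
have b1 := le_trans (h1 r rT r1 s s01) s1; have b2 := le_trans (h2 r rT r2 s s01) s1.
split; first by rewrite (_ : _ - _ = (tau1 r s - tau1 t s + (tau2 r s - tau2 t s)) / 2); [exact: norm_half_sum|rewrite /tb; field].
have -> : nu r s - nu t s = (tau1 r s - tau1 t s) - (tau2 r s - tau2 t s) by rewrite /nu; ring.
by apply: le_trans (ler_normB _ _) _; exact: addself_le.
Qed.

Lemma tbz_diff i t r : 0 < t < T -> 0 < r < T ->
  \int[mu]_(s in I01) (tb r s * zz i r s ^+ 2) - \int[mu]_(s in I01) (tb t s * zz i t s ^+ 2) =
  \int[mu]_(s in I01) ((tb r s - tb t s) * zz i r s ^+ 2) +
  \int[mu]_(s in I01) ((zz i r s - zz i t s) * (tb t s * (zz i r s + zz i t s))).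
Proof.
move=> tT rT; have tT' : 0 <= t <= T by slra.
have rT' : 0 <= r <= T by slra.
have [Lr _] := zz_bnd ev1 ev2 i rT'; have [Lt _] := zz_bnd ev1 ev2 i tT'.
have [ir _] := tbz_itg ev1 ev2 c_gt0 tl1 tl2 i rT; have [it _] := tbz_itg ev1 ev2 c_gt0 tl1 tl2 i tT.
have [Lts _] := tb_L2 tT (L2D m01 Lr Lt).
have i2 := L2_mul m01 (L2B m01 Lr Lt) Lts.
have [Ltr _] := tb_L2 tT Lr.
have i3 : itg I01 (fun s => (tb r s - tb t s) * zz i r s ^+ 2).
  apply: (itg_eq (f := fun s => tb r s * zz i r s ^+ 2 - (tb t s * zz i r s) * zz i r s)) => //.
    by move=> s _; ring.
  by apply: itgB => //; exact: L2_mul.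
rewrite -RintegralB// -RintegralD//; apply: Rint_eq => s _; ring.
Qed.

Lemma zz_nm2 i t : 0 <= t <= T -> nm (zz i t) <= 2.
Proof.
move=> tT; have [[mz _] b] := zz_bnd ev1 ev2 i tT.
by apply: le_trans (nm_bnd mz b) _; rewrite ger0_norm.
Qed.

Lemma dist2_cts t e : 0 < t < T -> 0 < e -> exists2 d : R, 0 < d &
  forall r, 0 < r < T -> `|r - t| < d -> `|dist2 r - dist2 t| <= e.
Proof.
move=> tT e0; have tT' : 0 <= t <= T by slra.
have ew_bnd i r : 0 <= r <= T -> L2I (ww i r) /\ nm (ww i r) <= 2 * M.
  move=> rT; have [_ _ _ Lww b] := ww_prim ev1 ev2 i rT; split => //.
  have [mw _] := Lww; by apply: le_trans (nm_bnd mw b) _; rewrite ger0_norm ?mulr_ge0.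
have cw i : tcts T (ww i).
  move=> r rT e1 e10; have [d d0 hd] := @pair_near (e1 / 2) r rT ltac:(slra); exists d => // x xT xr.
  by have [_ _ _] := hd x xT xr i; rewrite mulrCA divff// mulr1.
have [d1 d10 h1] := tcts_energy (fun i r rT => proj1 (ew_bnd i r rT)) (fun i r rT => proj2 (ew_bnd i r rT)) cw tT' (ltac:(slra) : 0 < e / 2).
pose N : R := n%:R * (4 + 8 * C1) + 1.
have N0 : 0 < N by rewrite ltr_pwDr// mulr_ge0// addr_ge0// mulr_ge0.
have e1 : 0 < e / 2 / N by rewrite divr_gt0//; slra.
have [d2 d20 h2] := tb_close tT e1; have [d3 d30 h3] := pair_near tT' e1.
exists (Num.min d1 (Num.min d2 d3)); first by rewrite !lt_min d10 d20 d30.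
move=> r rT; rewrite !lt_min => /andP[r1 /andP[r2 r3]]; have rT' : 0 <= r <= T by slra.
have {}h1 := h1 r rT' r1.
have zd i : `|\int[mu]_(s in I01) (tb r s * zz i r s ^+ 2) - \int[mu]_(s in I01) (tb t s * zz i t s ^+ 2)| <= (4 + 8 * C1) * (e / 2 / N).
  rewrite tbz_diff//; have [Lr br] := zz_bnd ev1 ev2 i rT'; have [Lt bt] := zz_bnd ev1 ev2 i tT'.
  have [Lts nts] := tb_L2 tT (L2D m01 Lr Lt).
  have A1 : `|\int[mu]_(s in I01) ((tb r s - tb t s) * zz i r s ^+ 2)| <= 4 * (e / 2 / N).
    have mtr := proj1 (tb_bnd ev1 ev2 tl1 tl2 rT); have mtt := proj1 (tb_bnd ev1 ev2 tl1 tl2 tT).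
    have Lz : L2I (fun s => (tb r s - tb t s) * zz i r s).
      apply: (L2_bndM (M := e / 2 / N)) => //; first exact: measurable_funB.
      by move=> s; rewrite /= in_itv/= => s01; have [] := h2 r rT r2 s s01.
    rewrite (Rint_eq (g := fun s => (tb r s - tb t s) * zz i r s * zz i r s)); last by move=> s _; ring.
    apply: le_trans (nm_ip Lz Lr) _; rewrite -[4](_ : 2 * 2 = _ :> R); last by rewrite -natrM.
    rewrite mulrAC; apply: ler_pM (zz_nm2 i rT') => //; try exact: nm_ge0.
    have bz s : 0 < s < 1 -> `|(tb r s - tb t s) * zz i r s| <= 2 * (e / 2 / N).
      by move=> s01; rewrite normrM mulrC; apply: ler_pM => //; [exact: br|have [] := h2 r rT r2 s s01].
    have [mLz _] := Lz; apply: le_trans (nm_bnd mLz bz) _; rewrite ger0_norm//.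
    by rewrite mulr_ge0// ltW.
  have A2 : `|\int[mu]_(s in I01) ((zz i r s - zz i t s) * (tb t s * (zz i r s + zz i t s)))| <= 8 * C1 * (e / 2 / N).
    apply: le_trans (nm_ip (L2B m01 Lr Lt) Lts) _; have [_ _ z1 _] := h3 r rT' r3 i.
    have z2 : nm (fun s => zz i r s + zz i t s) <= 4.
      apply: le_trans (nmD Lr Lt) _; apply: le_trans (addself_le (zz_nm2 i rT') (zz_nm2 i tT')) _.
      by rewrite -natrM.
    apply: le_trans (ler_pM (nm_ge0 _) (nm_ge0 _) z1 (le_trans nts (ler_wpM2l K1 z2))) _.
    by rewrite le_eqVlt; apply/orP; left; apply/eqP; ring.
  by apply: le_trans (ler_normD _ _) _; rewrite mulrDl; exact: lerD.
have -> : dist2 r - dist2 t = (\sum_i nm (ww i r) ^+ 2 - \sum_i nm (ww i t) ^+ 2) +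
   \sum_i (\int[mu]_(s in I01) (tb r s * zz i r s ^+ 2) - \int[mu]_(s in I01) (tb t s * zz i t s ^+ 2)).
  by rewrite /dist2 !big_split/= sumrN; ring.
apply: le_trans (ler_normD _ _) _.
have A : `|\sum_i (\int[mu]_(s in I01) (tb r s * zz i r s ^+ 2) - \int[mu]_(s in I01) (tb t s * zz i t s ^+ 2))| <= e / 2.
  apply: le_trans (ler_norm_sum _ _ _) _.
  apply: (@le_trans _ _ (\sum_(i < n) ((4 + 8 * C1) * (e / 2 / N)))); first by apply: ler_sum => i _; exact: zd.
  rewrite sumr_const card_ord -[leLHS]mulr_natl mulrA.
  rewrite -[leRHS](divfK (lt0r_neq0 N0)) [leRHS]mulrC ler_wpM2r//; first exact: ltW.
  by rewrite /N lerDl.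
by rewrite [leRHS](splitr e); exact: lerD.
Qed.

(** [J_bound] holds at good times; continuity of both of its sides extends it to all times in
    [J_bound_all]. *)
Lemma J_cts t e : 0 < t < T -> 0 < e -> exists2 d : R, 0 < d &
  forall r, 0 < r < T -> `|r - t| < d -> `|J r - J t| <= e.
Proof.
move=> tT e0; have tT' : 0 <= t <= T by slra.
have nub r : 0 < r < T -> measurable_fun I01 (nu r) /\ forall s, 0 < s < 1 -> `|nu r s| <= 2 * C1.
  move=> rT; have [pt1 _ _ _] := ev_tau ev1 rT; have [pt2 _ _ _] := ev_tau ev2 rT; split.
    by apply: measurable_funB; [exact: prim_meas pt1|exact: prim_meas pt2].
  move=> s s01; apply: le_trans (norm_diff_nneg (tau_bnd ev1 rT s01) (tau_bnd ev2 rT s01)) _.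
  by rewrite ler_wpM2l// ler_piMr//; case/andP: s01 => _ /ltW.
have asb r i : 0 <= r <= T -> L2I (asum i r) /\ nm (asum i r) <= 2 * M.
  move=> rT; have La1 := ev_a ev1 i rT; have La2 := ev_a ev2 i rT; split; first exact: L2D.
  by apply: le_trans (nmD La1 La2) _; exact: addself_le (a_bnd ev1 i rT) (a_bnd ev2 i rT).
have C0 : 0 <= 2 * C1 by rewrite mulr_ge0.
pose N : R := n%:R * (8 * M + 8 * C1 + 8 * (C1 * M)) + 1.
have N0 : 0 < N by rewrite ltr_pwDr// mulr_ge0// addr_ge0// ?addr_ge0 ?mulr_ge0// mulr_ge0.
have e1 : 0 < e / N by rewrite divr_gt0.
have [d2 d20 h2] := tb_close tT e1; have [d3 d30 h3] := pair_near tT' e1.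
exists (Num.min d2 d3); first by rewrite lt_min d20.
move=> r rT; rewrite lt_min => /andP[r2 r3]; have rT' : 0 <= r <= T by slra.
rewrite /J -sumrB; apply: le_trans (ler_norm_sum _ _ _) _.
have zd i : `|\int[mu]_(s in I01) (nu r s * asum i r s * zz i r s) - \int[mu]_(s in I01) (nu t s * asum i t s * zz i t s)|
    <= (8 * M + 8 * C1 + 8 * (C1 * M)) * (e / N).
  have [Lr br] := zz_bnd ev1 ev2 i rT'; have [Lt bt] := zz_bnd ev1 ev2 i tT'.
  have [Ar ar] := asb r i rT'; have [At at'] := asb t i tT'.
  have [mnr bnr] := nub r rT; have [mnt bnt] := nub t tT.
  have [_ da dz _] := h3 r rT' r3 i.
  have bM (u f : R -> R) (k : R) : 0 <= k -> measurable_fun I01 u -> (forall s, 0 < s < 1 -> `|u s| <= k) ->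
      L2I f -> L2I (fun s => u s * f s) /\ nm (fun s => u s * f s) <= k * nm f.
    move=> k0 mu' ub Lf; have L : L2I (fun s => u s * f s).
      by apply: (L2_bndM (M := k)) => // s; rewrite /= in_itv/=; exact: ub.
    split => //; rewrite -[k]ger0_norm// -nmZ//; apply: nm_le => //; first exact: L2Z.
    by move=> s s01; rewrite !normrM ler_wpM2r// (ger0_norm k0); exact: ub.
  have dn s : 0 < s < 1 -> `|nu r s - nu t s| <= 2 * (e / N) by move=> s01; have [] := h2 r rT r2 s s01.
  have e2 : 0 <= 2 * (e / N) by rewrite mulr_ge0// ltW.
  have [X1 Y1] := bM _ _ _ e2 (measurable_funB mnr mnt) dn Ar.
  have [X2 Y2] := bM _ _ _ C0 mnt bnt (L2B m01 Ar At).
  have [X3 Y3] := bM _ _ _ C0 mnt bnt At.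
  have i1 := L2_mul m01 X1 Lr; have i2 := L2_mul m01 X2 Lr; have i3 := L2_mul m01 X3 (L2B m01 Lr Lt).
  have [X4 _] := bM _ _ _ C0 mnr bnr Ar.
  have i4 := L2_mul m01 X4 Lr; have i5 := L2_mul m01 X3 Lt.
  rewrite -RintegralB//.
  rewrite (Rint_eq (g := fun s => (nu r s - nu t s) * asum i r s * zz i r s + nu t s * (asum i r s - asum i t s) * zz i r s
     + nu t s * asum i t s * (zz i r s - zz i t s))); last by move=> s _; ring.
  have i12 := itgD m01 i1 i2; rewrite RintegralD// RintegralD//.
  apply: le_trans (ler_normD _ _) _; rewrite 2!mulrDl; apply: lerD.
    apply: le_trans (ler_normD _ _) _; apply: lerD.
      apply: le_trans (nm_ip X1 Lr) _.
      apply: le_trans (ler_pM (nm_ge0 _) (nm_ge0 _) (le_trans Y1 (ler_wpM2l e2 ar)) (zz_nm2 i rT')) _.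
      by rewrite le_eqVlt; apply/orP; left; apply/eqP; ring.
    apply: le_trans (nm_ip X2 Lr) _.
    apply: le_trans (ler_pM (nm_ge0 _) (nm_ge0 _) (le_trans Y2 (ler_wpM2l C0 da)) (zz_nm2 i rT')) _.
    by rewrite le_eqVlt; apply/orP; left; apply/eqP; ring.
  apply: le_trans (nm_ip X3 (L2B m01 Lr Lt)) _.
  apply: le_trans (ler_pM (nm_ge0 _) (nm_ge0 _) (le_trans Y3 (ler_wpM2l C0 at')) dz) _.
  by rewrite le_eqVlt; apply/orP; left; apply/eqP; ring.
apply: (@le_trans _ _ (\sum_(i < n) ((8 * M + 8 * C1 + 8 * (C1 * M)) * (e / N)))); first by apply: ler_sum => i _; exact: zd.
rewrite sumr_const card_ord -[leLHS]mulr_natl mulrA.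
rewrite -[leRHS](divfK (lt0r_neq0 N0)) [leRHS]mulrC ler_wpM2r//; first exact: ltW.
by rewrite /N lerDl.
Qed.

Lemma zz_quot (t e : R) : 0 < t < T -> 0 < e -> exists2 d : R, 0 < d & forall r, t < r < t + d -> r < T -> forall i,
  nm (fun s => zz i r s - zz i t s - (r - t) * alpha i t s) <= (r - t) * (2 * e).
Proof.
move=> tT e0; have tT' : 0 <= t <= T by slra.
have Q (v p w a : 'I_n -> R -> R -> R) (tau sig : R -> R -> R) : evolution T M v p w a tau sig ->
    exists2 d : R, 0 < d & forall r, `|r - t| < d -> forall i, t < r < T -> nm (fun s => v i r s - v i t s - (r - t) * a i t s) <= (r - t) * e.
  move=> ev; apply: fin_near => i; have [d d0 hd] := ev_dv ev i tT' e0; exists d => // r rd rT.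
  have r0 : 0 < r - t by slra.
  have rT' : 0 <= r <= T by slra.
  have L : L2I (fun s => (r - t)^-1 * (v i r s - v i t s) - a i t s).
    apply: L2B => //; [apply: L2Z => //; apply: L2B => //; exact: (v_L2 ev)|exact: (ev_a ev)].
  have := hd r rT' _ rd; rewrite gt_eqF ?subr_gt0; last by slra.
  move=> /(_ isT) h; apply: le_trans (ler_wpM2l (ltW r0) h); rewrite -[X in X * nm _]gtr0_norm// -nmZ//.
  rewrite le_eqVlt; apply/orP; left; apply/eqP/nm_ext => s _; rewrite mulrBr mulrA divff ?mul1r//.
  by rewrite gt_eqF.
have [d1 d10 h1] := Q _ _ _ _ _ _ ev1; have [d2 d20 h2] := Q _ _ _ _ _ _ ev2.
exists (Num.min d1 d2); first by rewrite lt_min d10.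
move=> r /andP[tr rd] rT i; have : `|r - t| < Num.min d1 d2 by rewrite gtr0_norm; slra.
rewrite lt_min => /andP[r1 r2]; have rT' : 0 <= r <= T by slra.
have b1 := h1 r r1 i ltac:(slra); have b2 := h2 r r2 i ltac:(slra).
have L (v p w a : 'I_n -> R -> R -> R) (tau sig : R -> R -> R) : evolution T M v p w a tau sig ->
    L2I (fun s => v i r s - v i t s - (r - t) * a i t s).
  by move=> ev; apply: L2B => //; [apply: L2B => //; exact: (v_L2 ev)|apply: L2Z => //; exact: (ev_a ev)].
have L1 := L _ _ _ _ _ _ ev1; have L2 := L _ _ _ _ _ _ ev2.
rewrite mulrCA; apply: le_trans (addself_le b1 b2); rewrite -[X in _ <= _ + X]nmN.
apply: le_trans (nmD L1 (L2N m01 L2)); rewrite le_eqVlt; apply/orP; left; apply/eqP/nm_ext => s _.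
by rewrite /zz /alpha; ring.
Qed.

(** As in [energy_slow], the increment of e is tested with e r + e t, whose derivative is 2 alpha t
    up to a small error. Here the leading term does not vanish; together with the one of [tbz_step]
    it adds up to J. *)
Lemma ww_step (t e : R) : 0 < t < T -> 0 < e -> exists2 d : R, 0 < d & forall r, t <= r < t + d -> r < T -> forall i,
  nm (ww i r) ^+ 2 - nm (ww i t) ^+ 2 <=
    (r - t) * (- (2 * \int[mu]_(s in I01) (GG i t s * alpha i t s)) + (8 * M + 4 * C1) * e).
Proof.
move=> tT e0; have tT' : 0 <= t <= T by slra.
have [d1 d10 h1] := w_eq ev1 tT e0; have [d2 d20 h2] := w_eq ev2 tT e0; have [d3 d30 h3] := pair_near tT' e0.
exists (Num.min d1 (Num.min d2 d3)); first by rewrite !lt_min d10 d20.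
move=> r /andP[tr rd] rT i; have rT' : 0 <= r <= T by slra.
have : r - t < Num.min d1 (Num.min d2 d3) by slra.
rewrite !lt_min => /and3P[r1 r2 r3].
have [ad _ _ _] := h3 r rT' (ltac:(by rewrite ger0_norm; slra)) i.
have [pr Lpr er Lwr _] := ww_prim ev1 ev2 i rT'; have [pt Lpt et Lwt _] := ww_prim ev1 ev2 i tT'.
have c0 : ww i r s + ww i t s @[s --> 1^'-] --> (0 : R).
  by have := @cvgD _ _ _ _ _ _ _ _ _ er et; rewrite addr0; exact.
have H1 := h1 r tr rT (ltac:(slra)) i _ _ (primD pr pt) (L2D m01 Lpr Lpt) c0.
have H2 := h2 r tr rT (ltac:(slra)) i _ _ (primD pr pt) (L2D m01 Lpr Lpt) c0.
have [Lar nar] := alpha_L2 i rT'; have [Lat nat'] := alpha_L2 i tT'; have [LG nG] := GG_L2 i tT.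
have npsi : nm (fun s => a1 i r s - a2 i r s + (a1 i t s - a2 i t s)) <= 4 * M.
  by apply: le_trans (nmD Lar Lat) _; apply: le_trans (addself_le nar nat') _; rewrite mulrA -natrM.
have Lps := L2D m01 Lpr Lpt; have Lw := L2D m01 Lwr Lwt.
have [[_ Lw1r] [_ Lw2r]] := (w_L2 ev1 i rT', w_L2 ev2 i rT').
have [[_ Lw1t] [_ Lw2t]] := (w_L2 ev1 i tT', w_L2 ev2 i tT').
have LF1 := F_L2 ev1 i tT; have LF2 := F_L2 ev2 i tT.
have E1 : nm (ww i r) ^+ 2 - nm (ww i t) ^+ 2 =
    (\int[mu]_(s in I01) (w1 i r s * (ww i r s + ww i t s)) - \int[mu]_(s in I01) (w1 i t s * (ww i r s + ww i t s)))
    - (\int[mu]_(s in I01) (w2 i r s * (ww i r s + ww i t s)) - \int[mu]_(s in I01) (w2 i t s * (ww i r s + ww i t s))).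
  have [x1 x2] := (L2_mul m01 Lw1r Lw, L2_mul m01 Lw1t Lw); have [x3 x4] := (L2_mul m01 Lw2r Lw, L2_mul m01 Lw2t Lw).
  have [y1 y2] := (itgB m01 x1 x2, itgB m01 x3 x4).
  rewrite sqr_nm_diff// -!RintegralB//; apply: Rint_eq => s _; rewrite /ww; ring.
have E2 : \int[mu]_(s in I01) (flux (v := v1) (tau := tau1) i t s * (a1 i r s - a2 i r s + (a1 i t s - a2 i t s)))
    - \int[mu]_(s in I01) (flux (v := v2) (tau := tau2) i t s * (a1 i r s - a2 i r s + (a1 i t s - a2 i t s))) =
    2 * \int[mu]_(s in I01) (GG i t s * alpha i t s) + \int[mu]_(s in I01) (GG i t s * (alpha i r s - alpha i t s)).
  have [x1 x2] := (L2_mul m01 LF1 Lps, L2_mul m01 LF2 Lps).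
  have [y1 y2] := (L2_mul m01 LG Lat, L2_mul m01 LG (L2B m01 Lar Lat)); have z1 := itgZ 2 m01 y1.
  rewrite -RintegralZl// -RintegralB// -RintegralD//; apply: Rint_eq => s _; rewrite /GG /flux /alpha; ring.
have E3 : `|\int[mu]_(s in I01) (GG i t s * (alpha i r s - alpha i t s))| <= 4 * C1 * e.
  apply: le_trans (nm_ip LG (L2B m01 Lar Lat)) _.
  apply: le_trans (ler_pM (nm_ge0 _) (nm_ge0 _) nG ad) _.
  by rewrite le_eqVlt; apply/orP; left; apply/eqP; ring.
have r0 : 0 <= r - t by rewrite subr_ge0.
have {}H1 := le_trans H1 (ler_wpM2l r0 (ler_wpM2l (ltW e0) npsi)).
have {}H2 := le_trans H2 (ler_wpM2l r0 (ler_wpM2l (ltW e0) npsi)).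
rewrite E1; move: E2 E3 H1 H2 r0.
exact: duality_arith.
Qed.

(** The increment of taubar is at most C6 s (r - t) by [lip_tau], and s <= taubar / c turns its
    contribution into a multiple of the energy. The increment of z is (r - t) alpha up to a small
    error, which gives the pairing of taubar z with alpha. *)
Lemma tbz_step (t e : R) : 0 < t < T -> 0 < e -> exists2 d : R, 0 < d & forall r, t < r < t + d -> r < T -> forall i,
  \int[mu]_(s in I01) (tb r s * zz i r s ^+ 2) - \int[mu]_(s in I01) (tb t s * zz i t s ^+ 2) <=
    (r - t) * (2 * \int[mu]_(s in I01) (tb t s * zz i t s * alpha i t s) +
      C6 * c^-1 * \int[mu]_(s in I01) (tb t s * zz i t s ^+ 2) + (8 * C6 + 8 * C1 + 4 * (M * C1)) * e).
Proof.
move=> tT e0; have tT' : 0 <= t <= T by slra.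
have [d1 d10 h1] := zz_quot tT e0; have [d3 d30 h3] := pair_near tT' e0.
exists (Num.min d1 d3); first by rewrite lt_min d10.
move=> r /andP[tr rd] rT i; have rT' : 0 <= r <= T by slra.
have rT2 : 0 < r < T by slra.
have : r - t < Num.min d1 d3 by slra.
rewrite lt_min => /andP[r1 r3]; have k0 : 0 <= r - t by slra.
have Q := h1 r (ltac:(slra)) rT i.
have [_ _ zd _] := h3 r rT' (ltac:(by rewrite ger0_norm)) i.
have [Lr br] := zz_bnd ev1 ev2 i rT'; have [Lt bt] := zz_bnd ev1 ev2 i tT'.
have [La na] := alpha_L2 i tT'; have Lp := L2D m01 Lr Lt; have Lm := L2B m01 Lr Lt.
have [Ltp ntp] := tb_L2 tT Lp; have [Ltt _] := tb_L2 tT Lt; have [Ltm ntm] := tb_L2 tT Lm.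
have C60 : 0 <= C6 by exact: C6_ge0 ev1.
have n4 : nm (fun s => zz i r s + zz i t s) <= 4.
  apply: le_trans (nmD Lr Lt) _; apply: le_trans (addself_le (zz_nm2 i rT') (zz_nm2 i tT')) _.
  by rewrite -natrM.
have Ls (f : R -> R) : L2I f -> L2I (fun s => s * f s) /\ nm (fun s => s * f s) <= nm f.
  move=> Lf; have mid : measurable_fun I01 (fun s : R => s) by [].
  have b (s : R) : 0 < s < 1 -> `|s| <= 1 by move=> s01; rewrite (ger0_norm (unit_ge0 s01)); case/andP: s01 => _ /ltW.
  have L : L2I (fun s => s * f s) by apply: (L2_bndM (M := 1)) => // s; rewrite /= in_itv/=; exact: b.
  by split => //; apply: nm_le => // s s01; rewrite normrM ler_piMl// b.
have isr : itg I01 (fun s => s * zz i r s ^+ 2).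
  apply: (itg_eq (f := fun s => s * zz i r s * zz i r s)) => //; first by move=> s _; rewrite -mulrA.
  by apply: L2_mul => //; case: (Ls _ Lr).
have ist : itg I01 (fun s => s * zz i t s ^+ 2).
  apply: (itg_eq (f := fun s => s * zz i t s * zz i t s)) => //; first by move=> s _; rewrite -mulrA.
  by apply: L2_mul => //; case: (Ls _ Lt).
have [itt tt0] := tbz_itg ev1 ev2 c_gt0 tl1 tl2 i tT.
have [itr _] := tbz_itg ev1 ev2 c_gt0 tl1 tl2 i rT2.
have [_ tbt] := tb_bnd ev1 ev2 tl1 tl2 tT.
have B1 : \int[mu]_(s in I01) ((tb r s - tb t s) * zz i r s ^+ 2) <= (r - t) * (C6 * \int[mu]_(s in I01) (s * zz i r s ^+ 2)).
  have i1 : itg I01 (fun s => (tb r s - tb t s) * zz i r s ^+ 2).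
    have [Ltr' _] := tb_L2 tT Lr.
    apply: (itg_eq (f := fun s => tb r s * zz i r s ^+ 2 - (tb t s * zz i r s) * zz i r s)) => //.
      by move=> s _; ring.
    by apply: itgB => //; exact: L2_mul.
  rewrite mulrA -RintegralZl//; apply: le_Rintegral => //; first exact: itgZ.
  move=> s; rewrite /= in_itv/= => s01; rewrite mulrA ler_wpM2r ?sqr_ge0//.
  have l1 := lip_tau ev1 tT rT2 s01; have l2 := lip_tau ev2 tT rT2 s01.
  have -> : tb r s - tb t s = (tau1 r s - tau1 t s + (tau2 r s - tau2 t s)) / 2 by rewrite /tb; field.
  apply: le_trans (ler_norm _) _; apply: le_trans (norm_half_sum l1 l2) _.
  by rewrite (ger0_norm k0) le_eqVlt; apply/orP; left; apply/eqP; ring.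
have B2 : \int[mu]_(s in I01) (s * zz i r s ^+ 2) <= \int[mu]_(s in I01) (s * zz i t s ^+ 2) + 8 * e.
  have [Lsp nsp] := Ls _ Lp; have i2 := L2_mul m01 Lm Lsp.
  rewrite (Rint_eq (g := fun s => s * zz i t s ^+ 2 + (zz i r s - zz i t s) * (s * (zz i r s + zz i t s)))); last by move=> s _; ring.
  rewrite RintegralD// lerD2l; apply: le_trans (ler_norm _) _; apply: le_trans (nm_ip Lm Lsp) _.
  apply: le_trans (ler_pM (nm_ge0 _) (nm_ge0 _) zd (le_trans nsp n4)) _.
  by rewrite le_eqVlt; apply/orP; left; apply/eqP; ring.
have B3 : \int[mu]_(s in I01) (s * zz i t s ^+ 2) <= c^-1 * \int[mu]_(s in I01) (tb t s * zz i t s ^+ 2).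
  rewrite -RintegralZl//; apply: le_Rintegral => //; first exact: itgZ.
  move=> s; rewrite /= in_itv/= => s01; rewrite mulrA ler_wpM2r ?sqr_ge0// mulrC ler_pdivlMr//.
  by have /andP[] := tbt s s01.
have LD : L2I (fun s => zz i r s - zz i t s - (r - t) * alpha i t s) by apply: L2B => //; exact: L2Z.
have B4 : \int[mu]_(s in I01) ((zz i r s - zz i t s - (r - t) * alpha i t s) * (tb t s * (zz i r s + zz i t s)))
    <= (r - t) * (8 * C1 * e).
  apply: le_trans (ler_norm _) _; apply: le_trans (nm_ip LD Ltp) _.
  apply: le_trans (ler_pM (nm_ge0 _) (nm_ge0 _) Q (le_trans ntp (ler_wpM2l K1 n4))) _.
  by rewrite le_eqVlt; apply/orP; left; apply/eqP; ring.
have B5 : \int[mu]_(s in I01) ((r - t) * (alpha i t s * (tb t s * (zz i r s + zz i t s)))) =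
   (r - t) * (2 * \int[mu]_(s in I01) (tb t s * zz i t s * alpha i t s) +
     \int[mu]_(s in I01) (alpha i t s * (tb t s * (zz i r s - zz i t s)))).
  have [x1 x2] := (L2_mul m01 Ltt La, L2_mul m01 La Ltm); have x3 := itgZ 2 m01 x1; have x4 := L2_mul m01 La Ltp.
  rewrite RintegralZl//; congr (_ * _); rewrite -RintegralZl// -RintegralD//.
  by apply: Rint_eq => s _; ring.
have B6 : \int[mu]_(s in I01) (alpha i t s * (tb t s * (zz i r s - zz i t s))) <= 4 * (M * C1) * e.
  apply: le_trans (ler_norm _) _; apply: le_trans (nm_ip La Ltm) _.
  apply: le_trans (ler_pM (nm_ge0 _) (nm_ge0 _) na (le_trans ntm (ler_wpM2l K1 zd))) _.
  by rewrite le_eqVlt; apply/orP; left; apply/eqP; ring.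
rewrite tbz_diff//.
have -> : \int[mu]_(s in I01) ((zz i r s - zz i t s) * (tb t s * (zz i r s + zz i t s))) =
  \int[mu]_(s in I01) ((zz i r s - zz i t s - (r - t) * alpha i t s) * (tb t s * (zz i r s + zz i t s))) +
  \int[mu]_(s in I01) ((r - t) * (alpha i t s * (tb t s * (zz i r s + zz i t s)))).
  have [x1 x2] := (L2_mul m01 LD Ltp, L2_mul m01 La Ltp); have x3 := itgZ (r - t) m01 x2.
  by rewrite -RintegralD//; apply: Rint_eq => s _; ring.
exact: quot_arith B1 B2 B3 B4 B5 B6.
Qed.

Lemma dist2_step t e : 0 < t < T -> 0 < e -> exists2 d : R, 0 < d & forall r, t < r < t + d -> r < T ->
  dist2 r - dist2 t <= (r - t) * (J t + C6 * c^-1 * dist2 t + e).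
Proof.
move=> tT e0; have tT' : 0 <= t <= T by slra.
have C60 : 0 <= C6 by exact: C6_ge0 ev1.
pose k1 := 8 * M + 4 * C1; pose k2 := 8 * C6 + 8 * C1 + 4 * (M * C1).
have k10 : 0 <= k1 by rewrite addr_ge0// mulr_ge0.
have k20 : 0 <= k2.
  exact: addr_ge0 (addr_ge0 (mulr_ge0 (ler0n _ _) C60) (mulr_ge0 (ler0n _ _) K1)) (mulr_ge0 (ler0n _ _) (mulr_ge0 M0 K1)).
pose N : R := n%:R * (k1 + k2) + 1.
have N0 : 0 < N by rewrite ltr_pwDr// mulr_ge0// addr_ge0.
have e1 : 0 < e / N by rewrite divr_gt0.
have [d1 d10 h1] := ww_step tT e1; have [d2 d20 h2] := tbz_step tT e1.
exists (Num.min d1 d2); first by rewrite lt_min d10.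
move=> r /andP[tr rd] rT; have : r - t < Num.min d1 d2 by slra.
rewrite lt_min => /andP[r1 r2]; rewrite -(J_identity tT) /dist2.
have H i : (nm (ww i r) ^+ 2 + \int[mu]_(s in I01) (tb r s * zz i r s ^+ 2)) -
    (nm (ww i t) ^+ 2 + \int[mu]_(s in I01) (tb t s * zz i t s ^+ 2)) <= (r - t) *
   ((2 * \int[mu]_(s in I01) (tb t s * zz i t s * alpha i t s) - 2 * \int[mu]_(s in I01) (GG i t s * alpha i t s)) +
    C6 * c^-1 * (nm (ww i t) ^+ 2 + \int[mu]_(s in I01) (tb t s * zz i t s ^+ 2)) + (k1 + k2) * (e / N)).
  have H1 := h1 r (ltac:(slra)) rT i; have H2 := h2 r (ltac:(slra)) rT i.
  (* A nonnegative multiple of |e|^2 is added so that the whole of [dist2] appears on the right. *)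
  have cc : 0 <= (r - t) * (C6 * c^-1 * nm (ww i t) ^+ 2).
    apply: mulr_ge0; first by slra.
    have cV : 0 <= c^-1 by rewrite invr_ge0 ltW.
    exact: (mulr_ge0 (mulr_ge0 C60 cV) (sqr_ge0 _)).
  rewrite opprD addrACA; apply: le_trans (lerD H1 H2) _; rewrite -subr_ge0; move: cc.
  by rewrite -/k1 -/k2; congr (0 <= _); ring.
rewrite -sumrB; apply: le_trans (ler_sum _ (fun i _ => H i)) _; rewrite -mulr_sumr ler_wpM2l//; first by slra.
rewrite 2!big_split/= -[X in _ + X + _]mulr_sumr sumr_const card_ord lerD2l// -[leLHS]mulr_natl mulrA.
rewrite -[leRHS](divfK (lt0r_neq0 N0)) [leRHS]mulrC ler_wpM2r//; first exact: ltW.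
by rewrite /N lerDl.
Qed.

Context (pe1 : forall i t, 0 < t < T -> good1 t -> p1 i t s @[s --> 1^'-] --> (0 : R)).
Context (pe2 : forall i t, 0 < t < T -> good2 t -> p2 i t s @[s --> 1^'-] --> (0 : R)).

Lemma J_bound_all : exists2 K : R, 0 <= K & forall t, 0 < t < T -> `|J t| <= K * dist2 t.
Proof.
have [K K0 hK] := J_bound ev1 ev2 c_gt0 tl1 tl2 pe1 pe2; exists K => // t tT.
apply/ler_addgt0Pr => e e0; pose e1 := e / (K + 1); have e10 : 0 < e1 by rewrite divr_gt0//; slra.
have [d1 d10 h1] := dist2_cts tT e10; have [d2 d20 h2] := J_cts tT e10.
have m0 : 0 < Num.min d1 d2 by rewrite lt_min d10.
have m1 : Num.min d1 d2 <= d1 by rewrite ge_min lexx.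
have m2 : Num.min d1 d2 <= d2 by rewrite ge_min lexx orbT.
move: (Num.min d1 d2) m0 m1 m2 => d d0 dd1 dd2.
have ab : Num.max 0 (t - d) < Num.min T (t + d) by rewrite lt_min !gt_max; slra.
have [r + [g1 g2]] := ae_dense ab (ae_and (ev_good ev1) (ev_good ev2)).
rewrite gt_max lt_min => /andP[/andP[r0 r1] /andP[r2 r3]]; have rT : 0 < r < T by slra.
have rd : `|r - t| < d by rewrite ltr_norml; slra.
have H1 := h1 r rT ltac:(slra); have H2 := h2 r rT ltac:(slra).
have H3 := hK r rT (fun i => g1 rT i) (fun i => g2 rT i).
have H4 : dist2 r <= dist2 t + e1 by rewrite addrC -lerBlDr; exact: le_trans (ler_norm _) H1.
have H5 : `|J t| <= `|J r| + e1.
  have := ler_normB (J r) (J r - J t); rewrite opprB addrC subrK.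
  by move=> h; apply: le_trans h _; rewrite lerD2l.
apply: le_trans H5 _; apply: le_trans (lerD (le_trans H3 (ler_wpM2l K0 H4)) (lexx _)) _.
have -> : K * (dist2 t + e1) + e1 = K * dist2 t + e1 * (K + 1) by ring.
by rewrite lerD2l /e1 divfK// gt_eqF//; slra.
Qed.

Lemma dist2_zero : (forall i s, 0 < s < 1 -> v1 i 0 s = v2 i 0 s /\ w1 i 0 s = w2 i 0 s) ->
  forall t, 0 < t < T -> dist2 t = 0.
Proof.
move=> h0; have [K K0 hK] := J_bound_all; have C60 : 0 <= C6 by exact: C6_ge0 ev1.
have cV : 0 <= c^-1 by rewrite invr_ge0 ltW.
apply: (@gronwall _ T (K + C6 * c^-1)).
- exact: (addr_ge0 K0 (mulr_ge0 C60 cV)).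
- by move=> t tT; exact: (dist2_ge0 ev1 ev2 c_gt0 tl1 tl2 tT).
- by move=> t e tT e0; exact: dist2_cts.
- move=> t e tT e0; have [d d0 hd] := dist2_step tT e0; exists d => // r /andP[tr rd] rT.
  have [->|rt] := eqVneq r t; first by rewrite !subrr mul0r.
  have trl : t < r by rewrite lt_neqAle eq_sym rt tr.
  apply: le_trans (hd r _ rT) _; first by rewrite trl rd.
  rewrite ler_wpM2l ?subr_ge0// lerD2r mulrDl lerD2r; apply: le_trans (ler_norm _) _; exact: hK.
move=> e e0; pose N : R := n%:R * (4 + 4 * C1) + 1.
have N0 : 0 < N by rewrite ltr_pwDr// mulr_ge0// addr_ge0// mulr_ge0.
(* Since e1 <= 1, the squares of norms bounded by 2 e1 are at most 4 e1. *)
pose e1 := Num.min 1 (e / N); have e10 : 0 < e1 by rewrite lt_min ltr01/= divr_gt0.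
have e11 : e1 <= 1 by rewrite ge_min lexx.
have e1N : e1 <= e / N by rewrite ge_min lexx orbT.
have [d d0 hd] := @pair_near e1 0 ltac:(rewrite lexx ltW//) e10; exists d => // r /andP[r0 rd] rT.
have rT' : 0 <= r <= T by rewrite !ltW. have rT2 : 0 < r < T by rewrite r0.
rewrite /dist2; apply: (@le_trans _ _ (\sum_(i < n) ((4 + 4 * C1) * e1))); last first.
  rewrite sumr_const card_ord -[leLHS]mulr_natl mulrA; apply: le_trans (ler_wpM2l _ e1N) _.
    by rewrite mulr_ge0// addr_ge0// mulr_ge0.
  rewrite -[leRHS](divfK (lt0r_neq0 N0)) [leRHS]mulrC ler_wpM2r//; first by rewrite divr_ge0// ltW.
  by rewrite /N lerDl.
apply: ler_sum => i _; have [_ _ hz hw] := hd r rT' (ltac:(by rewrite subr0 gtr0_norm)) i.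
have nz : nm (zz i r) <= 2 * e1.
  apply: le_trans hz; rewrite le_eqVlt; apply/orP; left; apply/eqP/nm_ext => s s01.
  by rewrite /zz (proj1 (h0 i s s01)) subrr subr0.
have nw : nm (ww i r) <= 2 * e1.
  apply: le_trans hw; rewrite le_eqVlt; apply/orP; left; apply/eqP/nm_ext => s s01.
  by rewrite /ww (proj2 (h0 i s s01)) subrr subr0.
have [Lz _] := zz_bnd ev1 ev2 i rT'; have [Ltz ntz] := tb_L2 rT2 Lz.
have h1 : nm (ww i r) ^+ 2 <= 4 * e1.
  rewrite expr2; apply: le_trans (ler_pM (nm_ge0 _) (nm_ge0 _) nw nw) _.
  by rewrite mulrACA -natrM mulrA ler_piMr// mulr_ge0// ltW.
have h2 : \int[mu]_(s in I01) (tb r s * zz i r s ^+ 2) <= 4 * C1 * e1.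
  rewrite (Rint_eq (g := fun s => tb r s * zz i r s * zz i r s)); last by move=> s _; rewrite -mulrA.
  apply: le_trans (ler_norm _) _; apply: le_trans (nm_ip Ltz Lz) _.
  apply: le_trans (ler_pM (nm_ge0 _) (nm_ge0 _) (le_trans ntz (ler_wpM2l K1 nz)) nz) _.
  have -> : C1 * (2 * e1) * (2 * e1) = 4 * C1 * e1 * e1 by ring.
  by rewrite ler_piMr//; exact: (mulr_ge0 (mulr_ge0 (ler0n _ _) K1) (ltW e10)).
by rewrite mulrDl; exact: lerD.
Qed.

Lemma pair_unique : (forall i s, 0 < s < 1 -> v1 i 0 s = v2 i 0 s /\ w1 i 0 s = w2 i 0 s) ->
  forall i t s, 0 < t < T -> 0 < s < 1 -> v1 i t s = v2 i t s.
Proof.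
move=> h0 i t s tT s01; have E := dist2_zero h0 tT; have tT' : 0 <= t <= T by case/andP: tT => /ltW -> /ltW ->.
have [Lz nz] := rtz_bnd ev1 ev2 c_gt0 tl1 tl2 i tT.
rewrite E sqrtr0 mulr0 in nz; have z0 : nm (fun s => rt s * zz i t s) = 0 by apply/le_anti; rewrite nz nm_ge0.
apply: (prim_ae_eq (ev_v ev1 i tT') (ev_v ev2 i tT')) s01.
apply: (filterS_ae (nm0_ae Lz z0)) => r h r01; have := h r01 => /eqP.
have [/andP[r0 _] _] := rt_gt0 (ltac:(by move: r01; rewrite /= in_itv/=) : 0 < r < 1).
by rewrite mulf_eq0 gt_eqF//= subr_eq0 => /eqP.
Qed.

End Distance.

(** * Uniqueness for the extracted data *)

Section Uniqueness.
Context {R : realType}.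
Local Notation mu := (@lebesgue_measure R).
Local Notation itg D f := (mu.-integrable D (EFin \o f)).
Local Notation I01 := (`]@GRing.zero R, @GRing.one R[%classic).
Local Notation L2I := (L2 I01).
Local Notation rt := (@Num.sqrt R).

Let m01 : measurable I01. Proof. exact: measurable_itv. Qed.

(** Conservation keeps w = 0, so its derivative a vanishes almost everywhere and [ev_dv2] shows that
    v does not change; continuity reaches the time 0. *)
Lemma zero_energy n T M (v p w a : 'I_n -> R -> R -> R) tau sig : evolution T M v p w a tau sig ->
  energy (w := w) 0 = 0 -> forall i t s, 0 < t < T -> 0 < s < 1 -> v i t s = v i 0 s.
Proof.
move=> ev e0 i.
have Le r : 0 <= r <= T -> L2I (v i r) by move=> rT; exact: (v_L2 ev).
have a0 r : 0 < r < T -> {ae mu, forall s, I01 s -> a i r s = 0}.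
  move=> rT; have rT' : 0 <= r <= T by case/andP: rT => /ltW -> /ltW ->.
  have := energy_const ev rT; rewrite e0 => /eqP; rewrite psumr_eq0; last by move=> j _; exact: sqr_ge0.
  move=> /allP/(_ i); rewrite mem_index_enum sqrf_eq0 => /(_ isT)/eqP nw.
  have [pw w1] := ev_w ev i rT'; have [_ Lw] := w_L2 ev i rT'.
  have p0 : prim (fun=> 0 : R) (fun=> 0 : R) by exact: prim_cst.
  have w0 := prim_ae_eq pw p0 (nm0_ae Lw nw).
  have pw' : prim (w i r) (fun=> 0) by apply: (prim_eq _ _ p0) => // s s01; rewrite w0.
  by apply: (prim_deriv_ae pw pw') => //; case: (ev_a ev i rT').
have cst r t : 0 < r -> r <= t -> t < T -> nm (fun s => v i t s - v i r s) = 0.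
  move=> r0 rt' tT; have rT' : 0 <= r <= T by slra.
  have tT' : 0 <= t <= T by slra.
  have Lp : L2I (fun s => v i t s - v i r s) by apply: L2B => //; exact: Le.
  have H : {ae mu, forall x : R, r < x < t -> 0 <= \int[mu]_(s in I01) (a i x s * (v i t s - v i r s)) <= 0}.
    apply/aeW => x xrt; have xT : 0 < x < T by slra.
    have xT' : 0 <= x <= T by slra.
    have ix := L2_mul m01 (ev_a ev i xT') Lp.
    rewrite (Rint_ae_eq (g := fun=> 0))// ?Rint01_cst ?lexx//; first exact: itg_meas ix.
    by apply: (filterS_ae (a0 x xT)) => s h s01; rewrite h// mul0r.
  have := @ev_dv2 _ _ _ _ _ _ _ _ _ _ ev i _ Lp _ _ _ _ r0 rt' tT H; rewrite !mul0r => /andP[h1 h2].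
  have [i1 i2] := (L2_mul m01 (Le t tT') Lp, L2_mul m01 (Le r rT') Lp).
  apply/eqP; rewrite -(sqrf_eq0 (nm _)) nm_sqr; apply/eqP/le_anti.
  have E : \int[mu]_(s in I01) ((v i t s - v i r s) ^+ 2) =
      \int[mu]_(s in I01) (v i t s * (v i t s - v i r s)) - \int[mu]_(s in I01) (v i r s * (v i t s - v i r s)).
    by rewrite -RintegralB//; apply: Rint_eq => s _; ring.
  by rewrite E h1 h2.
move=> t s tT s01; have tT' : 0 <= t <= T by case/andP: tT => /ltW -> /ltW ->.
have T0 : 0 <= (0 : R) <= T by rewrite lexx ltW//; exact: ev_T ev.
have n0 : nm (fun s => v i t s - v i 0 s) = 0.
  apply/le_anti; rewrite nm_ge0 andbT; apply/ler_addgt0Pr => e e1; rewrite add0r.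
  have [d d0 hd] := v_tcts ev i T0 e1; pose r := Num.min (d / 2) t.
  have [r0 rd rt'] : [/\ 0 < r, r <= d / 2 & r <= t].
    by rewrite /r lt_min !ge_min !lexx orbT; split => //; slra.
  have rT' : 0 <= r <= T by slra.
  apply: le_trans (nm_tri (Le t tT') (Le r rT') (Le 0 T0)) _.
  rewrite cst ?add0r//; last by case/andP: tT.
  by apply: hd => //; rewrite subr0 gtr0_norm//; slra.
apply: (prim_ae_eq (ev_v ev i tT') (ev_v ev i T0)) s01.
have Ld : L2I (fun s => v i t s - v i 0 s) by apply: L2B => //; exact: Le.
by apply: (filterS_ae (nm0_ae Ld n0)) => r h r01; apply/eqP; rewrite -subr_eq0 h.
Qed.

(** Equal v have equal derivatives p in s and a in time, so the two tensions solve the same problem,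
    and [bvp_bound] applies to their difference with zero source. *)
Lemma tension_unique n T M (v1 p1 w1 a1 v2 p2 w2 a2 : 'I_n -> R -> R -> R) tau1 sig1 tau2 sig2 :
  evolution T M v1 p1 w1 a1 tau1 sig1 -> evolution T M v2 p2 w2 a2 tau2 sig2 ->
  (forall i t s, 0 < t < T -> 0 < s < 1 -> v1 i t s = v2 i t s) ->
  forall t s, 0 < t < T -> 0 < s < 1 -> tau1 t s = tau2 t s.
Proof.
move=> ev1 ev2 vv t s tT s01; have tT' : 0 <= t <= T by case/andP: tT => /ltW -> /ltW ->.
have pp i : {ae mu, forall s, I01 s -> p1 i t s = p2 i t s}.
  have pv := ev_v ev1 i tT'.
  have pv' : prim (v1 i t) (p2 i t) by apply: (prim_eq _ _ (ev_v ev2 i tT')) => // r r01; rewrite vv.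
  by apply: (prim_deriv_ae pv pv'); [exact: (ev_pm ev1)|exact: (ev_pm ev2)].
have aa i : {ae mu, forall s, I01 s -> a1 i t s = a2 i t s}.
  have [La1 La2] := (ev_a ev1 i tT', ev_a ev2 i tT').
  have n0 : nm (fun s => a1 i t s - a2 i t s) = 0.
    apply/le_anti; rewrite nm_ge0 andbT; apply/ler_addgt0Pr => e e1; rewrite add0r.
    have [d1 d10 h1] := ev_dv ev1 i tT' (ltac:(slra) : 0 < e / 2).
    have [d2 d20 h2] := ev_dv ev2 i tT' (ltac:(slra) : 0 < e / 2).
    have m0 : 0 < Num.min (Num.min d1 d2) (T - t) by rewrite !lt_min d10 d20 subr_gt0; slra.
    have m1 : Num.min (Num.min d1 d2) (T - t) <= d1 by rewrite !ge_min lexx.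
    have m2 : Num.min (Num.min d1 d2) (T - t) <= d2 by rewrite !ge_min lexx orbT.
    have m3 : Num.min (Num.min d1 d2) (T - t) <= T - t by rewrite ge_min lexx orbT.
    move: (Num.min _ _) m0 m1 m2 m3 => d d0 dd1 dd2 dT; pose r := t + d / 2.
    have rT' : 0 <= r <= T by rewrite /r; slra.
    have rT : 0 < r < T by rewrite /r; slra.
    have rt' : r != t by rewrite /r gt_eqF//; slra.
    have rd : `|r - t| < d by rewrite /r addrAC subrr add0r gtr0_norm; slra.
    have H1 := h1 r rT' rt' (lt_le_trans rd dd1); have H2 := h2 r rT' rt' (lt_le_trans rd dd2).
    have Lq (v p w a : 'I_n -> R -> R -> R) tau sig : evolution T M v p w a tau sig ->
      L2I (fun s => (r - t)^-1 * (v i r s - v i t s) - a i t s).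
      move=> ev; apply: L2B => //; last exact: (ev_a ev).
      by apply: L2Z => //; apply: L2B => //; exact: (v_L2 ev).
    rewrite [leRHS](splitr e); apply: le_trans (lerD H2 H1); rewrite -[X in _ <= _ + X]nmN.
    apply: le_trans (nmD (Lq _ _ _ _ _ _ ev2) (L2N m01 (Lq _ _ _ _ _ _ ev1))); rewrite le_eqVlt; apply/orP; left; apply/eqP/nm_ext => x x01.
    by rewrite !vv//; ring.
  by apply: (filterS_ae (nm0_ae (L2B m01 La1 La2) n0)) => r h r01; apply/eqP; rewrite -subr_eq0 h.
have [pt1 ps1 t01 s11] := ev_tau ev1 tT; have [pt2 ps2 t02 s12] := ev_tau ev2 tT.
have [mq [_ _]] := psq_int ev1 tT'.
have pn := primB pt1 pt2; have mn := prim_meas pn.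
have pns : prim (fun s => sig1 t s - sig2 t s) (fun s => psq (p := p1) t s * (tau1 t s - tau2 t s) + 0).
  apply: prim_ae (primB ps1 ps2).
    by apply: measurable_funD => //; exact: measurable_funM.
  have all_ae (Q : 'I_n -> R -> Prop) : (forall i, {ae mu, forall s, I01 s -> Q i s}) -> {ae mu, forall s, I01 s -> forall i, Q i s}.
    move=> h; apply: (filterS_ae (ae_all_ord h)) => r hr r01 i; exact: hr.
  apply: (filterS_ae (ae_and (all_ae _ pp) (all_ae _ aa))) => r [h1 h2] r01.
  have -> : \sum_i p2 i t r ^+ 2 = \sum_i p1 i t r ^+ 2 by apply: eq_bigr => i _; rewrite (h1 r01).
  have -> : \sum_i a2 i t r ^+ 2 = \sum_i a1 i t r ^+ 2 by apply: eq_bigr => i _; rewrite (h2 r01).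
  by rewrite /psq; ring.
have n0 : tau1 t s - tau2 t s @[s --> 0^'+] --> (0 : R).
  by have := @cvgB _ _ _ _ _ _ _ _ _ t01 t02; rewrite subr0; exact.
have n1 : sig1 t s - sig2 t s @[s --> 1^'-] --> (0 : R).
  by have := @cvgB _ _ _ _ _ _ _ _ _ s11 s12; rewrite subr0; exact.
have i0 : itg I01 (fun=> 0 : R) by apply: L2_itg; [exact: m01|exact: mu01_lty|exact: L2_cst01].
have := bvp_bound (g := fun=> 0) pn pns _ _ i0 n0 n1 s01.
rewrite Rint01_cst mulr0 => H; apply/eqP; rewrite -subr_eq0 -normr_le0; apply: H => r _; last by rewrite normr0.
exact: psq_ge0.
Qed.

Theorem evolution_unique n T M (v1 p1 w1 a1 v2 p2 w2 a2 : 'I_n -> R -> R -> R) tau1 sig1 tau2 sig2 :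
  evolution T M v1 p1 w1 a1 tau1 sig1 -> evolution T M v2 p2 w2 a2 tau2 sig2 ->
  (forall i s, 0 < s < 1 -> v1 i 0 s = v2 i 0 s /\ w1 i 0 s = w2 i 0 s) ->
  forall t s, 0 < t < T -> 0 < s < 1 -> (forall i, v1 i t s = v2 i t s) /\ tau1 t s = tau2 t s.
Proof.
move=> ev1 ev2 h0.
have vv : forall i t s, 0 < t < T -> 0 < s < 1 -> v1 i t s = v2 i t s.
  have ee : energy (w := w1) 0 = energy (w := w2) 0.
    by apply: eq_bigr => i _; congr (_ ^+ 2); apply: nm_ext => s s01; case: (h0 i s s01).
  have [e0|e0] := eqVneq (energy (w := w1) 0) 0.
    move=> i t s tT s01; rewrite (zero_energy ev1 e0 i tT s01) (zero_energy ev2 _ i tT s01) -?ee//.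
    by case: (h0 i s s01).
  (* [c0] depends on the solution only through its initial energy, so one constant serves both. *)
  have c12 : c0 (M := M) (w := w1) = c0 (M := M) (w := w2) by rewrite /c0 ee.
  have c_gt0 : 0 < c0 (M := M) (w := w1).
    have e1 : 0 < energy (w := w1) 0 by rewrite lt_neqAle eq_sym e0; apply: sumr_ge0 => i _; exact: sqr_ge0.
    apply: mulr_gt0; last by rewrite divr_gt0.
    by rewrite divr_gt0 ?exprn_gt0 ?expR_gt0// ltr_pwDl// C1_ge0.
  have c_gt0' := c_gt0; rewrite c12 in c_gt0'.
  have tl1 t s (tT : 0 < t < T) (s01 : 0 < s < 1) := tau_low ev1 tT s01.
  have tl2 t s : 0 < t < T -> 0 < s < 1 -> s * c0 (M := M) (w := w1) <= tau2 t s.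
    by move=> tT s01; rewrite c12; exact: (tau_low ev2 tT s01).
  apply: (pair_unique ev1 ev2 c_gt0 tl1 tl2) => //.
  - by move=> i t tT gt; exact: (p_end ev1 i c_gt0 tT gt).
  - by move=> i t tT gt; exact: (p_end ev2 i c_gt0' tT gt).
by move=> t s tT s01; split; [move=> i; exact: vv|exact: (tension_unique ev1 ev2 vv)].
Qed.

End Uniqueness.

(** * From solutions to regular representatives *)

Section Representatives.
Context {R : realType}.
Local Notation mu := (@lebesgue_measure R).
Local Notation itg D f := (mu.-integrable D (EFin \o f)).
Local Notation I01 := (`]@GRing.zero R, @GRing.one R[%classic).
Local Notation L2I := (L2 I01).
Local Notation rt := (@Num.sqrt R).

Let m01 : measurable I01. Proof. exact: measurable_itv. Qed.

(* The regular representative of f if there is one, and f itself otherwise. *)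
Definition prep (f : R -> R) : R -> R :=
  xget f [set u | (exists u', prim u u') /\ {ae mu, forall s, I01 s -> f s = u s}].

Lemma prep_ae f : {ae mu, forall s, I01 s -> f s = prep f s}.
Proof. by rewrite /prep; case: xgetP => [u _ []//|_]; exact: aeW. Qed.

Lemma prep_meas f : measurable_fun I01 f -> measurable_fun I01 (prep f).
Proof. by rewrite /prep; case: xgetP => [u _ [[u' pu] _] _|//]; exact: prim_meas pu. Qed.

(** Two regular representatives agree at every point of (0, 1), so the chosen one coincides with any
    given one. *)
Lemma prep_prim f u u' : prim u u' -> {ae mu, forall s, I01 s -> f s = u s} ->
  (forall s, 0 < s < 1 -> prep f s = u s) /\ prim (prep f) u'.
Proof.
move=> pu fu; have [[u1 pu1] fp] : (exists u1, prim (prep f) u1) /\ {ae mu, forall s, I01 s -> f s = prep f s}.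
  by rewrite /prep; case: xgetP => [//|/(_ u) []]; split => //; exists u'.
have E : forall s, 0 < s < 1 -> prep f s = u s.
  by apply: (prim_ae_eq pu1 pu); apply: (filterS_ae (ae_and fu fp)) => s [a b] s01; rewrite -a// -b.
by split => //; apply: (prim_eq _ _ pu) => // s s01; rewrite E.
Qed.

Lemma prep_wderiv f : has_wderiv f -> prim (prep f) (wderiv f).
Proof. by move=> /wderiv_rep[u pu fu]; have [] := prep_prim pu fu. Qed.

Lemma prep_L2 f : L2I f -> L2I (prep f).
Proof.
move=> Lf; have [mf _] := Lf; apply: L2_ae_eq Lf => //; first exact: prep_meas.
exact: prep_ae.
Qed.

(** The boundary value is that of some representative [w]. Near any interior point there are points
    where [f], [u] and [w] agree, and the continuity of [u] carries the closeness to [l] from those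
    to every point. *)
Lemma bval_near (f u u' : R -> R) (z l : R) : prim u u' ->
  {ae mu, forall s, I01 s -> f s = u s} -> boundary_value f z l ->
  forall e : R, 0 < e -> exists2 d : R, 0 < d & forall s, 0 < s < 1 -> `|s - z| < d -> `|u s - l| <= e.
Proof.
move=> pu fu [w [fw /cvgrPdist_le wl]] e e0.
have := wl e e0; rewrite near_withinE => /nbhs_ballP[d d0 hd]; exists d => // s s01 sd.
apply/ler_addgt0Pr => e' e'0.
have /cvgrPdist_le/(_ e' e'0)/nbhs_ballP[d' d'0 hd'] := prim_continuous_at pu s01.
have mm : exists a b : R, [/\ a < b, s - d' < a, b < s + d', 0 < a /\ b < 1 & z - d < a /\ b < z + d].
  have sz : z - d < s < z + d by move: sd; rewrite ltr_norml; slra.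
  pose k := Num.min (Num.min d' (Num.min s (1 - s))) (Num.min (s - (z - d)) (z + d - s)).
  have k0 : 0 < k by rewrite !lt_min; rewrite /= in d'0; slra.
  have [k1 k2 k3 k4 k5] : [/\ k <= d', k <= s, k <= 1 - s, k <= s - (z - d) & k <= z + d - s].
    by rewrite /k; split; rewrite !ge_min lexx ?orbT.
  by exists (s - k / 2), (s + k / 2); move: (k) k0 k1 k2 k3 k4 k5 => y *; split; slra.
have [a [b [ab a1 b1 [a0 b0] [az bz]]]] := mm.
have [r /andP[ar rb] [h1 h2]] := ae_dense ab (ae_and fu fw).
have r01 : 0 < r < 1 by slra.
have ur : u r = w r by rewrite -h1 ?h2//= in_itv.
have B1 : `|l - w r| <= e by apply: hd; rewrite /ball/= ?in_itv//= ltr_norml; slra.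
have B2 : `|u s - u r| <= e' by apply: hd'; rewrite /ball/= ltr_norml; slra.
rewrite -(subrKA (u r)) addrC [leRHS]addrC -[e]opprK; rewrite opprK ur in B1 *.
apply: le_trans (ler_normD _ _) _; rewrite addrC; apply: lerD; last by rewrite -ur.
by rewrite distrC.
Qed.

Lemma bval_right (f u u' : R -> R) (l : R) : prim u u' ->
  {ae mu, forall s, I01 s -> f s = u s} -> boundary_value f 0 l -> u s @[s --> 0^'+] --> l.
Proof.
move=> pu fu fl; apply/cvgrPdist_le => e e0; have [d d0 hd] := bval_near pu fu fl e0.
near=> s; rewrite distrC; apply: hd; first by near: s; exact: near01_0.
have s01 : 0 < s < 1 by near: s; exact: near01_0.
by rewrite subr0 gtr0_norm; [near: s; exact: nbhs_right_lt|case/andP: s01].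
Unshelve. all: by end_near. Qed.

Lemma bval_left (f u u' : R -> R) (l : R) : prim u u' ->
  {ae mu, forall s, I01 s -> f s = u s} -> boundary_value f 1 l -> u s @[s --> 1^'-] --> l.
Proof.
move=> pu fu fl; apply/cvgrPdist_le => e e0; have [d d0 hd] := bval_near pu fu fl e0.
near=> s; rewrite distrC; apply: hd; first by near: s; exact: near01_1.
have s01 : 0 < s < 1 by near: s; exact: near01_1.
have sd : 1 - d < s by near: s; apply: nbhs_left_gt; rewrite gtrBl.
by rewrite ltr_norml; slra.
Unshelve. all: by end_near. Qed.

Lemma bval_coord m (f : R -> 'rV[R]_m) (z : R) (l : 'rV[R]_m) i : boundary_value f z l ->
  boundary_value (fun s => f s 0 i) z (l 0 i).
Proof.
move=> [w [fw wl]]; exists (fun s => w s 0 i); split.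
  by apply: (filterS_ae fw) => s h s01; rewrite h.
apply: (@cvg_comp _ _ _ w (fun A : 'rV[R]_m => A 0 i) _ _ _ wl); exact: coord_continuous.
Qed.

(** Continuity in L^2 carries the equality to t = 0 and t = T. *)
Lemma tcts_eq (T : R) (f g : R -> R -> R) : 0 < T -> (forall t, 0 <= t <= T -> L2I (f t)) ->
  (forall t, 0 <= t <= T -> L2I (g t)) -> tcts T f -> tcts T g ->
  (forall t, 0 < t < T -> {ae mu, forall s, I01 s -> f t s = g t s}) ->
  forall t, 0 <= t <= T -> {ae mu, forall s, I01 s -> f t s = g t s}.
Proof.
move=> T0 Lf Lg cf cg fg t tT.
have n0 : nm (fun s => f t s - g t s) = 0.
  apply/le_anti; rewrite nm_ge0 andbT; apply/ler_addgt0Pr => e e0; rewrite add0r.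
  have [d1 d10 h1] := cf t tT (e / 2) ltac:(slra); have [d2 d20 h2] := cg t tT (e / 2) ltac:(slra).
  have [r [rT r1 r2]] : exists r, [/\ 0 < r < T, `|r - t| < d1 & `|r - t| < d2].
    pose k := Num.min (Num.min d1 d2) T; have k0 : 0 < k by rewrite !lt_min d10 d20.
    have [k1 k2 k3] : [/\ k <= d1, k <= d2 & k <= T] by rewrite /k; split; rewrite !ge_min lexx ?orbT.
    move: k k0 k1 k2 k3 => k k0 k1 k2 k3; have [tT2|tT2] := ltP t (T / 2).
      by exists (t + k / 3); rewrite (addrC t) addrK gtr0_norm; [split|]; slra.
    by exists (t - k / 3); rewrite (addrC t) addrK normrN gtr0_norm; [split|]; slra.
  have rT' : 0 <= r <= T by slra.
  have B1 := h1 r rT' r1; have B2 := h2 r rT' r2.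
  have Lfr := Lf r rT'; have Lft := Lf t tT; have Lgr := Lg r rT'; have Lgt := Lg t tT.
  rewrite nmBC in B1; have E : nm (fun s => f r s - g r s) = 0.
    rewrite (nm_ae (g := fun=> 0)) ?nm_cst ?normr0//; first by case: (L2B m01 Lfr Lgr).
    by apply: (filterS_ae (fg r rT)) => s h s01; rewrite h// subrr.
  apply: le_trans (nm_tri Lft Lfr Lgt) _; apply: le_trans (lerD B1 (nm_tri Lfr Lgr Lgt)) _.
  by rewrite E add0r [leRHS](splitr e) lerD2l.
by apply: (filterS_ae (nm0_ae (L2B m01 (Lf t tT) (Lg t tT)) n0)) => s h s01; apply/eqP; rewrite -subr_eq0 h.
Qed.

Lemma int_small_ae0 (k : R -> R) : itg I01 k -> (forall s, 0 <= k s) ->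
  (forall e : R, 0 < e -> \int[mu]_(s in I01) k s <= e) -> {ae mu, forall s, I01 s -> k s = 0}.
Proof.
move=> ik k0 ke; have mk := itg_meas ik.
have E s : rt (k s) ^+ 2 = k s by rewrite sqr_sqrtr.
have L : L2I (fun s => rt (k s)).
  split; last by apply: (itg_eq (f := k)) => // s _; rewrite E.
  by apply: measurableT_comp mk; apply: continuous_measurable_fun; exact: sqrt_continuous.
have n0 : nm (fun s => rt (k s)) = 0.
  apply/eqP; rewrite -(sqrf_eq0 (nm _)) nm_sqr -(Rint_eq (f := k)); last by move=> s _; rewrite E.
  rewrite eq_le Rint_ge0// ?andbT//; apply/ler_addgt0Pr => e e0; rewrite add0r; exact: ke.
apply: (filterS_ae (nm0_ae L n0)) => s h s01.
by rewrite -E h// expr0n.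
Qed.

Lemma tail_bnd (f g : R -> R) (s : R) : L2I f -> L2I g -> 0 <= s ->
  `|\int[mu]_(r in `[s, 1]) f r - \int[mu]_(r in `[s, 1]) g r| <= nm (fun r => f r - g r).
Proof.
move=> Lf Lg s0; have i1 := L2_itg m01 mu01_lty Lf; have i2 := L2_itg m01 mu01_lty Lg.
rewrite -RintegralB//; [|exact: itg_seg01|exact: itg_seg01].
by apply: abs_int_le => //; exact: L2B.
Qed.

Lemma tail_nm (f g : R -> R) : L2I f -> L2I g ->
  L2I (fun s => - \int[mu]_(r in `[s, 1]) f r) /\
  nm (fun s => (- \int[mu]_(r in `[s, 1]) f r) - (- \int[mu]_(r in `[s, 1]) g r)) <= nm (fun r => f r - g r).
Proof.
move=> Lf Lg; have i1 := L2_itg m01 mu01_lty Lf; have i2 := L2_itg m01 mu01_lty Lg.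
have p1 := primN (prim_int1 i1); have p2 := primN (prim_int1 i2); split.
  apply: (L2_bnd01 (c := nm f)); first exact: prim_meas p1.
  by move=> s s01; rewrite normrN; apply: abs_int_le => //; case/andP: s01 => /ltW.
rewrite -[leRHS]ger0_norm ?nm_ge0//; apply: nm_bnd; first exact: prim_meas (primB p1 p2).
move=> s s01; rewrite -opprD normrN; apply: tail_bnd => //; case/andP: s01 => /ltW//.
Qed.

Lemma nm_of_int (f : R -> R) (e : R) : 0 <= e -> \int[mu]_(s in I01) (f s ^+ 2) <= e ^+ 2 -> nm f <= e.
Proof. by move=> e0; rewrite nm_leP. Qed.

End Representatives.

(** Step from [t] away from the nearer end of [0, T], which also works when [t] is an end point. *)
Lemma pick_near {R : realFieldType} (T t d1 d2 : R) : 0 < T -> 0 <= t <= T -> 0 < d1 -> 0 < d2 ->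
  exists r, [/\ r != t, 0 <= r <= T, `|r - t| < d1 & `|r - t| < d2].
Proof.
move=> T0 tT d10 d20; pose y := Num.min (Num.min d1 d2) T; have y0 : 0 < y by rewrite !lt_min d10 d20.
have [y1 y2 y3] : [/\ y <= d1, y <= d2 & y <= T] by rewrite /y; split; rewrite !ge_min lexx ?orbT.
move: y y0 y1 y2 y3 => y y0 y1 y2 y3; have [tT2|tT2] := ltP t (T / 2).
  by exists (t + y / 3); rewrite (addrC t) addrK gtr0_norm; [split; rewrite ?gt_eqF|]; lra.
by exists (t - y / 3); rewrite (addrC t) addrK normrN gtr0_norm; [split; rewrite ?lt_eqF|]; lra.
Qed.

(** * The data extracted from one solution *)

Section SolutionData.
Context {R : realType}.
Local Notation mu := (@lebesgue_measure R).
Local Notation itg D f := (mu.-integrable D (EFin \o f)).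
Local Notation I01 := (`]@GRing.zero R, @GRing.one R[%classic).
Local Notation L2I := (L2 I01).
Local Notation rt := (@Num.sqrt R).

Let m01 : measurable I01. Proof. exact: measurable_itv. Qed.

Context {T : R} {x : R -> R -> 'rV[R]_3} {tau : R -> R -> R}.
Context (T_gt0 : 0 < T) (reg : time_regular T x) (mot : motion_equation T x tau).
Context (inext : inextensible T x).
Context (bnd : forall t : R, `]0, T[%classic t -> boundary_value (x t) 1 (0 : 'rV[R]_3)).
Context (ten : is_tension T x tau) (cls : in_class T x).

Definition xc i t s : R := x t s 0 i.
Definition uc i t s : R := ds x t s 0 i.
Definition dc i t s : R := dt T (ds x) t s 0 i.

Context {vr pr ar : 'I_3 -> R -> R -> R} {taur sigr : R -> R -> R}.
Context (vrE : forall i t, vr i t = prep (uc i t)) (prE : forall i t, pr i t = prep (wderiv (uc i t))).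
Context (arE : forall i t, ar i t = prep (dc i t)).
Context (taurE : forall t, taur t = prep (tau t)) (sigrE : forall t, sigr t = prep (wderiv (tau t))).

(** The candidate for x_t, which vanishes at s = 1 by construction; [dtx_rep] identifies it with the
    time derivative of x. *)
Definition wr i t s : R := - \int[mu]_(r in `[s, 1]) ar i t r.

Lemma int_close_nm (T' : R) (g : R -> R -> R) (t : R) :
  (forall e : R, 0 < e -> exists2 d : R, 0 < d & forall r : R, 0 <= r <= T' -> `|r - t| < d ->
     \int[mu]_(s in I01) ((g r s - g t s) ^+ 2) <= e) ->
  forall e : R, 0 < e -> exists2 d : R, 0 < d & forall r : R, 0 <= r <= T' -> `|r - t| < d ->
     nm (fun s => g r s - g t s) <= e.
Proof.
move=> h e e0; have [d d0 hd] := h (e ^+ 2) ltac:(exact: exprn_gt0); exists d => // r rT rd.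
by apply: nm_of_int; [exact: ltW|exact: hd].
Qed.

Lemma uc_wderiv i t : uc i t = wderiv (xc i t).
Proof. by rewrite /uc /ds wderivvE. Qed.

Lemma uc_L2 i t : 0 <= t <= T -> [/\ L2I (uc i t), has_wderiv (uc i t) & itg I01 (fun s => s * wderiv (uc i t) s ^+ 2)].
Proof. by move=> tT; have [_ _ /C0time_X1[h _] _] := reg; exact: h. Qed.

Lemma vr_prim i t : 0 <= t <= T -> [/\ prim (vr i t) (wderiv (uc i t)), L2I (vr i t) & {ae mu, forall s, I01 s -> uc i t s = vr i t s}].
Proof. by move=> tT; have [L h _] := uc_L2 i tT; rewrite vrE; split; [exact: prep_wderiv|exact: prep_L2|exact: prep_ae]. Qed.

Lemma nm_ae2 (f g f' g' : R -> R) : L2I f -> L2I g -> L2I f' -> L2I g' ->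
  {ae mu, forall s, I01 s -> f s = f' s} -> {ae mu, forall s, I01 s -> g s = g' s} ->
  nm (fun s => f s - g s) = nm (fun s => f' s - g' s).
Proof.
move=> Lf Lg Lf' Lg' ff gg; have [mB _] := L2B m01 Lf Lg; have [mB' _] := L2B m01 Lf' Lg'.
by apply: nm_ae => //; apply: (filterS_ae (ae_and ff gg)) => s [a b] s01; rewrite a// b.
Qed.

Lemma vr_tcts i : tcts T (vr i).
Proof.
move=> t tT; have [_ _ /C0time_X1[_ h] _] := reg.
have [_ Lt At] := vr_prim i tT; have [Ut _ _] := uc_L2 i tT.
have H : forall e : R, 0 < e -> exists2 d : R, 0 < d & forall r : R, 0 <= r <= T -> `|r - t| < d -> nm (fun s => uc i r s - uc i t s) <= e.
  apply: int_close_nm => e e0; have [d d0 hd] := h t tT e e0; exists d => // r rT rd.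
  by have [] := hd r rT rd i.
move=> e e0; have [d d0 hd] := H e e0; exists d => // r rT rd.
have [_ Lr Ar] := vr_prim i rT; have [Ur _ _] := uc_L2 i rT.
by rewrite -(nm_ae2 Ur Ut Lr Lt Ar At); exact: hd.
Qed.

Lemma pr_ae i t : 0 <= t <= T -> measurable_fun I01 (pr i t) /\ {ae mu, forall s, I01 s -> wderiv (uc i t) s = pr i t s}.
Proof.
move=> tT; have [_ h _] := uc_L2 i tT; rewrite prE; split; last exact: prep_ae.
by apply: prep_meas; exact: wderiv_meas.
Qed.

Lemma vr_prim_pr i t : 0 <= t <= T -> prim (vr i t) (pr i t).
Proof. by move=> tT; have [pv _ _] := vr_prim i tT; have [mp ap] := pr_ae i tT; exact: prim_ae mp ap pv. Qed.

Lemma rtw_L2 i t : 0 <= t <= T -> L2I (fun s => rt s * wderiv (uc i t) s) /\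
  L2I (fun s => rt s * pr i t s) /\ {ae mu, forall s, I01 s -> rt s * wderiv (uc i t) s = rt s * pr i t s}.
Proof.
move=> tT; have [_ h iw] := uc_L2 i tT; have [mp ap] := pr_ae i tT.
have A : {ae mu, forall s, I01 s -> rt s * wderiv (uc i t) s = rt s * pr i t s}.
  by apply: (filterS_ae ap) => s e s01; rewrite e.
have L : L2I (fun s => rt s * wderiv (uc i t) s).
  split; first by apply: measurable_funM; [exact: meas_rt|exact: wderiv_meas].
  apply: (itg_eq (f := fun s => s * wderiv (uc i t) s ^+ 2)) => // s; rewrite /= in_itv/= => s01.
  by rewrite exprMn rt_sqr.
by split => //; split => //; apply: L2_ae_eq L => //; apply: measurable_funM => //; exact: meas_rt.
Qed.

Lemma pr_tcts i : tcts T (fun t s => rt s * pr i t s).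
Proof.
move=> t tT; have [_ _ /C0time_X1[_ h] _] := reg.
have [Wt [Lt At]] := rtw_L2 i tT.
have H : forall e : R, 0 < e -> exists2 d : R, 0 < d & forall r : R, 0 <= r <= T -> `|r - t| < d ->
    nm (fun s => rt s * wderiv (uc i r) s - rt s * wderiv (uc i t) s) <= e.
  apply: (@int_close_nm T (fun t s => rt s * wderiv (uc i t) s)) => e e0.
  have [d d0 hd] := h t tT e e0; exists d => // r rT rd.
  have [_] := hd r rT rd i; apply: le_trans; rewrite le_eqVlt; apply/orP; left; apply/eqP/Rint_eq => s s01.
  by rewrite -mulrBr exprMn rt_sqr.
move=> e e0; have [d d0 hd] := H e e0; exists d => // r rT rd.
have [Wr [Lr Ar]] := rtw_L2 i rT.
by rewrite -(nm_ae2 Wr Wt Lr Lt Ar At); exact: hd.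
Qed.

Lemma ar_ae i t : 0 <= t <= T -> [/\ L2I (dc i t), L2I (ar i t) & {ae mu, forall s, I01 s -> dc i t s = ar i t s}].
Proof.
move=> tT; have [_ _ _ /C1time_coords[h _ _]] := reg; have L : L2I (dc i t) := h t i tT.
by rewrite arE; split => //; [exact: prep_L2|exact: prep_ae].
Qed.

Lemma ar_tcts i : tcts T (ar i).
Proof.
move=> t tT; have [_ _ _ /C1time_coords[_ h _]] := reg; have [Dt Lt At] := ar_ae i tT.
have H : forall e : R, 0 < e -> exists2 d : R, 0 < d & forall r : R, 0 <= r <= T -> `|r - t| < d -> nm (fun s => dc i r s - dc i t s) <= e.
  apply: int_close_nm => e e0; have [d d0 hd] := h t tT e e0; exists d => // r rT rd; exact: hd.
move=> e e0; have [d d0 hd] := H e e0; exists d => // r rT rd; have [Dr Lr Ar] := ar_ae i rT.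
by rewrite -(nm_ae2 Dr Dt Lr Lt Ar At); exact: hd.
Qed.

Lemma quot_L2 (f g a : R -> R) k : L2I f -> L2I g -> L2I a -> L2I (fun s => k * (f s - g s) - a s).
Proof. by move=> Lf Lg La; apply: L2B => //; apply: L2Z => //; exact: L2B. Qed.

Lemma vr_dt i t : 0 <= t <= T -> forall e : R, 0 < e -> exists2 d : R, 0 < d &
  forall r, 0 <= r <= T -> r != t -> `|r - t| < d ->
    nm (fun s => (r - t)^-1 * (vr i r s - vr i t s) - ar i t s) <= e.
Proof.
move=> tT e e0; have [_ _ _ /C1time_coords[_ _ h]] := reg.
have [d d0 hd] := h t tT (e ^+ 2) ltac:(exact: exprn_gt0); exists d => // r rT rt' rd.
have [_ Lr Ar] := vr_prim i rT; have [Ur _ _] := uc_L2 i rT.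
have [_ Lt At] := vr_prim i tT; have [Ut _ _] := uc_L2 i tT; have [Dt La Aa] := ar_ae i tT.
have := nm_of_int (ltW e0) (hd r rT rt' rd i); congr (_ <= _).
have [mq _] := quot_L2 (r - t)^-1 Ur Ut Dt; have [mq' _] := quot_L2 (r - t)^-1 Lr Lt La.
apply: nm_ae => //; apply: (filterS_ae (ae_and (ae_and Ar At) Aa)) => s [[h1 h2] h3] s01.
by rewrite -h1// -h2// -h3.
Qed.

Lemma wr_prim i t : 0 <= t <= T -> prim (wr i t) (ar i t) /\ wr i t s @[s --> 1^'-] --> (0 : R).
Proof.
move=> tT; have [_ La _] := ar_ae i tT; have ia := L2_itg m01 mu01_lty La; split.
  by apply: (prim_eq _ _ (primN (prim_int1 ia))) => // s _; rewrite opprK.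
by rewrite -(oppr0 R); apply: cvgN; exact: int1_cvg1.
Qed.

(** Inextensibility is given at almost every time. At any time t, |v t|^2 is compared in L^1 with |v
    r|^2 = 1 at such times r nearby, and continuity in s then removes the exceptional points. *)
Lemma vr_unit t s : 0 <= t <= T -> 0 < s < 1 -> \sum_i vr i t s ^+ 2 = 1.
Proof.
move=> tT s01.
have Lv r i (rT : 0 <= r <= T) : L2I (vr i r) by have [] := vr_prim i rT.
pose K := 1 + \sum_i nm (vr i t); have K0 : 0 < K by rewrite ltr_pwDl// sumr_ge0// => i _; exact: nm_ge0.
pose k s' := `|\sum_i vr i t s' ^+ 2 - 1|.
have p1 : prim (fun s => \sum_i vr i t s ^+ 2) (fun s => \sum_i (pr i t s * vr i t s + vr i t s * pr i t s)).
  apply: prim_sum => i; have pp := vr_prim_pr i tT; exact: (prim_eq _ _ (primM pp pp)).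
have ik : itg I01 k.
  apply: itg_norm; apply: itgB => //; last by apply: L2_itg => //; [exact: mu01_lty|exact: L2_cst01].
  by apply: itg_sum => // i; case: (Lv t i tT).
apply: (prim_ae_eq p1 (prim_cst 1)) s01.
have k0 : {ae mu, forall s, I01 s -> k s = 0}.
  (* 6 (K + 1) stands for three coordinates times the factor 2 (K + 1) of [sqdiff], where K + 1
     bounds both norms. *)
  apply: (int_small_ae0 ik (fun s => normr_ge0 _)) => e e0; pose e1 := Num.min 1 (e / (6 * (K + 1))).
  have K1 : 0 < 6 * (K + 1) by rewrite mulr_gt0// addr_gt0.
  have e10 : 0 < e1 by rewrite lt_min ltr01 divr_gt0.
  have e11 : e1 <= 1 by rewrite ge_min lexx.
  have e1K : e1 <= e / (6 * (K + 1)) by rewrite ge_min lexx orbT.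
  have [d d0 hd] : exists2 d : R, 0 < d & forall r, `|r - t| < d -> forall i, 0 <= r <= T -> nm (fun s => vr i r s - vr i t s) <= e1.
    by apply: fin_near => i; have [d d0 hd] := vr_tcts i tT e10; exists d => // r rd rT; exact: hd.
  have ab : Num.max 0 (t - d) < Num.min T (t + d) by rewrite lt_min !gt_max T_gt0/=; lra.
  have [r + gr] := ae_dense ab inext; rewrite gt_max lt_min => /andP[/andP[r0 r1] /andP[r2 r3]].
  have rT : 0 <= r <= T by rewrite !ltW.
  have rd : `|r - t| < d by rewrite ltr_norml; lra.
  have {}gr := gr (ltac:(by rewrite /= in_itv/= r0)).
  have bK i : nm (vr i t) <= K.
    rewrite /K (bigD1 i)//= addrCA lerDl addr_ge0// sumr_ge0// => j _; exact: nm_ge0.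
  have S i : itg I01 (fun s => `|vr i t s ^+ 2 - vr i r s ^+ 2|) /\
      \int[mu]_(s in I01) `|vr i t s ^+ 2 - vr i r s ^+ 2| <= 2 * (K + 1) * e1.
    have H := hd r rd i rT.
    apply: sqdiff; [exact: Lv|exact: Lv| | |by rewrite nmBC].
      by apply: le_trans (bK i) _; rewrite lerDl.
    by apply: le_trans (nmB_le (Lv r i rT) (Lv t i tT)) _; apply: lerD => //; exact: le_trans H e11.
  have iS : itg I01 (fun s => \sum_i `|vr i t s ^+ 2 - vr i r s ^+ 2|) by apply: itg_sum => // i; case: (S i).
  have i0 : itg I01 (fun=> 0 : R) by apply: L2_itg => //; [exact: mu01_lty|exact: L2_cst01].
  have A : {ae mu, forall s, I01 s -> 0 <= k s <= \sum_i `|vr i t s ^+ 2 - vr i r s ^+ 2|}.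
    have aeu := ae_all_ord (fun i => let: And3 _ _ h := vr_prim i rT in h).
    apply: (filterS_ae (ae_and gr aeu)) => s1 [h1 h2] s11; rewrite /k normr_ge0/=.
    have -> : 1 = \sum_i vr i r s1 ^+ 2.
      have := enorm_sqr (ds x r s1); rewrite h1// expr1n => ->.
      by apply: eq_bigr => i _; rewrite -/(uc i r s1) h2.
    by rewrite -sumrB; exact: ler_norm_sum.
  apply: le_trans (proj2 (andP (Rint_ae_between m01 i0 iS A))) _.
  rewrite Rint_sum//; last by move=> i; case: (S i).
  apply: (@le_trans _ _ (\sum_(i < 3) (2 * (K + 1) * e1))); first by apply: ler_sum => i _; case: (S i).
  rewrite sumr_const card_ord -[leLHS]mulr_natl !mulrA -natrM.
  by apply: le_trans (ler_wpM2l (ltW K1) e1K) _; rewrite mulrC divfK// gt_eqF.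
by apply: (filterS_ae k0) => r h r01; apply/eqP; rewrite -subr_eq0 -normr_eq0 -/(k r) h.
Qed.

(** Since |v r|^2 = |v t|^2, the quotient (v r - v t) / (r - t) is orthogonal to v r + v t.
    Replacing the quotient by a, and v r + v t by 2 v t, costs two errors that are small in L^1. *)
Lemma ar_orth t : 0 <= t <= T -> {ae mu, forall s, I01 s -> \sum_i vr i t s * ar i t s = 0}.
Proof.
move=> tT.
have Lv r i (rT : 0 <= r <= T) : L2I (vr i r) by have [] := vr_prim i rT.
have La i : L2I (ar i t) by have [] := ar_ae i tT.
have vb r i s : 0 <= r <= T -> 0 < s < 1 -> `|vr i r s| <= 1.
  move=> rT s01; rewrite -(@expr_le1 _ 2)// real_normK ?num_real// -(vr_unit rT s01).
  by rewrite (bigD1 i)//= lerDl; apply: sumr_ge0 => j _; exact: sqr_ge0.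
have nv r i : 0 <= r <= T -> nm (vr i r) <= 1.
  by move=> rT; have [mv _] := Lv r i rT; apply: le_trans (nm_bnd mv (fun s => @vb r i s rT)) _; rewrite normr1.
have ik i : itg I01 (fun s => vr i t s * ar i t s) := L2_mul m01 (Lv t i tT) (La i).
pose K := \sum_i nm (ar i t); have K0 : 0 <= K by apply: sumr_ge0 => i _; exact: nm_ge0.
have aK i : nm (ar i t) <= K.
  by rewrite /K (bigD1 i)//= lerDl sumr_ge0// => j _; exact: nm_ge0.
pose k s := `|\sum_i vr i t s * ar i t s|.
have iS : itg I01 k by apply: itg_norm; exact: itg_sum.
have k0 : {ae mu, forall s, I01 s -> k s = 0}.
  apply: (int_small_ae0 iS (fun s => normr_ge0 _)) => e e0; pose e1 := e / (6 + 3 * K).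
  have K1 : 0 < 6 + 3 * K by rewrite ltr_pwDl// mulr_ge0.
  have e10 : 0 < e1 by rewrite divr_gt0.
  have [d1 d10 h1] : exists2 d : R, 0 < d & forall r, `|r - t| < d -> forall i, 0 <= r <= T -> nm (fun s => vr i r s - vr i t s) <= e1.
    by apply: fin_near => i; have [d d0 hd] := vr_tcts i tT e10; exists d => // r rd rT; exact: hd.
  have [d2 d20 h2] : exists2 d : R, 0 < d & forall r, `|r - t| < d -> forall i, 0 <= r <= T -> r != t ->
      nm (fun s => (r - t)^-1 * (vr i r s - vr i t s) - ar i t s) <= e1.
    by apply: fin_near => i; have [d d0 hd] := vr_dt i tT e10; exists d => // r rd rT rt'; exact: hd.
  have [r [rt' rT r1 r2]] := pick_near T_gt0 tT d10 d20.
  pose D i s := (r - t)^-1 * (vr i r s - vr i t s) - ar i t s.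
  have LD i : L2I (D i) by apply: quot_L2 => //; exact: Lv.
  have Lp i := L2D m01 (Lv r i rT) (Lv t i tT); have Lm i := L2B m01 (Lv r i rT) (Lv t i tT).
  have np i : nm (fun s => vr i r s + vr i t s) <= 2.
    by apply: le_trans (nmD (Lv r i rT) (Lv t i tT)) _; rewrite (_ : 2 = 1 + 1 :> R)// lerD ?nv.
  have [B1 C1] : (forall i, itg I01 (fun s => `|D i s * (vr i r s + vr i t s)|) /\ \int[mu]_(s in I01) `|D i s * (vr i r s + vr i t s)| <= e1 * 2) /\
     (forall i, itg I01 (fun s => `|ar i t s * (vr i r s - vr i t s)|) /\ \int[mu]_(s in I01) `|ar i t s * (vr i r s - vr i t s)| <= K * e1).
    split => i.
      have [a1 a2] := ip_abs (LD i) (Lp i); split => //; apply: le_trans a2 _.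
      by apply: ler_pM; rewrite ?nm_ge0//; exact: h2.
    have [a1 a2] := ip_abs (La i) (Lm i); split => //; apply: le_trans a2 _.
    by apply: ler_pM; rewrite ?nm_ge0//; exact: h1.
  pose g i s := `|D i s * (vr i r s + vr i t s)| + `|ar i t s * (vr i r s - vr i t s)|.
  have ig i : itg I01 (g i) by apply: itgD => //; [case: (B1 i)|case: (C1 i)].
  apply: (@le_trans _ _ (\int[mu]_(s in I01) \sum_i g i s)).
    apply: le_Rintegral => //; first exact: itg_sum.
    move=> s; rewrite /= in_itv/= => s01; rewrite /k.
    have E : 2 * (\sum_i vr i t s * ar i t s) = - \sum_i (D i s * (vr i r s + vr i t s) + ar i t s * (vr i r s - vr i t s)).
      have E0 : \sum_i (r - t)^-1 * (vr i r s ^+ 2 - vr i t s ^+ 2) = 0.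
        by rewrite -mulr_sumr sumrB (vr_unit rT s01) (vr_unit tT s01) subrr mulr0.
      rewrite -[RHS]addr0 -[X in _ = _ + X]E0 mulr_sumr -sumrN -big_split/=; apply: eq_bigr => i _.
      by rewrite /D; ring.
    apply: (@le_trans _ _ (`|2 * (\sum_i vr i t s * ar i t s)|)).
      by rewrite normrM ger0_norm// ler_peMl// ler1n.
    rewrite E normrN; apply: le_trans (ler_norm_sum _ _ _) _; apply: ler_sum => i _; exact: ler_normD.
  rewrite Rint_sum//; apply: (@le_trans _ _ (\sum_(i < 3) ((2 + K) * e1))).
    apply: ler_sum => i _; have [b1 b2] := B1 i; have [c1 c2] := C1 i.
    by rewrite RintegralD// mulrDl (mulrC 2); exact: lerD.
  rewrite sumr_const card_ord -[leLHS]mulr_natl mulrA mulrDr -natrM.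
  by rewrite /e1 mulrC divfK// gt_eqF.
by apply: (filterS_ae k0) => s h s01; apply/eqP; rewrite -normr_eq0 -/(k s) h.
Qed.

Lemma tension_rep t : 0 < t < T -> [/\ prim (taur t) (sigr t),
  prim (sigr t) (fun s => (\sum_i pr i t s ^+ 2) * taur t s - \sum_i ar i t s ^+ 2),
  taur t s @[s --> 0^'+] --> (0 : R) & sigr t s @[s --> 1^'-] --> (0 : R)].
Proof.
move=> tT; have tT' : 0 <= t <= T by case/andP: tT => /ltW -> /ltW ->.
have [hw hw' eq b0 b1] := ten (ltac:(by rewrite /= in_itv) : `]0, T[%classic t).
have pt : prim (taur t) (wderiv (tau t)) by rewrite taurE; exact: prep_wderiv.
have ps : prim (sigr t) (wderiv (wderiv (tau t))) by rewrite sigrE; exact: prep_wderiv.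
have at' : {ae mu, forall s, I01 s -> tau t s = taur t s} by rewrite taurE; exact: prep_ae.
have as' : {ae mu, forall s, I01 s -> wderiv (tau t) s = sigr t s} by rewrite sigrE; exact: prep_ae.
have ms : measurable_fun I01 (sigr t) := prim_meas ps.
split; first exact: prim_ae ms as' pt.
- have mp i : measurable_fun I01 (pr i t) by have [] := pr_ae i tT'.
  have ma i : measurable_fun I01 (ar i t) by have [_ [h _] _] := ar_ae i tT'.
  apply: prim_ae ps.
    apply: measurable_funB; last by apply: measurable_sum => i; exact: measurable_funX.
    apply: measurable_funM; last exact: prim_meas pt.
    by apply: measurable_sum => i; exact: measurable_funX.
  have ap := ae_all_ord (fun i => proj2 (pr_ae i tT')).
  have aa := ae_all_ord (fun i => let: And3 _ _ h := ar_ae i tT' in h).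
  apply: (filterS_ae (ae_and (ae_and eq at') (ae_and ap aa))) => s [[h1 h2] [h3 h4]] s01.
  have := h1 s01; rewrite !enorm_sqr -(h2 s01).
  have -> : \sum_i ds (ds x) t s 0 i ^+ 2 = \sum_i pr i t s ^+ 2.
    apply: eq_bigr => i _; rewrite -(h3 i s01); congr (_ ^+ 2).
    by rewrite /ds -[LHS]/((fun s => wderivv (ds x t) s 0 i) s) wderivvE.
  have -> : \sum_i dt T (ds x) t s 0 i ^+ 2 = \sum_i ar i t s ^+ 2.
    by apply: eq_bigr => i _; rewrite -(h4 i s01).
  by move=> <-; ring.
- exact: bval_right pt at' b0.
- exact: bval_left ps as' b1.
Qed.

Lemma xc_L2 i : (forall t, 0 <= t <= T -> [/\ L2I (xc i t), has_wderiv (xc i t) & L2I (fun s => dt T x t s 0 i)]) /\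
  tcts T (xc i) /\ tcts T (fun t s => dt T x t s 0 i).
Proof.
have [/C0time_X1[h1 h2] /C1time_coords[h3 h4 _] _ _] := reg; split.
  by move=> t tT; have [a1 a2 _] := h1 t i tT; split => //; exact: h3.
split=> t tT.
  apply: int_close_nm => e e0; have [d d0 hd] := h2 t tT e e0; exists d => // r rT rd.
  by have [] := hd r rT rd i.
apply: (@int_close_nm T (fun t s => dt T x t s 0 i)) => e e0; have [d d0 hd] := h4 t tT e e0; exists d => // r rT rd; exact: hd.
Qed.

(** The condition x = 0 at s = 1 recovers x from x'. *)
Definition xr i t s : R := - \int[mu]_(r in `[s, 1]) vr i t r.

Lemma xc_rep i t : 0 <= t <= T -> {ae mu, forall s, I01 s -> xc i t s = xr i t s}.
Proof.
have [Lx [cx _]] := xc_L2 i.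
have Lv r (rT : 0 <= r <= T) : L2I (vr i r) by have [] := vr_prim i rT.
apply: (tcts_eq T_gt0) => //.
- by move=> r rT; have [] := Lx r rT.
- by move=> r rT; have [] := tail_nm (Lv r rT) (Lv r rT).
- move=> r rT e e0; have [d d0 hd] := vr_tcts i rT e0; exists d => // y yT yr.
  by have [_ h] := tail_nm (Lv y yT) (Lv r rT); apply: le_trans h _; exact: hd.
move=> {}t tT; have tT' : 0 <= t <= T by case/andP: tT => /ltW -> /ltW ->.
have [_ hx _] := Lx t tT'; have px := prep_wderiv hx; have ax := prep_ae (xc i t).
have [_ _ au] := vr_prim i tT'; rewrite uc_wderiv in au.
have [mv _] := Lv t tT'; have pv : prim (prep (xc i t)) (vr i t) := prim_ae mv au px.
have b1 : prep (xc i t) s @[s --> 1^'-] --> (0 : R).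
  have := bval_coord i (bnd (ltac:(by rewrite /= in_itv) : `]0, T[%classic t)); rewrite mxE.
  exact: bval_left pv ax.
apply: (filterS_ae ax) => s h s01; rewrite h// (prim_right pv (L2_itg m01 mu01_lty (Lv t tT')) b1) ?sub0r//.
Qed.

(** Integration from s = 1 is continuous in L^2, so it commutes with the limit of the difference
    quotients in time. *)
Lemma dtx_rep i t : 0 <= t <= T -> {ae mu, forall s, I01 s -> dt T x t s 0 i = wr i t s}.
Proof.
move=> tT; have [Lx _] := xc_L2 i.
have Lv r (rT : 0 <= r <= T) : L2I (vr i r) by have [] := vr_prim i rT.
have [_ La _] := ar_ae i tT; have [_ _ Ld] := Lx t tT; have [Lw _] := tail_nm La La.
have n0 : nm (fun s => dt T x t s 0 i - wr i t s) = 0.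
  apply/le_anti; rewrite nm_ge0 andbT; apply/ler_addgt0Pr => e e0; rewrite add0r.
  have [_ /C1time_coords[_ _ h] _ _] := reg.
  have e2 : 0 < e / 2 by lra.
  have [d1 d10 h1] := h t tT ((e / 2) ^+ 2) ltac:(exact: exprn_gt0); have [d2 d20 h2] := vr_dt i tT e2.
  have [r [rt' rT r1 r2]] := pick_near T_gt0 tT d10 d20.
  have H1 := nm_of_int (ltW e2) (h1 r rT rt' r1 i); have H2 := h2 r rT rt' r2.
  pose q s := (r - t)^-1 * (vr i r s - vr i t s).
  have Lq : L2I q by apply: L2Z => //; apply: L2B => //; exact: Lv.
  have [Lqt nqt] := tail_nm Lq La; have [Lxr _ _] := Lx r rT; have [Lxt _ _] := Lx t tT.
  have Lqx : L2I (fun s => (r - t)^-1 * (xc i r s - xc i t s)) by apply: L2Z => //; exact: L2B.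
  rewrite [leRHS](splitr e); apply: le_trans (lerD H1 (le_trans nqt H2)).
  apply: le_trans (nm_tri Ld Lqx Lw) _; rewrite nmBC lerD2l le_eqVlt; apply/orP; left; apply/eqP.
  have [m1 _] := L2B m01 Lqx Lw; have [m2 _] := L2B m01 Lqt Lw.
  apply: nm_ae => //; apply: (filterS_ae (ae_and (xc_rep i rT) (xc_rep i tT))) => s [g1 g2] s01.
  rewrite g1// g2// /wr /xr; congr (_ - _).
  have [ir it] := (L2_itg m01 mu01_lty (Lv r rT), L2_itg m01 mu01_lty (Lv t tT)).
  have s0 : 0 <= s by move: s01; rewrite /= in_itv/= => /andP[/ltW].
  have [jr jt] := (itg_seg01 ir s0 (lexx _), itg_seg01 it s0 (lexx _)).
  by rewrite /q RintegralZl// ?RintegralB//; [ring|exact: itgB].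
by apply: (filterS_ae (nm0_ae (L2B m01 Ld Lw) n0)) => s h s01; apply/eqP; rewrite -subr_eq0 h.
Qed.

Lemma ip_cts (f : R -> R -> R) (psi : R -> R) (t : R) : (forall r, 0 <= r <= T -> L2I (f r)) -> tcts T f ->
  L2I psi -> 0 < t < T -> {for t, continuous (fun r => \int[mu]_(s in I01) (f r s * psi s))}.
Proof.
move=> Lf cf Lp tT; have tT' : 0 <= t <= T by case/andP: tT => /ltW -> /ltW ->.
apply/cvgrPdist_le => e e0; have n1 : 0 < nm psi + 1 by rewrite ltr_wpDl ?nm_ge0.
have [d d0 hd] := cf t tT' (e / (nm psi + 1)) ltac:(by rewrite divr_gt0).
apply/nbhs_ballP; exists (Num.min d (Num.min t (T - t))); first by rewrite /= !lt_min d0; lra.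
move=> r; rewrite /ball/= distrC !lt_min => /and3P[rd r1 r2].
have rT : 0 <= r <= T by move: r1 r2; rewrite !ltr_norml; lra.
rewrite distrC; apply: le_trans (ip_small (Lf r rT) (Lf t tT') Lp (hd r rT rd)) _.
rewrite mulrAC ler_pdivrMr// ler_wpM2l ?lerDl//; exact: ltW.
Qed.

Lemma ip_derive i (psi : R -> R) (t : R) : L2I psi -> 0 < t < T ->
  is_derive t (1 : R) (fun r => \int[mu]_(s in I01) (vr i r s * psi s)) (\int[mu]_(s in I01) (ar i t s * psi s)).
Proof.
move=> Lp tT; have tT' : 0 <= t <= T by case/andP: tT => /ltW -> /ltW ->.
have Lv r (rT : 0 <= r <= T) : L2I (vr i r) by have [] := vr_prim i rT.
have [_ La _] := ar_ae i tT'.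
apply: is_derive_eps => e e0; have n1 : 0 < nm psi + 1 by rewrite ltr_wpDl ?nm_ge0.
have [d d0 hd] := vr_dt i tT' (ltac:(by rewrite divr_gt0) : 0 < e / (nm psi + 1)).
exists (Num.min d (Num.min t (T - t))); first by rewrite /= !lt_min d0; lra.
move=> r rt'; rewrite !lt_min => /and3P[rd r1 r2].
have rT : 0 <= r <= T by move: r1 r2; rewrite !ltr_norml; lra.
have Lq : L2I (fun s => (r - t)^-1 * (vr i r s - vr i t s)) by apply: L2Z => //; apply: L2B => //; exact: Lv.
have -> : (r - t)^-1 * (\int[mu]_(s in I01) (vr i r s * psi s) - \int[mu]_(s in I01) (vr i t s * psi s)) =
    \int[mu]_(s in I01) ((r - t)^-1 * (vr i r s - vr i t s) * psi s).
  have [i1 i2] := (L2_mul m01 (Lv r rT) Lp, L2_mul m01 (Lv t tT') Lp); have i3 := itgB m01 i1 i2.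
  by rewrite -RintegralB// -RintegralZl//; apply: Rint_eq => s _; ring.
apply: le_trans (ip_small Lq La Lp (hd r rT rt' rd)) _.
rewrite mulrAC ler_pdivrMr// ler_wpM2l ?lerDl//; exact: ltW.
Qed.

Lemma vr_increment i psi : L2I psi -> forall t1 t2 K1 K2 : R, 0 < t1 -> t1 <= t2 -> t2 < T ->
  {ae mu, forall r, t1 < r < t2 -> K1 <= \int[mu]_(s in I01) (ar i r s * psi s) <= K2} ->
  K1 * (t2 - t1) <= \int[mu]_(s in I01) (vr i t2 s * psi s) - \int[mu]_(s in I01) (vr i t1 s * psi s)
    <= K2 * (t2 - t1).
Proof.
move=> Lp t1 t2 K1 K2 t10 t12 t2T H.
have Lv r (rT : 0 <= r <= T) : L2I (vr i r) by have [] := vr_prim i rT.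
have La r (rT : 0 <= r <= T) : L2I (ar i r) by have [] := ar_ae i rT.
apply: (weak_dt_bound (T := T) (P := fun r => \int[mu]_(s in I01) (vr i r s * psi s)) t10 t12 t2T _ _ H).
  by move=> t tT; exact: ip_cts Lv (@vr_tcts i) Lp tT.
move=> phi tphi; apply: test_parts tphi => t tT; first exact: ip_derive.
exact: ip_cts La (@ar_tcts i) Lp tT.
Qed.

(** [weak_dt_bound] with Q the pairing of x_tt: at almost every time the equation of motion replaces
    x_tt by the weak derivative of tau x', which is tau' v + tau p almost everywhere. *)
Lemma wr_increment i psi : L2I psi -> forall t1 t2 K1 K2 : R, 0 < t1 -> t1 <= t2 -> t2 < T ->
  {ae mu, forall r, t1 < r < t2 ->
     K1 <= \int[mu]_(s in I01) ((sigr r s * vr i r s + taur r s * pr i r s) * psi s) <= K2} ->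
  K1 * (t2 - t1) <= \int[mu]_(s in I01) (wr i t2 s * psi s) - \int[mu]_(s in I01) (wr i t1 s * psi s)
    <= K2 * (t2 - t1).
Proof.
move=> Lp t1 t2 K1 K2 t10 t12 t2T H; have [xtt [[_ [Mx bx]] wk eqm]] := mot.
have [Lx [_ cd]] := xc_L2 i.
have Ld r (rT : 0 <= r <= T) : L2I (fun s => dt T x r s 0 i) by have [] := Lx r rT.
have E r : 0 <= r <= T -> \int[mu]_(s in I01) (wr i r s * psi s) = \int[mu]_(s in I01) (dt T x r s 0 i * psi s).
  move=> rT; have [_ La _] := ar_ae i rT; have [Lw _] := tail_nm La La.
  apply: Rint_ae_eq => //; [exact: itg_meas (L2_mul m01 Lw Lp)|exact: itg_meas (L2_mul m01 (Ld r rT) Lp)|].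
  by apply: (filterS_ae (dtx_rep i rT)) => s h s01; rewrite h.
rewrite !E; [|by lra|by lra].
apply: (weak_dt_bound (T := T) (P := fun r => \int[mu]_(s in I01) (dt T x r s 0 i * psi s))
  (Q := fun r => \int[mu]_(s in I01) (xtt r s 0 i * psi s)) t10 t12 t2T).
- by move=> t tT; exact: ip_cts Ld cd Lp tT.
- move=> phi tphi; have W := wk phi _ tphi (nspace_delta i Lp); apply: (eq_trans (eq_trans _ W)).
    by apply: eq_Rintegral => t _; rewrite L2dot_delta.
  by congr (- _); apply: eq_Rintegral => t _; congr (_ * _); rewrite L2dot_delta.
apply: (filterS_ae (ae_and (ae_and bx eqm) H)) => t [[hb he] hK] tt.
have tT : 0 < t < T by lra.
have tT' : 0 <= t <= T by lra.
have tI : `]0, T[%classic t by rewrite /= in_itv.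
have [nx _] := hb tI; have [hw hx] := he tI.
have [pt _ _ _] := tension_rep tT; have [_ _ au] := vr_prim i tT'.
have pF := primM pt (vr_prim_pr i tT'); have [mp _] := pr_ae i tT'.
have mF : measurable_fun I01 (fun s => sigr t s * vr i t s + taur t s * pr i t s).
  have [_ ps _ _] := tension_rep tT.
  apply: measurable_funD; apply: measurable_funM => //; [exact: prim_meas ps| |exact: prim_meas pt].
  by have [_ [h _] _] := vr_prim i tT'.
have at' : {ae mu, forall s, I01 s -> tau t s = taur t s} by rewrite taurE; exact: prep_ae.
have fe : {ae mu, forall s, I01 s -> (tau t s *: ds x t s) 0 i = taur t s * vr i t s}.
  apply: (filterS_ae (ae_and at' au)) => s [h1 h2] s01.
  by rewrite mxE -/(uc i t s) h2// h1.
have we := wderiv_primE (hw i) pF mF fe.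
rewrite (_ : Rintegral _ _ _ = \int[mu]_(s in I01) ((sigr t s * vr i t s + taur t s * pr i t s) * psi s)); first exact: hK tt.
apply: Rint_ae_eq => //.
- by apply: measurable_funM; [exact: (nspace_meas nx)|case: Lp].
- by apply: measurable_funM => //; case: Lp.
apply: (filterS_ae (ae_and hx we)) => s [h1 h2] s01; congr (_ * _).
have /eqP := h1 s01; rewrite subr_eq0 => /eqP ->; rewrite -h2//.
by rewrite -(wderivvE (fun r => tau t r *: ds x t r) i).
Qed.

(** Every larger constant is allowed, because two solutions must share the same [M]. *)
Lemma slices_good : exists M0 : R, 0 <= M0 /\ forall M, M0 <= M ->
  {ae mu, forall t, 0 < t < T -> forall i, good_slice M (pr i t) (ar i t)}.
Proof.
have [[_ [M1 b1]] W1] := cls; have [_ _ _ C1t] := reg.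
have [V [M2 M20 b2]] := dt_ae_X1 C1t W1.
exists (`|M1| + M2); split; first by rewrite addr_ge0.
move=> M MM; have MM1 : `|M1| <= M by apply: le_trans MM; rewrite lerDl.
have MM2 : M2 <= M by apply: le_trans MM; rewrite lerDr.
have bd (f : R -> R) (c k : R) : \int[mu]_(s in I01) (f s ^+ 2) <= c ^+ 2 -> `|c| <= k -> nm f <= k.
  move=> h; apply: le_trans; rewrite nm_leP//; apply: le_trans h _; by rewrite real_normK ?num_real.
apply: (filterS_ae (ae_and b1 b2)) => t [h1 h2] tT i; have tT' : 0 <= t <= T by lra.
have tI : `]0, T[%classic t by rewrite /= in_itv.
have [nU le] := h1 tI; have [hu hp [Lp ip] [is2 isp]] := X2norm_le (nspace_meas nU) le i.
have [aV hV iV nV nwV] := h2 tT i; have [u pu Vu] := wderiv_rep hV.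
have [[mV _ _] _ _] := wderivP hV.
have [Ldc La Aa] := ar_ae i tT'; have mwV := wderiv_meas hV.
have [_ pa] : (forall s, 0 < s < 1 -> ar i t s = u s) /\ prim (ar i t) (wderiv (fun s => V t s 0 i)).
  by rewrite arE; apply: prep_prim pu _; apply: (filterS_ae (ae_and aV Vu)) => s [g1 g2] s01; rewrite -g2// g1.
have M20n : `|M2| <= M by rewrite ger0_norm.
have [mp ap] := pr_ae i tT'; have Lpr : L2I (pr i t) by exact: L2_ae_eq ap Lp.
exists (wderiv (wderiv (uc i t))), (wderiv (fun s => V t s 0 i)); split.
- by split; [rewrite prE; exact: prep_wderiv|exact: pa].
- split => //; rewrite -(nm_ae _ _ ap)//; [exact: bd ip MM1|by case: Lp].
- rewrite -(nm_ae (f := fun s => V t s 0 i)) //; [exact: bd nV M20n|by case: La|].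
  by apply: (filterS_ae (ae_and aV Aa)) => s [g1 g2] s01; rewrite g1// -g2.
- have mw : measurable_fun I01 (wderiv (wderiv (uc i t))) := wderiv_meas hp.
  have E s : 0 < s < 1 -> s ^+ 2 * wderiv (wderiv (uc i t)) s ^+ 2 = (s * wderiv (wderiv (uc i t)) s) ^+ 2.
    by move=> _; rewrite exprMn.
  split; last by apply: bd MM1; rewrite -(Rint_eq E).
  split; first exact: measurable_funM.
  by apply: (itg_eq _ _ is2) => // s; rewrite /= in_itv/=; exact: E.
have E s : 0 < s < 1 -> s * wderiv (fun s => V t s 0 i) s ^+ 2 = (rt s * wderiv (fun s => V t s 0 i) s) ^+ 2.
  by move=> s01; rewrite exprMn rt_sqr.
split; last by apply: bd M20n; rewrite -(Rint_eq E).
split; first by apply: measurable_funM => //; exact: meas_rt.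
by apply: (itg_eq _ _ iV) => // s; rewrite /= in_itv/=; exact: E.
Qed.

Lemma solution_evolution : exists M0 : R, 0 <= M0 /\ forall M, M0 <= M ->
  evolution T M vr pr wr ar taur sigr.
Proof.
have [M0 [M00 hM]] := slices_good; exists M0; split => // M MM; split => //.
- exact: le_trans MM.
- by move=> i t tT; exact: vr_prim_pr.
- by move=> i t tT; have [] := pr_ae i tT.
- by move=> i t tT; have [_ []] := rtw_L2 i tT.
- by move=> i; exact: pr_tcts.
- by move=> t s; exact: vr_unit.
- by move=> i t tT; have [] := ar_ae i tT.
- by move=> i; exact: ar_tcts.
- by move=> i t; exact: vr_dt.
- by move=> i t; exact: wr_prim.
- by move=> t; exact: ar_orth.
- by move=> t; exact: tension_rep.
- exact: hM.
- by move=> i psi Lp t1 t2 K1 K2; exact: wr_increment.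
- by move=> i psi Lp t1 t2 K1 K2; exact: vr_increment.
Qed.

End SolutionData.

Section Data.
Context {R : realType}.
Local Notation mu := (@lebesgue_measure R).
Local Notation I01 := (`]@GRing.zero R, @GRing.one R[%classic).

Lemma solution_rep (T : R) (x0 x1 : R -> 'rV[R]_3) (x : R -> R -> 'rV[R]_3) (tau : R -> R -> R) :
  0 < T -> is_solution T x0 x1 x tau -> in_class T x ->
  exists v p a tr sr,
  [/\ (exists M0 : R, 0 <= M0 /\ forall M, M0 <= M -> evolution T M v p (wr (ar := a)) a tr sr),
      forall i t, 0 <= t <= T -> [/\ L2 I01 (xc (x := x) i t), L2 I01 (v i t) &
        {ae mu, forall s, I01 s -> x t s 0 i = xr (vr := v) i t s}],
      forall i, tcts T (xc (x := x) i) /\ forall t, 0 <= t <= T -> prim (xr (vr := v) i t) (v i t),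
      {ae mu, forall s, I01 s -> forall i, xr (vr := v) i 0 s = x0 s 0 i /\ wr (ar := a) i 0 s = x1 s 0 i} &
      forall t, 0 < t < T -> {ae mu, forall s, I01 s -> tau t s = tr t s}].
Proof.
move=> T0 [reg [mot inext] bnd ten init] cls.
pose v i t := prep (uc (x := x) i t); pose p i t := prep (wderiv (uc (x := x) i t)).
pose a i t := prep (dc (T := T) (x := x) i t); pose tr t := prep (tau t); pose sr t := prep (wderiv (tau t)).
have vE i t : v i t = prep (uc (x := x) i t) by [].
have pE i t : p i t = prep (wderiv (uc (x := x) i t)) by [].
have aE i t : a i t = prep (dc (T := T) (x := x) i t) by []. have tE t : tr t = prep (tau t) by [].
have sE t : sr t = prep (wderiv (tau t)) by [].
exists v, p, a, tr, sr; split.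
- exact: (solution_evolution T0 reg mot inext bnd ten cls vE pE aE tE sE).
- move=> i t tT; have [Lx _] := xc_L2 reg i; split; first by have [] := Lx t tT.
    by have [] := vr_prim reg vE i tT.
  exact: (xc_rep T0 reg bnd vE).
- move=> i; have [_ [cx _]] := xc_L2 reg i; split => // t tT.
  have [_ Lv _] := vr_prim reg vE i tT.
  have iv := L2_itg (measurable_itv _) mu01_lty Lv.
  by apply: (prim_eq _ _ (primN (prim_int1 iv))) => // s _; rewrite opprK.
- have z0 : 0 <= (0 : R) <= T by rewrite lexx ltW.
  have h1 := ae_all_ord (fun i => xc_rep T0 reg bnd vE i z0).
  have h2 := ae_all_ord (fun i => dtx_rep T0 reg bnd vE aE i z0).
  apply: (filterS_ae (ae_and init (ae_and h1 h2))) => s [g1 [g2 g3]] s01 i.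
  have [e1 e2] := g1 s01; split; first by rewrite -(g2 i s01) /xc e1.
  by rewrite -(g3 i s01) e2.
- by move=> t tT; rewrite tE; exact: prep_ae.
Qed.

End Data.

Theorem theorem2p4 (R : realType) (T : R) (hT : 0 < T)
    (x0in x1in : R -> 'rV[R]_3)
    (x1 x2 : R -> R -> 'rV[R]_3) (tau1 tau2 : R -> R -> R)
    (hsol1 : is_solution T x0in x1in x1 tau1) (hx1 : in_class T x1)
    (hsol2 : is_solution T x0in x1in x2 tau2) (hx2 : in_class T x2) :
  (forall t : R, `[0, T]%classic t ->
     {ae lebesgue_measure, forall s : R, `]0, 1[%classic s ->
        x1 t s = x2 t s}) /\
  (forall t : R, `]0, T[%classic t ->
     {ae lebesgue_measure, forall s : R, `]0, 1[%classic s ->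
        tau1 t s = tau2 t s}).
Proof.
have [v1 [p1 [a1 [tr1 [sr1 [[M1 [M10 ev1]] X1 Y1 Z1 W1]]]]]] := solution_rep hT hsol1 hx1.
have [v2 [p2 [a2 [tr2 [sr2 [[M2 [M20 ev2]] X2 Y2 Z2 W2]]]]]] := solution_rep hT hsol2 hx2.
(* M1 + M2 is admissible for both solutions. *)
have {}ev1 := ev1 (M1 + M2) (ltac:(by rewrite lerDl)).
have {}ev2 := ev2 (M1 + M2) (ltac:(by rewrite lerDr)).
have z0 : 0 <= (0 : R) <= T by rewrite lexx ltW.
have m01 : measurable (`]0, 1[%classic : set R) := measurable_itv _.
(* The data prescribe x and x_t. Equality of x' at time 0 follows since primitives that agree have
   almost everywhere the same derivative, and v is continuous in s. *)
have init i s : 0 < s < 1 -> v1 i 0 s = v2 i 0 s /\ wr (ar := a1) i 0 s = wr (ar := a2) i 0 s.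
  have [pv1 pv2] := (ev_v ev1 i z0, ev_v ev2 i z0).
  have [_ /(_ 0 z0) px1] := Y1 i; have [_ /(_ 0 z0) px2] := Y2 i.
  have xx : forall s, 0 < s < 1 -> xr (vr := v1) i 0 s = xr (vr := v2) i 0 s.
    apply: (prim_ae_eq px1 px2); apply: (filterS_ae (ae_and Z1 Z2)) => r [g1 g2] r01.
    by have [-> _] := g1 r01 i; have [-> _] := g2 r01 i.
  have px : prim (xr (vr := v1) i 0) (v2 i 0) by apply: (prim_eq _ _ px2) => // r r01; rewrite xx.
  have vv := prim_deriv_ae px1 px (prim_meas pv1) (prim_meas pv2).
  move=> s01; split; first exact: prim_ae_eq pv1 pv2 vv s s01.
  have [pw1 _] := ev_w ev1 i z0; have [pw2 _] := ev_w ev2 i z0.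
  apply: (prim_ae_eq pw1 pw2) s01; apply: (filterS_ae (ae_and Z1 Z2)) => r [g1 g2] r01.
  by have [_ ->] := g1 r01 i; have [_ ->] := g2 r01 i.
have U := evolution_unique ev1 ev2 init.
split; last first.
  move=> t tI; have tT : 0 < t < T by move: tI; rewrite /= in_itv.
  apply: (filterS_ae (ae_and (W1 t tT) (W2 t tT))) => s [h1 h2] s01.
  have [_ e] := U t s tT (ltac:(by move: s01; rewrite /= in_itv)).
  by rewrite h1// h2.
move=> t tI; have tT : 0 <= t <= T by move: tI; rewrite /= in_itv.
(* Inside ]0, T[, x is recovered from v by integration from s = 1; [tcts_eq] adds the end points of
   [0, T]. *)
have xe i : {ae lebesgue_measure, forall s, `]0, 1[%classic s -> xc (x := x1) i t s = xc (x := x2) i t s}.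
  apply: (tcts_eq hT _ _ (proj1 (Y1 i)) (proj1 (Y2 i))) tT.
  - by move=> r rT; have [] := X1 i r rT.
  - by move=> r rT; have [] := X2 i r rT.
  move=> r rT; have rT' : 0 <= r <= T by case/andP: rT => /ltW -> /ltW ->.
  have [_ L1 e1] := X1 i r rT'; have [_ L2 e2] := X2 i r rT'.
  apply: (filterS_ae (ae_and e1 e2)) => s [h1 h2] s01; rewrite /xc h1// h2// /xr; congr (- _).
  have {}s01 : 0 < s < 1 by move: s01; rewrite /= in_itv.
  apply/eqP; rewrite -subr_eq0 -normr_le0; apply: le_trans (tail_bnd L1 L2 (unit_ge0 s01)) _.
  rewrite (nm_ext (g := fun=> 0)) ?nm_cst ?normr0// => y y01.
  by have [-> _] := U r y rT y01; rewrite subrr.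
apply: (filterS_ae (ae_all_ord xe)) => s h s01; apply/rowP => i.
exact: h.
Qed.
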